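(* Let $k$ be a field and let $H$ be a pointed Hopf algebra over $k$ with group $G=G(H)$ of group-like elements. Let $\operatorname{gr}H$ be the associated graded Hopf algebra of $H$ with respect to its coradical filtration, and let $R\subset \operatorname{gr}H$ be the graded algebra of coinvariants of the canonical projection $\operatorname{gr}H\to H_0=kG$, so that $\operatorname{gr}H\cong R\# kG$. If $R$ is a finitely generated algebra, then $$\operatorname{GKdim} R+\operatorname{GKdim} kG=\operatorname{GKdim}\operatorname{gr}H=\operatorname{GKdim}H.$$
   Context: A Hopf algebra $H$ is pointed if its coradical $H_0$ (the sum of all simple subcoalgebras) equals $kG(H)$, the span of the group-like elements. $\{H_n\}_{n\ge0}$ denotes the coradical filtration of $H$; for pointed $H$ the space $\operatorname{gr}H=\bigoplus_{n\ge0}H_n/H_{n-1}$ (with $H_{-1}=0$) is a graded Hopf algebra with degree-zero part $H_0=kG$. Let $\psi:\operatorname{gr}H\to H_0$ be the canonical Hopf projection onto degree zero, and $R=(\operatorname{gr}H)^{co\,\psi}=\{a\in\operatorname{gr}H : (\mathrm{id}\otimes\psi)\Delta(a)=a\otimes 1\}$, a graded subalgebra of $\operatorname{gr}H$ with $R(0)=k$; it is well known that $\operatorname{gr}H\cong R\#kG$ (bosonization; as an algebra this is the skew group algebra $R*G$). $\operatorname{GKdim}$ denotes Gelfand–Kirillov dimension over $k$. *)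

(* Defs.v *)
From HB Require Import structures.
From mathcomp Require Import all_boot all_order all_algebra generic_quotient.
From mathcomp Require Import all_classical all_reals all_analysis.

Set Implicit Arguments.
Unset Strict Implicit.
Unset Printing Implicit Defensive.

Import Order.TTheory GRing.Theory Num.Theory.

Local Open Scope classical_set_scope.
Local Open Scope ring_scope.
Local Open Scope quotient_scope.

Section TensorProduct.
Variables (k : fieldType) (V W : lmodType k).

(* A list [:: (v1, w1); ...; (vn, wn)] stands for v1 (x) w1 + ... + vn (x) wn;
   [tens_eq] is the congruence on formal sums that imposes bilinearity. *)
Inductive tens_eq : seq (V * W) -> seq (V * W) -> Prop :=
| tens_eq_refl s : tens_eq s s
| tens_eq_sym s t : tens_eq s t -> tens_eq t s
| tens_eq_trans s t u : tens_eq s t -> tens_eq t u -> tens_eq s u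
| tens_eq_cat s1 t1 s2 t2 :
    tens_eq s1 t1 -> tens_eq s2 t2 -> tens_eq (s1 ++ s2) (t1 ++ t2)
| tens_eq_catC s t : tens_eq (s ++ t) (t ++ s)
| tens_eq_0 w : tens_eq [:: (0, w)] [::]
| tens_eq_Dl v1 v2 w : tens_eq [:: (v1 + v2, w)] [:: (v1, w); (v2, w)]
| tens_eq_Dr v w1 w2 : tens_eq [:: (v, w1 + w2)] [:: (v, w1); (v, w2)]
| tens_eq_Z a v w : tens_eq [:: (a *: v, w)] [:: (v, a *: w)].

Definition tens_eqb (s t : seq (V * W)) : bool := `[< tens_eq s t >].

Lemma tens_eqb_refl : reflexive tens_eqb.
Proof. by move=> s; apply/asboolP; constructor. Qed.

Lemma tens_eqb_sym : symmetric tens_eqb.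
Proof. by move=> s t; apply/asboolP/asboolP; apply: tens_eq_sym. Qed.

Lemma tens_eqb_trans : transitive tens_eqb.
Proof.
by move=> s t u /asboolP ts /asboolP su; apply/asboolP; apply: tens_eq_trans su.
Qed.

Canonical tens_equiv_rel :=
  EquivRel tens_eqb tens_eqb_refl tens_eqb_sym tens_eqb_trans.

Definition tens := {eq_quot tens_eqb}.

HB.instance Definition _ : EqQuotient _ tens_eqb tens := EqQuotient.on tens.
HB.instance Definition _ := Choice.on tens.

Definition tens_sum (s : seq (V * W)) : tens := \pi_tens s.

Definition tpure (v : V) (w : W) : tens := tens_sum [:: (v, w)].

Definition tens_add (x y : tens) : tens := tens_sum (repr x ++ repr y).

Definition tens_scale (a : k) (x : tens) : tens :=
  tens_sum [seq (a *: p.1, p.2) | p <- repr x].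

Lemma tens_sumP s t : tens_sum s = tens_sum t <-> tens_eq s t.
Proof. by split=> [/eqmodP/asboolP//|st]; apply/eqmodP/asboolP. Qed.

Lemma tens_sumK x : tens_sum (repr x) = x.
Proof. exact: reprK. Qed.

Lemma tens_eq_repr s : tens_eq (repr (tens_sum s)) s.
Proof. by apply/tens_sumP; rewrite tens_sumK. Qed.

Lemma tens_addE s t : tens_add (tens_sum s) (tens_sum t) = tens_sum (s ++ t).
Proof. by apply/tens_sumP/tens_eq_cat; apply: tens_eq_repr. Qed.

Lemma tens_eq_scale a s t : tens_eq s t ->
  tens_eq [seq (a *: p.1, p.2) | p <- s] [seq (a *: p.1, p.2) | p <- t].
Proof.
elim=> {s t} /=.
- by move=> s; constructor.
- by move=> s t _; apply: tens_eq_sym.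
- by move=> s t u _ + _; apply: tens_eq_trans.
- by move=> s1 t1 s2 t2 _ e1 _ e2; rewrite !map_cat; apply: tens_eq_cat.
- by move=> s t; rewrite !map_cat; apply: tens_eq_catC.
- by move=> w; rewrite scaler0; apply: tens_eq_0.
- by move=> v1 v2 w; rewrite scalerDr; apply: tens_eq_Dl.
- by move=> v w1 w2; apply: tens_eq_Dr.
- by move=> b v w; rewrite scalerA mulrC -scalerA; apply: tens_eq_Z.
Qed.

Lemma tens_scaleE a s :
  tens_scale a (tens_sum s) = tens_sum [seq (a *: p.1, p.2) | p <- s].
Proof. exact/tens_sumP/tens_eq_scale/tens_eq_repr. Qed.

Let ind (P : tens -> Prop) : (forall s, P (tens_sum s)) -> forall x, P x.
Proof. by move=> Ps x; rewrite -(tens_sumK x). Qed.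

Lemma tens_addA : associative tens_add.
Proof.
by elim/ind=> s; elim/ind=> t; elim/ind=> u; rewrite !tens_addE catA.
Qed.

Lemma tens_addC : commutative tens_add.
Proof.
by elim/ind=> s; elim/ind=> t; rewrite !tens_addE; apply/tens_sumP/tens_eq_catC.
Qed.

Lemma tens_add0 : left_id (tens_sum [::]) tens_add.
Proof. by elim/ind=> s; rewrite tens_addE. Qed.

Lemma tens_scale0_sum s : tens_sum [seq (0 *: p.1, p.2) | p <- s] = tens_sum [::].
Proof.
apply/tens_sumP; elim: s => [|[v w] s IHs] /=; first by constructor.
rewrite scale0r -[_ :: _]cat1s -(cats0 [::]).
by apply: tens_eq_cat IHs; apply: tens_eq_0.
Qed.

Lemma tens_scaleDl x : {morph tens_scale^~ x : a b / a + b >-> tens_add a b}.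
Proof.
move=> a b; elim/ind: x => s; rewrite !tens_scaleE tens_addE.
apply/tens_sumP; elim: s => [|[v w] s IHs] /=; first by constructor.
set sab := map _ s in IHs *; set sa := map _ s in IHs *; set sb := map _ s in IHs *.
apply: (@tens_eq_trans _ ([:: (a *: v, w); (b *: v, w)] ++ (sa ++ sb))).
  rewrite -[_ :: sab]cat1s scalerDl.
  by apply: tens_eq_cat IHs; apply: tens_eq_Dl.
apply: (tens_eq_cat (tens_eq_refl [:: (a *: v, w)])
  (_ : tens_eq ([:: (b *: v, w)] ++ (sa ++ sb)) (sa ++ [:: (b *: v, w)] ++ sb))).
rewrite [sa ++ (_ ++ _)]catA.
exact: (tens_eq_cat (tens_eq_catC [:: _] sa) (tens_eq_refl sb)).
Qed.

Lemma tens_scale1 : left_id 1 tens_scale.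
Proof.
elim/ind=> s; rewrite tens_scaleE; congr tens_sum.
by elim: s => //= -[v w] s ->; rewrite scale1r.
Qed.

Lemma tens_scaleA a b x : tens_scale a (tens_scale b x) = tens_scale (a * b) x.
Proof.
elim/ind: x => s; rewrite !tens_scaleE -map_comp; congr tens_sum.
by apply: eq_map => -[v w] /=; rewrite scalerA.
Qed.

Lemma tens_scaleDr : right_distributive tens_scale tens_add.
Proof.
move=> a; elim/ind=> s; elim/ind=> t.
by rewrite tens_addE !tens_scaleE tens_addE map_cat.
Qed.

Lemma tens_addN : left_inverse (tens_sum [::]) (tens_scale (-1)) tens_add.
Proof.
move=> x; rewrite -{2}[x]tens_scale1 -tens_scaleDl addNr.
by elim/ind: x => s; rewrite tens_scaleE tens_scale0_sum.
Qed.

HB.instance Definition _ :=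
  GRing.isZmodule.Build tens tens_addA tens_addC tens_add0 tens_addN.

HB.instance Definition _ := GRing.Zmodule_isLmodule.Build k tens
  tens_scaleA tens_scale1 tens_scaleDr tens_scaleDl.

Lemma tens_sum_cat s t : tens_sum (s ++ t) = tens_sum s + tens_sum t.
Proof. by rewrite -tens_addE. Qed.

Lemma tens_sumE s : tens_sum s = \sum_(p <- s) tpure p.1 p.2.
Proof.
elim: s => [|[v w] s IHs]; first by rewrite big_nil.
by rewrite big_cons -cat1s tens_sum_cat IHs.
Qed.

Lemma tensE x : x = \sum_(p <- repr x) tpure p.1 p.2.
Proof. by rewrite -tens_sumE tens_sumK. Qed.

Lemma tpureDl v1 v2 w : tpure (v1 + v2) w = tpure v1 w + tpure v2 w.
Proof. by rewrite -tens_sum_cat; apply/tens_sumP/tens_eq_Dl. Qed.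

Lemma tpureDr v w1 w2 : tpure v (w1 + w2) = tpure v w1 + tpure v w2.
Proof. by rewrite -tens_sum_cat; apply/tens_sumP/tens_eq_Dr. Qed.

Lemma tpureZl a v w : tpure (a *: v) w = a *: tpure v w.
Proof. by rewrite /tpure [RHS]tens_scaleE. Qed.

Lemma tpureZr a v w : tpure v (a *: w) = a *: tpure v w.
Proof. by rewrite -tpureZl; apply/esym/tens_sumP/tens_eq_Z. Qed.

End TensorProduct.

Notation "V ⊗ W" := (tens V%type W%type) (at level 40, left associativity) : type_scope.
Notation "v ⊗ w" := (tpure v w) (at level 40, left associativity) : ring_scope.

(* The linear map V (x) W -> U induced by a bilinear map f : V -> W -> U. *)
Definition tens_lift (k : fieldType) (V W U : lmodType k) (f : V -> W -> U)
  (x : V ⊗ W) : U := \sum_(p <- repr x) f p.1 p.2.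

Definition bilin (k : fieldType) (V W U : lmodType k) (f : V -> W -> U) :=
  (forall v, linear (f v)) /\ (forall w, linear (f^~ w)).

Definition tens_map (k : fieldType) (V W V' W' : lmodType k)
  (f : V -> V') (g : W -> W') : V ⊗ W -> V' ⊗ W' :=
  tens_lift (fun v w => f v ⊗ g w).

Definition tens_assoc (k : fieldType) (U V W : lmodType k) :
  (U ⊗ V) ⊗ W -> U ⊗ (V ⊗ W) :=
  tens_lift (fun t w => tens_lift (fun u v => u ⊗ (v ⊗ w)) t).

Section TensorTheory.
Variable k : fieldType.
Implicit Types U V W : lmodType k.

Lemma bilin0l V W U (f : V -> W -> U) w : bilin f -> f 0 w = 0.
Proof. by move=> [_ /(_ w) fl]; have := fl (-1) 0 0; rewrite scaler0 addr0 scaleN1r addNr. Qed.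

Lemma tens_lift_sum V W U (f : V -> W -> U) s : bilin f ->
  tens_lift f (tens_sum s) = \sum_(p <- s) f p.1 p.2.
Proof.
move=> bf; have [fr fl] := bf; rewrite /tens_lift.
suff: forall t u, tens_eq t u ->
  \sum_(p <- t) f p.1 p.2 = \sum_(p <- u) f p.1 p.2.
  by apply; apply: tens_eq_repr.
move=> t0 u0; elim=> {t0 u0} //=.
- by move=> t1 t2 t3 _ -> _ ->.
- by move=> s1 t1 s2 t2 _ e1 _ e2; rewrite !big_cat /= e1 e2.
- by move=> t1 t2; rewrite !big_cat /= addrC.
- by move=> w; rewrite big_seq1 big_nil /= bilin0l.
- move=> v1 v2 w; rewrite big_seq1 big_cons big_seq1 /=.
  by have := fl w 1 v1 v2; rewrite !scale1r.
- move=> v w1 w2; rewrite big_seq1 big_cons big_seq1 /=.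
  by have := fr v 1 w1 w2; rewrite !scale1r.
- move=> a v w; rewrite !big_seq1 /=.
  have := fl w a v 0; have := fr v a w 0; rewrite !addr0.
  have -> : f v 0 = 0 by have := fr v (-1) 0 0; rewrite scaler0 addr0 scaleN1r addNr.
  by rewrite bilin0l // !addr0 => -> ->.
Qed.

Lemma tens_lift_linear V W U (f : V -> W -> U) : bilin f -> linear (tens_lift f).
Proof.
move=> bf a x y; rewrite -(tens_sumK x) -(tens_sumK y).
set s := repr x; set t := repr y.
have -> : a *: tens_sum s = tens_sum [seq (a *: p.1, p.2) | p <- s].
  by rewrite [LHS]tens_scaleE.
rewrite -tens_sum_cat !tens_lift_sum // big_cat /= big_map /=; congr (_ + _).
rewrite scaler_sumr; apply: eq_bigr => -[v w] _ /=.
have [_ fl] := bf; have := fl w a v 0.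
by rewrite !addr0 bilin0l // addr0.
Qed.

Lemma tens_lift_pure V W U (f : V -> W -> U) v w :
  bilin f -> tens_lift f (v ⊗ w) = f v w.
Proof. by move=> bf; rewrite tens_lift_sum // big_seq1. Qed.

Lemma tens_ind V W (P : V ⊗ W -> Prop) : (forall v w, P (v ⊗ w)) ->
  P 0 -> (forall x y, P x -> P y -> P (x + y)) -> forall x, P x.
Proof. by move=> Pp P0 PD x; rewrite (tensE x); elim/big_ind: _. Qed.

End TensorTheory.

HB.mixin Record isCoalgebra (k : fieldType) C of GRing.Lmodule k C := {
  comul : C -> C ⊗ C;
  counit : C -> k;
  comul_linear : linear comul;
  counit_linear : linear_for *%R counit;
  comulA : forall x,
    tens_assoc (tens_map comul id (comul x)) = tens_map id comul (comul x);
  counitl : forall x, tens_lift (fun a b => counit a *: b) (comul x) = x;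
  counitr : forall x, tens_lift (fun a b => counit b *: a) (comul x) = x
}.

#[short(type="coalgType")]
HB.structure Definition Coalgebra (k : fieldType) :=
  {C of GRing.Lmodule k C & isCoalgebra k C}.

Definition tens_mul (k : fieldType) (A : algType k) (s t : A ⊗ A) : A ⊗ A :=
  tens_lift (fun a b => tens_lift (fun c d => (a * c) ⊗ (b * d)) t) s.

HB.mixin Record isHopfAlgebra (k : fieldType) H
    of GRing.NzRing H & GRing.Algebra k H & Coalgebra k H := {
  comulM : forall x y : H, comul (x * y) = tens_mul (comul x) (comul y);
  comul1 : comul (1 : H) = 1 ⊗ 1;
  counitM : {morph (@counit k H) : x y / x * y};
  counit1 : counit (1 : H) = 1 :> k;
  antipode : H -> H;
  antipode_linear : linear antipode;
  antipodel : forall x : H,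
    tens_lift (fun a b => antipode a * b) (comul x) = (counit x)%:A;
  antipoder : forall x : H,
    tens_lift (fun a b => a * antipode b) (comul x) = (counit x)%:A
}.

#[short(type="hopfAlgType")]
HB.structure Definition HopfAlgebra (k : fieldType) :=
  {H of GRing.NzRing H & GRing.Algebra k H & Coalgebra k H & isHopfAlgebra k H}.

Section Subspaces.
Variable k : fieldType.
Implicit Types V W : lmodType k.

Definition subspace V (U : set V) : Prop :=
  U 0 /\ forall a x y, U x -> U y -> U (a *: x + y).

Definition lspan V (S : set V) : set V :=
  [set v | exists2 s : seq (k * V),
    (forall p, p \in s -> S p.2) & v = \sum_(p <- s) p.1 *: p.2].

Definition addset V (U W : set V) : set V := [set x + y | x in U & y in W].

(* the image of U (x) U' in V (x) W, for subspaces U of V and U' of W *)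
Definition tens_sub V W (U : set V) (U' : set W) : set (V ⊗ W) :=
  lspan [set u ⊗ w | u in U & w in U'].

End Subspaces.

Section Coradical.
Variables (k : fieldType) (C : coalgType k).

Definition subcoalgebra (D : set C) : Prop :=
  subspace D /\ forall x, D x -> tens_sub D D (comul x).

Definition simple_subcoalgebra (D : set C) : Prop :=
  [/\ subcoalgebra D, D <> [set 0] &
      forall E, subcoalgebra E -> E `<=` D -> E = [set 0] \/ E = D].

Definition coradical : set C :=
  lspan (\bigcup_(D in [set D | simple_subcoalgebra D]) D).

Definition wedge (U W : set C) : set C :=
  [set x | addset (tens_sub U setT) (tens_sub setT W) (comul x)].

Fixpoint corad_filt (n : nat) : set C :=
  if n is m.+1 then wedge coradical (corad_filt m) else coradical.

(* H_{n-1}, with H_{-1} = 0 *)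
Definition corad_filt_pred (n : nat) : set C :=
  if n is m.+1 then corad_filt m else [set 0].

Definition grouplike (g : C) : Prop := comul g = g ⊗ g /\ counit g = 1.

End Coradical.

(* kG(H), for G(H) the set of group-like elements *)
Definition grouplike_span (k : fieldType) (C : coalgType k) : set C :=
  lspan [set g | grouplike g].

Arguments coradical {k} C.
Arguments corad_filt {k} C n.
Arguments corad_filt_pred {k} C n.
Arguments grouplike_span {k} C.

Definition pointed (k : fieldType) (C : coalgType k) : Prop :=
  coradical C = grouplike_span C.

Section SubspaceTheory.
Variable k : fieldType.
Implicit Types U V W : lmodType k.

Lemma lin0 V W (f : V -> W) : linear f -> f 0 = 0.
Proof. by move=> /(_ (-1) 0 0); rewrite scaler0 addr0 scaleN1r addNr. Qed.

Lemma linD V W (f : V -> W) : linear f -> {morph f : x y / x + y}.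
Proof. by move=> fl x y; have := fl 1 x y; rewrite !scale1r. Qed.

Lemma linZ V W (f : V -> W) a : linear f -> {morph f : x / a *: x}.
Proof. by move=> fl x; have := fl a x 0; rewrite !addr0 (lin0 fl) addr0. Qed.

Lemma linB V W (f : V -> W) : linear f -> {morph f : x y / x - y}.
Proof. by move=> fl x y; rewrite -!scaleN1r linD // linZ. Qed.

Lemma lin_sum V W (f : V -> W) (I : Type) (r : seq I) (F : I -> V) :
  linear f -> f (\sum_(i <- r) F i) = \sum_(i <- r) f (F i).
Proof. by move=> fl; apply: big_morph; [apply: linD|apply: lin0]. Qed.

Lemma subspaceD V (S : set V) x y : subspace S -> S x -> S y -> S (x + y).
Proof. by move=> [_ h] Sx Sy; have := h 1 x y Sx Sy; rewrite scale1r. Qed.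

Lemma subspaceZ V (S : set V) a x : subspace S -> S x -> S (a *: x).
Proof. by move=> [S0 h] Sx; have := h a x 0 Sx S0; rewrite addr0. Qed.

Lemma subspaceB V (S : set V) x y : subspace S -> S x -> S y -> S (x - y).
Proof. by move=> sS Sx Sy; rewrite -scaleN1r; apply: subspaceD => //; apply: subspaceZ. Qed.

Lemma subspace_sum V (S : set V) (I : eqType) (r : seq I) (F : I -> V) :
  subspace S -> (forall i, i \in r -> S (F i)) -> S (\sum_(i <- r) F i).
Proof.
move=> sS SF; rewrite big_seq; elim/big_ind: _ => //; first by case: sS.
by move=> x y; apply: subspaceD.
Qed.

Lemma lspan_subspace V (S : set V) : subspace (lspan S).
Proof.
split=> [|a x y [s Ss ->] [t St ->]]; first by exists [::]; rewrite ?big_nil.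
exists ([seq (a * p.1, p.2) | p <- s] ++ t).
  by move=> p; rewrite mem_cat => /orP[/mapP[q /Ss Sq ->]//|/St].
rewrite big_cat big_map scaler_sumr; congr (_ + _).
by apply: eq_bigr => p _; rewrite scalerA.
Qed.

Lemma sub_lspan V (S : set V) : S `<=` lspan S.
Proof.
move=> x Sx; exists [:: (1, x)]; last by rewrite big_seq1 scale1r.
by move=> p; rewrite inE => /eqP->.
Qed.

Lemma lspan_min V (S T : set V) : subspace T -> S `<=` T -> lspan S `<=` T.
Proof.
move=> sT ST x [s Ss ->]; apply: subspace_sum => // p /Ss/ST.
exact: subspaceZ.
Qed.

Lemma addset_subspace V (S T : set V) :
  subspace S -> subspace T -> subspace (addset S T).
Proof.
move=> sS sT; split; first by exists 0; [case: sS|exists 0; [case: sT|rewrite addr0]].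
move=> a _ _ [x Sx [y Ty <-]] [x' Sx' [y' Ty' <-]].
exists (a *: x + x'); first by case: sS => _; apply.
exists (a *: y + y'); first by case: sT => _; apply.
by rewrite scalerDr addrACA.
Qed.

Lemma addset_l V (S T : set V) : subspace T -> S `<=` addset S T.
Proof. by move=> [T0 _] x Sx; exists x => //; exists 0; rewrite ?addr0. Qed.

Lemma addset_r V (S T : set V) : subspace S -> T `<=` addset S T.
Proof. by move=> [S0 _] x Sx; exists 0 => //; exists x; rewrite ?add0r. Qed.

Lemma addset_min V (S T E : set V) : subspace E ->
  S `<=` E -> T `<=` E -> addset S T `<=` E.
Proof.
by move=> sE SE TE _ [x /SE Ex [y /TE Ey <-]]; apply: subspaceD.
Qed.

Lemma preimage_subspace V W (f : V -> W) (T : set W) :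
  linear f -> subspace T -> subspace [set v | T (f v)].
Proof.
move=> fl sT; split=> /=; first by rewrite lin0 //; case: sT.
by move=> a x y Tx Ty; rewrite fl; case: sT => _; apply.
Qed.

Lemma set0_subspace V : subspace [set (0 : V)].
Proof. by split=> // a x y -> ->; rewrite scaler0 addr0. Qed.

Lemma setT_subspace V : subspace [set: V].
Proof. by []. Qed.

Lemma tens_sub_pure V W (S : set V) (T : set W) v w :
  S v -> T w -> tens_sub S T (v ⊗ w).
Proof. by move=> Sv Tw; apply: sub_lspan; exists v => //; exists w. Qed.

Lemma tens_sub_min V W (S : set V) (T : set W) (E : set (V ⊗ W)) :
  subspace E -> (forall v w, S v -> T w -> E (v ⊗ w)) -> tens_sub S T `<=` E.
Proof.
by move=> sE h; apply: lspan_min => // _ [v Sv [w Tw <-]]; apply: h.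
Qed.

Lemma tens_subS V W (S S' : set V) (T T' : set W) :
  S `<=` S' -> T `<=` T' -> tens_sub S T `<=` tens_sub S' T'.
Proof.
move=> SS TT; apply: tens_sub_min; first exact: lspan_subspace.
by move=> v w /SS Sv /TT Tw; apply: tens_sub_pure.
Qed.

Lemma subspace_proj V (U : set V) : subspace U ->
  exists q : V -> V, [/\ linear q, forall v, q v = 0 <-> U v
                       & forall v, U (v - q v)].
Proof.
move=> sU.
pose P (D : set V) := D = set0 \/ (subspace D /\ forall w, D w -> U w -> w = 0).
have [F FP totF|D [PD maxD]] := @Zorn_bigcup V P.
  have [[D0 [FD0 [w0 D0w0]]]|nF] :=
      pselect (exists D : set V, F D /\ exists w, D w); last first.
    left; apply/seteqP; split=> // x [D FD Dx]; apply: nF.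
    by exists D; split=> //; exists x.
  have key (D : set V) x : F D -> D x ->
      subspace D /\ forall w, D w -> U w -> w = 0.
    by move=> FD Dx; have [E|//] := FP _ FD; rewrite E in Dx.
  right; split; last by move=> w [D FD Dw]; apply: (key D w FD Dw).2.
  split; first by exists D0 => //; case: (key _ _ FD0 D0w0) => -[].
  move=> a x y [D1 FD1 D1x] [D2 FD2 D2y].
  have [D12|D21] := totF _ _ FD1 FD2.
    by exists D2 => //; apply: (key _ _ FD2 D2y).1.2 => //; apply: D12.
  by exists D1 => //; apply: (key _ _ FD1 D1x).1.2 => //; apply: D21.
have nD0 : D <> set0.
  move=> D0; apply: (maxD [set 0]).
    by rewrite D0; split=> // /(_ 0 erefl).
  by right; split; [apply: set0_subspace|move=> w ->].
have [//|[sD DU]] := PD.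
have full v : exists w, D w /\ U (v - w).
  apply: contrapT => nv.
  pose E := [set w | exists c d, D d /\ w = c *: v + d].
  apply: (maxD E).
    split=> [w Dw|/(_ v) h]; first by exists 0, w; rewrite scale0r add0r.
    apply: nv; exists v; split; last by rewrite subrr; case: sU.
    by apply: h; exists 1, 0; rewrite scale1r addr0; case: sD.
  right; split.
    split; first by exists 0, 0; rewrite scale0r addr0; case: sD.
    move=> a _ _ [c [d [Dd ->]]] [c' [d' [Dd' ->]]].
    exists (a * c + c'), (a *: d + d'); split; first by case: sD => _; apply.
    by rewrite scalerDr addrACA scalerA scalerDl.
  move=> _ [c [d [Dd ->]]] Uw; have [c0|c0] := eqVneq c 0.
    by move: Uw; rewrite c0 scale0r !add0r; apply: DU.
  case: nv; exists (- (c^-1 *: d)); split.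
    by rewrite -scaleN1r; do 2 apply: subspaceZ => //.
  rewrite opprK -[v]scale1r -(mulVf c0) -scalerA -scalerDr.
  exact: subspaceZ.
have [q qP] := choice full.
have uniq_q v w : D w -> U (v - w) -> q v = w.
  move=> Dw Uvw; apply/eqP; rewrite -subr_eq0; apply/eqP/DU.
    by apply: subspaceB => //; case: (qP v).
  have -> : q v - w = (v - w) - (v - q v) by rewrite opprB [RHS]addrC addrA subrK.
  by apply: subspaceB => //; case: (qP v).
exists q; split=> [a x y|v|v]; last by case: (qP v).
  have [[Dx Ux] [Dy Uy]] := (qP x, qP y).
  apply: uniq_q; first by case: sD => _; apply.
  by rewrite opprD addrACA -scalerBr; case: sU => _; apply.
split=> [q0|Uv]; last by apply: uniq_q; [case: sD|rewrite subr0].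
by have [_] := qP v; rewrite q0 subr0.
Qed.

Lemma tens_map_bilin V W V' W' (f : V -> V') (g : W -> W') :
  linear f -> linear g -> bilin (fun v w => f v ⊗ g w).
Proof.
move=> fl gl; split=> [v a x y|w a x y].
  by rewrite gl tpureDr tpureZr.
by rewrite fl tpureDl tpureZl.
Qed.

Lemma tens_map_linear V W V' W' (f : V -> V') (g : W -> W') :
  linear f -> linear g -> linear (tens_map f g).
Proof. by move=> fl gl; apply/tens_lift_linear/tens_map_bilin. Qed.

Lemma tens_map_pure V W V' W' (f : V -> V') (g : W -> W') v w :
  linear f -> linear g -> tens_map f g (v ⊗ w) = f v ⊗ g w.
Proof. by move=> fl gl; apply/tens_lift_pure/tens_map_bilin. Qed.

Lemma tpure0l V W (w : W) : (0 : V) ⊗ w = 0.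
Proof. by rewrite -(scale0r 0) tpureZl scale0r. Qed.

Lemma tpure0r V W (v : V) : v ⊗ (0 : W) = 0.
Proof. by rewrite -(scale0r 0) tpureZr scale0r. Qed.

Lemma id_linear V : linear (@id V). Proof. by []. Qed.

Lemma comp_linear V W V' (f : V -> W) (g : W -> V') :
  linear f -> linear g -> linear (g \o f).
Proof. by move=> fl gl a x y; rewrite /= fl gl. Qed.

Lemma tens_ext V W V' (f g : V ⊗ W -> V') : linear f -> linear g ->
  (forall v w, f (v ⊗ w) = g (v ⊗ w)) -> f =1 g.
Proof.
move=> fl gl fg; elim/tens_ind=> [//||x y Ex Ey]; first by rewrite !lin0.
by rewrite !linD // Ex Ey.
Qed.

Lemma tens_mapA V W V' W' V'' W'' (f : V -> V') (g : W -> W')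
  (f' : V' -> V'') (g' : W' -> W'') x :
  linear f -> linear g -> linear f' -> linear g' ->
  tens_map f' g' (tens_map f g x) = tens_map (f' \o f) (g' \o g) x.
Proof.
move=> fl gl fl' gl'.
apply: (@tens_ext V W _ (tens_map f' g' \o tens_map f g)) => [||v w /=].
- exact: (comp_linear (tens_map_linear fl gl) (tens_map_linear fl' gl')).
- by apply: tens_map_linear; [apply: comp_linear fl fl'|apply: comp_linear gl gl'].
by rewrite !tens_map_pure //; apply: comp_linear.
Qed.

Lemma tens_proj_sub V W (S : set V) (T : set W) (p : V -> V) (q : W -> W) t :
  subspace S -> subspace T -> linear p -> linear q ->
  (forall v, S (v - p v)) -> (forall w, T (w - q w)) ->
  addset (tens_sub S setT) (tens_sub setT T) (t - tens_map p q t).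
Proof.
move=> sS sT pl ql Sp Tq; have sub : subspace
    (addset (tens_sub S [set: W]) (tens_sub [set: V] T)).
  by apply: addset_subspace; apply: lspan_subspace.
elim/tens_ind: t => [v w||x y].
- exists ((v - p v) ⊗ w); first exact: tens_sub_pure.
  exists (p v ⊗ (w - q w)); first exact: tens_sub_pure.
  rewrite tens_map_pure // -scaleN1r tpureDl tpureZl -(scaleN1r (q w)).
  by rewrite tpureDr tpureZr !scaleN1r addrA subrK.
- by rewrite (lin0 (tens_map_linear pl ql)) subr0; case: sub.
move=> Ex Ey; rewrite (linD (tens_map_linear pl ql)) opprD addrACA.
exact: subspaceD.
Qed.

Lemma tens_proj0 V W V' W' (S : set V) (T : set W) (p : V -> V') (q : W -> W') t :
  linear p -> linear q -> (forall v, S v -> p v = 0) -> (forall w, T w -> q w = 0) ->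
  addset (tens_sub S setT) (tens_sub setT T) t -> tens_map p q t = 0.
Proof.
move=> pl ql p0 q0; have pql := tens_map_linear pl ql.
have s0 : subspace [set x | tens_map p q x = 0].
  have := preimage_subspace pql (@set0_subspace (V' ⊗ W')%type).
  by [].
apply: (addset_min s0); apply: (tens_sub_min s0) => v w Sv Tw /=.
  by rewrite tens_map_pure // p0 // tpure0l.
by rewrite tens_map_pure // q0 // tpure0r.
Qed.

Lemma lin_factor V W V' (f : V -> W) (q : V -> V') : linear f -> linear q ->
  (forall v, f v = 0 -> q v = 0) -> exists2 s, linear s & forall v, q v = s (f v).
Proof.
move=> fl ql fq.
have sI : subspace (range f).
  split; first by exists 0; rewrite ?(lin0 fl).
  by move=> a _ _ [x _ <-] [y _ <-]; exists (a *: x + y); rewrite ?fl.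
have [r [rl r0 rI]] := subspace_proj sI.
have ex w : exists v, f v = w - r w by have [v _ fv] := rI w; exists v.
have [g fg] := choice ex.
have qg v v' : f v = f v' -> q v = q v'.
  move=> E; apply/eqP; rewrite -subr_eq0 -linB //; apply/eqP/fq.
  by rewrite linB // E subrr.
exists (q \o g) => [a x y|v] /=; last first.
  by apply: qg; rewrite fg (r0 _).2 ?subr0 //; exists v.
rewrite -ql; apply: qg; rewrite fl !fg rl opprD addrACA.
by rewrite scalerBr.
Qed.

Lemma tens_map_idB V W (q : W -> W) (t : V ⊗ W) : linear q ->
  tens_map id (fun w => w - q w) t = t - tens_map id q t.
Proof.
move=> ql; have idl := @id_linear V.
have pl : linear (fun w => w - q w).
  by move=> a u v; rewrite ql opprD addrACA scalerBr.
have l : linear (fun t : V ⊗ W => t - tens_map id q t).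
  move=> a u v; rewrite (tens_map_linear idl ql) opprD addrACA.
  by rewrite scalerBr.
refine (tens_ext (tens_map_linear idl pl) l _ t) => a b.
by rewrite !tens_map_pure // -scaleN1r tpureDr tpureZr scaleN1r.
Qed.

Lemma tens_sub_ker V W (T : set W) (q : W -> W) (t : V ⊗ W) :
  linear q -> (forall w, T (w - q w)) -> tens_map id q t = 0 ->
  tens_sub setT T t.
Proof.
move=> ql Tq qt; rewrite -[t]subr0 -qt -tens_map_idB //.
have idl := @id_linear V.
have pl : linear (fun w => w - q w).
  by move=> a u v; rewrite ql opprD addrACA scalerBr.
have sE : subspace (tens_sub [set: V] T) by apply: lspan_subspace.
have := preimage_subspace (tens_map_linear idl pl) sE.
move=> sP; elim/tens_ind: t {qt} => [v w||x y Ex Ey].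
- by rewrite tens_map_pure //; apply: tens_sub_pure.
- by case: sP.
by rewrite (linD (tens_map_linear idl pl)); apply: subspaceD.
Qed.

Lemma tens_sub_cap V W (S : set V) (T T' : set W) t :
  subspace S -> subspace T -> subspace T' -> T `<=` T' ->
  tens_sub setT T' t -> addset (tens_sub S setT) (tens_sub setT T) t ->
  addset (tens_sub S T') (tens_sub setT T) t.
Proof.
move=> sS sT sT' TT' tT' tST.
have [q [ql q0 qr]] := subspace_proj sT'; have idl := @id_linear V.
have pl : linear (fun w => w - q w).
  by move=> a u v; rewrite ql opprD addrACA scalerBr.
have qt : tens_map id q t = 0.
  move: t tT' {tST}; apply: tens_sub_min.
    exact: (preimage_subspace (tens_map_linear idl ql) (@set0_subspace _)).
  by move=> v w _ /q0 qw; rewrite /= tens_map_pure // qw tpure0r.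
rewrite -[t]subr0 -qt -tens_map_idB //.
have sE : subspace (addset (tens_sub S T') (tens_sub [set: V] T)).
  by apply: addset_subspace; apply: lspan_subspace.
have sP := preimage_subspace (tens_map_linear idl pl) sE.
move: {tT' qt} t tST; apply: (addset_min sP); apply: (tens_sub_min sP) => v w Uv Uw /=.
  rewrite tens_map_pure //; apply: addset_l; first exact: lspan_subspace.
  exact: tens_sub_pure.
have /q0 qw := TT' _ Uw.
rewrite tens_map_pure // qw subr0; apply: addset_r; first exact: lspan_subspace.
exact: tens_sub_pure.
Qed.

End SubspaceTheory.

Section TensorAssociativity.
Variables (k : fieldType) (U V W : lmodType k).

Lemma assoc_inner_bilin (w : W) :
  bilin (fun (u : U) (v : V) => u ⊗ (v ⊗ w)).
Proof.
split=> [u a x y|v a x y]; last by rewrite tpureDl tpureZl.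
by rewrite tpureDl tpureZl tpureDr tpureZr.
Qed.

Lemma assoc_bilin : bilin (fun (t : U ⊗ V) (w : W) =>
  tens_lift (fun u v => u ⊗ (v ⊗ w)) t).
Proof.
split=> [t a x y|w]; last exact/tens_lift_linear/assoc_inner_bilin.
rewrite /tens_lift scaler_sumr -big_split; apply: eq_bigr => p _ /=.
by rewrite tpureDr tpureZr tpureDr tpureZr.
Qed.

Lemma tens_assoc_linear : linear (@tens_assoc k U V W).
Proof. exact/tens_lift_linear/assoc_bilin. Qed.

Lemma tens_assoc_pure (u : U) (v : V) (w : W) :
  tens_assoc ((u ⊗ v) ⊗ w) = u ⊗ (v ⊗ w).
Proof.
by rewrite /tens_assoc (tens_lift_pure _ _ assoc_bilin)
  (tens_lift_pure _ _ (assoc_inner_bilin w)).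
Qed.

Lemma tens_assoc_inj : injective (@tens_assoc k U V W).
Proof.
pose g (u : U) (v : V) (w : W) := (u ⊗ v) ⊗ w.
have gb u : bilin (g u).
  split=> [v a x y|w a x y]; rewrite /g; first by rewrite tpureDr tpureZr.
  by rewrite tpureDr tpureZr tpureDl tpureZl.
have hb : bilin (fun u => tens_lift (g u)).
  split=> [u|t a x y]; first exact: tens_lift_linear.
  rewrite /tens_lift scaler_sumr -big_split; apply: eq_bigr => p _ /=.
  by rewrite /g tpureDl tpureZl tpureDl tpureZl.
apply: (can_inj (g := tens_lift (fun u => tens_lift (g u)))).
have lL := comp_linear tens_assoc_linear (tens_lift_linear hb).
have idl := @id_linear _ ((U ⊗ V) ⊗ W)%type.
apply: (tens_ext lL idl) => s w /=; pose i (s : U ⊗ V) := s ⊗ w.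
have il : linear i by move=> a x y; rewrite /i tpureDl tpureZl.
apply: (tens_ext (comp_linear il lL) (comp_linear il idl)) => u v /=.
by rewrite /i tens_assoc_pure (tens_lift_pure _ _ hb) (tens_lift_pure _ _ (gb u)).
Qed.

End TensorAssociativity.

Lemma tens_assoc_nat (k : fieldType) (U V W U' V' W' : lmodType k)
  (f : U -> U') (g : V -> V') (h : W -> W') t :
  linear f -> linear g -> linear h ->
  tens_map f (tens_map g h) (tens_assoc t) =
  tens_assoc (tens_map (tens_map f g) h t).
Proof.
move=> fl gl hl.
have ghl := tens_map_linear gl hl; have fgl := tens_map_linear fl gl.
have lL := comp_linear (@tens_assoc_linear k U V W) (tens_map_linear fl ghl).
have lR := comp_linear (tens_map_linear fgl hl) (@tens_assoc_linear k U' V' W').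
apply: (tens_ext lL lR) => s w /=; pose i (s : U ⊗ V) := s ⊗ w.
have il : linear i by move=> a x y; rewrite /i tpureDl tpureZl.
apply: (tens_ext (comp_linear il lL) (comp_linear il lR)) => u v /=.
by rewrite /i tens_assoc_pure !tens_map_pure // tens_assoc_pure.
Qed.

Section TensorMul.
Variables (k : fieldType) (A : algType k).

Lemma tens_mul_inner_bilin (a b : A) :
  bilin (fun c d : A => (a * c) ⊗ (b * d)).
Proof.
split=> [c e x y|d e x y].
  by rewrite mulrDr -scalerAr tpureDr tpureZr.
by rewrite mulrDr -scalerAr tpureDl tpureZl.
Qed.

Lemma tens_mul_bilin (t : A ⊗ A) : bilin (fun a b : A =>
  tens_lift (fun c d : A => (a * c) ⊗ (b * d)) t).
Proof.
split=> [a e x y|b e x y]; rewrite /tens_lift scaler_sumr -big_split;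
  apply: eq_bigr => p _ /=.
  by rewrite mulrDl -scalerAl tpureDr tpureZr.
by rewrite mulrDl -scalerAl tpureDl tpureZl.
Qed.

Lemma tens_mul_linearl (t : A ⊗ A) : linear (fun s => tens_mul s t).
Proof. exact/tens_lift_linear/tens_mul_bilin. Qed.

Lemma tens_mul_linearr (s : A ⊗ A) : linear (tens_mul s).
Proof.
move=> e x y; pose f (p : A * A) := tens_lift (fun c d => (p.1 * c) ⊗ (p.2 * d)).
transitivity (\sum_(p <- repr s) (e *: f p x + f p y)); last first.
  by rewrite big_split -scaler_sumr.
by apply: eq_bigr => p _; apply/tens_lift_linear/tens_mul_inner_bilin.
Qed.

Lemma tens_mul_pure (a b c d : A) :
  tens_mul (a ⊗ b) (c ⊗ d) = (a * c) ⊗ (b * d).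
Proof.
by rewrite /tens_mul (tens_lift_pure _ _ (tens_mul_bilin _))
  (tens_lift_pure _ _ (tens_mul_inner_bilin _ _)).
Qed.

Lemma tens_mul_sub (S T S' T' : set A) (E : set (A ⊗ A)) s t : subspace E ->
  (forall a b c d, S a -> T b -> S' c -> T' d -> E ((a * c) ⊗ (b * d))) ->
  tens_sub S T s -> tens_sub S' T' t -> E (tens_mul s t).
Proof.
move=> sE h; move: s; apply: tens_sub_min.
  split=> [_|e x y Ex Ey St]; first by rewrite (lin0 (tens_mul_linearl t)); case: sE.
  by rewrite tens_mul_linearl; case: sE => _; apply; [apply: Ex|apply: Ey].
move=> a b Sa Tb; move: t; apply: tens_sub_min.
  exact: (preimage_subspace (@tens_mul_linearr _) sE).
by move=> c d Sc Td; rewrite /= tens_mul_pure; apply: h.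
Qed.

End TensorMul.

Section CoradicalFiltration.
Variables (k : fieldType) (H : hopfAlgType k) (pH : pointed H).
Local Notation F := (corad_filt_pred H).
Local Notation comulL := (@comul_linear k H).

Lemma coradical_subspace : subspace (coradical H).
Proof. exact: lspan_subspace. Qed.

Lemma wedge_subspace (U W : set H) : subspace (wedge U W).
Proof.
apply: (preimage_subspace comulL).
by apply: addset_subspace; apply: lspan_subspace.
Qed.

Lemma corad_filt_pred_subspace n : subspace (F n).
Proof.
case: n => [|[|n]]; first exact: set0_subspace.
  exact: coradical_subspace.
exact: wedge_subspace.
Qed.

Lemma coradical_comul x :
  coradical H x -> tens_sub (coradical H) (coradical H) (comul x).
Proof.
rewrite {1}pH; move: x; apply: lspan_min.
  exact: (preimage_subspace comulL (lspan_subspace _)).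
move=> g Gg; have [-> _] := Gg.
by rewrite pH; apply: tens_sub_pure; apply: sub_lspan.
Qed.

Lemma corad_filt_pred_leS n : F n `<=` F n.+1.
Proof.
elim: n => [|[|n] IHn] x.
- by move=> ->; case: coradical_subspace.
- move=> Hx; apply: addset_l; first exact: lspan_subspace.
  by apply: tens_subS (coradical_comul Hx).
move=> [s Ss [t St E]]; exists s => //; exists t => //.
by apply: tens_subS St.
Qed.

Lemma corad_filt_pred_le m n : (m <= n)%N -> F m `<=` F n.
Proof.
move=> /subnK<-; elim: (n - m)%N => // i IHi.
exact: subset_trans (@corad_filt_pred_leS (i + m)).
Qed.

Lemma comul_corad_filt n x : F n.+1 x ->
  addset (tens_sub (coradical H) (F n.+1)) (tens_sub setT (F n)) (comul x).
Proof.
case: n => [|n] Fx.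
  by apply: addset_l (coradical_comul Fx); apply: lspan_subspace.
have [q0 [q0l q00 q0r]] := subspace_proj coradical_subspace.
have [qm [qml qm0 qmr]] := subspace_proj (corad_filt_pred_subspace n.+1).
have [qn [qnl qn0 qnr]] := subspace_proj (corad_filt_pred_subspace n.+2).
pose f := tens_map q0 qm \o (@comul k H).
have fl : linear f := comp_linear comulL (tens_map_linear q0l qml).
have f0 y : f y = 0 -> F n.+2 y.
  move=> fy; rewrite /= /wedge /=; rewrite -[comul y]subr0 -fy.
  apply: tens_proj_sub => //; first exact: coradical_subspace.
  exact: (corad_filt_pred_subspace n.+1).
have [s sl qs] : exists2 s, linear s & forall v, qn v = s (f v).
  by apply: lin_factor => // v /f0 /qn0.
have idl := @id_linear k H.
have qnx : tens_map id qn (comul x) = 0.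
  have -> : qn = s \o f by apply/funext.
  rewrite -[id]/(id \o @id H) -tens_mapA //.
  have -> : tens_map id f (comul x) = 0.
    rewrite /f -[id]/(id \o @id H) -tens_mapA //;
      [|exact: comulL|exact: tens_map_linear].
    rewrite -comulA tens_assoc_nat // tens_mapA //;
      [|exact: comulL|exact: tens_map_linear].
    rewrite (_ : tens_map _ _ _ = 0) ?(lin0 (@tens_assoc_linear k _ _ _)) //.
    apply: tens_proj0 Fx => //.
    - by apply: (comp_linear comulL); apply: tens_map_linear.
    - move=> v /coradical_comul /=; move: (comul v); apply: tens_sub_min.
        exact: (preimage_subspace (tens_map_linear idl q0l) (@set0_subspace _ _)).
      by move=> a b _ /q00 qb; rewrite /= tens_map_pure // qb tpure0r.
    - by move=> w /qm0.
  exact: (lin0 (tens_map_linear idl sl)).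
apply: tens_sub_cap => //; first exact: coradical_subspace.
- exact: (corad_filt_pred_subspace n.+1).
- exact: wedge_subspace.
- exact: (@corad_filt_pred_leS n.+1).
exact: tens_sub_ker qnl qnr qnx.
Qed.

Lemma corad_filt_predS n : F n.+1 = wedge (F 1) (F n).
Proof.
case: n => // ; apply/seteqP; split=> x Hx.
  by apply: addset_l (tens_subS _ _ (coradical_comul Hx)) => //; apply: lspan_subspace.
have [q [ql q0 qr]] := subspace_proj coradical_subspace.
have idl := @id_linear k H.
pose e t : H := tens_lift (fun a b : H => counit b *: a) t.
have eb : bilin (fun a b : H => counit b *: a).
  split=> [a c x1 y1|b c x1 y1]; first by rewrite counit_linear scalerDl scalerA.
  by rewrite scalerDr scalerA mulrC -scalerA.
have sP := preimage_subspace (tens_lift_linear eb) coradical_subspace.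
rewrite /= -[x]counitr; move: Hx; apply: (addset_min sP); apply: (tens_sub_min sP).
  move=> a b Ca _; rewrite /= (tens_lift_pure _ _ eb).
  by apply: subspaceZ => //; apply: coradical_subspace.
move=> a b _ ->; rewrite tpure0r.
by rewrite /= (lin0 (tens_lift_linear eb)); case: coradical_subspace.
Qed.

Lemma corad_filt_pred_wedge i j : F (i + j) `<=` wedge (F i) (F j).
Proof.
elim: i j => [|i IHi] j x.
  case: j => [->|j Fx].
    by have := wedge_subspace (F 0) (F 0); case.
  have [s Ss [t Tt E]] := comul_corad_filt Fx.
  apply: addset_r; first exact: lspan_subspace.
  rewrite -E; apply: subspaceD; first exact: lspan_subspace.
    exact: tens_subS Ss.
  by apply: tens_subS Tt => //; apply: (@corad_filt_pred_leS j).
rewrite addSn corad_filt_predS => Fx.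
have [q0 [q0l q00 q0r]] := subspace_proj (corad_filt_pred_subspace 1).
have [qi [qil qi0 qir]] := subspace_proj (corad_filt_pred_subspace i).
have [qj [qjl qj0 qjr]] := subspace_proj (corad_filt_pred_subspace j).
have [qn [qnl qn0 qnr]] := subspace_proj (corad_filt_pred_subspace i.+1).
have idl := @id_linear k H.
have q0il := tens_map_linear q0l qil; have qijl := tens_map_linear qil qjl.
pose f := tens_map q0 qi \o (@comul k H).
have fl : linear f := comp_linear comulL q0il.
have f0 y : f y = 0 -> F i.+1 y.
  move=> fy; rewrite corad_filt_predS /wedge /= -[comul y]subr0 -fy.
  apply: tens_proj_sub => //; first exact: (corad_filt_pred_subspace 1).
  exact: (corad_filt_pred_subspace i).
have [s sl qs] : exists2 s, linear s & forall v, qn v = s (f v).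
  by apply: lin_factor => // v /f0 /qn0.
have fx : tens_map f qj (comul x) = 0.
  apply: tens_assoc_inj; rewrite (lin0 (@tens_assoc_linear k _ _ _)).
  rewrite -[qj]/(qj \o @id H) -(tens_mapA _ comulL idl q0il qjl).
  rewrite -(tens_assoc_nat _ q0l qil qjl) comulA (tens_mapA _ idl comulL q0l qijl).
  apply: tens_proj0 Fx => //; first exact: comp_linear comulL qijl.
    by move=> v /q00.
  by move=> w /IHi /=; apply: tens_proj0 => // v; [move/qi0|move/qj0].
have qx : tens_map qn qj (comul x) = 0.
  have -> : qn = s \o f by apply/funext.
  rewrite -[qj]/(id \o qj) -tens_mapA // fx.
  exact: lin0 (tens_map_linear sl idl).
rewrite /wedge /= -[comul x]subr0 -qx.
apply: tens_proj_sub => //; first exact: (corad_filt_pred_subspace i.+1).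
exact: (corad_filt_pred_subspace j).
Qed.

Lemma coradicalM x y : coradical H x -> coradical H y -> coradical H (x * y).
Proof.
rewrite pH => Hx Hy; move: x Hx; apply: lspan_min.
  split=> [|a u v]; first by rewrite /= mul0r; case: (lspan_subspace [set g : H | grouplike g]).
  by rewrite /= mulrDl -scalerAl; case: (lspan_subspace [set g : H | grouplike g]) => _; apply.
move=> g [gg g1]; move: y Hy; apply: lspan_min.
  split=> [|a u v]; first by rewrite /= mulr0; case: (lspan_subspace [set g : H | grouplike g]).
  by rewrite /= mulrDr -scalerAr; case: (lspan_subspace [set g : H | grouplike g]) => _; apply.
move=> h [hh h1]; apply: sub_lspan; split; last by rewrite counitM g1 h1 mulr1.
by rewrite comulM gg hh tens_mul_pure.
Qed.

Lemma coradical1 : coradical H 1.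
Proof. by rewrite pH; apply: sub_lspan; split; [apply: comul1|apply: counit1]. Qed.

Lemma corad_filt_predM i j x y : F i x -> F j y -> F (i + j).-1 (x * y).
Proof.
have [N] := ubnP (i + j); elim: N i j x y => // N IHN [|i] [|j] x y ltN.
- by move=> -> _; rewrite mul0r; case: (corad_filt_pred_subspace 0).
- by move=> -> _; rewrite mul0r; case: (corad_filt_pred_subspace j).
- by move=> _ ->; rewrite mulr0; case: (corad_filt_pred_subspace (i.+1 + 0).-1).
have [/andP[/eqP-> /eqP->]|ij0] := boolP ((i == 0) && (j == 0))%N.
  exact: coradicalM.
move=> Fx Fy.
have [n nE] : exists n, (i + j)%N = n.+1.
  by exists (i + j).-1; rewrite prednK // lt0n addn_eq0.
have -> : (i.+1 + j.+1).-1 = n.+2 by rewrite addnS addSn nE.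
rewrite addnS addSn ltnS in ltN.
have [s1 S1 [t1 T1 ex]] := comul_corad_filt Fx.
have [s2 S2 [t2 T2 ey]] := comul_corad_filt Fy.
rewrite /= /wedge /= comulM -ex -ey.
have sL := @lspan_subspace k (H ⊗ H)%type.
rewrite (linD (@tens_mul_linearr k H _)).
rewrite !(linD (@tens_mul_linearl k H _)) -!addrA.
exists (tens_mul s1 s2).
  apply: tens_mul_sub S1 S2; first exact: sL.
  by move=> a b c d Sa _ Sc _; apply: tens_sub_pure => //; apply: coradicalM.
eexists; last reflexivity.
have sT := sL [set u ⊗ w | u in [set: H] & w in corad_filt H n].
have key a b (u v : H) : F a u -> F b v -> (a + b <= n.+2)%N -> F n.+1 (u * v).
  move=> Fu Fv ab; apply: (@corad_filt_pred_le (a + b).-1).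
    by case: (a + b)%N ab.
  by apply: IHN => //; apply: leq_ltn_trans ab _; rewrite -nE.
apply: subspaceD; first exact: sT.
  apply: tens_mul_sub T1 S2; first exact: sT.
  move=> a b c d _ Fb _ Fd; apply: tens_sub_pure => //.
  by apply: key Fb Fd _; rewrite addnS nE.
apply: subspaceD; first exact: sT.
  apply: tens_mul_sub S1 T2; first exact: sT.
  move=> a b c d _ Fb _ Fd; apply: tens_sub_pure => //.
  by apply: key Fb Fd _; rewrite addSn nE.
apply: tens_mul_sub T1 T2; first exact: sT.
move=> a b c d _ Fb _ Fd; apply: tens_sub_pure => //.
by apply: key Fb Fd _; rewrite nE.
Qed.

End CoradicalFiltration.

Section AssociatedGraded.
Variables (k : fieldType) (H : hopfAlgType k) (pH : pointed H).

(* A finitely supported sequence (x_n) with x_n in H_n is stored as the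
   polynomial \sum_n x_n X^n, so that convolution is polynomial product. The
   unused argument lets type inference find the proof that such sequences form
   a ring, which depends on H being pointed. *)
Definition in_filt_sum (pH0 : pointed H) : {pred {poly H}} :=
  fun p => `[< forall n, corad_filt H n p`_n >].

Lemma in_filt_sumP (p : {poly H}) :
  reflect (forall n, corad_filt H n p`_n) (p \in in_filt_sum pH).
Proof. exact: asboolP. Qed.

Lemma corad_filt_subspace n : subspace (corad_filt H n).
Proof. exact: (corad_filt_pred_subspace H n.+1). Qed.

Lemma corad_filtM i j x y :
  corad_filt H i x -> corad_filt H j y -> corad_filt H (i + j) (x * y).
Proof.
by move=> Fx Fy; have := @corad_filt_predM _ _ pH i.+1 j.+1 x y Fx Fy; rewrite addnS addSn.
Qed.

Lemma in_filt_sum_subring : subring_closed (in_filt_sum pH).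
Proof.
split=> [|p q /in_filt_sumP Fp /in_filt_sumP Fq|p q /in_filt_sumP Fp /in_filt_sumP Fq];
  apply/in_filt_sumP => n.
- rewrite coef1; case: n => [|n] /=; first exact: coradical1.
  by case: (corad_filt_subspace n.+1).
- by rewrite coefB; apply: subspaceB => //; apply: corad_filt_subspace.
rewrite coefM; apply: subspace_sum; first exact: corad_filt_subspace.
move=> i _; have -> : corad_filt H n = corad_filt H (i + (n - i))%N.
  by rewrite subnKC // -ltnS.
exact: corad_filtM.
Qed.

HB.instance Definition _ :=
  GRing.isSubringClosed.Build {poly H} (in_filt_sum pH) in_filt_sum_subring.

Record filt_sum (pH0 : pointed H) :=
  FiltSum { filt_seq :> {poly H}; filt_seqP : filt_seq \in in_filt_sum pH0 }.

HB.instance Definition _ := [isSub for @filt_seq pH].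
HB.instance Definition _ := [Choice of filt_sum pH by <:].
HB.instance Definition _ := [SubChoice_isSubNzRing of filt_sum pH by <:].

Lemma filt_sumP (p : filt_sum pH) n : corad_filt H n p`_n.
Proof. by move/in_filt_sumP: (filt_seqP p); apply. Qed.

(* the sequences (x_n) with x_n in H_{n-1} *)
Definition filt_sum_pred (pH0 : pointed H) : {pred filt_sum pH0} :=
  fun p => `[< forall n, corad_filt_pred H n p`_n >].
Arguments filt_sum_pred : clear implicits.

Lemma filt_sum_predP (p : filt_sum pH) :
  reflect (forall n, corad_filt_pred H n p`_n) (p \in filt_sum_pred pH).
Proof. exact: asboolP. Qed.

Lemma filt_sum_pred_zmod : zmod_closed (filt_sum_pred pH).
Proof.
split=> [|p q /filt_sum_predP Fp /filt_sum_predP Fq]; apply/filt_sum_predP => n.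
  by rewrite /= coef0; case: (corad_filt_pred_subspace H n).
by rewrite /= coefB; apply: subspaceB => //; apply: corad_filt_pred_subspace.
Qed.

HB.instance Definition _ :=
  GRing.isZmodClosed.Build (filt_sum pH) (filt_sum_pred pH) filt_sum_pred_zmod.

(* gr H = (\bigoplus_n H_n) / (\bigoplus_n H_{n-1}) = \bigoplus_n H_n / H_{n-1} *)
Definition gr := Quotient.quot (filt_sum_pred pH).

HB.instance Definition _ := GRing.Zmodule.on gr.
HB.instance Definition _ := Quotient.on gr.

Definition gr_class (p : filt_sum pH) : gr := \pi_gr p.

Lemma gr_class_repr (x : gr) : gr_class (repr x) = x.
Proof. exact: reprK. Qed.

Lemma gr_classP (p q : filt_sum pH) :
  gr_class p = gr_class q <-> forall n, corad_filt_pred H n (p`_n - q`_n).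
Proof.
rewrite /gr_class; split=> [/eqP|pq].
  rewrite -Quotient.idealrBE => /filt_sum_predP pq n.
  by have := pq n; rewrite /= coefB.
apply/eqP; rewrite -Quotient.idealrBE; apply/filt_sum_predP => n.
by rewrite /= coefB.
Qed.

Lemma gr_classD p q : gr_class p + gr_class q = gr_class (p + q).
Proof. by rewrite /gr_class !piE. Qed.

Definition gr_one : gr := gr_class 1.

Definition gr_mul (x y : gr) : gr := gr_class (repr x * repr y).

Lemma gr_mulE p q : gr_mul (gr_class p) (gr_class q) = gr_class (p * q).
Proof.
have hp := (gr_classP _ _).1 (gr_class_repr (gr_class p)).
have hq := (gr_classP _ _).1 (gr_class_repr (gr_class q)).
apply/gr_classP => n; set p' := repr _ in hp *; set q' := repr _ in hq *.
rewrite /= -coefB.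
have -> : val p' * val q' - val p * val q =
    (val p' - val p) * val q' + val p * (val q' - val q).
  by rewrite mulrBl mulrBr addrA subrK.
rewrite coefD !coefM.
have sF := corad_filt_pred_subspace H n.
apply: subspaceD => //; apply: subspace_sum => // i _; rewrite coefB.
  have -> : corad_filt_pred H n = corad_filt_pred H (i + (n - i).+1).-1.
    by rewrite addnS /= subnKC // -ltnS.
  by apply: (corad_filt_predM pH (hp i)); apply: filt_sumP.
have -> : corad_filt_pred H n = corad_filt_pred H (i.+1 + (n - i)).-1.
  by rewrite addSn /= subnKC // -ltnS.
by apply: (corad_filt_predM pH _ (hq _)); apply: filt_sumP.
Qed.

Let ind (P : gr -> Prop) : (forall p, P (gr_class p)) -> forall x, P x.
Proof. by move=> Pp x; rewrite -(gr_class_repr x). Qed.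

Lemma gr_mulA : associative gr_mul.
Proof. by elim/ind=> p; elim/ind=> q; elim/ind=> r; rewrite !gr_mulE mulrA. Qed.

Lemma gr_mul1l : left_id gr_one gr_mul.
Proof. by elim/ind=> p; rewrite gr_mulE mul1r. Qed.

Lemma gr_mul1r : right_id gr_one gr_mul.
Proof. by elim/ind=> p; rewrite gr_mulE mulr1. Qed.

Lemma gr_mulDl : left_distributive gr_mul +%R.
Proof.
elim/ind=> p; elim/ind=> q; elim/ind=> r.
by rewrite !gr_mulE !gr_classD gr_mulE mulrDl.
Qed.

Lemma gr_mulDr : right_distributive gr_mul +%R.
Proof.
elim/ind=> p; elim/ind=> q; elim/ind=> r.
by rewrite !gr_mulE !gr_classD gr_mulE mulrDr.
Qed.

Lemma gr_one_neq0 : gr_one != 0.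
Proof.
apply/eqP; have -> : 0 = gr_class 0 by rewrite /gr_class !piE.
move=> /gr_classP /(_ 0) /=; rewrite coef1 coef0 subr0 => /eqP.
by rewrite oner_eq0.
Qed.

HB.instance Definition _ := GRing.Zmodule_isNzRing.Build gr
  gr_mulA gr_mul1l gr_mul1r gr_mulDl gr_mulDr gr_one_neq0.

Lemma filt_scale_subproof a (p : filt_sum pH) :
  a%:A *: (p : {poly H}) \in in_filt_sum pH.
Proof.
apply/in_filt_sumP => n; rewrite coefZ mulr_algl.
by apply: subspaceZ; [apply: corad_filt_subspace|apply: filt_sumP].
Qed.

Definition filt_scale (a : k) (p : filt_sum pH) : filt_sum pH :=
  FiltSum (filt_scale_subproof a p).

Lemma filt_scale_coef a p n : (filt_scale a p)`_n = a *: p`_n.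
Proof. by rewrite /= coefZ mulr_algl. Qed.

Definition gr_scale (a : k) (x : gr) : gr := gr_class (filt_scale a (repr x)).

Lemma gr_scaleE a p : gr_scale a (gr_class p) = gr_class (filt_scale a p).
Proof.
have hp := (gr_classP _ _).1 (gr_class_repr (gr_class p)).
apply/gr_classP => n; rewrite !filt_scale_coef -scalerBr.
by apply: subspaceZ; first exact: corad_filt_pred_subspace.
Qed.

Lemma gr_eq (p q : filt_sum pH) :
  (forall n, p`_n = q`_n) -> gr_class p = gr_class q.
Proof.
move=> pq; apply/gr_classP => n; rewrite pq subrr.
by case: (corad_filt_pred_subspace H n).
Qed.

Lemma gr_scaleA a b x : gr_scale a (gr_scale b x) = gr_scale (a * b) x.
Proof.
elim/ind: x => p; rewrite !gr_scaleE; apply: gr_eq => n.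
by rewrite !filt_scale_coef scalerA.
Qed.

Lemma gr_scale1 : left_id 1 gr_scale.
Proof.
elim/ind=> p; rewrite !gr_scaleE; apply: gr_eq => n.
by rewrite !filt_scale_coef scale1r.
Qed.

Lemma gr_scaleDr : right_distributive gr_scale +%R.
Proof.
move=> a; elim/ind=> p; elim/ind=> q.
rewrite !gr_scaleE !gr_classD gr_scaleE; apply: gr_eq => n.
by rewrite filt_scale_coef [in RHS]coefD !filt_scale_coef /= coefD scalerDr.
Qed.

Lemma gr_scaleDl x : {morph gr_scale^~ x : a b / a + b}.
Proof.
move=> a b; elim/ind: x => p.
rewrite !gr_scaleE !gr_classD; apply: gr_eq => n.
by rewrite filt_scale_coef [in RHS]coefD !filt_scale_coef scalerDl.
Qed.

HB.instance Definition _ := GRing.Zmodule_isLmodule.Build k gr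
  gr_scaleA gr_scale1 gr_scaleDr gr_scaleDl.

Lemma gr_classZ a (p : filt_sum pH) :
  a *: gr_class p = gr_class (filt_scale a p).
Proof. exact: gr_scaleE. Qed.

Lemma gr_scaleAl (a : k) (x y : gr) : a *: (x * y) = (a *: x) * y.
Proof.
elim/ind: x => p; elim/ind: y => q.
rewrite /GRing.scale /GRing.mul /= gr_mulE !gr_scaleE gr_mulE; apply: gr_eq => n.
by rewrite /= -scalerAl.
Qed.

Lemma gr_scaleAr (a : k) (x y : gr) : a *: (x * y) = x * (a *: y).
Proof.
elim/ind: x => p; elim/ind: y => q.
rewrite /GRing.scale /GRing.mul /= gr_mulE !gr_scaleE gr_mulE; apply: gr_eq => n.
rewrite filt_scale_coef /= !coefM scaler_sumr; apply: eq_bigr => i _.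
by rewrite coefZ mulr_algl scalerAr.
Qed.

HB.instance Definition _ := GRing.Lmodule_isLalgebra.Build k gr gr_scaleAl.
HB.instance Definition _ := GRing.Lalgebra_isAlgebra.Build k gr gr_scaleAr.
End AssociatedGraded.

Section GradedComultiplication.
Variables (k : fieldType) (H : hopfAlgType k) (pH : pointed H).
Local Notation F := (corad_filt_pred H).

(* the class in H_n / H_{n-1} of x in H_n; 0 when x is not in H_n *)
Definition gr_in (n : nat) (x : H) : gr pH :=
  gr_class (insubd (0 : filt_sum pH) (x *: 'X^n)).

(* [decomp n x s] holds when s i lists tensors in H_i (x) H_{n-i}, for i <= n,
   that add up to the comultiplication of x. *)
Definition decomp (n : nat) (x : H) (s : nat -> seq (H * H)) : Prop :=
  (forall i p, (i <= n)%N -> p \in s i ->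
     corad_filt H i p.1 /\ corad_filt H (n - i) p.2) /\
  comul x = \sum_(i < n.+1) \sum_(p <- s i) p.1 ⊗ p.2.

Definition gr_decomp (n : nat) (s : nat -> seq (H * H)) : gr pH ⊗ gr pH :=
  \sum_(i < n.+1) \sum_(p <- s i) gr_in i p.1 ⊗ gr_in (n - i) p.2.

(* Delta of the class of x in H_n / H_{n-1}: the class of Delta x in
   \bigoplus_i H_i / H_{i-1} (x) H_{n-i} / H_{n-i-1}. A decomposition s exists
   by [decomp_exists], and the result does not depend on it by [gr_comul_homE]. *)
Definition gr_comul_hom (n : nat) (x : H) : gr pH ⊗ gr pH :=
  xget 0 [set t | exists2 s, decomp n x s & t = gr_decomp n s].

(* Independent of the representative of a, and linear: see [gr_comul_in] and
   [gr_comul_linear]. *)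
Definition gr_comul (a : gr pH) : gr pH ⊗ gr pH :=
  \sum_(n < size (repr a : {poly H})) gr_comul_hom n (repr a : {poly H})`_n.

Lemma gr_in_coef n x : corad_filt H n x ->
  forall i, (insubd (0 : filt_sum pH) (x *: 'X^n))`_i = if i == n then x else 0.
Proof.
move=> Fx i; rewrite val_insubd ifT; first by rewrite coefZ coefXn mulr_natr mulrb.
apply/in_filt_sumP => j; rewrite coefZ coefXn mulr_natr mulrb.
by case: eqP => [->//|_]; case: (corad_filt_subspace H j).
Qed.

Lemma gr_in_linear n a x y : corad_filt H n x -> corad_filt H n y ->
  gr_in n (a *: x + y) = a *: gr_in n x + gr_in n y.
Proof.
move=> Fx Fy; rewrite /gr_in gr_classZ gr_classD.
apply: gr_eq => i; rewrite coefD filt_scale_coef !gr_in_coef //.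
  by case: eqP; rewrite ?scaler0 ?addr0.
by case: (corad_filt_subspace H n) => _; apply.
Qed.

Lemma gr_in0 n x : F n x -> gr_in n x = 0.
Proof.
move=> Fx; have -> : 0 = gr_class (0 : filt_sum pH) by rewrite /gr_class !piE.
apply/gr_classP => i; rewrite gr_in_coef; last exact: (@corad_filt_pred_leS _ _ pH n).
by rewrite coef0 subr0; case: eqP => [->//|_]; case: (corad_filt_pred_subspace H i).
Qed.

Lemma decomp_exists n x : corad_filt H n x -> exists s, decomp n x s.
Proof.
move=> Fx.
suff : forall m, (m <= n.+1)%N -> exists s : nat -> seq (H * H),
    (forall i p, (i < m)%N -> p \in s i -> F i.+1 p.1 /\ F (n - i).+1 p.2) /\
    tens_sub setT (F (n.+1 - m))
      (comul x - \sum_(i < m) \sum_(p <- s i) p.1 ⊗ p.2).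
  move=> /(_ n.+1 (leqnn _)) [s [Fs]]; rewrite subnn => E.
  exists s; split=> [i p|]; first by rewrite -ltnS; apply: Fs.
  have t0 : tens_sub [set: H] [set (0 : H)] `<=` [set 0].
    by apply: tens_sub_min; [apply: set0_subspace|move=> v w _ ->; rewrite /= tpure0r].
  by apply/eqP; rewrite -subr_eq0; apply/eqP/t0.
elim=> [_|m IHm ltm].
  exists (fun=> [::]); split=> //; rewrite big_ord0 subr0 subn0.
  have [s Ss [t Tt <-]] := comul_corad_filt pH (Fx : F n.+1 x).
  apply: subspaceD; first exact: lspan_subspace.
    exact: tens_subS Ss.
  by apply: tens_subS Tt => //; apply: (@corad_filt_pred_leS _ _ pH n).
have [s [Fs Ts]] := IHm (ltnW ltm).
have sF j := corad_filt_pred_subspace H j.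
have sL := @lspan_subspace k (H ⊗ H)%type.
have nmE : (n.+1 - m)%N = (n - m).+1 by rewrite subSn // -ltnS.
have : addset (tens_sub (F m.+1) [set: H]) (tens_sub setT (F (n - m)))
    (comul x - \sum_(i < m) \sum_(p <- s i) p.1 ⊗ p.2).
  apply: subspaceB; first by apply: addset_subspace; apply: sL.
    apply: (corad_filt_pred_wedge pH); rewrite addSn subnKC // -ltnS.
  apply: addset_l; first exact: sL.
  apply: subspace_sum => [|i _]; first exact: sL.
  apply: subspace_sum => [|p ps]; first exact: sL.
  have [F1 _] := Fs i p (ltn_ord i) ps.
  apply: tens_sub_pure => //; apply: (corad_filt_pred_le pH _ F1).
  by rewrite ltnS ltnW.
rewrite nmE in Ts.
move=> /(tens_sub_cap (sF _) (sF _) (sF _)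
  (@corad_filt_pred_leS _ _ pH (n - m)%N) Ts).
move=> [u [r Sr uE] [v Tv E]].
have exg (q : k * (H ⊗ H)) : exists p : H * H, q \in r ->
    [/\ F m.+1 p.1, F (n - m).+1 p.2 & p.1 ⊗ p.2 = q.2].
  have [qr|nq] := boolP (q \in r).
    by have [a Fa [b Fb ab]] := Sr q qr; exists (a, b).
  by exists (0, 0).
have [g gP] := choice exg.
pose r' := [seq (q.1 *: (g q).1, (g q).2) | q <- r].
exists (fun i => if i == m then r' else s i); split.
  move=> i p; rewrite ltnS leq_eqVlt; case: eqVneq => [->|_] /=; last exact: Fs.
  move=> _ /mapP [q qr ->]; have [F1 F2 _] := gP q qr.
  by split=> //; apply: (subspaceZ _ (sF m.+1)).
rewrite subSS big_ord_recr /= eqxx opprD addrA.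
rewrite (eq_bigr (fun i : 'I_m => \sum_(p <- s i) p.1 ⊗ p.2)); last first.
  by move=> i _; rewrite ltn_eqF.
rewrite -E uE (_ : \sum_(p <- r') _ = \sum_(p <- r) p.1 *: p.2).
  by rewrite addrAC subrr add0r.
rewrite big_map big_seq [RHS]big_seq; apply: eq_bigr => q qr.
by have [_ _ e] := gP q qr; rewrite /= tpureZl e.
Qed.

Lemma gr_comul_hom_linear n : exists T : H -> gr pH ⊗ gr pH,
  [/\ linear T, forall x s, decomp n x s -> gr_decomp n s = T x
    & forall x, F n x -> T x = 0].
Proof.
have ex i : exists f : H -> gr pH, linear f /\
    (forall x, corad_filt H i x -> f x = gr_in i x).
  have [q [ql q0 qr]] := subspace_proj (corad_filt_subspace H i).
  exists (fun x => gr_in i (x - q x)); split.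
    move=> a x y; rewrite -gr_in_linear // ql opprD addrACA.
    by rewrite scalerBr.
  by move=> x /q0 ->; rewrite subr0.
have [f fP] := choice ex.
have fl i : linear (f i) by case: (fP i).
have fin i x : corad_filt H i x -> f i x = gr_in i x by case: (fP i) => _; apply.
have f0 i j x : (j <= i)%N -> F j x -> f i x = 0.
  move=> ji /(corad_filt_pred_le pH ji) Fx.
  rewrite fin ?gr_in0 //; exact: (@corad_filt_pred_leS _ _ pH _ _ Fx).
have ffl i := tens_map_linear (fl i) (fl (n - i)%N).
have comulL := @comul_linear k H.
pose T x := \sum_(i < n.+1) tens_map (f i) (f (n - i)%N) (comul x).
exists T; split=> [a x y|x s [Fs xE]|x].
- rewrite /T scaler_sumr -big_split; apply: eq_bigr => i _ /=.
  by rewrite comulL ffl.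
- rewrite /T /gr_decomp; apply: eq_bigr => i _.
  rewrite xE (lin_sum _ _ (ffl i)) (bigD1 i) //= [X in _ = _ + X]big1 ?addr0.
    rewrite (lin_sum _ _ (ffl i)) big_seq [RHS]big_seq; apply: eq_bigr => p ps.
    have [F1 F2] := Fs i p (leq_ord i) ps.
    by rewrite tens_map_pure // !fin.
  move=> j ji; rewrite (lin_sum _ _ (ffl i)) big_seq big1 // => p ps.
  have [F1 F2] := Fs j p (leq_ord j) ps; rewrite tens_map_pure //.
  have [lji|lij|E] := ltngtP j i; last by rewrite (val_inj E) eqxx in ji.
    by rewrite (f0 i j.+1 p.1) ?tpure0l.
  rewrite (f0 (n - i)%N (n - j).+1 p.2) ?tpure0r //.
  by apply: ltn_sub2l => //; apply: leq_trans lij (leq_ord j).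
case: n @T ffl => [|n] T ffl Fx.
  by rewrite /T Fx (lin0 comulL) big1 // => i _; rewrite (lin0 (ffl i)).
have [s [Fs xE]] := decomp_exists Fx.
rewrite /T big1 // => i _; rewrite xE (lin_sum _ _ (ffl i)) big1 // => j _.
rewrite (lin_sum _ _ (ffl i)) big_seq big1 // => p ps.
have [F1 F2] := Fs j p (leq_ord j) ps; rewrite tens_map_pure //.
have [ji|ij] := ltnP j i; first by rewrite (f0 i j.+1 p.1) ?tpure0l.
rewrite (f0 (n.+1 - i)%N (n - j).+1 p.2) ?tpure0r //.
by rewrite -subSn ?leq_ord // leq_sub2l.
Qed.

Lemma gr_comul_homE n x s : decomp n x s -> gr_comul_hom n x = gr_decomp n s.
Proof.
move=> ds; have [T [_ TE _]] := gr_comul_hom_linear n.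
rewrite /gr_comul_hom; case: xgetP => [_ -> [s' ds' ->]|/(_ (gr_decomp n s))].
  by rewrite (TE _ _ ds) (TE _ _ ds').
by move=> /= h; case: h; exists s.
Qed.

Lemma gr_comulE : exists2 T : nat -> H -> gr pH ⊗ gr pH,
  (forall n, linear (T n)) /\
  (forall n x, corad_filt H n x -> gr_comul_hom n x = T n x) &
  forall (p : filt_sum pH) N, (size (p : {poly H}) <= N)%N ->
    gr_comul (gr_class p) = \sum_(n < N) T n p`_n.
Proof.
have [T TP] := choice gr_comul_hom_linear.
have TL n : linear (T n) by case: (TP n).
have homT n x : corad_filt H n x -> gr_comul_hom n x = T n x.
  move=> Fx; have [s ds] := decomp_exists Fx.
  by rewrite (gr_comul_homE ds); case: (TP n) => _ /(_ _ _ ds).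
have ext (q : filt_sum pH) M N : (size (q : {poly H}) <= M)%N -> (M <= N)%N ->
    \sum_(n < M) T n q`_n = \sum_(n < N) T n q`_n.
  move=> qM MN; rewrite (big_ord_widen N (fun n => T n q`_n) MN) big_mkcond.
  apply: eq_bigr => n _; case: ltnP => // Mn.
  by rewrite nth_default ?(lin0 (TL n)) //; apply: leq_trans Mn.
exists T => // p N pN; rewrite /gr_comul; set p' := repr _.
rewrite (eq_bigr (fun n : 'I__ => T n p'`_n)); last first.
  by move=> n _; rewrite homT //; apply: filt_sumP.
rewrite (ext p' _ (maxn N (size (p' : {poly H})))) ?leq_maxr //.
rewrite (ext p N (maxn N (size (p' : {poly H})))) ?leq_maxl //.
apply: eq_bigr => n _; apply/eqP; rewrite -subr_eq0 -(linB (TL n)).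
case: (TP n) => _ _ ->//; apply: (gr_classP _ _).1.
by rewrite gr_class_repr.
Qed.

Lemma gr_comul_linear : linear gr_comul.
Proof.
have [T [TL _] TE] := gr_comulE.
move=> a x y; rewrite -(gr_class_repr x) -(gr_class_repr y) gr_classZ gr_classD.
set p := repr x; set q := repr y; set r := filt_scale a p + q.
pose N := maxn (size (r : {poly H})) (maxn (size (p : {poly H})) (size (q : {poly H}))).
have rN : (size (r : {poly H}) <= N)%N by apply: leq_maxl.
have pN : (size (p : {poly H}) <= N)%N by rewrite !leq_max leqnn orbT.
have qN : (size (q : {poly H}) <= N)%N by rewrite !leq_max leqnn !orbT.
rewrite (TE _ _ rN) (TE _ _ pN) (TE _ _ qN) scaler_sumr -big_split.
by apply: eq_bigr => n _; rewrite coefD filt_scale_coef TL.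
Qed.

Lemma gr_comul_in n x s : decomp n x s -> corad_filt H n x ->
  gr_comul (gr_in n x) = gr_decomp n s.
Proof.
move=> ds Fx; have [T [TL homT] TE] := gr_comulE.
rewrite -(gr_comul_homE ds) homT // /gr_in; set p := insubd _ _.
rewrite (TE p (maxn (size (p : {poly H})) n.+1)) ?leq_maxl //.
have nM : (n < maxn (size (p : {poly H})) n.+1)%N by apply: leq_maxr.
rewrite (bigD1 (Ordinal nM)) //= big1 ?addr0 => [|i]; first by rewrite gr_in_coef // eqxx.
rewrite -val_eqE /= => /negbTE ni; rewrite gr_in_coef // ni.
exact: lin0 (TL i).
Qed.

End GradedComultiplication.

Section Coinvariants.
Variables (k : fieldType) (H : hopfAlgType k) (pH : pointed H).

(* The projection psi of gr H onto its degree-zero part H_0 / H_{-1} = H_0,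
   which is viewed inside H. *)
Definition gr_proj0 (a : gr pH) : H := (repr a : {poly H})`_0.

Lemma gr_proj0E (p : filt_sum pH) : gr_proj0 (gr_class p) = p`_0.
Proof.
have /gr_classP /(_ 0) /= E := gr_class_repr (gr_class p).
by apply/eqP; rewrite -subr_eq0; apply/eqP.
Qed.

Lemma gr_proj0_linear : linear gr_proj0.
Proof.
move=> a x y; rewrite -(gr_class_repr x) -(gr_class_repr y) gr_classZ gr_classD.
by rewrite !gr_proj0E coefD filt_scale_coef.
Qed.

(* Stated in gr H (x) H, which contains gr H (x) H_0. *)
Definition gr_coinv : set (gr pH) :=
  [set a | tens_map id gr_proj0 (gr_comul a) = a ⊗ (1 : H)].

End Coinvariants.

Arguments gr_coinv {k H} pH.

Section GelfandKirillov.
Variable k : fieldType.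

Definition lin_free (V : lmodType k) (s : seq V) : Prop :=
  forall c : 'I_(size s) -> k,
    \sum_(i < size s) c i *: s`_i = 0 -> forall i, c i = 0.

(* the dimension of a finite-dimensional subspace; 0 otherwise *)
Definition vdim (V : lmodType k) (U : set V) : nat :=
  xget 0%N [set n | exists s : seq V,
    [/\ lin_free s, U = lspan [set` s] & size s = n]].

Variable A : algType k.

Definition prods (V : set A) : set A :=
  [set \prod_(x <- w) x | w in [set w : seq A | forall x, x \in w -> V x]].

(* V^0 + V^1 + ... + V^n, where V^0 = k *)
Definition power_sum (V : set A) (n : nat) : set A :=
  lspan [set \prod_(x <- w) x |
    w in [set w : seq A | (size w <= n)%N /\ forall x, x \in w -> V x]].

Definition finitely_generated (S : set A) : Prop :=
  exists s : seq A, S = lspan (prods [set` s]).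

Variable R : realType.

Definition gk_growth (V : set A) : \bar R :=
  limn_esup (fun n => (ln (vdim (power_sum V n))%:R / ln n%:R)%:E).

(* For a subalgebra S of A: the supremum of [gk_growth V] over the
   finite-dimensional subspaces V of S. *)
Definition GKdim (S : set A) : \bar R :=
  ereal_sup [set gk_growth (lspan [set` s]) |
    s in [set s : seq A | forall x, x \in s -> S x]].

End GelfandKirillov.

Arguments GKdim {k A} R S.

(* Main.v *)
(* The coinvariants R are graded with finite-dimensional pieces R(m), since they are finitely
   generated and R(0) = k. Put r(n) = dim R(0) + ... + dim R(n), and let f_T(n) be the size of the
   ball of radius n for a finite symmetric subset T of G. Every finite subset of gr H or of H spans
   a space V with dim V^n <= r(cn) f_T(n) for some T and c, and conversely r(n) f_T(n) <= dim V^{2n}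
   for a suitable V. In gr H this is the decomposition gr H = R * G. In H one bounds, in addition to
   the coradical degree, the support in G: an element of the wedge power of kT of order d that lies
   in H_m has its class in R(m) kT, and wedge powers multiply like the filtration does.

   Hence both dimensions are the supremum over T of limsup (ln r(n) + ln f_T(n)) / ln n. This limsup
   is the sum of the two separate ones because ln f_T(n) / ln n converges whenever its limsup is
   finite: then the group generated by T is virtually nilpotent (Gromov), and f_T(n) is bounded above
   and below by multiples of n^d for an integer d (Bass, Guivarc'h). Gromov's theorem is proved along
   the lines of Kleiner: Lipschitz harmonic functions form a finite-dimensional space, on which the
   group acts, and this yields a homomorphism of a subgroup of finite index onto the integers. *)

Require Import Defs.
From HB Require Import structures.
From mathcomp Require Import all_boot all_order all_algebra.
From mathcomp Require Import all_classical all_reals all_analysis.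
From mathcomp Require Import zify ring lra.

Set Implicit Arguments.
Unset Strict Implicit.
Unset Printing Implicit Defensive.

Import Order.TTheory GRing.Theory Num.Theory numFieldNormedType.Exports.
Local Open Scope classical_set_scope.
Local Notation subspace := Defs.subspace.

(** * Finitely generated groups and growth *)

(** The passage from a finite-dimensional action to a homomorphism uses no structure theory of
    linear groups. Translations preserve the Lipschitz seminorm, so by pigeonhole a subgroup of
    finite index is generated by elements close to the identity. Commutators of such elements are
    quadratically closer to it, whereas polynomial growth forces a relation in every long chain of
    iterated commutators; the two together make long commutators act trivially. The same counting
    relation, applied to commutators with one fixed element, makes a power of that element act
    unipotently on a nilpotent kernel, and this carries virtual nilpotency from the kernel of the
    homomorphism to the whole group. On the Hopf side the statements about tensors are turned into
    statements about contractions of the comultiplication with linear functionals: membership in a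
    wedge, the coaction of the group algebra and the support of an element all become conditions on
    such contractions. That the coradical filtration exhausts [H] has to be proved as well; it
    follows from the simple subquotients of finite-dimensional left coideals. *)

Section Balls.
Variable G : groupType.
Local Open Scope group_scope.
Implicit Types (S T : seq G) (A B : set G) (x y : G).

(** Symmetry is a condition on multisets: sums over [T], with repetitions as weights, are then
    invariant under inversion, and [1] in [T] makes the balls nested. Repetitions do occur, in the
    list of products of two generators. *)
Definition symm T := 1 \in T /\ perm_eq T [seq x^-1 | x <- T].

Fixpoint ball T n : seq G :=
  if n is m.+1 then undup [seq x * t | x <- ball T m, t <- T] else [:: 1].

Definition sgen T : set G := [set x | exists n, x \in ball T n].

Definition subgroup A : Prop :=
  [/\ A 1, forall x y, A x -> A y -> A (x * y) & forall x, A x -> A x^-1].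

Definition poly_growth T (D : nat) : Prop :=
  exists C : nat, forall n, (size (ball T n) <= C * n.+1 ^ D)%N.

(* [r] meets every right coset [A x], [x] in [B] *)
Definition fin_index A B : Prop :=
  exists r : seq G, forall x, B x -> exists2 y, y \in r & A (x * y^-1).

Definition symz T : seq G := undup (1 :: T ++ [seq x^-1 | x <- T]).

Lemma symm1 T : symm T -> 1 \in T. Proof. by case. Qed.

Lemma symmV T x : symm T -> (x^-1 \in T) = (x \in T).
Proof.
move=> [_ /perm_mem ->]; apply/mapP/idP => [[y yT /invg_inj ->//]|xT].
by exists x.
Qed.

Lemma mem_symz T x : (x \in symz T) = [|| x == 1, x \in T | x^-1 \in T].
Proof.
rewrite mem_undup inE mem_cat; congr [|| _, _ | _].
apply/mapP/idP => [[y yT ->]|xT]; first by rewrite invgK.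
by exists x^-1; rewrite ?invgK.
Qed.

Lemma symm_symz T : symm (symz T).
Proof.
split; first by rewrite mem_symz eqxx.
apply: uniq_perm; rewrite ?undup_uniq //.
  by rewrite map_inj_uniq ?undup_uniq //; apply: invg_inj.
move=> x; rewrite mem_symz; apply/idP/mapP => [|[y]].
  move=> h; exists x^-1; rewrite ?invgK // mem_symz invgK invg_eq1.
  by rewrite orbA orbAC -orbA.
by rewrite mem_symz => h ->; rewrite invgK invg_eq1 orbA orbAC -orbA.
Qed.

Lemma sub_symz T : {subset T <= symz T}.
Proof. by move=> x xT; rewrite mem_symz xT orbT. Qed.

Lemma ball_uniq T n : uniq (ball T n).
Proof. by case: n => //= n; apply: undup_uniq. Qed.

Lemma ballSP T n y :
  reflect (exists x t, [/\ x \in ball T n, t \in T & y = x * t]) (y \in ball T n.+1).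
Proof.
rewrite /= mem_undup; apply: (iffP allpairsP) => [[[x t] [xB tT ->]]|[x [t [xB tT ->]]]].
  by exists x, t.
by exists (x, t).
Qed.

Lemma ball_gen T t : t \in T -> t \in ball T 1.
Proof. by move=> tT; apply/ballSP; exists 1, t; rewrite mul1g inE. Qed.

Lemma ball_mul T i j x y : x \in ball T i -> y \in ball T j -> x * y \in ball T (i + j).
Proof.
move=> xB; elim: j y => [|j IHj] y; first by rewrite inE => /eqP ->; rewrite mulg1 addn0.
move=> /ballSP [z [t [zB tT ->]]]; rewrite mulgA addnS; apply/ballSP.
by exists (x * z), t; rewrite IHj.
Qed.

Lemma ball_one T n : symm T -> 1 \in ball T n.
Proof.
move=> sT; elim: n => [|n IHn]; first by rewrite inE.
by apply/ballSP; exists 1, 1; rewrite IHn symm1 // mulg1.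
Qed.

Lemma ball_le T m n : symm T -> (m <= n)%N -> {subset ball T m <= ball T n}.
Proof.
move=> sT /subnKC <- x xB; rewrite -[x]mulg1; apply: ball_mul => //.
exact: ball_one.
Qed.

Lemma ball_inv T n x : symm T -> x \in ball T n -> x^-1 \in ball T n.
Proof.
move=> sT; elim: n x => [|n IHn] x; first by rewrite !inE => /eqP ->; rewrite invg1.
move=> /ballSP [y [t [yB tT ->]]]; rewrite invgM -[n.+1]add1n; apply: ball_mul (IHn _ yB).
by apply: ball_gen; rewrite symmV.
Qed.

Lemma ball_pow T n x m : x \in ball T n -> x ^+ m \in ball T (n * m).
Proof.
move=> xB; elim: m => [|m IHm]; first by rewrite muln0 inE.
by rewrite mulnS expgS; apply: ball_mul.
Qed.

Lemma ball_comm T m n x y : symm T -> x \in ball T m -> y \in ball T n ->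
  [~ x, y] \in ball T (2 * (m + n)).
Proof.
move=> sT xB yB; have -> : [~ x, y] = (x^-1 * y^-1) * (x * y).
  by rewrite /commg /conjg !mulgA.
rewrite mul2n -addnn; apply: ball_mul; apply: ball_mul => //; exact: ball_inv.
Qed.

Lemma ball_sub S T c n : (forall t, t \in T -> t \in ball S c) ->
  {subset ball T n <= ball S (c * n)}.
Proof.
move=> TS; elim: n => [|n IHn] x; first by rewrite muln0 inE.
move=> /ballSP [y [t [yB tT ->]]]; rewrite mulnS addnC; apply: ball_mul; last exact: TS.
exact: IHn.
Qed.

Lemma size_ball_le S T m n : {subset ball S m <= ball T n} ->
  (size (ball S m) <= size (ball T n))%N.
Proof. by move=> h; apply: uniq_leq_size => //; apply: ball_uniq. Qed.

Lemma size_ball_gt0 T n : symm T -> (0 < size (ball T n))%N.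
Proof. by move=> sT; have := ball_one n sT; case: (ball T n). Qed.

Lemma sgen_gen T t : t \in T -> sgen T t.
Proof. by move=> /ball_gen; exists 1%N. Qed.

Lemma sgen_subgroup T : symm T -> subgroup (sgen T).
Proof.
move=> sT; split=> [|x y [i xB] [j yB]|x [i xB]]; first by exists 0%N; rewrite inE.
  by exists (i + j)%N; apply: ball_mul.
by exists i; apply: ball_inv.
Qed.

Lemma sgen_min A T : subgroup A -> (forall t, t \in T -> A t) -> sgen T `<=` A.
Proof.
move=> [A1 AM _] TA x [n]; elim: n x => [|n IHn] x; first by rewrite inE => /eqP ->.
by move=> /ballSP [y [t [/IHn yA /TA tA ->]]]; apply: AM.
Qed.

Lemma sgen_sub S T : symm T -> (forall t, t \in S -> sgen T t) -> sgen S `<=` sgen T.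
Proof. by move=> sT; apply: sgen_min; apply: sgen_subgroup. Qed.

Lemma sgen_symz_sub A T : subgroup A -> (forall t, t \in T -> A t) ->
  sgen (symz T) `<=` A.
Proof.
move=> sA TA; apply: sgen_min => // t; rewrite mem_symz; have [A1 _ AV] := sA.
by case/or3P => [/eqP ->//|/TA//|/TA/AV]; rewrite invgK.
Qed.

Lemma finite_sgen_ball S (X : seq G) : symm S -> (forall x, x \in X -> sgen S x) ->
  exists c, forall x, x \in X -> x \in ball S c.
Proof.
move=> sS; elim: X => [|x X IHX] XS; first by exists 0%N.
have [|c cP] := IHX; first by move=> y yX; apply: XS; rewrite inE yX orbT.
have [n xn] := XS x (mem_head _ _); exists (maxn n c) => y; rewrite inE.
case/orP => [/eqP ->|/cP]; first by apply: ball_le xn => //; apply: leq_maxl.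
by apply: ball_le => //; apply: leq_maxr.
Qed.

Lemma poly_growth_sub S T D : symm S -> (forall t, t \in T -> sgen S t) ->
  poly_growth S D -> poly_growth T D.
Proof.
move=> sS TS [C CP]; have [c cP] := finite_sgen_ball sS TS.
exists (C * c.+1 ^ D)%N => n; apply: leq_trans (size_ball_le (ball_sub (n := n) cP)) _.
apply: leq_trans (CP _) _; rewrite -mulnA -expnMn leq_mul2l.
by apply/orP; right; case: D {CP} => // D; rewrite leq_exp2r //; lia.
Qed.

Lemma subgroup1 A : subgroup A -> A 1. Proof. by case. Qed.

Lemma subgroupM A x y : subgroup A -> A x -> A y -> A (x * y).
Proof. by case=> _ + _; apply. Qed.

Lemma subgroupV A x : subgroup A -> A x -> A x^-1.
Proof. by case=> _ _; apply. Qed.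

Lemma subgroupJ A x y : subgroup A -> A x -> A y -> A (x ^ y).
Proof.
by move=> sA Ax Ay; apply: subgroupM => //; [apply: subgroupV|apply: subgroupM].
Qed.

Lemma subgroupR A x y : subgroup A -> A x -> A y -> A [~ x, y].
Proof.
by move=> sA Ax Ay; apply: subgroupM => //; [apply: subgroupV|apply: subgroupJ].
Qed.

Lemma subgroupX A x n : subgroup A -> A x -> A (x ^+ n).
Proof.
by move=> sA Ax; elim: n => [|n IHn]; [case: sA|rewrite expgS; apply: subgroupM].
Qed.

Lemma subgroup_prod A (I : eqType) (r : seq I) (F : I -> G) : subgroup A ->
  (forall i, i \in r -> A (F i)) -> A (\prod_(i <- r) F i).
Proof.
move=> [A1 AM _] AF; rewrite big_seq; elim/big_ind: _ => //.
Qed.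

Lemma subgroupMr A x y : subgroup A -> A y -> A (x * y) <-> A x.
Proof.
move=> [_ AM AV] Ay; split=> [h|Ax]; last exact: AM.
by rewrite -(mulgK y x); apply: AM h (AV _ Ay).
Qed.

Lemma subgroupMl A x y : subgroup A -> A x -> A (x * y) <-> A y.
Proof.
move=> [_ AM AV] Ax; split=> [h|Ay]; last exact: AM.
by rewrite -(mulKg x y); apply: AM (AV _ Ax) h.
Qed.

Lemma subgroupVE A x : subgroup A -> A x^-1 <-> A x.
Proof. by move=> [_ _ AV]; split=> /AV //; rewrite invgK. Qed.

Lemma fin_index_trans A B C : subgroup A -> subgroup B ->
  A `<=` B -> fin_index A B -> fin_index B C -> fin_index A C.
Proof.
move=> sA sB AB [r rP] [s sP]; exists [seq y * z | y <- r, z <- s] => x Cx.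
have [z zs Bz] := sP x Cx; have [y yr Ay] := rP _ Bz.
exists (y * z); first by apply/allpairsP; exists (y, z).
by rewrite invgM mulgA.
Qed.

Lemma fin_indexS A B C : B `<=` C -> fin_index A C -> fin_index A B.
Proof. by move=> BC [r rP]; exists r => x /BC; apply: rP. Qed.

(** Schreier's lemma. A letter [s] read after the coset representative [y] contributes the generator
    [y * s * y'^-1]. The comparison of lengths in the conclusion is what later transfers growth
    between a group and a subgroup of finite index. *)
Lemma fin_index_gens A S : subgroup A -> symm S -> A `<=` sgen S ->
    fin_index A (sgen S) ->
  exists S' (r : seq G), [/\ symm S', A = sgen S' &
    forall n x, x \in ball S n -> exists a y,
      [/\ a \in ball S' n.+1, y \in r & x = a * y]].
Proof.
move=> sA sS AS [r rP]; have [A1 AM AV] := sA.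
have sG := sgen_subgroup sS; have [G1 GM GV] := sG.
pose L := [seq a * b^-1 | a <- [seq y * s | y <- r, s <- S], b <- r].
(* The representatives and their inverses are included because the representative of 1 need not be
   1, which costs the extra letter in [n.+1], and because a word for an element of [A] ends at a
   representative that lies in [A]. *)
pose L' := [seq g <- L ++ r ++ [seq y^-1 | y <- r] | `[< A g >]].
exists (symz L'), r; have sL := symm_symz L'.
have L'A x : x \in L' -> A x by rewrite mem_filter => /andP [/asboolP].
have key n x : x \in ball S n -> exists a y,
    [/\ a \in ball (symz L') n.+1, y \in r & x = a * y].
  move=> xB; have : exists a y, [/\ a \in ball (symz L') n.+1, y \in r, A a & x = a * y].
    elim: n x xB => [|n IHn] x.
      rewrite inE => /eqP ->; have [y yr] := rP 1 G1; rewrite mul1g => Ay.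
      exists y^-1, y; split=> //; last by rewrite mulVg.
      apply/ball_gen/sub_symz; rewrite mem_filter asboolT //= !mem_cat.
      by rewrite (map_f (fun y => y^-1) yr) !orbT.
    move=> /ballSP [z [s [zB sS' ->]]]; have [a [y [aB yr Aa zE]]] := IHn z zB.
    have Gy : sgen S y.
      by rewrite -(mulKg a y) -zE; apply: GM; [apply/GV/AS|exists n].
    have [y' y'r Ay'] := rP (y * s) (GM _ _ Gy (sgen_gen sS')).
    exists (a * (y * s * y'^-1)), y'; split=> //; last by rewrite zE !mulgA mulgVK.
      rewrite -addn1; apply: ball_mul => //; apply/ball_gen/sub_symz.
      rewrite mem_filter asboolT //= !mem_cat; apply/orP; left.
      by apply: allpairs_f => //; apply: allpairs_f.
    exact: AM.
  by move=> [a [y [? ? ? ?]]]; exists a, y.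
split=> //; apply/seteqP; split=> [x Ax|]; last exact: sgen_symz_sub.
have [n xB] := AS x Ax; have [a [y [aB yr E]]] := key n x xB.
have [_ LM _] := sgen_subgroup sL.
rewrite E; apply: LM; first by exists n.+1.
apply/sgen_gen/sub_symz; rewrite mem_filter !mem_cat yr orbT andbT; apply/asboolP.
apply/(@subgroupMl A a y) => //; last by rewrite -E.
by apply: (sgen_symz_sub (T := L')) => //; exists n.+1.
Qed.

End Balls.

(** * Harmonic functions *)

(* A list of pairs (c, x) stands for the finitely supported function
   [\sum c * delta_x] on the group. *)
Section WeightedSums.
Variables (R : realType) (G : groupType) (S : seq G).
Hypothesis sS : symm S.
Local Open Scope ring_scope.
Implicit Types (L : seq (R * G)) (x y g : G).

Definition inner L L' : R :=
  \sum_(p <- L) \sum_(q <- L') p.1 * q.1 * (p.2 == q.2)%:R.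

Definition wscale (c : R) L := [seq (c * p.1, p.2) | p <- L].
Definition wtrans g L : seq (R * G) := [seq (p.1, (g * p.2)%g) | p <- L].
Definition wconv L : seq (R * G) :=
  [seq ((size S)%:R^-1 * p.1, (p.2 * t)%g) | p <- L, t <- S].
Definition wmass L : R := \sum_(p <- L) p.1.
Definition wdelta x : seq (R * G) := [:: (1, x)].

Lemma innerC L L' : inner L L' = inner L' L.
Proof.
rewrite /inner exchange_big /=; apply: eq_bigr => q _; apply: eq_bigr => p _.
by rewrite eq_sym [p.1 * _]mulrC.
Qed.

Lemma inner_catl L1 L2 L : inner (L1 ++ L2) L = inner L1 L + inner L2 L.
Proof. by rewrite /inner big_cat. Qed.

Lemma inner_catr L1 L2 L : inner L (L1 ++ L2) = inner L L1 + inner L L2.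
Proof. by rewrite innerC inner_catl ![inner L _]innerC. Qed.

Lemma inner_scalel c L L' : inner (wscale c L) L' = c * inner L L'.
Proof.
rewrite /inner big_map mulr_sumr; apply: eq_bigr => p _ /=.
by rewrite mulr_sumr; apply: eq_bigr => q _; rewrite !mulrA.
Qed.

Lemma inner_scaler c L L' : inner L (wscale c L') = c * inner L L'.
Proof. by rewrite innerC inner_scalel innerC. Qed.

Lemma inner_trans g L L' : inner (wtrans g L) (wtrans g L') = inner L L'.
Proof.
rewrite /inner big_map; apply: eq_bigr => p _; rewrite big_map; apply: eq_bigr => q _ /=.
by rewrite (inj_eq (mulgI g)).
Qed.

Lemma size_S_gt0 : 0 < (size S)%:R :> R.
Proof. by rewrite ltr0n; case: sS => + _; case: (S). Qed.

(** [wconv] averages over right translations by [S]. Inverting [t] moves the translation from one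
    argument to the other, and [S] is symmetric. *)
Lemma inner_conv L L' : inner (wconv L) L' = inner L (wconv L').
Proof.
rewrite /inner /wconv big_allpairs_dep; apply: eq_bigr => p _ /=.
rewrite exchange_big big_allpairs_dep /=; apply: eq_bigr => q _ /=.
rewrite [RHS](perm_big _ (proj2 sS)) big_map /=; apply: eq_bigr => t _.
rewrite -(inj_eq (mulIg t) p.2) mulgVK; ring.
Qed.

Lemma inner_ge0 L : 0 <= inner L L.
Proof.
pose Z := undup [seq p.2 | p <- L].
suff -> : inner L L = \sum_(z <- Z) (\sum_(p <- L) p.1 * (p.2 == z)%:R) ^+ 2.
  by apply: sumr_ge0 => z _; apply: sqr_ge0.
under [RHS]eq_bigr => z _ do rewrite expr2 big_distrl /=.
rewrite exchange_big /inner /= big_seq [RHS]big_seq; apply: eq_bigr => p pL.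
under [RHS]eq_bigr => z _ do rewrite big_distrr /=.
rewrite exchange_big /=; apply: eq_bigr => q _.
have pZ : p.2 \in Z by rewrite mem_undup map_f.
rewrite (bigD1_seq p.2) ?undup_uniq //= eqxx big1 ?addr0 => [|z zp].
  by rewrite mulr1 mulrA [q.2 == _]eq_sym.
by rewrite [p.2 == _]eq_sym (negbTE zp) mulr0 mul0r.
Qed.

Lemma inner_CS L L' : inner L L' ^+ 2 <= inner L L * inner L' L'.
Proof.
have key c : 0 <= inner L L + 2 * c * inner L L' + c ^+ 2 * inner L' L'.
  have := inner_ge0 (L ++ wscale c L').
  rewrite !inner_catl !inner_catr !inner_scalel !inner_scaler [inner L' L]innerC.
  by congr (0 <= _); ring.
have A0 := inner_ge0 L; have C0 := inner_ge0 L'.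
move: key A0 C0; set A := inner L L; set B := inner L L'; set C := inner L' L' => key A0 C0.
(* The form is degenerate on lists, which are not reduced, so a vector of norm zero needs its own
   argument: a suitable multiple of it would make [key] negative. *)
have [C1|C1] := eqVneq C 0.
  have [->|B0] := eqVneq B 0; first by rewrite expr0n mulr_ge0.
  have := key (- (A + 1) / (2 * B)); rewrite C1 mulr0 addr0.
  have -> : A + 2 * (- (A + 1) / (2 * B)) * B = -1 by field.
  by rewrite oppr_ge0 ler10.
have {}C0 : 0 < C by rewrite lt_def C1.
have := key (- B / C).
have -> : A + 2 * (- B / C) * B + (- B / C) ^+ 2 * C = (A * C - B ^+ 2) / C by field.
by rewrite pmulr_lge0 ?invr_gt0 // subr_ge0.
Qed.

Lemma inner_add_le L L' : inner (L ++ L') (L ++ L') <= 2 * inner L L + 2 * inner L' L'.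
Proof.
have := inner_ge0 (L ++ wscale (-1) L').
rewrite !inner_catl !inner_catr !inner_scalel !inner_scaler [inner L' L]innerC.
by lra.
Qed.

Definition wpow m L := iter m wconv L.

Lemma inner_wpow m L L' : inner (wpow m L) L' = inner L (wpow m L').
Proof.
elim: m L L' => // m IHm L L'; rewrite /wpow iterS inner_conv.
by rewrite [LHS]IHm /wpow -iterSr.
Qed.

Lemma wconv_cat L L' : wconv (L ++ L') = wconv L ++ wconv L'.
Proof. by rewrite /wconv allpairs_cat. Qed.

Lemma wpow_cat m L L' : wpow m (L ++ L') = wpow m L ++ wpow m L'.
Proof. by elim: m => // m IHm; rewrite /wpow !iterS -wconv_cat -[iter m _ _]/(wpow _ _) IHm. Qed.

Lemma wconv_scale c L : wconv (wscale c L) = wscale c (wconv L).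
Proof.
rewrite /wconv /wscale map_allpairs allpairs_mapl.
by apply: eq_allpairs => p t /=; rewrite mulrCA.
Qed.

Lemma wpow_scale m c L : wpow m (wscale c L) = wscale c (wpow m L).
Proof. by elim: m => // m IHm; rewrite /wpow !iterS -wconv_scale -[iter m _ _]/(wpow _ _) IHm. Qed.

Lemma wconv_trans g L : wconv (wtrans g L) = wtrans g (wconv L).
Proof.
rewrite /wconv /wtrans map_allpairs allpairs_mapl.
by apply: eq_allpairs => p t /=; rewrite mulgA.
Qed.

Lemma wpow_trans m g L : wpow m (wtrans g L) = wtrans g (wpow m L).
Proof. by elim: m => // m IHm; rewrite /wpow !iterS -wconv_trans -[iter m _ _]/(wpow _ _) IHm. Qed.

Lemma wmass_conv L : wmass (wconv L) = wmass L.
Proof.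
rewrite /wmass big_allpairs_dep; apply: eq_bigr => p _ /=.
rewrite big_const_seq count_predT iter_addr_0 -[LHS]mulr_natl mulrA mulfV ?mul1r //.
by rewrite gt_eqF // size_S_gt0.
Qed.

Lemma wmass_pow m L : wmass (wpow m L) = wmass L.
Proof. by elim: m => // m IHm; rewrite /wpow iterS wmass_conv. Qed.

Lemma wpow_ge0 m L : all (fun p => 0 <= p.1) L -> all (fun p => 0 <= p.1) (wpow m L).
Proof.
move=> L0; elim: m => // m /allP IHm; apply/allP => _ /allpairsP [[p t] [/IHm /= p0 _ ->]] /=.
by rewrite mulr_ge0 // invr_ge0 ler0n.
Qed.

Lemma wpow_ball m : all (fun p => p.2 \in ball S m) (wpow m (wdelta 1%g)).
Proof.
elim: m => [|m /allP IHm]; first by rewrite /= inE eqxx.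
apply/allP => _ /allpairsP [[p t] [/IHm /= pB tS ->]].
by apply/ballSP; exists p.2, t.
Qed.

End WeightedSums.

(** * Almost harmonic functions from return probabilities *)

Section AlmostHarmonic.
Variables (R : realType) (G : groupType) (S : seq G).
Hypothesis sS : symm S.
Local Open Scope ring_scope.
Implicit Types (L : seq (R * G)) (x y g : G).
Local Notation wpow := (@wpow R G S).
Local Notation wdelta := (@wdelta R G).

Definition wdiff x y := wdelta x ++ wscale (-1) (wdelta y).
(** With [P] the averaging operator of the walk on [S], this is the form of [P^2m]. Hence [ret m] is
    the probability of return after [2m] steps, and [ret1], [ret2] are its successive differences,
    the values of [(1 - P^2) P^2m] and [(1 - P^2)^2 P^2m] at a unit mass. Even times make them
    nonnegative; [T] lists the steps of [P^2]. *)
Definition form m L L' := inner (wpow m L) (wpow m L').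
Definition ret m := form m (wdelta 1%g) (wdelta 1%g).
Definition ret1 m := ret m - ret m.+1.
Definition ret2 m := ret1 m - ret1 m.+1.
Let T := [seq (s * t)%g | s <- S, t <- S].
Let kT : R := (size T)%:R.

Lemma form_catl m L1 L2 L : form m (L1 ++ L2) L = form m L1 L + form m L2 L.
Proof. by rewrite /form wpow_cat inner_catl. Qed.
Lemma formC m L L' : form m L L' = form m L' L.
Proof. exact: innerC. Qed.
Lemma form_catr m L1 L2 L : form m L (L1 ++ L2) = form m L L1 + form m L L2.
Proof. by rewrite formC form_catl ![form m L _]formC. Qed.
Lemma form_scalel m c L L' : form m (wscale c L) L' = c * form m L L'.
Proof. by rewrite /form wpow_scale inner_scalel. Qed.
Lemma form_scaler m c L L' : form m L (wscale c L') = c * form m L L'.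
Proof. by rewrite formC form_scalel formC. Qed.
Lemma form_trans m g L L' : form m (wtrans g L) (wtrans g L') = form m L L'.
Proof. by rewrite /form !wpow_trans inner_trans. Qed.
Lemma form_ge0 m L : 0 <= form m L L. Proof. exact: inner_ge0. Qed.
Lemma form_CS m L L' : form m L L' ^+ 2 <= form m L L * form m L' L'.
Proof. exact: inner_CS. Qed.

Lemma form_sum m L L' : form m L L' = \sum_(p <- L) p.1 * form m (wdelta p.2) L'.
Proof.
elim: L => [|[c x] L IHL].
  by rewrite big_nil -[[::]]/(wscale 0 [::]) form_scalel mul0r.
rewrite big_cons -IHL -[_ :: L]cat1s form_catl; congr (_ + _).
by rewrite -form_scalel /wscale /= mulr1.
Qed.

Lemma form_wpow2 m L L' : form m (wpow 2 L) L' = form m.+1 L L'.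
Proof.
rewrite /form -[wpow m (wpow 2 L)]iterD addnC /= inner_conv //.
Qed.

Lemma form_sum_T m x L :
  \sum_(t <- T) form m (wdelta (x * t)%g) L = kT * form m (wpow 2 (wdelta x)) L.
Proof.
rewrite [in RHS]form_sum /= /wconv !big_allpairs_dep big_seq1 /= mulr_sumr.
apply: eq_bigr => s _; rewrite mulr_sumr; apply: eq_bigr => t _ /=.
rewrite /kT size_allpairs natrM mulgA !mulr1 !mulrA.
rewrite -[LHS]mul1r; congr (_ * _).
have := size_S_gt0 R sS; move: (_%:R) => c c0; field; lra.
Qed.

Lemma kT_gt0 : 0 < kT.
Proof. by rewrite /kT size_allpairs natrM mulr_gt0 // size_S_gt0. Qed.

Lemma form_delta m x : form m (wdelta x) (wdelta x) = ret m.
Proof.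
rewrite -[RHS](form_trans m x) /wtrans /= mulg1.
by [].
Qed.

Lemma form_wdiff m x y :
  form m (wdiff x y) (wdiff x y) = 2 * ret m - 2 * form m (wdelta x) (wdelta y).
Proof.
rewrite form_catl !form_catr !form_scalel !form_scaler !form_delta.
by rewrite [form m (wdelta y) _]formC; ring.
Qed.

(** The decrease of the return probability is a Dirichlet energy: averaged over [T], the cross terms
    of the squared norms of [P^m (delta_t - delta_1)] become [ret m.+1]. *)
Lemma ret1E m : ret1 m = (2 * kT)^-1 * \sum_(t <- T) form m (wdiff t 1%g) (wdiff t 1%g).
Proof.
have k0 := kT_gt0.
have -> : \sum_(t <- T) form m (wdiff t 1%g) (wdiff t 1%g) =
    \sum_(t <- T) (2 * ret m - 2 * form m (wdelta (1 * t)%g) (wdelta 1%g)).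
  by apply: eq_bigr => t _; rewrite form_wdiff mul1g.
rewrite sumrB -[X in _ - X]mulr_sumr form_sum_T form_wpow2 -/(ret m.+1).
rewrite big_const_seq count_predT iter_addr_0 -mulr_natl -/kT /ret1.
field; lra.
Qed.

Lemma ret2E m : ret2 m = form m (wpow 2 (wdelta 1%g) ++ wscale (-1) (wdelta 1%g))
                                (wpow 2 (wdelta 1%g) ++ wscale (-1) (wdelta 1%g)).
Proof.
rewrite form_catl !form_catr !form_scalel !form_scaler !form_wpow2.
rewrite ![form _ (wdelta 1%g) (wpow 2 _)]formC !form_wpow2 /ret2 /ret1 /ret; ring.
Qed.

Lemma ret1_ge0 m : 0 <= ret1 m.
Proof.
rewrite ret1E mulr_ge0 // ?invr_ge0 ?mulr_ge0 ?ler0n //.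
by apply: sumr_ge0 => t _; apply: form_ge0.
Qed.

Lemma ret2_ge0 m : 0 <= ret2 m. Proof. by rewrite ret2E form_ge0. Qed.

Lemma seq_argmax (X : seq G) (f : G -> R) : X != [::] ->
  exists2 s, s \in X & forall t, t \in X -> f t <= f s.
Proof.
elim: X => // x [|y X] IHX _; first by exists x => [|t]; rewrite ?inE // => /eqP ->.
have [s sX sP] := IHX isT; have [h|h] := leP (f x) (f s).
  exists s => [|t]; first by rewrite inE sX orbT.
  by rewrite inE => /orP [/eqP ->|/sP].
exists x => [|t]; first by rewrite mem_head.
by rewrite inE => /orP [/eqP ->//|/sP] /le_trans; apply; apply: ltW.
Qed.

(** The function pairs [P^m (delta_x - delta_1)] with [P^m (delta_s - delta_1)] and divides by [N],
    where [s] is a step of largest energy [N]. Cauchy-Schwarz and the choice of [s] give the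
    Lipschitz bound. The Laplacian pairs [(P^2 - 1) delta_x] with the same vector, so its square is
    controlled by [ret2 m / N], and [N >= ret1 m] because a maximum is at least the average. *)
Lemma almost_harmonic m : 0 < ret1 m -> exists u : G -> R,
  [/\ u 1%g = 0, forall x t, t \in T -> `|u (x * t)%g - u x| <= 1,
      exists2 s, s \in T & u s = 1 &
      forall x, (\sum_(t <- T) (u (x * t)%g - u x)) ^+ 2 <= kT ^+ 2 * (ret2 m / ret1 m)].
Proof.
move=> r0; have k0 := kT_gt0.
have T0 : T != [::] by apply/eqP => E; move: k0; rewrite /kT E ltxx.
have [s sT sP] := seq_argmax (fun t => form m (wdiff t 1%g) (wdiff t 1%g)) T0.
set N := form m _ _ in sP.
have N0 : ret1 m <= N.
  rewrite ret1E ler_pdivrMl ?mulr_gt0 //.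
  apply: (@le_trans _ _ (\sum_(t <- T) N)).
    by rewrite big_seq [leRHS]big_seq; apply: ler_sum => t /sP.
  rewrite big_const_seq count_predT iter_addr_0 -[leLHS]mulr_natl -/kT.
  have : 0 <= N by apply: form_ge0.
  by nra.
have N1 : 0 < N by apply: lt_le_trans N0.
pose u x := form m (wdiff x 1%g) (wdiff s 1%g) / N.
have uD x y : u x - u y = form m (wdiff x y) (wdiff s 1%g) / N.
  rewrite /u /wdiff !form_catl !form_scalel; field; lra.
exists u; split.
- by rewrite /u /wdiff form_catl form_scalel mulN1r subrr mul0r.
- move=> x t tT; rewrite uD normrM normfV (gtr0_norm N1) ler_pdivrMr // mul1r.
  have -> : wdiff (x * t)%g x = wtrans x (wdiff t 1%g).
    by rewrite /wdiff /wtrans /= mulg1.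
  rewrite -[leRHS]gtr0_norm // -ler_sqr ?nnegrE // !real_normK ?num_real //.
  apply: le_trans (form_CS _ _ _) _; rewrite form_trans -/N expr2.
  by rewrite ler_pM2r // sP.
- by exists s => //; rewrite /u divff // gt_eqF.
move=> x; have -> : \sum_(t <- T) (u (x * t)%g - u x) =
    kT * (form m (wtrans x (wpow 2 (wdelta 1%g) ++ wscale (-1) (wdelta 1%g)))
      (wdiff s 1%g) / N).
  have tv : wtrans x (wdelta 1%g) = wdelta x by rewrite /wtrans /= mulg1.
  have -> : wtrans x (wpow 2 (wdelta 1%g) ++ wscale (-1) (wdelta 1%g)) =
      wpow 2 (wdelta x) ++ wscale (-1) (wdelta x).
    by rewrite /wtrans map_cat -/(wtrans x (wpow 2 _)) -wpow_trans tv /wscale /= mulg1.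
  rewrite form_catl form_scalel.
  under eq_bigr => t _ do rewrite uD /wdiff form_catl form_scalel.
  rewrite -mulr_suml big_split /= form_sum_T.
  rewrite big_const_seq count_predT iter_addr_0 -[(_ *+ _)]mulr_natl -/kT.
  by field; lra.
rewrite exprMn ler_pM2l ?exprn_gt0 // expr_div_n.
apply: (@le_trans _ _ (ret2 m / N)).
  rewrite ler_pdivrMr ?exprn_gt0 // expr2 mulrA mulfVK ?gt_eqF //.
  by apply: le_trans (form_CS _ _ _) _; rewrite form_trans -ret2E.
by rewrite ler_wpM2l ?ret2_ge0 // lef_pV2 ?posrE.
Qed.

End AlmostHarmonic.

Section RealFacts.
Variable R : realType.
Local Open Scope ring_scope.

(** Bernoulli's inequality bounds [x ^+ n] below by a linear function; its power [D + 1], at the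
    exponent [(D + 1) k], outgrows degree [D]. *)
Lemma exp_beats_poly (x c : R) (D : nat) : 1 < x -> exists n : nat, c * n.+1%:R ^+ D < x ^+ n.
Proof.
move=> x1; pose h := Num.min (x - 1) 1.
have h0 : 0 < h by rewrite lt_min subr_gt0 x1 ltr01.
have h1 : h <= 1 by rewrite ge_min lexx orbT.
have hx : 1 + h <= x by rewrite -lerBrDl ge_min lexx.
have bern n : h * n.+1%:R <= x ^+ n.
  elim: n => [|n IHn]; first by rewrite expr0 mulr1.
  have xn : 1 <= x ^+ n by rewrite exprn_ege1 // ltW.
  rewrite exprS -natr1; apply: (@le_trans _ _ ((1 + h) * x ^+ n)); first by nra.
  by rewrite ler_pM2r //; apply: lt_le_trans xn.
pose c' := Num.max c 0; have c'0 : 0 <= c' by rewrite le_max lexx orbT.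
pose K := c' * D.+1%:R ^+ D / h ^+ D.+1.
have [k kK] : exists k : nat, K < k%:R.
  by exists (Num.truncn K).+1; rewrite truncnS_gt.
exists (D.+1 * k)%N; apply: (@le_lt_trans _ _ (c' * (D.+1%:R * k.+1%:R) ^+ D)).
  apply: (@le_trans _ _ (c' * (D.+1 * k).+1%:R ^+ D)).
    by rewrite ler_wpM2r ?exprn_ge0 // le_max lexx.
  rewrite ler_wpM2l // lerXn2r ?nnegrE ?mulr_ge0 //.
  by rewrite -natrM ler_nat mulnS; lia.
apply: (@lt_le_trans _ _ ((h * k.+1%:R) ^+ D.+1)); last first.
  rewrite mulnC exprM lerXn2r ?nnegrE ?bern //; last first.
    by rewrite exprn_ge0 // ltW // (lt_trans _ x1).
  by rewrite mulr_ge0 // ltW.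
have -> : (h * k.+1%:R) ^+ D.+1 = h ^+ D.+1 * k.+1%:R * k.+1%:R ^+ D.
  by rewrite exprMn [X in _ * X]exprS mulrA.
rewrite exprMn mulrA ltr_pM2r ?exprn_gt0 // [ltRHS]mulrC -ltr_pdivrMr ?exprn_gt0 //.
by apply: (lt_trans kK); rewrite ltr_nat.
Qed.

Lemma ultra_bounded_cvg (F : set_system nat) (u : nat -> R) (c : R) :
  UltraFilter F -> (forall n, `|u n| <= c) -> exists l : R, u @ F --> l.
Proof.
move=> UF uc; have cpt := @segment_compact R (- c) c.
have FC : F (u @^-1` `[- c, c]).
  by apply: filterS filterT => n _ /=; have := uc n; rewrite ler_norml in_itv.
have [l [_ cl]] := cpt (u @ F) _ FC.
exists l => A Al; have [//|FA] := in_ultra_setVsetC (u @^-1` A) UF.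
have [y [/= nAy Ay]] := cl (~` A) A FA Al; by case: nAy.
Qed.

Lemma cvg_sum_seq (F : set_system nat) (I : Type) (r : seq I) (f : I -> nat -> R)
    (l : I -> R) : ProperFilter F -> (forall i, (fun j => f i j) @ F --> l i) ->
  (fun j => \sum_(i <- r) f i j) @ F --> \sum_(i <- r) l i.
Proof.
move=> PF fl; elim: r => [|i r IHr].
  rewrite big_nil (_ : (fun j => _) = cst 0); first exact: cvg_cst.
  by apply/funext => j; rewrite big_nil.
rewrite big_cons (_ : (fun j => _) = (fun j => f i j + \sum_(i <- r) f i j)).
  by apply: cvgD.
by apply/funext => j; rewrite big_cons.
Qed.

End RealFacts.

Section HarmonicExists.
Variables (R : realType) (G : groupType) (S : seq G).
Hypothesis sS : symm S.
Local Open Scope ring_scope.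
Local Notation wpow := (@wpow R G S).
Local Notation wdelta := (@wdelta R G).
Local Notation wdiff := (@wdiff R G).
Local Notation form := (@form R G S).
Local Notation ret := (@ret R G S).
Local Notation ret1 := (@ret1 R G S).
Local Notation ret2 := (@ret2 R G S).
Let T := [seq (s * t)%g | s <- S, t <- S].

Lemma inner_unit (L : seq (R * G)) (X : seq G) : uniq X ->
  all (fun p => 0 <= p.1) L -> inner L [seq (1, x) | x <- X] <= wmass L.
Proof.
move=> uX /allP L0; rewrite /inner /wmass big_seq [leRHS]big_seq; apply: ler_sum => p pL.
rewrite big_map /=; have p0 := L0 p pL.
have [pX|pX] := boolP (p.2 \in X).
  rewrite (bigD1_seq p.2) //= eqxx big1 ?addr0 ?mulr1 // => x.
  by rewrite eq_sym => /negbTE ->; rewrite mulr0.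
rewrite big1_seq // => x /= xX; have /negbTE -> : p.2 != x.
  by apply: contraNneq pX => ->.
by rewrite mulr0.
Qed.

Lemma inner_ball (m : nat) :
  inner (wpow m (wdelta 1%g)) [seq (1, x) | x <- ball S m] = 1.
Proof.
transitivity (wmass (wpow m (wdelta 1%g))); last first.
  by rewrite wmass_pow // /wmass big_seq1.
have /allP wb := @wpow_ball R G S m.
rewrite /inner /wmass big_seq [RHS]big_seq; apply: eq_bigr => p /wb pB.
rewrite big_map /= (bigD1_seq p.2) ?ball_uniq //= eqxx big1 ?addr0 ?mulr1 // => x.
by rewrite eq_sym => /negbTE ->; rewrite mulr0.
Qed.

Lemma inner_unit_self (X : seq G) : uniq X ->
  inner [seq (1 : R, x) | x <- X] [seq (1, x) | x <- X] = (size X)%:R.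
Proof.
move=> uX; rewrite /inner big_map /= (eq_big_seq (fun=> 1)) => [|x xX].
  by rewrite big_const_seq count_predT iter_addr_0.
rewrite big_map (bigD1_seq x) //= eqxx big1 ?addr0 ?mulr1 // => y.
by rewrite eq_sym => /negbTE ->; rewrite mulr0.
Qed.

(** Cauchy-Schwarz against the indicator of the ball of radius [m], which carries all of the mass 1
    of the walk after [m] steps. *)
Lemma ret_ge m : 1 <= ret m * (size (ball S m))%:R.
Proof.
have := inner_CS (wpow m (wdelta 1%g)) [seq (1, x) | x <- ball S m].
by rewrite inner_ball expr1n inner_unit_self ?ball_uniq.
Qed.

Lemma form_triangle m x y z : form m (wdiff x z) (wdiff x z) <=
  2 * form m (wdiff x y) (wdiff x y) + 2 * form m (wdiff y z) (wdiff y z).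
Proof.
have := inner_add_le (wpow m (wdiff x y)) (wpow m (wdiff y z)).
rewrite -wpow_cat -![inner _ _]/(form m _ _); congr (_ <= _).
rewrite /wdiff !form_catl !form_catr !form_scalel !form_scaler.
by rewrite ![form m (wdelta y) _]formC ![form m (wdelta z) (wdelta x)]formC; ring.
Qed.

(** A single step is one term of the energy in [ret1E]; each further letter costs a factor 4 by the
    squared triangle inequality. The exponential constant is harmless, since the radius will be
    fixed before [m]. *)
Lemma form_ball m n x : x \in ball T n ->
  form m (wdiff x 1%g) (wdiff x 1%g) <= 4 ^+ n * (2 * (size T)%:R) * ret1 m.
Proof.
have k0 := kT_gt0 R sS; rewrite -/T in k0.
have base t : t \in T ->
    form m (wdiff t 1%g) (wdiff t 1%g) <= 2 * (size T)%:R * ret1 m.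
  move=> tT; rewrite ret1E -/T // mulrA mulfV ?mul1r; last by lra.
  have -> : \sum_(t <- T) form m (wdiff t 1%g) (wdiff t 1%g) =
      form m (wdiff t 1%g) (wdiff t 1%g) +
      \sum_(s <- rem t T) form m (wdiff s 1%g) (wdiff s 1%g).
    by rewrite (perm_big _ (perm_to_rem tT)) big_cons.
  by rewrite lerDl; apply: sumr_ge0 => s _; apply: form_ge0.
have r0 := @ret1_ge0 R G S sS m.
elim: n x => [|n IHn] x.
  rewrite inE => /eqP ->; rewrite form_wdiff // subrr.
  by rewrite !mulr_ge0 // ltW.
move=> /ballSP [y [t [yB tT ->]]].
apply: le_trans (form_triangle m _ y _) _.
have -> : form m (wdiff (y * t)%g y) (wdiff (y * t)%g y) = form m (wdiff t 1%g) (wdiff t 1%g).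
  by rewrite -(form_trans _ m y (wdiff t 1%g)) /wtrans /= mulg1.
have := base t tT; have := IHn y yB; rewrite exprS.
set a := form _ _ _; set b := form _ _ _; set c := 2 * _.
have : 1 <= 4 ^+ n :> R by rewrite exprn_ege1 // ler1n.
set p := 4 ^+ n => p1 ha hb.
have : 0 <= c * ret1 m by rewrite mulr_ge0 // mulr_ge0 // ltW.
have -> : 4 * p * c * ret1 m = 4 * (p * (c * ret1 m)) by ring.
move: ha hb; rewrite -!mulrA; move: (c * ret1 m) => z ha hb z0; nra.
Qed.

Hypothesis genS : forall x, sgen S x.
Hypothesis infG : forall M, exists n, (M <= size (ball S n))%N.
Variable D : nat.
Hypothesis pS : poly_growth S D.

Lemma ball_sub_T n : {subset ball S n <= ball T n}.
Proof.
move=> x xS; rewrite -[n]mul1n; apply: (ball_sub _ xS) => t tS.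
apply: ball_gen; rewrite -[t]mulg1; apply: allpairs_f => //; exact: symm1.
Qed.

(** When [ret1 m] is small, the distribution after [2m] steps is nearly constant on a ball chosen in
    advance. Its mass is at most 1, so its value at 1 is at most about the inverse of the size of
    that ball, and balls are arbitrarily large. *)
Lemma ret_small eta : 0 < eta -> exists delta, 0 < delta /\
  forall m, ret1 m <= delta -> ret m <= eta.
Proof.
move=> e0; have [M ME] : exists M : nat, 2 / eta <= M%:R.
  by exists (Num.truncn (2 / eta)).+1; rewrite ltW // truncnS_gt.
have [n Mn] := infG M; pose c : R := 4 ^+ n * (2 * (size T)%:R).
have k0 := kT_gt0 R sS; rewrite -/T in k0.
have c0 : 0 < c by rewrite mulr_gt0 ?exprn_gt0 // mulr_gt0.
exists (eta / c); split=> [|m md]; first exact: divr_gt0.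
pose X := ball S n; have uX : uniq X := ball_uniq S n.
have up : \sum_(x <- X) form m (wdelta x) (wdelta 1%g) <= 1.
  have : inner (wpow m (wpow m (wdelta 1%g))) [seq (1, x) | x <- X] <= 1.
    apply: le_trans (inner_unit uX _) _.
      by do 2 apply: wpow_ge0 => //; rewrite /= ler01.
    by rewrite !wmass_pow // /wmass big_seq1.
  rewrite inner_wpow // innerC -/(form m [seq (1, x) | x <- X] _) form_sum big_map.
  by congr (_ <= _); apply: eq_bigr => x _; rewrite /= mul1r.
have low x : x \in X -> ret m - eta / 2 <= form m (wdelta x) (wdelta 1%g).
  move=> /ball_sub_T /(form_ball m); rewrite form_wdiff // -/c.
  move: md; rewrite ler_pdivlMr // mulrC => md h.
  by have := le_trans h md; lra.
have : \sum_(x <- X) (ret m - eta / 2) <= 1.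
  by apply: le_trans up; rewrite big_seq [leRHS]big_seq; apply: ler_sum => x /low.
rewrite big_const_seq count_predT iter_addr_0 -[leLHS]mulr_natl.
have : (2 / eta) <= (size X)%:R by apply: le_trans ME _; rewrite ler_nat.
rewrite ler_pdivrMr //; move: (size X)%:R => s h1 h2.
rewrite leNgt; apply/negP => h3.
have s0 : 0 < s by rewrite -(pmulr_lgt0 _ e0); lra.
have : 0 < s * (ret m - eta) by rewrite mulr_gt0 // subr_gt0.
by move=> h4; nra.
Qed.

(** Otherwise [ret1] would decay geometrically. As [ret] then tends to 0, summing its differences
    would make [ret] decay geometrically as well, against [ret_ge] and polynomial growth. *)
Lemma ret2_small (eps : R) : 0 < eps -> exists m, 0 < ret1 m /\ ret2 m <= eps * ret1 m.
Proof.
move=> e0; apply: contrapT => nE.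
have r1 := @ret1_ge0 R G S sS; have r2 := @ret2_ge0 R G S sS.
(* The maximum with [1/2] keeps the ratio positive when [eps >= 1]. *)
pose rho := Num.max (1 - eps) 2^-1.
have rho1 : rho < 1 by rewrite gt_max; apply/andP; split; lra.
have rho0 : 0 < rho by rewrite lt_max; apply/orP; right; lra.
have dec m : ret1 m.+1 <= rho * ret1 m.
  have E : ret1 m.+1 = ret1 m - ret2 m by rewrite /ret2 subKr.
  apply: (@le_trans _ _ ((1 - eps) * ret1 m)); last first.
    by rewrite ler_wpM2r // le_max lexx.
  have [r0|r0] := ltP 0 (ret1 m).
    have [h|h] := leP (ret2 m) (eps * ret1 m); first by case: nE; exists m.
    rewrite E; lra.
  have := r1 m; have := r2 m; rewrite E; have -> : ret1 m = 0 by apply/le_anti; rewrite r0 r1.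
  lra.
have geo m : ret1 m <= rho ^+ m * ret1 0%N.
  elim: m => [|m IHm]; first by rewrite mul1r.
  by apply: le_trans (dec m) _; rewrite exprS -mulrA ler_pM2l.
have tele i m : ret m - ret (m + i)%N <= ret1 m / (1 - rho).
  elim: i m => [|i IHi] m; first by rewrite addn0 subrr divr_ge0 // subr_ge0 ltW.
  rewrite addnS -addSn; have -> : ret m - ret (m.+1 + i)%N =
    ret1 m + (ret m.+1 - ret (m.+1 + i)%N) by rewrite /ret1 addrA subrK.
  apply: le_trans (lerD (lexx _) (IHi _)) _.
  apply: (@le_trans _ _ (ret1 m + rho * ret1 m / (1 - rho))).
    by rewrite lerD2l ler_wpM2r // invr_ge0 subr_ge0 ltW.
  by rewrite le_eqVlt; apply/orP; left; apply/eqP; field; lra.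
pose K := ret1 0%N / (1 - rho).
have K0 : 0 <= K by rewrite divr_ge0 // subr_ge0 ltW.
have irho : 1 < rho^-1 by rewrite invf_gt1.
(* [tele] bounds only differences of [ret]; that [ret] has limit 0 comes from [ret_small], because
   [ret1] tends to 0. *)
have ret0 m : ret m <= rho ^+ m * K.
  apply/ler_addgt0Pr => eta /ret_small [delta [d0 dP]].
  have [i iP] := exp_beats_poly (ret1 0%N / delta) 0 irho.
  have ri : ret1 (m + i)%N <= delta.
    apply: le_trans (geo _) _; rewrite exprD.
    move: iP; rewrite expr0 mulr1 ltr_pdivrMr // exprVn.
    have p0 : 0 < rho ^+ i by rewrite exprn_gt0.
    rewrite -ltr_pdivrMl ?invr_gt0 // invrK => /ltW; apply: le_trans.
    rewrite mulrAC mulrC ler_pM2l //.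
    by rewrite ler_piMl // exprn_ile1 // ltW.
  have := tele i m; have := dP _ ri; have : ret1 m / (1 - rho) <= rho ^+ m * K.
    rewrite /K mulrA ler_wpM2r ?geo // invr_ge0 subr_ge0 ltW //.
  by lra.
have [C CP] := pS.
have [n nP] := exp_beats_poly (K * C%:R) D irho.
have := ret_ge n; apply/negP; rewrite -ltNge.
apply: (@le_lt_trans _ _ (rho ^+ n * K * (C * n.+1 ^ D)%:R)).
  by apply: ler_pM => //; [apply: form_ge0|rewrite ler_nat CP].
move: nP; rewrite exprVn -[ltRHS]div1r ltr_pdivlMr ?exprn_gt0 //.
by rewrite natrM natrX; congr (_ < _); ring.
Qed.

(** A limit along an ultrafilter of almost harmonic functions whose defect tends to 0; the
    ultrafilter gives convergence at all points at once. The list [T'] consists of the products of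
    two elements of [S]. *)
Theorem harmonic_exists : exists (T' : seq G) (u : G -> R),
  [/\ symm T', forall x, sgen T' x,
  forall x t, t \in T' -> `|u (x * t)%g - u x| <= 1,
  forall x, \sum_(t <- T') (u (x * t)%g - u x) = 0 & exists x, u x != u 1%g].
Proof.
have kT0 := kT_gt0 R sS; rewrite -/T in kT0.
have symT : symm T.
  split; first by rewrite -[1%g]mulg1; apply: allpairs_f; apply: symm1.
  rewrite map_allpairs; apply/permP => a.
  have cnt (X : seq G) : count a X = (\sum_(x <- X) a x)%N.
    by elim: X => [|x X IHX]; rewrite ?big_nil ?big_cons //= IHX.
  rewrite !cnt !big_allpairs_dep /= exchange_big /=.
  rewrite [LHS](perm_big _ (proj2 sS)) [LHS]big_map; apply: eq_bigr => s _.
  rewrite [LHS](perm_big _ (proj2 sS)) [LHS]big_map; apply: eq_bigr => t _.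
  by rewrite invgM.
have genT x : sgen T x by have [n /ball_sub_T xn] := genS x; exists n.
have seq_u (j : nat) : exists u : G -> R,
  [/\ u 1%g = 0, forall x t, t \in T -> `|u (x * t)%g - u x| <= 1,
      exists2 s, s \in T & u s = 1 &
      forall x, (\sum_(t <- T) (u (x * t)%g - u x)) ^+ 2 <= j.+1%:R^-1].
  have e0 : 0 < j.+1%:R^-1 / (size T)%:R ^+ 2 :> R.
    by rewrite divr_gt0 ?invr_gt0 ?exprn_gt0.
  have [m [m1 m2]] := ret2_small e0.
  have [u [u1 u2 u3 u4]] := almost_harmonic sS m1; exists u; split=> // x.
  apply: le_trans (u4 x) _; rewrite -/T mulrC -ler_pdivlMr ?exprn_gt0 //.
  by rewrite ler_pdivrMr.
have [u uP] := choice seq_u.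
have [F [UF Foo]] := @ultraFilterLemma nat \oo _.
have bnd x : exists c : R, forall j, `|u j x| <= c.
  have [n] := genT x; elim: n x => [|n IHn] x.
    by rewrite inE => /eqP ->; exists 0 => j; have [-> _ _ _] := uP j; rewrite normr0.
  move=> /ballSP [y [t [/IHn [c cP] tT ->]]]; exists (c + 1) => j.
  have [_ /(_ y t tT) h _ _] := uP j.
  by rewrite -(subrK (u j y) (u j _)) addrC; apply: le_trans (ler_normD _ _) _; apply: lerD.
have lim_u x : exists l : R, (fun j => u j x) @ F --> l.
  by have [c cP] := bnd x; apply: ultra_bounded_cvg cP.
have [v vP] := choice lim_u.
have PF : ProperFilter F := @ultra_proper _ F UF.
have v1 : v 1%g = 0.
  apply: (cvg_unique _ (vP 1%g)) => //; rewrite (_ : (fun j => u j 1%g) = cst 0).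
    exact: cvg_cst.
  by apply/funext => j; have [-> _ _ _] := uP j.
exists T, v; split=> //.
- move=> x t tT; have h : (fun j => `|u j (x * t)%g - u j x|) @ F --> `|v (x * t)%g - v x|.
    by apply: cvg_norm; apply: cvgB; apply: vP.
  apply: (cvgr_to_le h); apply: filterS filterT => j _.
  by have [_ /(_ x t tT)] := uP j.
- move=> x; have h : (fun j => (\sum_(t <- T) (u j (x * t)%g - u j x)) ^+ 2) @ F -->
      (\sum_(t <- T) (v (x * t)%g - v x)) ^+ 2.
    rewrite expr2; under eq_cvg do rewrite expr2.
    by apply: cvgM; apply: cvg_sum_seq => t; apply: cvgB; apply: vP.
  apply/eqP; rewrite -sqrf_eq0 eq_le sqr_ge0 andbT; apply/ler_addgt0Pl => e e0.
  rewrite addr0; apply: (cvgr_to_le h).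
  have : \oo [set j | j.+1%:R^-1 <= e].
    exists (Num.truncn e^-1) => // j /= jN; rewrite -[e]invrK lef_pV2 ?posrE ?invr_gt0 //.
    by apply: ltW; apply: lt_le_trans (truncnS_gt _) _; rewrite ler_nat ltnS.
  move=> /Foo; apply: filterS => j /= je; have [_ _ _ /(_ x)] := uP j.
  by move=> /le_trans; apply.
apply: contrapT => nv.
have v0 x : v x = 0.
  by apply/eqP; apply: contrapT => /negP h; case: nv; exists x; rewrite v1.
(* The step [s] with [u j s = 1] depends on [j]. The sum of squares over the finite list [T] is at
   least 1 for every [j], and this passes to the limit. *)
have h : (fun j => \sum_(t <- T) (u j t) ^+ 2) @ F --> \sum_(t <- T) (v t) ^+ 2.
  apply: cvg_sum_seq => t; rewrite expr2; under eq_cvg do rewrite expr2.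
  by apply: cvgM; apply: vP.
have : 1 <= \sum_(t <- T) (v t) ^+ 2.
  apply: (cvgr_to_ge h); apply: filterS filterT => j _.
  have [_ _ [s sT us] _] := uP j.
  rewrite (perm_big _ (perm_to_rem sT)) big_cons /= us expr1n lerDl.
  by apply: sumr_ge0 => t _; apply: sqr_ge0.
rewrite big1 => [|t _]; last by rewrite v0 expr0n.
by rewrite ler10.
Qed.

End HarmonicExists.

(** * Comparison of determinants of quadratic forms *)

Section Determinants.
Variable R : realFieldType.
Local Open Scope ring_scope.

Definition qform n (A : 'M[R]_n) (v : 'rV[R]_n) : R := (v *m A *m v^T) 0 0.

(** Completing the square: for positive [A] the vector [w0] is the minimizer, and the constant that
    remains is the Schur complement. *)
Lemma qform_block n (a : 'M[R]_1) (b : 'rV[R]_n) (A : 'M[R]_n) (w w0 : 'rV[R]_n) :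
  A^T = A -> w0 *m A = - b ->
  qform (block_mx a b b^T A) (row_mx 1%:M w : 'rV[R]_(1 + n)) =
  qform A (w - w0) + (a + w0 *m b^T) 0 0.
Proof.
move=> sA E; rewrite /qform mul_row_block tr_row_mx mul_row_col !mul1mx trmx1 mulmx1.
have Et : A *m w0^T = - b^T by rewrite -[A]sA -trmx_mul E linearN.
have -> : b = - (w0 *m A) by rewrite E opprK.
have -> : (w - w0)^T = w^T - w0^T by rewrite linearB.
have -> : (- (w0 *m A))^T = - (A *m w0^T) by rewrite linearN /= trmx_mul sA.
rewrite !(mulmxN, mulNmx, mulmxDl, mulmxDr) !mulmxA.
have symm_mx (x y : 'rV[R]_n) : (x *m A *m y^T) 0 0 = (y *m A *m x^T) 0 0.
  have -> : x *m A *m y^T = (y *m A *m x^T)^T by rewrite !trmx_mul trmxK sA mulmxA.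
  by rewrite [LHS]mxE.
have := symm_mx w w0; move: (w *m A *m w0^T) (w0 *m A *m w^T) (w *m A *m w^T) (w0 *m A *m w0^T).
by move=> X1 X2 X3 X4 E1; rewrite !mxE E1; ring.
Qed.

Lemma pos_unitmx n (A : 'M[R]_n) : (forall v, v != 0 -> 0 < qform A v) -> \det A != 0.
Proof.
move=> pA; apply/negP => /det0P [v v0 vA].
by have := pA v v0; rewrite /qform vA mul0mx mxE ltxx.
Qed.

Lemma det_schur n (a : 'M[R]_1) (b : 'rV[R]_n) (c : 'cV[R]_n) (A : 'M[R]_n) (w : 'cV[R]_n) :
  A *m w = - c -> \det (block_mx a b c A : 'M[R]_(1 + n)) = (a + b *m w) 0 0 * \det A.
Proof.
move=> E; rewrite -[LHS]mulr1 -[X in _ * X](_ : \det (block_mx 1%:M 0 w 1%:M) = 1).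
  rewrite -det_mulmx mulmx_block !mulmx1 !mulmx0 E subrr !add0r.
  by rewrite (det_ublock (a + b *m w)) {1}[a + _]mx11_scalar det_scalar1.
by rewrite det_lblock !det1 mulr1.
Qed.

(** Peel off the first coordinate. The Schur complement is the minimum of the form over the vectors
    [(1, w)], so the minimizer for [B] is a test vector for [A] and yields the factor [e 0]; the
    lower right blocks are handled by induction. The later factors [e i] need only hold where the
    first [i] coordinates vanish, so a strong estimate on a subspace of small codimension counts in
    full for the determinant. *)
Lemma det_le n (A B : 'M[R]_n) (e : nat -> R) : A^T = A -> B^T = B ->
    (forall v, v != 0 -> 0 < qform A v) -> (forall i, 0 <= e i) ->
    (forall i (v : 'rV[R]_n), (forall j : 'I_n, (j < i)%N -> v 0 j = 0) ->
       qform A v <= e i * qform B v) ->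
  0 < \det A /\ \det A <= (\prod_(i < n) e i) * \det B.
Proof.
elim: n => [|n IHn] in A B e *; first by rewrite !det_mx00 big_ord0 mulr1.
move=> sA sB pA e0 AB.
have pB v : v != 0 -> 0 < qform B v.
  move=> v0; have h : 0 < e 0%N * qform B v.
    by apply: lt_le_trans (pA v v0) (AB 0%N v _).
  have e1 : 0 < e 0%N.
    by rewrite lt_def e0 andbT; apply: contraTneq h => ->; rewrite mul0r ltxx.
  by rewrite pmulr_rgt0 in h.
have blk (M : 'M[R]_(1 + n)) : M^T = M -> exists a b M1, [/\ M1^T = M1 &
    M = block_mx a b b^T M1].
  move=> sM; exists (ulsubmx M), (ursubmx M), (drsubmx M).
  by rewrite trmx_drsub trmx_ursub sM submxK.
have [a [b [A1 [sA1 EA]]]] := blk A sA; have [a' [b' [B1 [sB1 EB]]]] := blk B sB.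
have low (M : 'M[R]_(1 + n)) x y z M1 (w : 'rV[R]_n) : M = block_mx x y z M1 ->
    qform M (row_mx 0 w : 'rV[R]_(1 + n)) = qform M1 w.
  move=> ->; rewrite /qform mul_row_block tr_row_mx mul_row_col !mul0mx trmx0 mulmx0.
  by rewrite !add0r.
have nz (w : 'rV[R]_n) : w != 0 -> (row_mx 0 w : 'rV[R]_(1 + n)) != 0.
  by apply: contra_neq => E; rewrite -(row_mxKr (0 : 'rV[R]_1) w) E linear0.
have pA1 w : w != 0 -> 0 < qform A1 w by move=> /nz /pA; rewrite (low _ _ _ _ _ _ EA).
have pB1 w : w != 0 -> 0 < qform B1 w by move=> /nz /pB; rewrite (low _ _ _ _ _ _ EB).
have [dA1 leA1] : 0 < \det A1 /\ \det A1 <= (\prod_(i < n) e i.+1) * \det B1.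
  apply: (IHn A1 B1 (fun i => e i.+1)) => // i w w0.
  rewrite -(low _ _ _ _ _ w EA) -(low _ _ _ _ _ w EB); apply: AB => j ji.
  rewrite mxE; case: split_ordP => k Ek; first by rewrite mxE.
  by apply: w0; move: ji; rewrite Ek.
have sol (M1 : 'M[R]_n) (y : 'rV[R]_n) : M1^T = M1 -> \det M1 != 0 ->
    exists w, w *m M1 = - y.
  move=> sM dM; exists (- y *m invmx M1); rewrite mulmxKV //.
  by rewrite unitmxE unitfE.
have [wA EwA] := sol A1 b sA1 (pos_unitmx pA1).
have [wB EwB] := sol B1 b' sB1 (pos_unitmx pB1).
have tr (M1 : 'M[R]_n) w y : M1^T = M1 -> w *m M1 = - y -> M1 *m w^T = - y^T.
  by move=> sM E; rewrite -[M1]sM -trmx_mul E linearN.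
have comm (y w : 'rV[R]_n) : (y *m w^T) 0 0 = (w *m y^T) 0 0.
  by rewrite -[in LHS](trmxK y) -trmx_mul mxE.
have detE (x : 'M[R]_1) y (M1 : 'M[R]_n) w : M1^T = M1 -> w *m M1 = - y ->
    \det (block_mx x y y^T M1 : 'M[R]_(1 + n)) = (x + w *m y^T) 0 0 * \det M1.
  move=> sM E; rewrite (det_schur x y (tr _ _ _ _ sM E)); congr (_ * _).
  by rewrite !mxE; congr (_ + _); have := comm y w; rewrite !mxE.
have qmin (x : 'M[R]_1) y (M1 : 'M[R]_n) w : M1^T = M1 -> w *m M1 = - y ->
   qform (block_mx x y y^T M1) (row_mx 1%:M w : 'rV[R]_(1 + n)) = (x + w *m y^T) 0 0.
  by move=> sM E; rewrite (qform_block _ _ sM E) subrr /qform !mul0mx [X in X + _]mxE add0r.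
have nz1 (w : 'rV[R]_n) : (row_mx 1%:M w : 'rV[R]_(1 + n)) != 0.
  apply/eqP => E; have := congr1 (fun M : 'rV[R]_(1 + n) => lsubmx M 0 0) E.
  by rewrite row_mxKl linear0 !mxE => /eqP; rewrite oner_eq0.
set sA' := (a + wA *m b^T) 0 0; set sB' := (a' + wB *m b'^T) 0 0.
have sA0 : 0 < sA' by rewrite /sA' -(qmin _ _ _ _ sA1 EwA) -EA; apply: pA.
have le0 : sA' <= e 0%N * sB'.
  apply: (@le_trans _ _ (qform A (row_mx 1%:M wB : 'rV[R]_(1 + n)))).
    rewrite [in leRHS]EA (qform_block _ _ sA1 EwA) lerDr.
    have [->|h] := eqVneq (wB - wA) 0; first by rewrite /qform !mul0mx mxE.
    by apply/ltW/pA1.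
  by rewrite /sB' -(qmin _ _ _ _ sB1 EwB) -EB; apply: AB.
have E1 : \det A = sA' * \det A1 by rewrite EA (detE _ _ _ _ sA1 EwA).
have E2 : \det B = sB' * \det B1 by rewrite EB (detE _ _ _ _ sB1 EwB).
rewrite E1 E2; split; first exact: mulr_gt0.
rewrite big_ord_recl /=; apply: (@le_trans _ _ (sA' * ((\prod_(i < n) e i.+1) * \det B1))).
  by rewrite ler_pM2l.
have -> : e 0%N * (\prod_(i < n) e i.+1) * (sB' * \det B1) =
  (e 0%N * sB') * ((\prod_(i < n) e i.+1) * \det B1) by ring.
rewrite ler_wpM2r //; apply: le_trans leA1; exact: ltW.
Qed.

(** Adapts the basis to [m] linear conditions in the way that [det_le] can exploit; the first [m]
    coordinates suffice because the rank of [L] is at most [m]. *)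
Lemma kernel_basis d m (L : 'M[R]_(d, m)) : exists2 P : 'M[R]_d, P \in unitmx &
  forall v : 'rV[R]_d, (forall j : 'I_d, (j < m)%N -> v 0 j = 0) -> v *m P *m L = 0.
Proof.
exists (invmx (col_ebase L)) => [|v v0]; first by rewrite unitmx_inv col_ebase_unit.
rewrite -{2}(mulmx_ebase L) !mulmxA mulmxKV ?col_ebase_unit //.
suff -> : v *m (pid_mx (\rank L) : 'M[R]_(d, m)) = 0 by rewrite mul0mx.
apply/rowP => j; rewrite !mxE big1 // => i _; rewrite mxE.
have [ir|ir] := ltnP i (\rank L); last by rewrite andbF mulr0.
by rewrite v0 ?mul0r //; apply: leq_trans ir (rank_leq_col L).
Qed.

End Determinants.

Section Sums.
Variable R : realType.
Local Open Scope ring_scope.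

Lemma sum_subset (I : eqType) (X Y : seq I) (F : I -> R) : uniq X -> {subset X <= Y} ->
  (forall y, y \in Y -> 0 <= F y) -> \sum_(x <- X) F x <= \sum_(y <- Y) F y.
Proof.
move=> uX XY F0; have p : perm_eq X [seq y <- undup Y | y \in X].
  apply: uniq_perm; rewrite ?filter_uniq ?undup_uniq // => x.
  by rewrite mem_filter mem_undup; case: (boolP (x \in X)) => //= /XY ->.
rewrite (perm_big _ p) big_filter big_mkcond /=.
apply: (@le_trans _ _ (\sum_(y <- undup Y) F y)).
  rewrite big_seq [leRHS]big_seq; apply: ler_sum => y; rewrite mem_undup => /F0.
  by case: ifP.
elim: Y F0 {XY p} => [|y Y IHY] F0 //=.
have {}IHY := IHY (fun z zY => F0 z (mem_behead (s := y :: Y) zY)).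
by case: ifP => _; rewrite !big_cons ?lerD2l // ler_wpDl // F0 ?mem_head.
Qed.

Lemma sum_inj (I J : eqType) (X : seq I) (h : I -> J) (Y : seq J) (F : J -> R) :
  uniq X -> {in X &, injective h} -> (forall x, x \in X -> h x \in Y) ->
  (forall y, y \in Y -> 0 <= F y) -> \sum_(x <- X) F (h x) <= \sum_(y <- Y) F y.
Proof.
move=> uX hi hY F0; rewrite -(big_map h predT F); apply: sum_subset => //.
  by rewrite map_inj_in_uniq.
by move=> _ /mapP [x xX ->]; apply: hY.
Qed.

Lemma sum_term (I : eqType) (X : seq I) (F : I -> R) x : x \in X ->
  (forall y, y \in X -> 0 <= F y) -> F x <= \sum_(y <- X) F y.
Proof.
move=> xX F0; rewrite -(big_seq1 +%R x F); apply: sum_subset => // y.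
by rewrite inE => /eqP ->.
Qed.

End Sums.

(** * Poincare and Caccioppoli inequalities *)

Section Geometry.
Variables (R : realType) (G : groupType) (T : seq G).
Hypothesis sT : symm T.
Local Open Scope ring_scope.
Implicit Types (u : G -> R) (x y z : G) (X : seq G).
Local Notation B n := (ball T n).
Local Notation f n := (size (ball T n))%:R.

Definition harmonic u := forall x, \sum_(t <- T) (u (x * t)%g - u x) = 0.
Definition local_energy u x : R := \sum_(t <- T) (u (x * t)%g - u x) ^+ 2.
(* energy and mass on the ball of radius [n] around [z] *)
Definition energy z n u : R := \sum_(b <- B n) local_energy u (z * b)%g.
Definition mass z n u : R := \sum_(b <- B n) u (z * b)%g ^+ 2.

Lemma local_energy_ge0 u x : 0 <= local_energy u x.
Proof. by apply: sumr_ge0 => t _; apply: sqr_ge0. Qed.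

Lemma energy_ge0 z n u : 0 <= energy z n u.
Proof. by apply: sumr_ge0 => b _; apply: local_energy_ge0. Qed.

Lemma mass_ge0 z n u : 0 <= mass z n u.
Proof. by apply: sumr_ge0 => b _; apply: sqr_ge0. Qed.

Lemma f_gt0 n : 0 < f n :> R.
Proof. by rewrite ltr0n size_ball_gt0. Qed.

(** Cauchy-Schwarz along a word that spells [g], one letter at a time. Right translation by a prefix
    is injective and maps the ball of radius [r] into that of radius [r + n], so each letter costs
    at most one copy of the energy. *)
Lemma path_energy u z r n g : g \in B n ->
  \sum_(b <- B r) (u (z * b * g)%g - u (z * b)%g) ^+ 2 <= n%:R ^+ 2 * energy z (r + n) u.
Proof.
elim: n g => [|n IHn] g.
  rewrite inE => /eqP ->; rewrite big1 ?mulr_ge0 ?energy_ge0 // => b _.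
  by rewrite mulg1 subrr expr0n.
move=> /ballSP [g' [t [gB tT ->]]].
have E1 : \sum_(b <- B r) (u (z * b * (g' * t))%g - u (z * b * g')%g) ^+ 2 <=
    energy z (r + n.+1) u.
  apply: (@le_trans _ _ (\sum_(b <- B r) local_energy u (z * (b * g'))%g)).
    apply: ler_sum => b _; rewrite !mulgA; apply: (sum_term (F := fun t => _)) => // s _.
    exact: sqr_ge0.
  apply: (sum_inj (h := fun b => (b * g')%g) (F := fun b => local_energy u (z * b)%g)).
  - exact: ball_uniq.
  - by move=> b b' _ _ /mulIg.
  - move=> b bB; apply: (@ball_le _ _ (r + n)) => //; last exact: ball_mul.
    by rewrite addnS.
  - by move=> b _; apply: local_energy_ge0.
have E2 : n%:R ^+ 2 * energy z (r + n) u <= n%:R ^+ 2 * energy z (r + n.+1) u.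
  rewrite ler_wpM2l ?sqr_ge0 //; apply: sum_subset; first exact: ball_uniq.
    by apply: ball_le => //; rewrite addnS.
  by move=> b _; apply: local_energy_ge0.
have {IHn} E3 := le_trans (IHn g' gB) E2.
case: n gB E1 E2 E3 => [|n] gB E1 E2 E3.
  move: gB E1; rewrite inE => /eqP -> E1; apply: le_trans _ (le_trans E1 _).
    by apply: ler_sum => b _; rewrite !mulg1.
  by rewrite expr1n mul1r.
set m : R := n.+1%:R; have m0 : 0 < m by rewrite /m ltr0n.
(* The weights [m + 1] and [1 + 1/m] are conjugate, and [(m + 1) + (1 + 1/m) m^2 = (m + 1)^2]
   reproduces the square of the length. *)
apply: (@le_trans _ _ (\sum_(b <- B r)
  ((m + 1) * (u (z * b * (g' * t))%g - u (z * b * g')%g) ^+ 2 +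
   (1 + m^-1) * (u (z * b * g')%g - u (z * b)%g) ^+ 2))).
  apply: ler_sum => b _.
  move: (u (z * b * (g' * t))%g) (u (z * b * g')%g) (u (z * b)%g) => a1 a2 a3.
  rewrite -subr_ge0.
  have -> : (m + 1) * (a1 - a2) ^+ 2 + (1 + m^-1) * (a2 - a3) ^+ 2 - (a1 - a3) ^+ 2 =
    m^-1 * (m * (a1 - a2) - (a2 - a3)) ^+ 2 by field; lra.
  by rewrite mulr_ge0 ?sqr_ge0 // invr_ge0 ltW.
rewrite big_split /= -!mulr_sumr.
apply: (@le_trans _ _ ((m + 1) * energy z (r + n.+2) u +
   (1 + m^-1) * (m ^+ 2 * energy z (r + n.+2) u))).
  apply: lerD; rewrite ler_wpM2l // ?addr_ge0 // ?invr_ge0 // ?ltW //.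
have -> : n.+2%:R = m + 1 :> R by rewrite /m -natr1.
by rewrite le_eqVlt; apply/orP; left; apply/eqP; field; lra.
Qed.

(** For mean zero, the mass times the size of the ball is half the double sum of squared
    differences. Writing the second point as [a * g], with [g] in the ball of radius [2r], leaves
    one application of [path_energy] for each [g], hence the factor [f (2 * r)] and the radius
    [3 * r]. *)
Lemma poincare u z r : \sum_(b <- B r) u (z * b)%g = 0 ->
  f r * mass z r u <= 2 * r%:R ^+ 2 * f (2 * r) * energy z (3 * r) u.
Proof.
move=> avg.
have E : 2 * (f r * mass z r u) =
    \sum_(a <- B r) \sum_(b <- B r) (u (z * b)%g - u (z * a)%g) ^+ 2.
  have -> : \sum_(a <- B r) \sum_(b <- B r) (u (z * b)%g - u (z * a)%g) ^+ 2 =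
    \sum_(a <- B r) (mass z r u + f r * u (z * a)%g ^+ 2).
    apply: eq_bigr => a _.
    have -> : f r * u (z * a)%g ^+ 2 = \sum_(b <- B r) u (z * a)%g ^+ 2.
      by rewrite big_const_seq count_predT iter_addr_0 mulr_natl.
    have Eb : \sum_(b <- B r) (u (z * b)%g - u (z * a)%g) ^+ 2 +
        2 * u (z * a)%g * \sum_(b <- B r) u (z * b)%g =
        mass z r u + \sum_(b <- B r) u (z * a)%g ^+ 2.
      by rewrite mulr_sumr /mass -!big_split; apply: eq_bigr => b _ /=; ring.
    by rewrite -Eb avg mulr0 addr0.
  rewrite big_split /= -mulr_sumr -/(mass z r u) big_const_seq count_predT iter_addr_0.
  by rewrite -[mass z r u *+ _]mulr_natl; ring.
rewrite -(ler_pM2l (x := 2)) // E.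
apply: (@le_trans _ _ (\sum_(a <- B r) \sum_(g <- B (2 * r))
    (u (z * a * g)%g - u (z * a)%g) ^+ 2)).
  rewrite big_seq [leRHS]big_seq; apply: ler_sum => a aB.
  apply: (@le_trans _ _ (\sum_(b <- B r) (u (z * a * (a^-1 * b))%g - u (z * a)%g) ^+ 2)).
    by apply: ler_sum => b _; rewrite mulgA mulgK.
  apply: (sum_inj (h := fun b => (a^-1 * b)%g)
    (F := fun g => (u (z * a * g)%g - u (z * a)%g) ^+ 2)).
  - exact: ball_uniq.
  - by move=> b b' _ _ /mulgI.
  - by move=> b bB; rewrite mul2n -addnn; apply: ball_mul => //; apply: ball_inv.
  - by move=> *; apply: sqr_ge0.
rewrite exchange_big /=.
apply: (@le_trans _ _ (\sum_(g <- B (2 * r)) ((2 * r)%:R ^+ 2 * energy z (r + 2 * r) u))).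
  by rewrite big_seq [leRHS]big_seq; apply: ler_sum => g; apply: path_energy.
rewrite big_const_seq count_predT iter_addr_0 -[leLHS]mulr_natl -mulSn natrM.
by rewrite le_eqVlt; apply/orP; left; apply/eqP; ring.
Qed.

Section Caccioppoli.
Variables (u : G -> R) (r rho : nat).
Hypotheses (hu : harmonic u) (rho0 : (0 < rho)%N).

(** A cutoff that is 1 on the ball of radius [r + 1], vanishes outside that of radius [r + rho] and
    changes by at most [1/rho] along an edge; as an average of indicators of balls it needs no
    distance function. *)
Let eta x : R := (\sum_(i < rho) (x \in B (r.+1 + i))%:R) / rho%:R.

Let rhoR : 0 < rho%:R :> R. Proof. by rewrite ltr0n. Qed.

Let eta_lip x t : t \in T -> eta x - eta (x * t)%g <= rho%:R^-1.
Proof.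
move=> tT; rewrite -mulrBl ler_pdivrMr // mulVf ?gt_eqF // lerBlDr.
apply: (@le_trans _ _ (\sum_(i < rho) ((x * t)%g \in B (r.+1 + i.+1))%:R)).
  apply: ler_sum => i _; rewrite ler_nat; case: (boolP (x \in _)) => // xB.
  by rewrite addnS -addn1; move: (ball_mul xB (ball_gen tT)) => ->.
have big (F : nat -> R) : \sum_(i < rho) F i.+1 + F 0%N = \sum_(i < rho.+1) F i.
  by rewrite [RHS]big_ord_recl addrC.
pose F i : R := ((x * t)%g \in B (r.+1 + i))%:R.
apply: (@le_trans _ _ (\sum_(i < rho.+1) F i)).
  by rewrite -(big F) lerDl ler0n.
by rewrite big_ord_recr /= addrC; apply: lerD => //; rewrite /F lern1; case: (_ \in _).
Qed.

Let eta_diff x t : t \in T -> (eta x - eta (x * t)%g) ^+ 2 <= rho%:R^-1 ^+ 2.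
Proof.
move=> tT; have h1 := eta_lip x tT.
have h2 : eta (x * t)%g - eta x <= rho%:R^-1.
  have tT' : (t^-1)%g \in T by rewrite symmV.
  by have := eta_lip (x * t)%g tT'; rewrite mulgK.
have : 0 < rho%:R^-1 :> R by rewrite invr_gt0.
by nra.
Qed.

Let eta1 x : x \in B r.+1 -> eta x = 1.
Proof.
move=> xB; rewrite /eta (eq_bigr (fun=> 1)) => [|i _].
  by rewrite sumr_const card_ord mulfV // gt_eqF.
by rewrite (ball_le _ _ xB) // leq_addr.
Qed.

Let eta0 x : eta x != 0 -> x \in B (r + rho).
Proof.
apply: contra_neqT => nx; rewrite /eta big1 ?mul0r // => i _.
case: (boolP (x \in _)) => // xB; case/negP: nx; apply: ball_le xB => //.
by rewrite addSn -addnS leq_add2l.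
Qed.

(** Test harmonicity against [eta^2 u]. The identity [key] separates the energy of [eta u] from a
    term in which only the cutoff is differentiated; that factor is at most [1/rho^2] and leaves the
    mass. *)
Lemma caccioppoli :
  energy 1%g r u <= (size T)%:R / rho%:R ^+ 2 * mass 1%g (r + rho + 2) u.
Proof.
(* One unit beyond the support of [w], so that translation by a step loses no term and the summation
   by parts has no boundary. *)
pose N := (r + rho + 1)%N; pose w x := eta x ^+ 2 * u x.
have w0 x : w x != 0 -> x \in B (r + rho).
  by move=> h; apply: eta0; apply: contra_neq h => h; rewrite /w h expr0n mul0r.
have mT X (F : G -> R) : \sum_(x <- X) \sum_(t <- T) F x =
    (size T)%:R * \sum_(x <- X) F x.
  rewrite mulr_sumr; apply: eq_bigr => x _.
  by rewrite big_const_seq count_predT iter_addr_0 mulr_natl.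
have supp t (F : G -> R) : t \in T ->
    \sum_(x <- B N) w (x * t)%g * F (x * t)%g = \sum_(y <- B (r + rho)) w y * F y.
  move=> tT; have tV : (t^-1)%g \in T by rewrite symmV.
  rewrite (bigID (fun x => (x * t)%g \in B (r + rho))) /= [X in _ + X]big1 ?addr0.
    rewrite -big_filter -(big_map (fun x => (x * t)%g) predT (fun y => w y * F y)).
    apply: perm_big; apply: uniq_perm; rewrite ?ball_uniq //.
      by rewrite map_inj_uniq ?filter_uniq ?ball_uniq //; apply: mulIg.
    move=> y; apply/mapP/idP => [[x] |yB]; first by rewrite mem_filter => /andP [? _ ->].
    exists (y * t^-1)%g; rewrite ?mulgVK // mem_filter mulgVK yB.
    by apply: ball_mul => //; apply: ball_gen.
  move=> x h; have -> : w (x * t)%g = 0; last by rewrite mul0r.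
  by apply/eqP; apply: contraNT h => /w0.
have parts : \sum_(x <- B N) \sum_(t <- T) (w (x * t)%g - w x) * (u (x * t)%g - u x) = 0.
  under eq_bigr => x _ do under eq_bigr => t _ do rewrite mulrBl.
  under eq_bigr => x _ do rewrite sumrB -mulr_sumr hu mulr0 subr0.
  rewrite exchange_big /= (eq_big_seq (fun t => \sum_(y <- B (r + rho))
      w y * (u y - u (y * t^-1)%g))); last first.
    move=> t tT; rewrite -(supp t (fun y => u y - u (y * t^-1)%g)) //.
    by apply: eq_bigr => x _; rewrite mulgK.
  rewrite exchange_big big1 //= => y _; rewrite -mulr_sumr.
  have -> : \sum_(t <- T) (u y - u (y * t^-1)%g) = - \sum_(t <- T) (u (y * t)%g - u y).
    rewrite -sumrN (perm_big _ (proj2 sT)) big_map; apply: eq_bigr => t _ /=.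
    by rewrite invgK opprB.
  by rewrite hu oppr0 mulr0.
have key x t : (w (x * t)%g - w x) * (u (x * t)%g - u x) =
  (eta (x * t)%g * u (x * t)%g - eta x * u x) ^+ 2 -
  u x * u (x * t)%g * (eta x - eta (x * t)%g) ^+ 2 by rewrite /w; ring.
have E : \sum_(x <- B N) \sum_(t <- T) (eta (x * t)%g * u (x * t)%g - eta x * u x) ^+ 2 =
    \sum_(x <- B N) \sum_(t <- T) u x * u (x * t)%g * (eta x - eta (x * t)%g) ^+ 2.
  apply/eqP; rewrite -subr_eq0 -sumrB; apply/eqP; rewrite -[RHS]parts.
  apply: eq_bigr => x _; rewrite -sumrB; apply: eq_bigr => t _.
  by rewrite key.
apply: (@le_trans _ _ (\sum_(x <- B N) \sum_(t <- T)
    (eta (x * t)%g * u (x * t)%g - eta x * u x) ^+ 2)).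
  apply: (@le_trans _ _ (\sum_(x <- B r) \sum_(t <- T)
    (eta (x * t)%g * u (x * t)%g - eta x * u x) ^+ 2)).
    rewrite /energy big_seq [leRHS]big_seq; apply: ler_sum => x xB.
    rewrite /local_energy big_seq [leRHS]big_seq mul1g; apply: ler_sum => t tT.
    rewrite !eta1 ?mul1r //; first by apply: ball_le xB.
    by rewrite -addn1; apply: ball_mul => //; apply: ball_gen.
  apply: sum_subset; first exact: ball_uniq.
    by apply: ball_le => //; rewrite /N -addnA leq_addr.
  by move=> x _; apply: sumr_ge0 => t _; apply: sqr_ge0.
rewrite {}E; pose c : R := rho%:R^-1 ^+ 2.
have c0 : 0 <= c by rewrite sqr_ge0.
apply: (@le_trans _ _ (\sum_(x <- B N) \sum_(t <- T)
    (c / 2 * u x ^+ 2 + c / 2 * u (x * t)%g ^+ 2))).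
  apply: ler_sum => x _; rewrite big_seq [leRHS]big_seq; apply: ler_sum => t tT.
  have := eta_diff x tT; rewrite -/c; set e := (_ - _) ^+ 2.
  have : 0 <= e by apply: sqr_ge0.
  move=> e0 ec; apply: (@le_trans _ _ ((u x ^+ 2 + u (x * t)%g ^+ 2) / 2 * e)).
    by rewrite ler_wpM2r //; have := sqr_ge0 (u x - u (x * t)%g); nra.
  have -> : c / 2 * u x ^+ 2 + c / 2 * u (x * t)%g ^+ 2 =
    (u x ^+ 2 + u (x * t)%g ^+ 2) / 2 * c by field.
  by rewrite ler_wpM2l // divr_ge0 // addr_ge0 // sqr_ge0.
have M1 : \sum_(x <- B N) u x ^+ 2 <= mass 1%g (r + rho + 2) u.
  rewrite /mass; under [leRHS]eq_bigr => b _ do rewrite mul1g.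
  apply: sum_subset; [exact: ball_uniq| |by move=> *; apply: sqr_ge0].
  by apply: ball_le => //; rewrite /N leq_add2l.
have M2 t : t \in T -> \sum_(x <- B N) u (x * t)%g ^+ 2 <= mass 1%g (r + rho + 2) u.
  move=> tT; rewrite /mass; under [leRHS]eq_bigr => b _ do rewrite mul1g.
  apply: (sum_inj (h := fun x => (x * t)%g) (F := fun x => u x ^+ 2)).
  - exact: ball_uniq.
  - by move=> ? ? _ _ /mulIg.
  - move=> x xB; rewrite (_ : (r + rho + 2 = N + 1)%N); last by rewrite /N; lia.
    by apply: ball_mul => //; apply: ball_gen.
  - by move=> *; apply: sqr_ge0.
under eq_bigr => x _ do rewrite big_split /=.
rewrite big_split /= mT -!mulr_sumr exchange_big /=.
have -> : (size T)%:R / rho%:R ^+ 2 * mass 1%g (r + rho + 2) u =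
    (size T)%:R * (c / 2 * mass 1%g (r + rho + 2) u) +
    \sum_(t <- T) (c / 2 * mass 1%g (r + rho + 2) u).
  rewrite big_const_seq count_predT iter_addr_0 -[X in _ = _ + X]mulr_natl /c exprVn.
  by field; rewrite gt_eqF.
apply: lerD; first by rewrite ler_wpM2l // ler_wpM2l // divr_ge0.
rewrite big_seq [leRHS]big_seq; apply: ler_sum => t tT; rewrite -mulr_sumr.
by rewrite ler_wpM2l ?M2 // divr_ge0.
Qed.

End Caccioppoli.
End Geometry.

(** * Coverings, packings and the growth of mass across scales *)

Section Covering.
Variables (R : realType) (G : groupType) (T : seq G).
Hypothesis sT : symm T.
Local Open Scope ring_scope.
Implicit Types (u : G -> R) (x y z : G) (X : seq G).
Local Notation B n := (ball T n).
Local Notation f n := (size (ball T n))%:R.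

Definition separated r X := forall x y, x \in X -> y \in X -> x != y ->
  (x^-1 * y)%g \notin B (2 * r).

Lemma separated_cover r (L : seq G) : exists X, [/\ uniq X, {subset X <= L},
  separated r X & forall z, z \in L -> exists2 x, x \in X & (x^-1 * z)%g \in B (2 * r)].
Proof.
elim: L => [|z L [X [uX XL sX cX]]]; first by exists [::].
have [[x xX xz]|nz] := pselect (exists2 x, x \in X & (x^-1 * z)%g \in B (2 * r)).
  exists X; split=> // [y /XL yL|y]; first by rewrite inE yL orbT.
  by rewrite inE => /orP [/eqP ->|/cX //]; exists x.
have nX x : x \in X -> (x^-1 * z)%g \notin B (2 * r).
  by move=> xX; apply/negP => h; apply: nz; exists x.
exists (z :: X); split.
- rewrite /= uX andbT; apply/negP => /nX; rewrite mulVg ball_one //.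
- by move=> x; rewrite !inE => /orP [->//|/XL ->]; rewrite orbT.
- move=> x y; rewrite !inE => /orP [/eqP ->|xX] /orP [/eqP ->|yX] xy.
  + by rewrite eqxx in xy.
  + apply: contra (nX y yX) => h.
    by rewrite -[(y^-1 * z)%g]invgK invgM invgK; apply: ball_inv.
  + exact: nX.
  + exact: sX.
move=> y; rewrite inE => /orP [/eqP ->|/cX [x xX xy]].
  by exists z; rewrite ?mem_head // mulVg ball_one.
by exists x => //; rewrite inE xX orbT.
Qed.

(** The balls of radius [r] around a separated set are disjoint: a common point would put
    [p1^-1 * p2] into the ball of radius [2 * r]. *)
Lemma packing r s z X : uniq X -> separated r X ->
  (forall x, x \in X -> (z^-1 * x)%g \in B s) ->
  (size X * size (B r) <= size (B (s + r)))%N.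
Proof.
move=> uX sX Xz; rewrite -(size_allpairs (fun x b => (z^-1 * x * b)%g)).
apply: uniq_leq_size; last first.
  by move=> _ /allpairsP [[x b] [/= /Xz xB bB ->]]; apply: ball_mul.
apply: allpairs_uniq => //; first exact: ball_uniq.
move=> [? ?] [? ?] /= /allpairsP [[p1 b] [/= xX bB [-> ->]]].
move=> /allpairsP [[p2 b'] [/= xX' bB' [-> ->]]]; rewrite -!mulgA => /mulgI E.
have [E1|/(sX _ _ xX xX')/negP[]] := eqVneq p1 p2.
  by rewrite -E1 in E *; rewrite (mulgI _ _ _ E).
rewrite mul2n -addnn; have -> : (p1^-1 * p2 = b * b'^-1)%g.
  by apply: (mulgI p1); apply: (mulIg b'); rewrite mulVKg -!mulgA mulVg mulg1 -E.
by apply: ball_mul => //; apply: ball_inv.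
Qed.

Section MassCover.
Variables (r N : nat) (K : R) (X : seq G) (u : G -> R).
Hypotheses (r0 : (0 < r)%N) (uX : uniq X) (sX : separated r X).
Hypothesis cX : forall z, z \in B N -> exists2 x, x \in X & (x^-1 * z)%g \in B (2 * r).
Hypothesis KP : f (8 * r) <= K * f r.
Hypothesis avg : forall x, x \in X -> \sum_(b <- B (2 * r)) u (x * b)%g = 0.

Let f_le m n : (m <= n)%N -> f m <= f n :> R.
Proof. by move=> mn; rewrite ler_nat; apply: size_ball_le; apply: ball_le. Qed.

Let K0 : 0 < K.
Proof.
have := lt_le_trans (f_gt0 R sT (8 * r)) KP.
by rewrite pmulr_lgt0 ?f_gt0.
Qed.

Let X' M := [seq x <- X | x \in B (M + 2 * r)].

Lemma mass_le_cover M : (M <= N)%N ->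
  mass T 1%g M u <= \sum_(x <- X' M) mass T x (2 * r) u.
Proof.
move=> MN; rewrite /mass; under eq_bigr => b _ do rewrite mul1g.
apply: (@le_trans _ _ (\sum_(y <- B M) \sum_(x <- X' M)
    ((x^-1 * y)%g \in B (2 * r))%:R * u y ^+ 2)).
  rewrite big_seq [leRHS]big_seq; apply: ler_sum => y yM.
  have [x xX xy] := cX (ball_le sT MN yM).
  have xX' : x \in X' M.
    rewrite mem_filter xX andbT -[x]invgK -(mulgK y x^-1%g) invgM invgK.
    by apply: ball_mul => //; apply: ball_inv.
  apply: le_trans (sum_term xX' _) => /=; first by rewrite xy mul1r.
  by move=> *; rewrite mulr_ge0 ?sqr_ge0.
rewrite exchange_big /=; apply: ler_sum => x _.
apply: (@le_trans _ _ (\sum_(y <- [seq y <- B M | (x^-1 * y)%g \in B (2 * r)])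
   u (x * (x^-1 * y))%g ^+ 2)).
  rewrite big_filter [leRHS]big_mkcond; apply: ler_sum => y _; rewrite mulVKg.
  by case: ifP; rewrite ?mul1r ?mul0r.
apply: (sum_inj (h := fun y => (x^-1 * y)%g) (F := fun y => u (x * y)%g ^+ 2)).
- by rewrite filter_uniq ?ball_uniq.
- by move=> ? ? _ _ /mulgI.
- by move=> y; rewrite mem_filter => /andP [].
- by move=> *; apply: sqr_ge0.
Qed.

(** A point lies in at most [K] of the balls of radius [6r]: their centres are separated and within
    [6r] of the point, so their number times [f r] is at most [f (7r)], hence at most [f (8r)]. *)
Lemma energy_cover M : \sum_(x <- X' M) energy T x (6 * r) u <=
  K * energy T 1%g (M + 8 * r) u.
Proof.
pose Y := B (M + 8 * r).
apply: (@le_trans _ _ (\sum_(x <- X' M) \sum_(y <- Y)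
   ((x^-1 * y)%g \in B (6 * r))%:R * local_energy T u y)).
  rewrite big_seq [leRHS]big_seq; apply: ler_sum => x; rewrite mem_filter => /andP [xB _].
  apply: (@le_trans _ _ (\sum_(b <- B (6 * r))
      ((x^-1 * (x * b))%g \in B (6 * r))%:R * local_energy T u (x * b)%g)).
    rewrite /energy big_seq [leRHS]big_seq; apply: ler_sum => b bB.
    by rewrite mulKg bB mul1r.
  apply: (sum_inj (h := fun b => (x * b)%g)
    (F := fun y => ((x^-1 * y)%g \in B (6 * r))%:R * local_energy T u y)).
  - exact: ball_uniq.
  - by move=> ? ? _ _ /mulgI.
  - move=> b bB; rewrite /Y (_ : (M + 8 * r = M + 2 * r + 6 * r)%N); last by lia.
    exact: ball_mul.
  - by move=> *; rewrite mulr_ge0 ?local_energy_ge0.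
rewrite exchange_big /= /energy mulr_sumr; apply: ler_sum => y _.
rewrite -mulr_suml mul1g ler_wpM2r ?local_energy_ge0 //.
pose X2 := [seq x <- X' M | (x^-1 * y)%g \in B (6 * r)].
have -> : \sum_(x <- X' M) ((x^-1 * y)%g \in B (6 * r))%:R = (size X2)%:R :> R.
  rewrite -sum1_size natr_sum /X2 [RHS]big_filter [RHS]big_mkcond; apply: eq_bigr => x _.
  by case: ifP.
rewrite -(ler_pM2r (f_gt0 R sT r)) -natrM; apply: le_trans KP.
rewrite ler_nat; apply: leq_trans (packing (z := y) _ _ _) _.
- by rewrite !filter_uniq.
- by move=> a b; rewrite !mem_filter => /and3P [_ _ aX] /and3P [_ _ bX]; apply: sX.
- move=> x; rewrite mem_filter => /andP [xy _].
  by rewrite -[(y^-1 * x)%g]invgK invgM invgK; apply: ball_inv xy.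
- by apply: size_ball_le; apply: ball_le => //; lia.
Qed.

(** Poincare on each ball of radius [2r] of the cover, where the mean is zero, then the bounded
    overlap. The resulting inequality runs opposite to Caccioppoli. *)
Lemma mass_energy M : (M <= N)%N ->
  mass T 1%g M u <= 8 * r%:R ^+ 2 * K ^+ 2 * energy T 1%g (M + 8 * r) u.
Proof.
move=> MN; apply: le_trans (mass_le_cover MN) _.
apply: (@le_trans _ _ (\sum_(x <- X' M) (8 * r%:R ^+ 2 * K * energy T x (6 * r) u))).
  rewrite big_seq [leRHS]big_seq; apply: ler_sum => x; rewrite mem_filter => /andP [_ xX].
  have := poincare sT (avg xX); rewrite !mulnA.
  rewrite -(ler_pM2l (f_gt0 R sT (2 * r))) => /le_trans; apply.
  have h1 : f (2 * 2 * r) <= f (2 * r) * K :> R.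
    rewrite mulrC; apply: le_trans (f_le (n := 8 * r) _) (le_trans KP _).
      by rewrite leq_mul2r orbT.
    by rewrite ler_pM2l // f_le //; lia.
  have -> : f (2 * r) * (8 * r%:R ^+ 2 * K * energy T x (6 * r) u) =
    (f (2 * r) * K) * (8 * r%:R ^+ 2 * energy T x (6 * r) u) by ring.
  rewrite [leLHS](_ : _ = f (2 * 2 * r) * (8 * r%:R ^+ 2 * energy T x (6 * r) u)).
    by rewrite ler_wpM2r // !mulr_ge0 ?energy_ge0.
  by rewrite natrM; ring.
rewrite -mulr_sumr; have -> : 8 * r%:R ^+ 2 * K ^+ 2 * energy T 1%g (M + 8 * r) u =
  8 * r%:R ^+ 2 * K * (K * energy T 1%g (M + 8 * r) u) by ring.
by rewrite ler_wpM2l ?energy_cover // !mulr_ge0 // ltW.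
Qed.

(** Poincare at the small scale [r = 8^j0] and Caccioppoli at the large scale [8^j] combine to the
    factor [(r / 8^j)^2], which is [64^-(j - j0)]. A harmonic function with mean zero at scale [r]
    must therefore grow fast at scales far above [r]. *)
Lemma mass_step j0 j : r = (8 ^ j0)%N -> (j0.+2 <= j)%N -> (8 ^ j <= N)%N -> harmonic T u ->
  mass T 1%g (8 ^ j) u <= K ^+ 2 * (size T)%:R / 64 ^+ (j - j0) * mass T 1%g (8 ^ j.+1) u.
Proof.
move=> rE jj jN hu; apply: le_trans (mass_energy jN) _.
(* The cutoff width [5 * 8^j] fits into the next scale: [8^j + 8r + 5 * 8^j + 2] is at most
   [8^(j + 1)]. *)
have p0 : (0 < 5 * 8 ^ j)%N by rewrite muln_gt0 expn_gt0.
have := caccioppoli sT (8 ^ j + 8 * r) hu p0.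
set m1 := mass _ _ _ u => h1.
have hm : m1 <= mass T 1%g (8 ^ j.+1) u.
  apply: sum_subset; [exact: ball_uniq| |by move=> *; apply: sqr_ge0].
  apply: ball_le => //; rewrite rE -expnS.
  have : (8 * 8 ^ j0.+1 <= 8 ^ j)%N by rewrite -expnS leq_pexp2l.
  have : (0 < 8 ^ j0.+1)%N by rewrite expn_gt0.
  rewrite [in (8 ^ j.+1)%N]expnS; move: (8 ^ j)%N (8 ^ j0.+1)%N => a b; lia.
apply: le_trans (ler_wpM2l _ h1) _; first by rewrite !mulr_ge0 // ?exprn_ge0 // ltW.
apply: (@le_trans _ _ (K ^+ 2 * (size T)%:R / 64 ^+ (j - j0) * m1)); last first.
  by rewrite ler_wpM2l // !mulr_ge0 ?invr_ge0 ?exprn_ge0 // ltW.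
have -> : 8 * r%:R ^+ 2 * K ^+ 2 * ((size T)%:R / (5 * 8 ^ j)%:R ^+ 2 * m1) =
  (8 / 25) * (K ^+ 2 * (size T)%:R / 64 ^+ (j - j0) * m1).
  have -> : (j = j0 + (j - j0))%N by rewrite subnKC //; lia.
  move: (j - j0)%N => i; rewrite addKn rE natrM !natrX exprD.
  have -> : 64 ^+ i = 8 ^+ i ^+ 2 :> R by rewrite -exprM mulnC exprM; congr (_ ^+ _); ring.
  have h8 k : 8 ^+ k != 0 :> R by rewrite expf_neq0.
  have := h8 i; have := h8 j0; move: (8 ^+ i) (8 ^+ j0) => a b a0 b0.
  by field; rewrite a0 b0.
have m10 : 0 <= m1 by apply: mass_ge0.
rewrite ler_piMl //; last by lra.
by rewrite !mulr_ge0 ?invr_ge0 ?exprn_ge0 // ltW.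
Qed.

End MassCover.
End Covering.

(** * Finite dimension of the Lipschitz harmonic functions *)

Section FiniteDimension.
Variables (R : realType) (G : groupType) (T : seq G).
Hypothesis sT : symm T.
Local Open Scope ring_scope.
Implicit Types (x y z : G) (X : seq G).
Local Notation B n := (ball T n).
Local Notation f n := (size (ball T n))%:R.

Definition lipschitz (c : R) (u : G -> R) :=
  forall x t, t \in T -> `|u (x * t)%g - u x| <= c.

Lemma lipschitz_ball c u n x : lipschitz c u -> u 1%g = 0 -> x \in B n ->
  `|u x| <= c * n%:R.
Proof.
move=> uc u1; elim: n x => [|n IHn] x.
  by rewrite inE => /eqP ->; rewrite u1 normr0 mulr0.
move=> /ballSP [y [t [/IHn yB tT ->]]]; rewrite -[n.+1%:R]natr1 mulrDr mulr1 addrC.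
by rewrite -(subrK (u y) (u _)); apply: le_trans (ler_normD _ _) _; apply: lerD => //; apply: uc.
Qed.

(** If every window of length [L] grew by more than twice the slope of the bound, [w] would overtake
    that bound. *)
Lemma growth_pigeonhole (w : nat -> R) (alpha beta : R) (i0 L : nat) : 0 < beta ->
  (0 < L)%N -> (forall n, (i0 <= n)%N -> w n <= alpha + beta * n%:R) ->
  exists2 i, (i0 <= i)%N & w (i + L)%N - w i <= 2 * beta * L%:R.
Proof.
move=> b0 L0 wb; apply: contrapT => nE.
have big k : w i0 + 2 * beta * L%:R * k%:R <= w (i0 + k * L)%N.
  elim: k => [|k IHk]; first by rewrite mulr0 addr0 addn0.
  rewrite (_ : (i0 + k.+1 * L = i0 + k * L + L)%N); last by rewrite mulSn; lia.
  rewrite -[k.+1%:R]natr1 mulrDr mulr1.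
  have [h|h] := leP (w (i0 + k * L + L)%N - w (i0 + k * L)%N) (2 * beta * L%:R).
    by case: nE; exists (i0 + k * L)%N => //; apply: leq_addr.
  by lra.
have bL : 0 < beta * L%:R by rewrite mulr_gt0 // ltr0n.
pose A := (alpha + beta * i0%:R - w i0) / (beta * L%:R).
have [k kA] : exists k : nat, A < k%:R by exists (Num.truncn A).+1; rewrite truncnS_gt.
have := le_trans (big k) (wb (i0 + k * L)%N (leq_addr _ _)).
move: kA; rewrite /A ltr_pdivrMr // natrD natrM.
by move=> h1 h2; nra.
Qed.

Lemma small_step (w : nat -> R) (c : R) (i n : nat) : (0 < n)%N ->
  w (i + n)%N - w i <= c * n%:R -> exists2 j, (j < n)%N & w (i + j).+1 - w (i + j)%N <= c.
Proof.
move=> n0; elim: n n0 => // n IHn _; rewrite addnS => h.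
have [h1|h1] := leP (w (i + n).+1 - w (i + n)%N) c; first by exists n.
case: n IHn h h1 => [|n] IHn h h1; first by move: h; rewrite addn0 in h1 *; lra.
have [//||j jn jc] := IHn; last by exists j => //; apply: ltnW.
by move: h; rewrite -[n.+2%:R]natr1; lra.
Qed.

Lemma dim_arith (a b c : R) : 0 <= 8 * a - 20 * (a - b) -> b <= c -> 0 <= c -> 0 <= b ->
  a <= 2 * c.
Proof. by move=> *; lra. Qed.

Section Basis.
Variables (d : nat) (u : 'I_d -> G -> R) (p : 'I_d -> G) (Lam : R).
Hypotheses (d0 : (0 < d)%N) (hu : forall i, harmonic T (u i)) (u1 : forall i, u i 1%g = 0).
Hypotheses (ul : forall i, lipschitz Lam (u i)) (Lam1 : 1 <= Lam).
Hypothesis up : \det (\matrix_(i, j) u i (p j)) != 0.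

Definition comb (v : 'rV[R]_d) x := \sum_i v 0 i * u i x.
Definition gram n : 'M[R]_d := \matrix_(i, j) \sum_(b <- B n) u i b * u j b.

Lemma comb_harmonic v : harmonic T (comb v).
Proof.
move=> x; rewrite /comb; under eq_bigr => t _ do rewrite -sumrB.
rewrite exchange_big big1 //= => i _; under eq_bigr => t _ do rewrite -mulrBr.
by rewrite -mulr_sumr hu mulr0.
Qed.

Lemma gram_sym n : (gram n)^T = gram n.
Proof. by apply/matrixP => i j; rewrite !mxE; apply: eq_bigr => b _; rewrite mulrC. Qed.

Lemma qform_gram n v : qform (gram n) v = mass T 1%g n (comb v).
Proof.
rewrite /qform /mass !mxE.
transitivity (\sum_(j < d) \sum_(b <- B n) v 0 j * u j b * comb v b).
  apply: eq_bigr => j _; rewrite !mxE mulr_suml.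
  under eq_bigr => i _ do rewrite mxE mulr_sumr mulr_suml.
  rewrite exchange_big /=; apply: eq_bigr => b _; rewrite /comb mulr_sumr.
  by apply: eq_bigr => i _; ring.
rewrite exchange_big /=; apply: eq_bigr => b _; rewrite -mulr_suml mul1g expr2.
by [].
Qed.

Lemma qform_gram_le m n v : (m <= n)%N -> qform (gram m) v <= qform (gram n) v.
Proof.
move=> mn; rewrite !qform_gram; apply: sum_subset; first exact: ball_uniq.
  exact: ball_le.
by move=> *; apply: sqr_ge0.
Qed.

(** The points [p j] certify independence: a combination without mass on a ball that contains them
    vanishes at all of them, which the nonzero determinant forbids. *)
Lemma qform_gram_pos n v : (forall j, p j \in B n) -> v != 0 -> 0 < qform (gram n) v.
Proof.
move=> pB v0; rewrite lt_def qform_gram mass_ge0 andbT; apply: contraNneq v0 => m0.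
apply/eqP/(row_free_inj (A := \matrix_(i, j) u i (p j))); first by rewrite row_free_unit unitmxE unitfE.
rewrite mul0mx; apply/rowP => j; rewrite !mxE.
transitivity (comb v (p j)); first by apply: eq_bigr => i _; rewrite mxE.
apply/eqP; rewrite -sqrf_eq0 eq_le sqr_ge0 andbT -m0 /mass.
under eq_bigr => b _ do rewrite mul1g.
by apply: (sum_term (pB j)) => *; apply: sqr_ge0.
Qed.

Lemma det_gram_gt0 n : (forall j, p j \in B n) -> 0 < \det (gram n).
Proof.
move=> pB; have [] := @det_le R d (gram n) (gram n) (fun=> 1) (gram_sym n) (gram_sym n) => //.
  by move=> v v0; apply: qform_gram_pos.
by move=> i v _; rewrite mul1r.
Qed.

Lemma det_gram_le m n : (forall j, p j \in B m) -> (m <= n)%N ->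
  \det (gram m) <= \det (gram n).
Proof.
move=> pB mn; have [] := @det_le R d (gram m) (gram n) (fun=> 1) (gram_sym m) (gram_sym n) => //.
- by move=> v v0; apply: qform_gram_pos.
- by move=> i v _; rewrite mul1r qform_gram_le.
by rewrite big1 // mul1r.
Qed.

(** Lipschitz functions grow at most linearly, so the Gram form of a ball lies below a scalar form
    whose factor is polynomial in the radius. *)
Lemma det_gram_bound n : (forall j, p j \in B n) ->
  \det (gram n) <= (f n * (d%:R * Lam ^+ 2 * n%:R ^+ 2)) ^+ d.
Proof.
move=> pB; set lam := (X in X ^+ d).
have qs v : qform (lam%:M : 'M[R]_d) v = lam * \sum_i v 0 i ^+ 2.
  rewrite /qform mul_mx_scalar -scalemxAl !mxE; congr (_ * _).
  by apply: eq_bigr => i _; rewrite mxE expr2.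
have [] := @det_le R d (gram n) lam%:M (fun=> 1) (gram_sym n) (tr_scalar_mx _ _) => //.
- by move=> v v0; apply: qform_gram_pos.
- move=> i v _; rewrite mul1r qs qform_gram /mass.
  apply: (@le_trans _ _ (\sum_(b <- B n)
    (d%:R * Lam ^+ 2 * n%:R ^+ 2 * \sum_i v 0 i ^+ 2))); last first.
    by rewrite big_const_seq count_predT iter_addr_0 -[leLHS]mulr_natl /lam mulrA.
  rewrite big_seq [leRHS]big_seq; apply: ler_sum => b bB; rewrite mul1g.
  apply: (@le_trans _ _ (d%:R * \sum_i (v 0 i * u i b) ^+ 2)).
    rewrite -(ler_pM2l (x := 2)) // -subr_ge0.
    suff -> : 2 * (d%:R * \sum_i (v 0 i * u i b) ^+ 2) - 2 * comb v b ^+ 2 =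
      \sum_i \sum_j (v 0 i * u i b - v 0 j * u j b) ^+ 2.
      by apply: sumr_ge0 => i' _; apply: sumr_ge0 => *; apply: sqr_ge0.
    pose a i := v 0 i * u i b; rewrite /comb -/(a _).
    have -> : \sum_i \sum_j (a i - a j) ^+ 2 =
        \sum_i (d%:R * a i ^+ 2 + \sum_j a j ^+ 2 - 2 * a i * \sum_j a j).
      apply: eq_bigr => i' _; rewrite mulr_sumr.
      have -> : d%:R * a i' ^+ 2 = \sum_(j < d) a i' ^+ 2.
        by rewrite sumr_const card_ord mulr_natl.
      by rewrite -big_split -sumrB; apply: eq_bigr => j _ /=; ring.
    rewrite sumrB big_split /= -mulr_sumr sumr_const card_ord -mulr_suml -mulr_sumr.
    by rewrite -[_ *+ d]mulr_natl; ring.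
  rewrite (_ : _ * n%:R ^+ 2 * _ = d%:R * (Lam ^+ 2 * n%:R ^+ 2 * \sum_i v 0 i ^+ 2)); last by ring.
  rewrite ler_wpM2l // mulr_sumr; apply: ler_sum => i' _.
  rewrite exprMn mulrC ler_wpM2r ?sqr_ge0 // -exprMn.
  rewrite -[leLHS]real_normK ?num_real // lerXn2r ?nnegrE ?(lipschitz_ball (ul i') (u1 i') bB) //.
  by rewrite mulr_ge0 // (le_trans _ Lam1).
by rewrite big1 // mul1r det_scalar.
Qed.

Hypothesis genT : forall x, sgen T x.
Variables (C D : nat).
Hypothesis CD : forall n, (size (B n) <= C * n.+1 ^ D)%N.

(** On the scales [8^i], [h] is the logarithm of the volume and [g] that of the [d]-th root of the
    Gram determinant. The slope of the linear bound on [h + g] is [beta]: the volume, of degree [D],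
    enters twice and the Lipschitz bound adds 2. It is essential that [beta] is independent of
    [d]. *)
Let beta : R := (2 * D + 2)%:R * ln 8.
Let h i := ln (f (8 ^ i)%N) : R.
Let g i := ln (\det (gram (8 ^ i))) / d%:R.

Let beta0 : 0 < beta.
Proof. by rewrite mulr_gt0 // ?ltr0n ?addn2 // ln_gt0 // ltr1n. Qed.

Let d0R : 0 < d%:R :> R. Proof. by rewrite ltr0n. Qed.

Let C0 : (0 < C)%N.
Proof. by have := CD 0; rewrite exp1n muln1; apply: leq_trans; apply: size_ball_gt0. Qed.

Let h_bound i : h i <= ln (C * 2 ^ D)%:R + (D * i)%:R * ln 8.
Proof.
have -> : (D * i)%:R * ln 8 = ln (8 ^+ (i * D)) :> R by rewrite lnXn // mulr_natl mulnC.
rewrite /h -lnM ?posrE ?ltr0n ?muln_gt0 ?C0 ?expn_gt0 // ?exprn_gt0 //.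
rewrite ler_ln ?posrE ?f_gt0 ?mulr_gt0 ?exprn_gt0 ?ltr0n ?muln_gt0 ?C0 ?expn_gt0 //.
rewrite -natrX -natrM ler_nat; apply: leq_trans (CD _) _.
rewrite -mulnA leq_mul2l expnM -expnMn; apply/orP; right.
case: D => // D'; rewrite leq_exp2r //.
have : (0 < 8 ^ i)%N by rewrite expn_gt0.
by lia.
Qed.

Lemma fin_dim_window : exists i0 alpha, forall n, (i0 <= n)%N ->
  (forall j, p j \in B (8 ^ n)) /\ h n + g n <= alpha + beta * n%:R.
Proof.
have [k kP] : exists k, forall j, p j \in B k.
  have [k kP] := choice (fun j => genT (p j)); exists (\max_j k j) => j.
  by apply: (ball_le sT _ (kP j)); apply: leq_bigmax.
have pB n : (k <= n)%N -> forall j, p j \in B (8 ^ n).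
  by move=> kn j; apply: (ball_le sT _ (kP j)); apply: leq_trans kn (ltnW (ltn_expl _ _)).
exists k, (2 * ln (C * 2 ^ D)%:R + ln (d%:R * Lam ^+ 2)) => n kn; split; first exact: pB.
have dL : 0 < d%:R * Lam ^+ 2 by rewrite mulr_gt0 // exprn_gt0 // (lt_le_trans _ Lam1).
have gb : g n <= h n + ln (d%:R * Lam ^+ 2) + (2 * n)%:R * ln 8.
  rewrite /g ler_pdivrMr //; apply: (@le_trans _ _ (ln ((f (8 ^ n)%N *
      (d%:R * Lam ^+ 2 * (8 ^ n)%:R ^+ 2)) ^+ d))).
    rewrite ler_ln ?posrE ?det_gram_bound ?det_gram_gt0 //; try exact: pB.
    by rewrite exprn_gt0 // !mulr_gt0 ?f_gt0 ?exprn_gt0 ?ltr0n ?expn_gt0 // (lt_le_trans _ Lam1).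
  have p8 : 0 < (8 ^ n)%:R ^+ 2 :> R by rewrite exprn_gt0 // ltr0n expn_gt0.
  have P1 : 0 < d%:R * Lam ^+ 2 * (8 ^ n)%:R ^+ 2 := mulr_gt0 dL p8.
  have P0 := mulr_gt0 (f_gt0 R sT (8 ^ n)) P1.
  rewrite (lnXn d) // -[leLHS]mulr_natr ler_pM2r //.
  rewrite lnM ?posrE ?f_gt0 // lnM ?posrE // -addrA lerD2l lerD2l.
  by rewrite natrX -exprM lnXn // mulr_natl mulnC.
have := h_bound n; move: gb; rewrite /beta !natrM natrD natrM.
by move=> gb hb; lra.
Qed.

(** Some window of [4l] scales has controlled growth of volume and determinant. Its lower half
    contains a doubling scale [r], and [m] balls of radius [2r] cover the ball of the last scale but
    one. Under the [m] conditions of mean zero on these balls, mass contracts by [theta] over each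
    of the top [l] scales, so by [det_le] the determinant grows by at least
    [exp (20 beta l (d - m))], while the window allows only [exp (8 beta l d)]. Hence [d <= 2m], and
    [m] is bounded by the volume growth of the window. *)
Lemma dim_le l : expR (4 * beta) ^+ 2 * (size T)%:R * expR (20 * beta) + 64 ^+ 2 < 64 ^+ l ->
  d%:R <= 2 * expR (2 * beta * (4 * l)%:R).
Proof.
move=> hl.
have T0 : 0 < (size T)%:R :> R by rewrite ltr0n; case: sT => + _; case: (T).
have l2 : (2 < l)%N.
  have : 64 ^+ 2 < 64 ^+ l :> R.
    by apply: le_lt_trans hl; rewrite lerDr !mulr_ge0 ?expR_ge0 // exprn_ge0 // expR_ge0.
  by rewrite ltr_eXn2l // ltr1n.
have l0 : (0 < 4 * l)%N by lia.
have [i0 [alpha win]] := fin_dim_window.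
have [i i0i hi] := growth_pigeonhole beta0 l0 (fun n hn => (win n hn).2).
have pB n : (i <= n)%N -> forall j, p j \in B (8 ^ n).
  by move=> /(leq_trans i0i) /win [].
have g0 n : (i <= n)%N -> 0 < \det (gram (8 ^ n)) by move=> /pB; apply: det_gram_gt0.
have h_le m n : (m <= n)%N -> h m <= h n.
  move=> mn; rewrite ler_ln ?posrE ?f_gt0 // ler_nat; apply: size_ball_le.
  by apply: ball_le => //; apply: leq_pexp2l.
have g_le m n : (i <= m)%N -> (m <= n)%N -> g m <= g n.
  move=> im mn; rewrite /g ler_pM2r ?invr_gt0 // ler_ln ?posrE ?g0 //; last exact: leq_trans mn.
  by apply: det_gram_le; [apply: pB|apply: leq_pexp2l].
have hgi := g_le i (i + 4 * l)%N (leqnn _) (leq_addr _ _).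
have hhi := h_le i (i + 4 * l)%N (leq_addr _ _).
(* Both functions are nondecreasing, so the bound on the growth of the sum holds for each. *)
have [hh hg] : h (i + 4 * l)%N - h i <= 2 * beta * (4 * l)%:R /\
    g (i + 4 * l)%N - g i <= 2 * beta * (4 * l)%:R by split; lra.
have [j1 j1l hj] : exists2 j, (j < 2 * l)%N & h (i + j).+1 - h (i + j)%N <= 4 * beta.
  apply: small_step; first by lia.
  have := h_le (i + 2 * l)%N (i + 4 * l)%N; rewrite leq_add2l => /(_ _) h1.
  have {}h1 := h1 (leq_mul (isT : (2 <= 4)%N) (leqnn l)).
  by move: hh h1; rewrite !natrM; lra.
pose j0 := (i + j1)%N; pose r := (8 ^ j0)%N; pose K := expR (4 * beta).
have r0 : (0 < r)%N by rewrite expn_gt0.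
have KP : f (8 * r) <= K * f r.
  rewrite -ler_ln ?posrE ?mulr_gt0 ?f_gt0 ?expR_gt0 // lnM ?posrE ?f_gt0 ?expR_gt0 //.
  by rewrite expRK -lerBlDr -expnS.
pose N := (8 ^ (i + 4 * l).-1)%N.
have [X [uX XN sX cX]] := separated_cover sT r (B N).
have Xsize : (size X)%:R <= expR (2 * beta * (4 * l)%:R).
  have XB x : x \in X -> (1^-1 * x)%g \in B N by rewrite invg1 mul1g => /XN.
  have := packing sT uX sX XB; rewrite -(ler_nat R) natrM.
  have le1 : (N + r <= 8 ^ (i + 4 * l))%N.
    have -> : (i + 4 * l = (i + 4 * l).-1.+1)%N by rewrite prednK // addn_gt0 l0 orbT.
    have rN : (r <= N)%N by apply: leq_pexp2l => //; rewrite /j0; clear -j1l; lia.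
    rewrite expnS -/N; apply: leq_trans (leq_add (leqnn N) rN) _.
    by rewrite addnn -mul2n leq_mul2r orbT.
  move=> le2; have : f (N + r) <= f (8 ^ (i + 4 * l))%N :> R.
    by rewrite ler_nat; apply: size_ball_le; apply: ball_le.
  move=> /(le_trans le2) le3.
  have : f (8 ^ (i + 4 * l)) <= expR (2 * beta * (4 * l)%:R) * f r.
    apply: (@le_trans _ _ (expR (2 * beta * (4 * l)%:R) * f (8 ^ i))).
      rewrite -ler_ln ?posrE ?mulr_gt0 ?f_gt0 ?expR_gt0 // lnM ?posrE ?f_gt0 ?expR_gt0 //.
      by rewrite expRK -lerBlDr.
    rewrite ler_pM2l ?expR_gt0 // ler_nat; apply: size_ball_le; apply: ball_le => //.
    by apply: leq_pexp2l => //; rewrite leq_addr.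
  by move=> /(le_trans le3); rewrite ler_pM2r ?f_gt0.
set M := expR _ in Xsize *; pose m := size X.
have [dm|md] := leqP d m.
  apply: le_trans (_ : m%:R <= _); first by rewrite ler_nat.
  by apply: le_trans Xsize _; rewrite ler_peMl ?expR_ge0 // ler1n.
pose L : 'M[R]_(d, m) := \matrix_(s, k) \sum_(b <- B (2 * r)) u s (nth 1%g X k * b)%g.
have [P uP PL] := kernel_basis L.
(* The contraction has to beat the growth allowed by the window, [20] against [8] in [dim_arith].
   The assumption [hl] makes [l] so large that [mass_step] achieves it at distance [l] from the
   doubling scale. *)
pose theta := expR (- (20 * beta)); have th0 : 0 < theta := expR_gt0 _.
have step v j : (forall x, x \in X -> \sum_(b <- B (2 * r)) comb v (x * b)%g = 0) ->
    (i + 3 * l <= j)%N -> (j < i + 4 * l)%N ->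
    mass T 1%g (8 ^ j) (comb v) <= theta * mass T 1%g (8 ^ j.+1) (comb v).
  move=> avg lj jl; apply: le_trans (mass_step sT r0 uX sX cX KP avg (erefl r) _ _ _) _.
  - by rewrite /j0; clear -l2 j1l lj; lia.
  - by apply: leq_pexp2l => //; clear -jl; lia.
  - exact: comb_harmonic.
  rewrite ler_wpM2r ?mass_ge0 // ler_pdivrMr ?exprn_gt0 //.
  apply: (@le_trans _ _ (theta * 64 ^+ l)); last first.
    by rewrite ler_pM2l // ler_weXn2l // ?ler1n // /j0; clear -j1l lj; lia.
  rewrite /theta expRN ler_pdivlMl ?expR_gt0 // mulrC -/K in hl *.
  apply/ltW/le_lt_trans/hl; by rewrite lerDl exprn_ge0.
have chain v n : (forall x, x \in X -> \sum_(b <- B (2 * r)) comb v (x * b)%g = 0) ->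
    (n <= l)%N -> mass T 1%g (8 ^ (i + 3 * l)) (comb v) <=
      theta ^+ n * mass T 1%g (8 ^ (i + 3 * l + n)) (comb v).
  move=> avg; elim: n => [|n IHn] nl; first by rewrite mul1r addn0.
  apply: le_trans (IHn (ltnW nl)) _; rewrite exprSr -mulrA ler_pM2l ?exprn_gt0 //.
  by rewrite addnS; apply: step => //; clear -nl; lia.
pose a := (8 ^ (i + 3 * l))%N; pose c := (8 ^ (i + 4 * l))%N.
have ac : (a <= c)%N by apply: leq_pexp2l => //; clear; lia.
have qP n v : qform (P *m gram n *m P^T) v = qform (gram n) (v *m P).
  by rewrite /qform trmx_mul !mulmxA.
have sP n : (P *m gram n *m P^T)^T = P *m gram n *m P^T.
  by rewrite !trmx_mul trmxK gram_sym mulmxA.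
(* No gain in the first [m] directions and the full contraction in the other [d - m], in the basis
   [P] adapted to the conditions. *)
pose e k : R := if (k < m)%N then 1 else theta ^+ l.
have detP n : \det (P *m gram n *m P^T) = \det P ^+ 2 * \det (gram n).
  by rewrite !det_mulmx det_tr expr2 mulrAC.
have detP0 : 0 < \det P ^+ 2.
  by rewrite lt_def sqr_ge0 andbT expf_neq0 // -unitfE -unitmxE.
have [] := @det_le R d (P *m gram a *m P^T) (P *m gram c *m P^T) e (sP a) (sP c).
- move=> v v0; rewrite qP; apply: qform_gram_pos; first by apply: pB; clear; lia.
  by apply: contra_neq v0 => vP; rewrite -(mulmxK uP v) vP mul0mx.
- by move=> k; rewrite /e; case: ifP => // _; rewrite exprn_ge0 // ltW.
- move=> k v v0; rewrite !qP /e; case: ifP => km; first by rewrite mul1r qform_gram_le.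
  have {}v0 : v *m P *m L = 0.
    by apply: PL => s sm; apply: v0; apply: leq_trans sm _; rewrite leqNgt km.
  rewrite !qform_gram /a /c; rewrite (_ : (i + 4 * l = i + 3 * l + l)%N); last by clear; lia.
  apply: chain => // x xX.
  have ix : (index x X < m)%N by rewrite index_mem.
  have := congr1 (fun A : 'rV[R]_m => A 0 (Ordinal ix)) v0; rewrite mxE [in RHS]mxE; apply: etrans.
  rewrite /comb exchange_big /=; apply: eq_bigr => s _.
  by rewrite -mulr_sumr [L _ _]mxE nth_index.
move=> _; rewrite !detP mulrCA ler_pM2l // => hdet.
have prod_e : \prod_(k < d) e k = theta ^+ (l * (d - m)).
  rewrite exprM -(subnKC (ltnW md)) big_split_ord /= big1 ?mul1r => [|k _]; last first.
    by rewrite /e ltn_ord.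
  rewrite (eq_bigr (fun=> theta ^+ l)) => [|k _]; last by rewrite /e ltnNge leq_addr.
  by rewrite prodr_const card_ord addKn.
rewrite prod_e in hdet.
have lna : ln (\det (gram a)) <= - (20 * beta) * (l * (d - m))%:R + ln (\det (gram c)).
  have -> : - (20 * beta) * (l * (d - m))%:R = ln (theta ^+ (l * (d - m))).
    by rewrite lnXn // expRK mulr_natr.
  have gc0 : 0 < \det (gram c) by apply: g0; clear; lia.
  rewrite -lnM ?posrE ?exprn_gt0 // ler_ln ?posrE ?mulr_gt0 ?exprn_gt0 //.
  by apply: g0; clear; lia.
have E n : ln (\det (gram (8 ^ n))) = g n * d%:R by rewrite /g mulfVK // gt_eqF.
have := g_le i (i + 3 * l)%N (leqnn _) (leq_addr _ _).
move: lna; rewrite /a /c !E natrM (natrB _ (ltnW md)) -/m => lna ga.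
have {}ga : g i * d%:R <= g (i + 3 * l)%N * d%:R by rewrite ler_pM2r.
have hg' : g (i + 4 * l)%N * d%:R <= (g i + 2 * beta * (4 * l)%:R) * d%:R.
  by rewrite ler_pM2r // -lerBlDl.
have lR : 0 < l%:R :> R by rewrite ltr0n; clear -l2; lia.
have key : 0 <= beta * l%:R * (8 * d%:R - 20 * (d%:R - m%:R)).
  move: hg' lna ga; rewrite natrM; clear.
  move: (g _) (g _) (g _) (d%:R) (m%:R) (l%:R) (beta) => g1 g2 g3 x1 x2 x3 x4 h1 h2 h3.
  have : g2 * x1 <= - (20 * x4) * (x3 * (x1 - x2)) + (g2 + 2 * x4 * (4 * x3)) * x1.
    by apply: le_trans h3 (le_trans h2 _); rewrite lerD2l.
  by rewrite -subr_ge0; congr (0 <= _); ring.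
rewrite pmulr_rge0 in key; last by rewrite mulr_gt0.
have M0 : 0 <= M := expR_ge0 _.
have m0 : 0 <= m%:R :> R by [].
exact: (dim_arith key Xsize M0 m0).
Qed.

End Basis.

Theorem harmonic_fin_dim (D : nat) : (forall x, sgen T x) -> poly_growth T D ->
  exists d0 : nat, forall (d : nat) (u : 'I_d -> G -> R) (p : 'I_d -> G),
    (forall i, [/\ harmonic T (u i), u i 1%g = 0 & exists c, lipschitz c (u i)]) ->
    \det (\matrix_(i, j) u i (p j)) != 0 -> (d <= d0)%N.
Proof.
move=> genT [C CD]; pose beta : R := (2 * D + 2)%:R * ln 8.
pose c := expR (4 * beta) ^+ 2 * (size T)%:R * expR (20 * beta) + 64 ^+ 2.
have x64 : 1 < 64 :> R by rewrite ltr1n.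
have [l] := exp_beats_poly c 0 x64.
rewrite expr0 mulr1 => hl; pose M := 2 * expR (2 * beta * (4 * l)%:R).
exists (Num.truncn M).+1 => d u p hu det0.
have [->//|d0] := posnP d.
have [L LP] : exists L : R, 1 <= L /\ forall i, lipschitz L (u i).
  have [L LP] := choice (fun i => let: And3 _ _ h := hu i in h).
  exists (1 + \sum_i `|L i|); split=> [|i x t tT].
    by rewrite lerDl; apply: sumr_ge0.
  apply: le_trans (LP i x t tT) _; rewrite (bigD1 i) //= addrCA.
  by apply: le_trans (ler_norm _) _; rewrite lerDl addr_ge0 // sumr_ge0.
have [L1 L2] := LP.
have : d%:R <= M.
  apply: (@dim_le d u p L d0 _ _ L2 L1 det0 genT C D CD l hl).
    by move=> i; case: (hu i).
  by move=> i; case: (hu i).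
move=> dM; rewrite -(ler_nat R); apply: le_trans dM _.
by apply: ltW; rewrite truncnS_gt.
Qed.

End FiniteDimension.

(** * Abelian groups and lower central series *)

Section FinitelyGeneratedAbelian.
Variable A : zmodType.
Local Open Scope ring_scope.
Implicit Types (s X : seq A) (c : nat -> int).

Definition icomb s c : A := \sum_(i < size s) s`_i *~ c i.
Definition indep s := forall c, icomb s c = 0 -> forall i, (i < size s)%N -> c i = 0.
Definition ispan s : set A := [set a | exists c, a = icomb s c].

Lemma icombD s c c' : icomb s (fun i => c i + c' i) = icomb s c + icomb s c'.
Proof. by rewrite /icomb -big_split; apply: eq_bigr => i _; rewrite mulrzDr. Qed.

Lemma icombZ s c n : icomb s (fun i => c i * n) = icomb s c *~ n.
Proof. by rewrite /icomb mulrz_suml; apply: eq_bigr => i _; rewrite mulrzA. Qed.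

Lemma icombB s c c' : icomb s (fun i => c i - c' i) = icomb s c - icomb s c'.
Proof. by rewrite /icomb -sumrB; apply: eq_bigr => i _; rewrite mulrzBr. Qed.

Lemma icomb_rcons s x c : icomb (rcons s x) c = icomb s c + x *~ c (size s).
Proof.
rewrite /icomb size_rcons big_ord_recr /= nth_rcons ltnn eqxx; congr (_ + _).
by apply: eq_bigr => i _; rewrite nth_rcons ltn_ord.
Qed.

Lemma ispan0 s : ispan s 0.
Proof. by exists (fun=> 0); rewrite /icomb big1 // => i _; rewrite mulr0z. Qed.

Lemma ispanD s x y : ispan s x -> ispan s y -> ispan s (x + y).
Proof. by move=> [c ->] [c' ->]; eexists; rewrite -icombD. Qed.

Lemma ispanZ s x n : ispan s x -> ispan s (x *~ n).
Proof. by move=> [c ->]; eexists; rewrite -icombZ. Qed.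

Lemma ispan_mem s x : x \in s -> ispan s x.
Proof.
move=> xs; exists (fun i => (i == index x s)%:Z); rewrite /icomb.
rewrite -index_mem in xs; rewrite (bigD1 (Ordinal xs)) //= eqxx mulr1z nth_index ?big1 ?addr0 //.
  by move=> i; rewrite -val_eqE /= => /negbTE ->; rewrite mulr0z.
by rewrite -index_mem.
Qed.

Lemma ispan_sub s t x : (forall y, y \in s -> ispan t y) -> ispan s x -> ispan t x.
Proof.
move=> st [c ->]; rewrite /icomb; elim/big_ind: _ => [||i _]; first exact: ispan0.
  exact: ispanD.
by apply/ispanZ/st/mem_nth.
Qed.

(** A dependent [x] has a nonzero multiple in the span of [Y], its coefficient in the relation being
    nonzero since [Y] is independent; [e] is the product of the absolute values of these
    coefficients. *)
Lemma max_indep (Y X : seq A) : indep Y -> exists Z e,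
  [/\ {subset Z <= X}, indep (Y ++ Z), (0 < e)%N &
      forall x, x \in X -> ispan (Y ++ Z) (x *+ e)].
Proof.
elim: X Y => [|x X IHX] Y iY; first by exists [::], 1%N; rewrite cats0; split.
have [ix|nix] := pselect (indep (rcons Y x)).
  have [Z [e [ZX iZ e0 eP]]] := IHX _ ix; rewrite cat_rcons in iZ eP.
  exists (x :: Z), e; split=> // y; rewrite inE => /orP [/eqP ->|].
  - exact: mem_head.
  - by move=> /ZX yX; rewrite inE yX orbT.
  - rewrite pmulrn; apply: ispanZ; apply: ispan_mem.
    by rewrite mem_cat mem_head orbT.
  - exact: eP.
have [Z [e [ZX iZ e0 eP]]] := IHX _ iY.
have [c [c0 [i [iY' ci]]]] : exists c, icomb (rcons Y x) c = 0 /\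
    exists i, (i < (size Y).+1)%N /\ c i != 0.
  apply: contrapT => h; apply: nix => c c0 i; rewrite size_rcons => iY'.
  by apply/eqP; apply: contrapT => /negP ci; apply: h; exists c; split=> //; exists i.
rewrite icomb_rcons in c0.
have cY : c (size Y) != 0.
  apply: contraNneq ci => cY; move: c0; rewrite cY mulr0z addr0 => /iY h.
  by move: iY'; rewrite ltnS leq_eqVlt => /orP [/eqP ->|/h ->]; rewrite ?cY.
exists Z, (e * `|c (size Y)|)%N; split=> //.
- by move=> y /ZX yX; rewrite inE yX orbT.
- by rewrite muln_gt0 e0 absz_gt0.
move=> y; rewrite inE => /orP [/eqP ->|/eP h]; last first.
  by rewrite mulrnA [_ *+ `|_|]pmulrn; apply: ispanZ.
have sx : ispan (Y ++ Z) (x *~ c (size Y)).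
  have -> : x *~ c (size Y) = icomb Y c *~ (-1).
    by apply/eqP; rewrite mulrNz mulr1z -addr_eq0 addrC c0.
  apply: ispanZ; apply: (ispan_sub (s := Y)); last by exists c.
  by move=> z zY; apply: ispan_mem; rewrite mem_cat zY.
rewrite mulnC mulrnA [_ *+ e]pmulrn; apply: ispanZ.
rewrite pmulrn abszE; case: (ger0P (c (size Y))) => _ //.
by rewrite mulrNz -mulrN1z; apply: ispanZ.
Qed.

Lemma indep_inj s c c' : indep s -> icomb s c = icomb s c' ->
  forall i, (i < size s)%N -> c i = c' i.
Proof.
move=> is_ E i si; apply/eqP; rewrite -subr_eq0; apply/eqP.
by apply: (is_ (fun i => c i - c' i)) => //; rewrite icombB E subrr.
Qed.

(** Extend [x] to a maximal independent family; [chi a] is the coordinate of [a *+ e] along [x]. It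
    is additive because coordinates are unique, and [chi x = e]. *)
Lemma hom_to_int X (x : A) : (forall a, ispan X a) -> (forall n, (0 < n)%N -> x *+ n != 0) ->
  exists chi : A -> int, (forall a b, chi (a + b) = chi a + chi b) /\ chi x != 0.
Proof.
move=> gX x0; have ix : indep [:: x].
  move=> c; rewrite /icomb big_ord1 /= => h [|i] //= _.
  apply/eqP; apply: contrapT => /negP c0; have := x0 `|c 0%N|%N; rewrite absz_gt0 => /(_ c0).
  rewrite pmulrn abszE; case: (ger0P (c 0%N)) => _; rewrite ?mulrNz h ?oppr0 eqxx //.
have [Z [e [_ iZ e0 eP]]] := max_indep X ix.
have ex a : exists c, a *+ e = icomb ([:: x] ++ Z) c.
  have [c ->] := gX a; suff : ispan ([:: x] ++ Z) (icomb X c *+ e) by [].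
  rewrite /icomb -sumrMnl; elim/big_ind: _ => [||i _]; first exact: ispan0.
    exact: ispanD.
  by rewrite pmulrn mulrzAC -pmulrn; apply/ispanZ/eP/mem_nth.
have [chi chiP] := choice ex; exists (fun a => chi a 0%N); split=> [a b|].
  apply: (indep_inj (s := [:: x] ++ Z) (c' := fun i => chi a i + chi b i)) => //.
  by rewrite icombD -!chiP mulrnDl.
have : chi x 0%N = e%:Z.
  have E : icomb ([:: x] ++ Z) (chi x) = icomb ([:: x] ++ Z) (fun i => (i == 0%N)%:Z * e%:Z).
    rewrite icombZ -chiP pmulrn /icomb big_ord_recl /= mulr1z big1 ?addr0 // => i _.
  by have := indep_inj iZ E (i := 0%N) isT; rewrite /= mul1r.
by move=> ->; case: e e0 {ex chi chiP eP}.
Qed.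

End FinitelyGeneratedAbelian.

Section AbelianQuotient.
Variables (G : groupType) (A B : set G).
Hypotheses (sA : subgroup A) (sB : subgroup B) (BA : B `<=` A).
Hypothesis AB : forall x y, A x -> A y -> B [~ x, y]%g.
Local Open Scope group_scope.
Local Open Scope quotient_scope.

Definition abq_pre := {x : G | `[< A x >]}.
HB.instance Definition _ := Choice.on abq_pre.

Let AP (u : abq_pre) : A (val u).
Proof. exact: (asboolW (valP u)). Qed.

Definition abq_mk (x : G) (Ax : A x) : abq_pre := exist _ x (asboolT Ax).

Definition abq_rel (u v : abq_pre) : bool := `[< B ((val u)^-1 * val v) >].

Lemma abq_refl : reflexive abq_rel.
Proof. by move=> u; apply/asboolP; rewrite mulVg; case: sB. Qed.
Lemma abq_sym : symmetric abq_rel.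
Proof.
by move=> u v; apply/asboolP/asboolP => /(subgroupV sB); rewrite invgM invgK.
Qed.
Lemma abq_trans : transitive abq_rel.
Proof.
move=> v u w /asboolP uv /asboolP vw; apply/asboolP.
by have := subgroupM sB uv vw; rewrite mulgA mulgK.
Qed.

Canonical abq_equiv := EquivRel abq_rel abq_refl abq_sym abq_trans.
Definition abq := {eq_quot abq_rel}.
HB.instance Definition _ : EqQuotient _ abq_rel abq := EqQuotient.on abq.
HB.instance Definition _ := Choice.on abq.

(** Total on [G]: elements outside [A] go to the class of 1, so its laws are stated for elements of
    [A]. *)
Definition abq_pi (x : G) : abq := \pi_abq (insubd (abq_mk (subgroup1 sA)) x).

Lemma abq_piE x y : A x -> A y -> abq_pi x = abq_pi y <-> B (x^-1 * y).
Proof.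
move=> Ax Ay; rewrite /abq_pi; split=> [/eqmodP/asboolP|h].
  by rewrite !val_insubd !asboolT.
by apply/eqmodP/asboolP; rewrite !val_insubd !asboolT.
Qed.

Lemma abq_surj (q : abq) : exists2 x, A x & q = abq_pi x.
Proof.
exists (val (repr q)); first exact: AP.
by rewrite /abq_pi valKd -[LHS]reprK.
Qed.

Let rp (q : abq) : G := val (repr q).
Let rpA q : A (rp q). Proof. exact: AP. Qed.
Let rpK q : abq_pi (rp q) = q. Proof. by rewrite /abq_pi valKd reprK. Qed.

Definition abq_add (q r : abq) := abq_pi (rp q * rp r).
Definition abq_opp (q : abq) := abq_pi (rp q)^-1.

Let BJ x y : B x -> A y -> B (x ^ y).
Proof.
move=> Bx Ay; have -> : x ^ y = x * [~ x, y] by rewrite /commg mulVKg.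
by apply: subgroupM => //; apply: AB => //; apply: BA.
Qed.

Lemma abq_addE x y : A x -> A y -> abq_add (abq_pi x) (abq_pi y) = abq_pi (x * y).
Proof.
move=> Ax Ay; apply/abq_piE; try exact: subgroupM.
have /abq_piE h1 : abq_pi (rp (abq_pi x)) = abq_pi x by rewrite rpK.
have /abq_piE h2 : abq_pi (rp (abq_pi y)) = abq_pi y by rewrite rpK.
rewrite invgM; have -> : (rp (abq_pi y))^-1 * (rp (abq_pi x))^-1 * (x * y) =
    ((rp (abq_pi x))^-1 * x) ^ rp (abq_pi y) * ((rp (abq_pi y))^-1 * y).
  by rewrite /conjg !mulgA mulgK.
by apply: subgroupM; [|apply: BJ; [apply: h1|]|apply: h2].
Qed.

Lemma abq_oppE x : A x -> abq_opp (abq_pi x) = abq_pi x^-1.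
Proof.
move=> Ax; apply/abq_piE; try exact: subgroupV.
have /abq_piE h1 : abq_pi (rp (abq_pi x)) = abq_pi x by rewrite rpK.
rewrite invgK; have -> : rp (abq_pi x) * x^-1 = ((rp (abq_pi x))^-1 * x)^-1 ^ x^-1.
  by rewrite /conjg invgM !invgK !mulgA mulgV mul1g.
by apply: BJ; [apply: subgroupV => //; apply: h1|apply: subgroupV].
Qed.

Let abqP (P : abq -> Prop) : (forall x, A x -> P (abq_pi x)) -> forall q, P q.
Proof. by move=> h q; have [x Ax ->] := abq_surj q; apply: h. Qed.

Lemma abq_addA : associative abq_add.
Proof.
elim/abqP=> x Ax; elim/abqP=> y Ay; elim/abqP=> z Az.
by rewrite !abq_addE ?mulgA //; apply: subgroupM.
Qed.

Lemma abq_addC : commutative abq_add.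
Proof.
elim/abqP=> x Ax; elim/abqP=> y Ay; rewrite !abq_addE //.
apply/abq_piE; try exact: subgroupM.
have -> : (x * y)^-1 * (y * x) = [~ y, x] by rewrite /commg /conjg invgM !mulgA.
exact: AB.
Qed.

Lemma abq_add0 : left_id (abq_pi 1) abq_add.
Proof. by elim/abqP=> x Ax; rewrite abq_addE ?mul1g //; apply: subgroup1. Qed.

Lemma abq_addN : left_inverse (abq_pi 1) abq_opp abq_add.
Proof.
elim/abqP=> x Ax; rewrite abq_oppE // abq_addE ?mulVg //; exact: subgroupV.
Qed.

HB.instance Definition _ :=
  GRing.isZmodule.Build abq abq_addA abq_addC abq_add0 abq_addN.

Lemma abelian_quotient : exists (Q : zmodType) (pi : G -> Q),
  [/\ forall x y, A x -> A y -> pi (x * y) = (pi x + pi y)%R,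
      forall x, A x -> pi x = 0%R <-> B x & forall q, exists2 x, A x & pi x = q].
Proof.
exists abq, abq_pi; split=> [x y Ax Ay|x Ax|q].
- by rewrite -abq_addE.
- have -> : (0 = abq_pi 1)%R by [].
  rewrite abq_piE //; last exact: subgroup1.
  by rewrite mulg1 subgroupVE.
by have [x Ax ->] := abq_surj q; exists x.
Qed.

End AbelianQuotient.

(** * Lower central series relative to a normal subgroup *)

Section LowerCentralSeries.
Variable G : groupType.
Local Open Scope group_scope.
Implicit Types (x y z : G) (A : set G).

Definition sgp A : set G := [set x | forall H, subgroup H -> A `<=` H -> H x].

Lemma sgp_subgroup A : subgroup (sgp A).
Proof.
split=> [H sH _|x y Ax Ay H sH AH|x Ax H sH AH]; first exact: subgroup1.
  by apply: subgroupM => //; [apply: Ax|apply: Ay].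
by apply: subgroupV => //; apply: Ax.
Qed.

Lemma sub_sgp A : A `<=` sgp A. Proof. by move=> x Ax H _; apply. Qed.

Lemma sgp_min A H : subgroup H -> A `<=` H -> sgp A `<=` H.
Proof. by move=> sH AH x; apply. Qed.

(* left-normed commutators of [i.+1] generators *)
Fixpoint lcl (T : seq G) i :=
  if i is j.+1 then [seq [~ x, t] | x <- lcl T j, t <- T] else T.

(** For [Z] normal in [sgen T], this is the preimage of the [i]-th term, counted from 0, of the
    lower central series of the quotient by [Z]. With the commutators of all larger weights among
    the generators, the series is decreasing by construction and normality is a check on
    generators. *)
Definition lcs T (Z : set G) i : set G :=
  sgp ([set x | exists2 j, (i <= j)%N & x \in lcl T j] `|` Z).

Variables (T : seq G) (Z : set G).
Hypotheses (sT : symm T) (sZ : subgroup Z) (ZT : Z `<=` sgen T).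
Hypothesis ZJ : forall z t, Z z -> t \in T -> Z (z ^ t).
Local Notation D := (lcs T Z).
Local Notation Gm := (sgen T).

Lemma lcs_subgroup i : subgroup (D i). Proof. exact: sgp_subgroup. Qed.

Lemma lcs_lcl i j x : (i <= j)%N -> x \in lcl T j -> D i x.
Proof. by move=> ij xl; apply: sub_sgp; left; exists j. Qed.

Lemma lcs_sub i : Z `<=` D i. Proof. by move=> z Zz; apply: sub_sgp; right. Qed.

Lemma lcs_min i A : subgroup A -> (forall j x, (i <= j)%N -> x \in lcl T j -> A x) ->
  Z `<=` A -> D i `<=` A.
Proof. by move=> sA lA ZA; apply: sgp_min => // x [[j ij xl]|/ZA//]; apply: lA ij xl. Qed.

Lemma lcs_le i j : (i <= j)%N -> D j `<=` D i.
Proof.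
move=> ij; apply: lcs_min (@lcs_sub i) => [|l x jl]; first exact: lcs_subgroup.
by apply: lcs_lcl; apply: leq_trans jl.
Qed.

Lemma lcl_sgen j x : x \in lcl T j -> Gm x.
Proof.
elim: j x => [|j IHj] x; first exact: sgen_gen.
move=> /allpairsP [[y t] [/IHj /= yG tT ->]].
by apply: (subgroupR (sgen_subgroup sT)) => //; apply: sgen_gen.
Qed.

Lemma lcs0 : D 0 = Gm.
Proof.
apply/seteqP; split.
  by apply: lcs_min => //; [apply: sgen_subgroup|move=> j x _; apply: lcl_sgen].
apply: sgen_min; first exact: lcs_subgroup.
by move=> t tT; apply: (lcs_lcl (j := 0)).
Qed.

Lemma lcs_sgen i : D i `<=` Gm.
Proof. by rewrite -lcs0; apply: lcs_le. Qed.

Lemma conjR x y : x ^ y = x * [~ x, y]. Proof. by rewrite /commg mulVKg. Qed.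

Lemma commMl x y z : [~ x * y, z] = [~ x, z] ^ y * [~ y, z].
Proof. by rewrite /commg /conjg !invgM !mulgA; rewrite !(mulgK, mulgVK). Qed.

Lemma commMr x y z : [~ x, y * z] = [~ x, z] * [~ x, y] ^ z.
Proof. by rewrite /commg /conjg !invgM !mulgA; rewrite !(mulgK, mulgVK). Qed.

Lemma commVl x y : [~ x^-1, y] = ([~ x, y] ^ x^-1)^-1.
Proof. by rewrite /commg /conjg !invgM !invgK !mulgA; rewrite !(mulgK, mulgVK). Qed.

Lemma commVr x y : [~ x, y^-1] = ([~ x, y] ^ y^-1)^-1.
Proof. by rewrite /commg /conjg !invgM !invgK !mulgA mulgV mul1g. Qed.

Lemma lcsJt i x t : D i x -> t \in T -> D i (x ^ t).
Proof.
move=> Dx tT; pose A := [set x | D i (x ^ t)].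
suff : D i `<=` A by apply.
apply: lcs_min => [|j y ij yl|z Zz].
- split=> [|y z|y]; rewrite /A /=; first by rewrite conj1g; apply: subgroup1 (lcs_subgroup i).
    by rewrite conjMg; apply: subgroupM (lcs_subgroup i).
  by rewrite conjVg; apply: subgroupV (lcs_subgroup i).
- rewrite /A /= conjR; apply: (subgroupM (lcs_subgroup i)); first exact: lcs_lcl yl.
  apply: (lcs_lcl (j := j.+1)); first exact: leqW.
  by apply/allpairsP; exists (y, t).
by apply: lcs_sub; apply: ZJ.
Qed.

Lemma lcsJ i x y : D i x -> Gm y -> D i (x ^ y).
Proof.
move=> Dx [n]; elim: n y => [|n IHn] y; first by rewrite inE => /eqP ->; rewrite conjg1.
by move=> /ballSP [z [t [/IHn zB tT ->]]]; rewrite conjgM; apply: lcsJt.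
Qed.

Lemma ZJs z y : Z z -> Gm y -> Z (z ^ y).
Proof.
move=> Zz [n]; elim: n y => [|n IHn] y; first by rewrite inE => /eqP ->; rewrite conjg1.
by move=> /ballSP [w [t [/IHn wB tT ->]]]; rewrite conjgM; apply: ZJ.
Qed.

Let GmV y : Gm y -> Gm y^-1. Proof. exact: subgroupV (sgen_subgroup sT). Qed.

Lemma lcsRt i x t : D i x -> t \in T -> D i.+1 [~ x, t].
Proof.
move=> Dx tT; pose A := [set x | Gm x /\ D i.+1 [~ x, t]].
suff : D i `<=` A by move=> /(_ x Dx) [].
have sD := lcs_subgroup i.+1.
apply: lcs_min => [|j y ij yl|z Zz].
- split=> [|y z [Gy Dy] [Gz Dz]|y [Gy Dy]]; rewrite /A /=.
  + by rewrite comm1g; split; [apply: (subgroup1 (sgen_subgroup sT))|apply: (subgroup1 sD)].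
  + split; first by apply: (subgroupM (sgen_subgroup sT)).
    by rewrite commMl; apply: (subgroupM sD) => //; apply: lcsJ.
  + split; first exact: GmV.
    by rewrite commVl; apply: (subgroupV sD) => //; apply: lcsJ => //; apply: GmV.
- split; first exact: lcl_sgen yl.
  apply: (lcs_lcl (j := j.+1)); first by [].
  by apply/allpairsP; exists (y, t).
split; first exact: ZT; apply: lcs_sub; rewrite /commg.
by apply: (subgroupM sZ); [apply: (subgroupV sZ)|apply: ZJ].
Qed.

Lemma lcsRG i x y : D i x -> Gm y -> D i.+1 [~ x, y].
Proof.
have sD := lcs_subgroup i.+1.
move=> Dx [n]; elim: n y => [|n IHn] y.
  by rewrite inE => /eqP ->; rewrite commg1; apply: (subgroup1 sD).
move=> /ballSP [z [t [/IHn zB tT ->]]]; rewrite commMr; apply: (subgroupM sD) => //.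
  exact: lcsRt.
exact: lcsJt.
Qed.

Lemma Hall_Witt x y z :
  [~ [~ x, y^-1], z] ^ y * [~ [~ y, z^-1], x] ^ z * [~ [~ z, x^-1], y] ^ x = 1.
Proof.
by rewrite /commg /conjg !invgM !invgK !mulgA; rewrite !(mulgK, mulgVK) mulVg.
Qed.

(** The three subgroups argument, by induction on [j]: for a generator [[c, t]] of the second
    factor, Hall-Witt expresses a conjugate of [[[c, t], x]] through [[[x, c^-1], t^-1]] and
    [[[t^-1, x^-1], c]], and the induction hypothesis applies to both. *)
Lemma lcsR i j x y : D i x -> D j y -> D (i + j).+1 [~ x, y].
Proof.
elim: j i x y => [|j IHj] i x y Dx; first by rewrite lcs0 addn0; apply: lcsRG.
move=> Dy; pose A := [set y | Gm y /\ D (i + j.+1).+1 [~ x, y]].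
suff : D j.+1 `<=` A by move=> /(_ y Dy) [].
have sD := lcs_subgroup (i + j.+1).+1; have sG := sgen_subgroup sT.
apply: lcs_min => [|l w jl wl|z Zz].
- split=> [|v w [Gv Dv] [Gw Dw]|v [Gv Dv]]; rewrite /A /=.
  + by rewrite commg1; split; [apply: (subgroup1 sG)|apply: (subgroup1 sD)].
  + rewrite commMr; split; first exact: (subgroupM sG).
    by apply: (subgroupM sD) => //; apply: lcsJ.
  + rewrite commVr; split; first exact: GmV.
    by apply: (subgroupV sD); apply: lcsJ => //; apply: GmV.
- split; first exact: lcl_sgen wl.
  case: l jl wl => // l jl /allpairsP [[c t] [/= cl tT ->]].
  have Dc : D j c by apply: lcs_lcl cl.
  have Gx := lcs_sgen Dx; have Gc := lcs_sgen Dc; have Gt := sgen_gen tT.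
  rewrite -invgR; apply: (subgroupV sD).
  have := Hall_Witt x c t^-1; rewrite invgK.
  set a := [~ _, t^-1] ^ c; set b := _ ^ t^-1; set d := _ ^ x => E.
  have Da : D (i + j.+1).+1 a.
    apply: lcsJ => //; rewrite addnS; apply: lcsRG; last exact: GmV.
    by apply: IHj => //; apply: (subgroupV (lcs_subgroup j)).
  have Dd : D (i + j.+1).+1 d.
    apply: lcsJ => //; rewrite addnS -addSn; apply: IHj => //.
    rewrite -invgR; apply: (subgroupV (lcs_subgroup _)).
    by apply: lcsRG; [apply: (subgroupV (lcs_subgroup _))|apply: GmV].
  have Db : D (i + j.+1).+1 b.
    have -> : b = a^-1 * d^-1.
      by apply: (mulgI a); apply: (mulIg d); rewrite mulVKg -mulgA mulVg mulgA E.
    by apply: (subgroupM sD); apply: (subgroupV sD).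
  have -> : [~ [~ c, t], x] = b ^ t by rewrite /b -conjgM mulVg conjg1.
  exact: lcsJ.
split; first exact: ZT.
apply: lcs_sub; rewrite -invgR; apply: (subgroupV sZ); rewrite /commg.
apply: (subgroupM sZ); first exact: (subgroupV sZ).
by apply: ZJs => //; apply: lcs_sgen Dx.
Qed.

Lemma lcs_gen i A : subgroup A -> D i.+1 `<=` A -> (forall x, x \in lcl T i -> A x) ->
  D i `<=` A.
Proof.
move=> sA DA lA; apply: lcs_min => // [j x|z Zz]; last exact: (DA _ (@lcs_sub i.+1 z Zz)).
by rewrite leq_eqVlt => /orP [/eqP <-|ij xl]; [apply: lA|apply: DA; apply: lcs_lcl xl].
Qed.

Lemma lcs_eq i : (forall x, x \in lcl T i -> Z x) -> D i = Z.
Proof.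
move=> lZ; apply/seteqP; split; last exact: lcs_sub.
have h j x : (i <= j)%N -> x \in lcl T j -> Z x.
  move=> /subnKC <-; elim: (j - i)%N x => [|l IHl] x; first by rewrite addn0; apply: lZ.
  rewrite addnS => /allpairsP [[y t] [/IHl /= Zy tT ->]].
  by rewrite /commg; apply: (subgroupM sZ); [apply: (subgroupV sZ)|apply: ZJ].
exact: lcs_min.
Qed.

(** The layer is abelian by [lcsR], and it is generated by the commutators of weight exactly
    [i + 1], since all other generators of [D i] lie in [D i.+1]. *)
Lemma lcs_quotient i : exists (Q : zmodType) (pi : G -> Q),
  [/\ forall x y, D i x -> D i y -> pi (x * y) = (pi x + pi y)%R,
      forall x, D i x -> pi x = 0%R <-> D i.+1 x,
      forall q, exists2 x, D i x & pi x = q &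
      forall q, ispan [seq pi x | x <- lcl T i] q].
Proof.
have [|Q [pi [piM pi0 piS]]] :=
    abelian_quotient (lcs_subgroup i) (lcs_subgroup i.+1) (lcs_le (leqnSn i)).
  by move=> x y Dx Dy; apply: (lcs_le _ (lcsR Dx Dy)); rewrite ltnS leq_addr.
exists Q, pi; split=> // q; have [x Dx <-] := piS q.
have sD := lcs_subgroup i.
have pi1 : pi 1 = 0%R by apply/pi0; [apply: (subgroup1 sD)|apply: (subgroup1 (lcs_subgroup _))].
pose A := [set x | D i x /\ ispan [seq pi x | x <- lcl T i] (pi x)].
suff : D i `<=` A by move=> /(_ x Dx) [].
apply: lcs_gen => [|y Dy|y yl].
- split=> [|y z [Dy sy] [Dz sz]|y [Dy sy]]; rewrite /A /=.
  + by split; [apply: (subgroup1 sD)|rewrite pi1; apply: ispan0].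
  + by split; [apply: (subgroupM sD)|rewrite piM //; apply: ispanD].
  + split; first exact: (subgroupV sD).
    have -> : pi y^-1 = (pi y *~ (-1))%R; last exact: ispanZ.
    apply/eqP; rewrite mulrNz mulr1z -GRing.addr_eq0 -piM //; last exact: (subgroupV sD).
    by rewrite mulVg pi1.
- have Dy' : D i y by apply: lcs_le Dy.
  by split=> //; have /pi0 -> := Dy; last exact: Dy'; apply: ispan0.
by split; [apply: lcs_lcl yl|apply: ispan_mem; rewrite map_f].
Qed.

End LowerCentralSeries.

Section NilpotentQuotients.
Variable G : groupType.
Local Open Scope group_scope.
Variables (T : seq G) (Z : set G).
Hypotheses (sT : symm T) (sZ : subgroup Z) (ZT : Z `<=` sgen T).
Hypothesis ZJ : forall z t, Z z -> t \in T -> Z (z ^ t).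
Local Notation D := (lcs T Z).
Local Notation Gm := (sgen T).

Let sD i : subgroup (D i). Proof. exact: lcs_subgroup. Qed.

(** Modulo [D i.+2], commutation with [t] is additive on powers of [y]: the correction [[[y^n, t],
    y]] already lies there. *)
Lemma lcs_commX i y t n : D i y -> Gm t -> D i.+2 ([~ y ^+ n, t]^-1 * [~ y, t] ^+ n).
Proof.
move=> Dy Gt; have [Q [pi [piM pi0 _ _]]] := lcs_quotient sT sZ ZT ZJ i.+1.
have Dc m : D i.+1 [~ y ^+ m, t] by apply: lcsRG => //; apply: (subgroupX _ (sD _)).
have Dn m : D i.+1 ([~ y, t] ^+ m) by apply: (subgroupX _ (sD _)) => //; have := Dc 1%N; rewrite expg1.
have pi1 : pi 1 = 0%R by apply/pi0; apply: (subgroup1 (sD _)).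
have E : pi [~ y ^+ n, t] = pi ([~ y, t] ^+ n).
  elim: n => [|n IHn]; first by rewrite !expg0 comm1g.
  rewrite expgSr commMl conjR // expgSr.
  have Dr : D i.+2 [~ [~ y ^+ n, t], y].
    by apply: lcsRG => //; apply: (lcs_sgen sT ZT) Dy.
  have Dr' : D i.+1 [~ [~ y ^+ n, t], y] by apply: lcs_le Dr.
  have Dyt := Dc 1%N; rewrite expg1 in Dyt.
  rewrite (piM _ _ (subgroupM (sD _) (Dc n) Dr') Dyt) (piM _ _ (Dc n) Dr').
  by rewrite (pi0 _ Dr').2 // addr0 IHn (piM _ _ (Dn n) Dyt).
apply/pi0; first by apply: (subgroupM (sD _)) => //; apply: (subgroupV (sD _)).
have DV : D i.+1 [~ y ^+ n, t]^-1 by apply: (subgroupV (sD _)).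
rewrite piM // -E -piM //; by rewrite mulVg.
Qed.

Lemma lcl_torsion : (forall t, t \in T -> exists2 e, (0 < e)%N & D 1 (t ^+ e)) ->
  forall i x, x \in lcl T i -> exists2 e, (0 < e)%N & D i.+1 (x ^+ e).
Proof.
move=> tor; elim=> [//|i IHi] x /allpairsP [[y t] [/= yl tT ->]].
have [e e0 De] := IHi y yl; exists e => //.
have Dy : D i y by apply: lcs_lcl yl.
have Gt := sgen_gen tT.
apply/(subgroupMl _ (x := [~ y ^+ e, t]^-1)); [exact: sD| |exact: lcs_commX].
by apply: (subgroupV (sD _)) => //; apply: lcsRG.
Qed.

Fixpoint exp_reps (E : nat) (s : seq G) : seq G :=
  if s is x :: s' then [seq x ^+ a * y | a <- iota 0 E, y <- exp_reps E s'] else [:: 1].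

Lemma fin_index_lcsS i :
    (forall x, x \in lcl T i -> exists2 e, (0 < e)%N & D i.+1 (x ^+ e)) ->
  fin_index (D i.+1) (D i).
Proof.
move=> tor; have [Q [pi [piM pi0 piS gQ]]] := lcs_quotient sT sZ ZT ZJ i.
have pi1 : pi 1 = 0%R by apply/pi0; apply: (subgroup1 (sD _)).
have piX x n : D i x -> pi (x ^+ n) = (pi x *+ n)%R.
  move=> Dx; elim: n => [|n IHn]; first by rewrite expg0 pi1.
  by rewrite expgS piM ?IHn ?mulrS //; apply: (subgroupX _ (sD _)).
have [E E0 tE] : exists2 E, (0 < E)%N & forall x, x \in lcl T i -> D i.+1 (x ^+ E).
  elim: (lcl T i) tor => [|x s IHs] tor; first by exists 1%N.
  have [E E0 EP] := IHs (fun y ys => tor y (mem_behead (s := x :: s) ys)).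
  have [e e0 De] := tor x (mem_head _ _); exists (E * e)%N; first by rewrite muln_gt0 E0.
  move=> y; rewrite inE => /orP [/eqP ->|/EP h]; last first.
    by rewrite expgnA; apply: (subgroupX _ (sD _)).
  by rewrite mulnC expgnA; apply: (subgroupX _ (sD _)).
have key (s : seq G) : {subset s <= lcl T i} -> forall q, ispan [seq pi x | x <- s] q ->
    exists y, [/\ y \in exp_reps E s, D i y & pi y = q].
  elim: s => [|x s IHs] sl q [c ->].
    by exists 1; rewrite inE /icomb big_ord0; split=> //; apply: (subgroup1 (sD _)).
  rewrite /icomb big_ord_recl /=.
  have [||y [ys Dy yE]] := IHs _ (icomb [seq pi x | x <- s] (fun j => c j.+1)).
  - by move=> z zs; apply: sl; rewrite inE zs orbT.
  - by exists (fun j => c j.+1).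
  have Dx : D i x by apply: lcs_lcl (sl x (mem_head _ _)).
  pose a := `|(c 0%N %% E%:Z)%Z|%N.
  have aE : (a < E)%N.
    by rewrite -ltz_nat /a gez0_abs ?modz_ge0 ?ltz_pmod //; rewrite -lt0n.
  have tx : (pi x *+ E = 0)%R.
    by rewrite -piX //; apply/pi0; [apply: (subgroupX _ (sD _))|apply: tE; apply: sl; rewrite mem_head].
  exists (x ^+ a * y); split.
  - by apply: allpairs_f => //; rewrite mem_iota.
  - by apply: (subgroupM (sD _)) => //; apply: (subgroupX _ (sD _)).
  rewrite piM ?piX //; last exact: (subgroupX _ (sD _)).
  rewrite yE /icomb; congr (_ + _)%R.
  rewrite [in RHS](divz_eq (c 0%N) E) mulrzDr mulrC mulrzA -pmulrn tx mul0rz add0r.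
  by rewrite pmulrn /a gez0_abs // modz_ge0 // -lt0n.
exists (exp_reps E (lcl T i)) => x Dx.
have [y [ys Dy yE]] := key _ (fun x h => h) _ (gQ (pi x)).
exists y => //; apply/pi0; first by apply: (subgroupM (sD _)) => //; apply: (subgroupV (sD _)).
have DV : D i y^-1 by apply: (subgroupV (sD _)).
by rewrite piM // -yE -piM // mulgV.
Qed.

(** A nilpotent group whose generators are torsion modulo commutators is finite: torsion spreads
    from each layer to the next by [lcs_commX], and a finitely generated torsion abelian group is
    finite. *)
Theorem nilpotent_torsion k : (forall x, x \in lcl T k -> Z x) ->
  (forall t, t \in T -> exists2 e, (0 < e)%N & D 1 (t ^+ e)) -> fin_index Z Gm.
Proof.
move=> kZ tor; rewrite -(lcs_eq sZ ZJ kZ) -(lcs0 sT ZT).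
elim: k {kZ} => [|k IHk]; first by exists [:: 1] => x Dx; exists 1; rewrite ?inE // invg1 mulg1.
apply: fin_index_trans IHk; [exact: sD|exact: sD|by apply: lcs_le|].
by apply: fin_index_lcsS; apply: lcl_torsion.
Qed.

Lemma abelianization_hom t : t \in T -> (forall e, (0 < e)%N -> ~ D 1 (t ^+ e)) ->
  exists chi : G -> int, (forall x y, Gm x -> Gm y -> chi (x * y) = (chi x + chi y)%R) /\
    chi t != 0%R.
Proof.
move=> tT tor; have [Q [pi [piM pi0 piS gQ]]] := lcs_quotient sT sZ ZT ZJ 0.
rewrite (lcs0 sT ZT) in piM pi0 piS; have Gt := sgen_gen tT.
have sG := sgen_subgroup sT.
have pi1 : pi 1 = 0%R by apply/pi0; [apply: (subgroup1 sG)|apply: (subgroup1 (sD 1))].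
have piX n : pi (t ^+ n) = (pi t *+ n)%R.
  elim: n => [|n IHn]; first by rewrite expg0 pi1.
  by rewrite expgS piM ?IHn ?mulrS //; apply: (subgroupX _ sG).
have [|chi [chiD chi0]] := hom_to_int gQ (x := pi t).
  move=> n n0; apply/eqP; rewrite -piX => /pi0 h; apply: (tor n n0).
  by apply: h; apply: (subgroupX _ sG).
by exists (chi \o pi); split=> // x y Gx Gy /=; rewrite piM.
Qed.

End NilpotentQuotients.

(** * Relations forced by polynomial growth *)

Section Counting.
Variable G : groupType.
Local Open Scope group_scope.
Variables (S : seq G) (D : nat).
Hypotheses (sS : symm S) (pS : poly_growth S D).

(* [(4 ^ D.+1) ^ k] products of length [O(4 ^ k)] cannot all be distinct *)
Lemma chain_relation (c : nat) : exists k, forall h : nat -> G,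
  (forall i, h i \in ball S (c * 4 ^ i)) ->
  exists i a e e', [/\ (i < k)%N, (0 < a < 4 ^ D.+1)%N, forall j, (e j < 4 ^ D.+1)%N,
    forall j, (e' j < 4 ^ D.+1)%N &
    h i ^+ a * \prod_(i.+1 <= j < k) h j ^+ e j = \prod_(i.+1 <= j < k) h j ^+ e' j].
Proof.
(* All products lie in a ball of radius [C * c * 4^k], of size at most [k * (4^k)^D], while there
   are [4^k * (4^k)^D] exponent vectors. The choice of [k] absorbs the constants into the inequality
   [k < 4^k]. *)
have [A AP] := pS; pose C := (4 ^ D.+1)%N; pose k := (A * (C * c).+1 ^ D)%N.
have C0 : (0 < C)%N by rewrite expn_gt0.
exists k => h hB.
pose g (f : {ffun 'I_k -> 'I_C}) i := if insub i is Some j then val (f j) else 0%N.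
have gC f i : (g f i < C)%N by rewrite /g; case: insubP => [j _ _|_] //; apply: ltn_ord.
pose F f := \prod_(0 <= i < k) h i ^+ g f i.
have FB f : F f \in ball S (C * c * 4 ^ k).
  rewrite /F; elim: (k) => [|m IHm]; first by rewrite big_geq //; apply: ball_one.
  rewrite big_nat_recr //=.
  apply: (ball_le sS (m := (C * c * 4 ^ m + c * 4 ^ m * C.-1)%N)).
    have : (c * 4 ^ m * C.-1 <= C * c * 4 ^ m)%N.
      by rewrite [leqLHS]mulnC -[leqRHS]mulnA leq_mul2r leq_pred orbT.
    rewrite [in X in _ -> X]expnS [in X in _ -> X](mulnCA (C * c)%N).
    by move: (C * c * 4 ^ m)%N (c * 4 ^ m * C.-1)%N => a b; clear; lia.
  apply: ball_mul => //.
  apply: (ball_le sS (m := (c * 4 ^ m * g f m)%N)); last exact: ball_pow.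
  by rewrite leq_mul2l -ltnS prednK // gC orbT.
have [f [f' [ff' E]]] : exists f f', f != f' /\ F f = F f'.
  apply: contrapT => nE; have iF : injective F.
    by move=> f f' E; apply/eqP; apply: contrapT => /negP ff'; apply: nE; exists f, f'.
  have : (size [seq F f | f <- enum {: {ffun 'I_k -> 'I_C}}] <= size (ball S (C * c * 4 ^ k)))%N.
    apply: uniq_leq_size; first by rewrite map_inj_uniq ?enum_uniq.
    by move=> _ /mapP [f _ ->].
  rewrite size_map -cardE card_ffun !card_ord; apply/negP; rewrite -ltnNge.
  apply: leq_ltn_trans (AP _) _.
  apply: (@leq_ltn_trans (k * (4 ^ k) ^ D)%N).
    set p := (4 ^ k)%N; have p0 : (0 < p)%N by rewrite expn_gt0.
    rewrite [leqRHS](_ : _ = A * ((C * c).+1 * p) ^ D)%N; last by rewrite expnMn mulnA.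
    rewrite leq_mul2l; apply/orP; right; case: (D) => // D'.
    by rewrite leq_exp2r // mulSn addnC -addn1 leq_add2l.
  have -> : (C ^ k = 4 ^ k * (4 ^ k) ^ D)%N by rewrite /C expnS expnMn -!expnM mulnC [(D * k)%N]mulnC mulnC.
  move: (k) => m; rewrite ltn_pmul2r; last by rewrite expn_gt0 expn_gt0.
  exact: ltn_expl.
have exi : exists i, (i < k)%N && (g f i != g f' i).
  apply: contrapT => nE; case/negP: ff'; apply/eqP/ffunP => i; apply: val_inj.
  apply/eqP; apply: contrapT => /negP ne; apply: nE; exists i; rewrite ltn_ord /=.
  by rewrite /g valK.
(* At the first index with different exponents the common prefix cancels, and the smaller power is
   moved to the other side. *)
case: (ex_minnP exi) => i /andP [ik gi] imin.
have tail : h i ^+ g f i * \prod_(i.+1 <= j < k) h j ^+ g f j =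
            h i ^+ g f' i * \prod_(i.+1 <= j < k) h j ^+ g f' j.
  move: E; rewrite /F !(big_cat_nat (leq0n i) (ltnW ik)) /=.
  have -> : \prod_(0 <= j < i) h j ^+ g f j = \prod_(0 <= j < i) h j ^+ g f' j.
    apply: eq_big_nat => j /andP [_ ji]; congr (_ ^+ _); apply/eqP.
    apply: contrapT => /negP ne; have := imin j; rewrite ne andbT (ltn_trans ji ik).
    by move=> /(_ isT); rewrite leqNgt ji.
  by move=> /mulgI; rewrite !(big_ltn ik).
have go (f1 f2 : {ffun 'I_k -> 'I_C}) : (g f1 i < g f2 i)%N ->
    h i ^+ g f2 i * \prod_(i.+1 <= j < k) h j ^+ g f2 j =
    h i ^+ g f1 i * \prod_(i.+1 <= j < k) h j ^+ g f1 j ->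
    exists i a e e', [/\ (i < k)%N, (0 < a < C)%N, forall j, (e j < C)%N,
      forall j, (e' j < C)%N &
      h i ^+ a * \prod_(i.+1 <= j < k) h j ^+ e j = \prod_(i.+1 <= j < k) h j ^+ e' j].
  move=> lt E1; exists i, (g f2 i - g f1 i)%N, (g f2), (g f1); split=> //.
    by rewrite subn_gt0 lt (leq_ltn_trans (leq_subr _ _)).
  by apply: (mulgI (h i ^+ g f1 i)); rewrite mulgA -expgnDr subnKC ?(ltnW lt).
case: (ltngtP (g f i) (g f' i)) => [lt|lt|eq]; last by rewrite eq eqxx in gi.
  exact: (go f f' lt (esym tail)).
exact: (go f' f lt tail).
Qed.

End Counting.

Section SubgroupType.
Variables (G : groupType) (A : set G).
Hypothesis sA : subgroup A.
Local Open Scope group_scope.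

Definition sgt := {x : G | `[< A x >]}.
HB.instance Definition _ := Choice.on sgt.

Let AP (u : sgt) : A (val u). Proof. exact: (asboolW (valP u)). Qed.
Definition sgt_mk (x : G) (Ax : A x) : sgt := exist _ x (asboolT Ax).
Definition sgt_one := sgt_mk (subgroup1 sA).
Definition sgt_mul (u v : sgt) := sgt_mk (subgroupM sA (AP u) (AP v)).
Definition sgt_inv (u : sgt) := sgt_mk (subgroupV sA (AP u)).

Lemma sgt_mulA : associative sgt_mul.
Proof. by move=> u v w; apply: val_inj; rewrite /= mulgA. Qed.
Lemma sgt_mul1 : left_id sgt_one sgt_mul.
Proof. by move=> u; apply: val_inj; rewrite /= mul1g. Qed.
Lemma sgt_1mul : right_id sgt_one sgt_mul.
Proof. by move=> u; apply: val_inj; rewrite /= mulg1. Qed.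
Lemma sgt_mulV : left_inverse sgt_one sgt_inv sgt_mul.
Proof. by move=> u; apply: val_inj; rewrite /= mulVg. Qed.
Lemma sgt_Vmul : right_inverse sgt_one sgt_inv sgt_mul.
Proof. by move=> u; apply: val_inj; rewrite /= mulgV. Qed.

HB.instance Definition _ :=
  isGroup.Build sgt sgt_mulA sgt_mul1 sgt_1mul sgt_mulV sgt_Vmul.

Lemma subgroup_type : exists (K : groupType) (f : K -> G),
  [/\ injective f, forall x y, f (x * y) = f x * f y & forall x, A x <-> exists y, f y = x].
Proof.
exists sgt, val; split=> [|//|x]; first exact: val_inj.
by split=> [Ax|[u <-]]; [exists (sgt_mk Ax)|apply: AP].
Qed.

End SubgroupType.

Section Embedding.
Variables (K G : groupType) (f : K -> G).
Local Open Scope group_scope.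
Hypotheses (fi : injective f) (fM : forall x y, f (x * y) = f x * f y).

Lemma emb1 : f 1 = 1.
Proof. by apply: (mulgI (f 1)); rewrite -fM !mulg1. Qed.

Lemma embV x : f x^-1 = (f x)^-1.
Proof. by apply: (mulgI (f x)); rewrite -fM !mulgV emb1. Qed.

Lemma emb_ball S n : ball (map f S) n = map f (ball S n).
Proof.
elim: n => [|n IHn] /=; first by rewrite emb1.
rewrite IHn -undup_map_inj // map_allpairs allpairs_mapl allpairs_mapr; congr undup.
by apply: eq_allpairs => x t; rewrite fM.
Qed.

Lemma emb_symm S : symm S -> symm (map f S).
Proof.
move=> [S1 SV]; split; first by rewrite -emb1 map_f.
have -> : [seq x^-1 | x <- [seq f x | x <- S]] = [seq f x | x <- [seq x^-1 | x <- S]].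
  by rewrite -!map_comp; apply: eq_map => x; rewrite /= embV.
exact: perm_map.
Qed.

Lemma emb_sgen S x : sgen (map f S) (f x) <-> sgen S x.
Proof. by split=> -[n]; rewrite ?emb_ball ?mem_map // => h; exists n; rewrite // emb_ball mem_map. Qed.

Lemma emb_growth S D : poly_growth (map f S) D <-> poly_growth S D.
Proof. by split=> -[C CP]; exists C => n; have := CP n; rewrite emb_ball size_map. Qed.

Lemma emb_comm x y : f [~ x, y] = [~ f x, f y].
Proof. by rewrite /commg /conjg !fM !embV. Qed.

Lemma emb_lcl S i : lcl (map f S) i = map f (lcl S i).
Proof.
elim: i => //= i IHi; rewrite IHi map_allpairs allpairs_mapl allpairs_mapr.
by apply: eq_allpairs => x t; rewrite emb_comm.
Qed.

End Embedding.

(** * Groups of polynomial growth *)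

(* [delta g] is the operator norm of [g - 1] on harmonic Lipschitz functions
   modulo constants, with the Lipschitz seminorm. *)
Section Displacement.
Variables (R : realType) (G : groupType) (T : seq G).
Hypothesis sT : symm T.
Local Open Scope ring_scope.
Implicit Types (u w : G -> R) (g h x : G) (a b c L : R).
Local Notation lip := (lipschitz T).
Local Notation harm := (harmonic T).

Definition trans g u x : R := u (g * x)%g.
Definition displ g u x : R := u (g * x)%g - u x.
Definition dle g c := forall u L, harm u -> lip L u -> lip (c * L) (displ g u).

Lemma harmonic_trans g u : harm u -> harm (trans g u).
Proof.
by move=> hu x; rewrite /trans -[RHS](hu (g * x)%g); apply: eq_bigr => t _; rewrite mulgA.
Qed.

Lemma lipschitz_trans g u L : lip L u -> lip L (trans g u).
Proof. by move=> uL x t tT; rewrite /trans mulgA; apply: uL. Qed.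

Lemma harmonicB u w : harm u -> harm w -> harm (fun x => u x - w x).
Proof.
move=> hu hw x; transitivity (\sum_(t <- T) (u (x * t)%g - u x) -
    \sum_(t <- T) (w (x * t)%g - w x)); last by rewrite hu hw subrr.
by rewrite -sumrB; apply: eq_bigr => t _; ring.
Qed.

Lemma lipschitzD u w L L' : lip L u -> lip L' w -> lip (L + L') (fun x => u x + w x).
Proof.
move=> uL wL x t tT; rewrite opprD addrACA.
by apply: le_trans (ler_normD _ _) _; apply: lerD; [apply: uL|apply: wL].
Qed.

Lemma lipschitzZ c u L : lip L u -> lip (`|c| * L) (fun x => c * u x).
Proof. by move=> uL x t tT; rewrite -mulrBr normrM ler_wpM2l // uL. Qed.

Lemma lipschitz_ge0 L u : lip L u -> 0 <= L.
Proof. by move=> /(_ 1%g 1%g (symm1 sT)); apply: le_trans. Qed.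

Lemma lipschitz_le L L' u : L <= L' -> lip L u -> lip L' u.
Proof. by move=> LL uL x t tT; apply: le_trans LL; apply: uL. Qed.

Lemma lipschitz_sum (I : finType) (F : I -> G -> R) (Ls : I -> R) :
  (forall i, lip (Ls i) (F i)) -> lip (\sum_i Ls i) (fun x => \sum_i F i x).
Proof.
move=> FL x t tT; rewrite -sumrB; apply: le_trans (ler_norm_sum _ _ _) _.
by apply: ler_sum => i _; apply: FL.
Qed.

Lemma harmonic_displ g u : harm u -> harm (displ g u).
Proof. by move=> hu; apply: harmonicB => //; apply: harmonic_trans. Qed.

Lemma dle_le g a b : a <= b -> dle g a -> dle g b.
Proof.
move=> ab ga u L hu uL; apply: lipschitz_le (ga u L hu uL).
by rewrite ler_wpM2r // (lipschitz_ge0 uL).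
Qed.

Lemma dle1 : dle 1%g 0.
Proof. by move=> u L _ _ x t _; rewrite /displ !mul1g !subrr normr0 mul0r. Qed.

Lemma dle2 g : dle g 2.
Proof.
move=> u L hu uL; rewrite mulrDl mul1r; apply: lipschitzD; first exact: lipschitz_trans.
by have := lipschitzZ (-1) uL; rewrite normrN1 mul1r => h x t tT; have := h x t tT; rewrite !mulN1r.
Qed.

Lemma dleM g h a b : dle g a -> dle h b -> dle (g * h)%g (a + b).
Proof.
move=> ga hb u L hu uL; rewrite mulrDl.
have := lipschitzD (lipschitz_trans h (ga u L hu uL)) (hb u L hu uL).
move=> H x t tT; have := H x t tT; rewrite /trans /displ -!mulgA !addrA.
by rewrite !subrK !mulgA.
Qed.

Lemma dleV g a : dle g a -> dle g^-1%g a.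
Proof.
move=> ga u L hu uL; have := lipschitzZ (-1) (lipschitz_trans g^-1%g (ga u L hu uL)).
rewrite normrN1 mul1r => H x t tT; have := H x t tT.
by rewrite /trans /displ !mulN1r !opprB !mulVKg.
Qed.

Lemma dleJ g h a : dle g a -> dle (g ^ h)%g a.
Proof.
move=> ga u L hu uL.
have := lipschitz_trans h (ga _ L (harmonic_trans h^-1%g hu) (lipschitz_trans h^-1%g uL)).
move=> H x t tT; have := H x t tT.
by rewrite /trans /displ /conjg -!mulgA !mulKg.
Qed.

(** As operators, [[g, h] - 1] is up to a translation the commutator of [g - 1] and [h - 1].
    Translations preserve the seminorm, so commutators of small elements are quadratically small. *)
Lemma dleR g h a b : dle g a -> dle h b -> dle [~ g, h]%g (2 * (a * b)).
Proof.
move=> ga hb u L hu uL; pose v := trans (h * g)^-1%g u.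
have hv : harm v by apply: harmonic_trans.
have vL : lip L v by apply: lipschitz_trans.
have H1 := hb _ _ (harmonic_displ g hv) (ga v L hv vL).
have H2 := ga _ _ (harmonic_displ h hv) (hb v L hv vL).
have := lipschitzD H1 (lipschitzZ (-1) H2); rewrite normrN1 mul1r.
have -> : b * (a * L) + a * (b * L) = 2 * (a * b) * L by ring.
move=> H x t tT; have := H x t tT; congr (`| _ | <= _).
have E y : displ h (displ g v) y + -1 * displ g (displ h v) y = displ [~ g, h]%g u y.
  rewrite /displ /v /trans; have -> : ((h * g)^-1 * (g * (h * y)))%g = ([~ g, h] * y)%g.
    by rewrite /commg /conjg invgM !mulgA.
  have -> : ((h * g)^-1 * (h * (g * y)) = y)%g by rewrite [(h * (g * y))%g]mulgA mulKg.
  ring.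
by rewrite !E.
Qed.

Lemma dleX g a n : dle g a -> dle (g ^+ n)%g (n%:R * a).
Proof.
move=> ga; elim: n => [|n IHn]; first by rewrite mul0r expg0; apply: dle1.
by rewrite expgSr -natr1 mulrDl mul1r; apply: dleM.
Qed.

Definition delta g : R := inf [set c | 0 <= c /\ dle g c].

Let dset g : has_inf [set c | 0 <= c /\ dle g c].
Proof. by split; [exists 2; split=> //; apply: dle2|exists 0 => c []]. Qed.

Lemma delta_le g c : 0 <= c -> dle g c -> delta g <= c.
Proof. by move=> c0 gc; apply: ge_inf => //; case: (dset g). Qed.

Lemma delta_ge0 g : 0 <= delta g.
Proof. by apply: lb_le_inf; [case: (dset g)|move=> c []]. Qed.

Lemma delta_dle g : dle g (delta g).
Proof.
move=> u L hu uL x t tT; have L0 := lipschitz_ge0 uL.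
have [L1|L1] := eqVneq L 0.
  by have [c [c0 gc]] := (dset g).1; have := gc u L hu uL x t tT; rewrite L1 !mulr0.
have {}L0 : 0 < L by rewrite lt_def L1.
rewrite -ler_pdivrMr //; apply: lb_le_inf; first by case: (dset g).
by move=> c [c0 gc]; rewrite ler_pdivrMr //; apply: gc.
Qed.

(** From [g^n - 1 = n (g - 1) - sum of (g^j - 1)(1 - g)] over [j < n]: as long as [n * delta g] is
    small, [g^n] displaces almost [n] times as much as [g]. *)
Lemma delta_pow g (n : nat) : n%:R * delta g <= delta (g ^+ n)%g + n%:R ^+ 2 * delta g ^+ 2.
Proof.
have [->|n0] := posnP n.
  by rewrite mul0r expr0n mul0r addr0 delta_ge0.
have nR : 0 < n%:R :> R by rewrite ltr0n.
rewrite mulrC -ler_pdivlMr //; apply: delta_le.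
  by rewrite divr_ge0 ?addr_ge0 ?delta_ge0 // mulr_ge0 // sqr_ge0.
move=> u L hu uL; have L0 := lipschitz_ge0 uL; set w := displ g u.
have hw : harm w by apply: harmonic_displ.
have wL : lip (delta g * L) w by apply: delta_dle.
have E x : w x = n%:R^-1 * (displ (g ^+ n)%g u x +
    -1 * \sum_(j < n) displ (g ^+ j)%g w x).
  rewrite /displ sumrB sumr_const card_ord.
  have -> : \sum_(j < n) w (g ^+ j * x)%g = u (g ^+ n * x)%g - u x.
    have tel m : \sum_(j < m) w (g ^+ j * x)%g = u (g ^+ m * x)%g - u x.
      elim: m => [|m IHm]; first by rewrite big_ord0 expg0 mul1g subrr.
      by rewrite big_ord_recr /= IHm /w /displ mulgA -expgS addrC subrKA.
    exact: tel.
  rewrite -[w x *+ n]mulr_natl; move: (n%:R) nR => m m0; field; lra.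
have HL : lip (`|n%:R^-1| * (delta (g ^+ n)%g * L +
   `|-1| * \sum_(j < n) (n%:R * delta g * (delta g * L)))) w.
  have H := lipschitzZ n%:R^-1 (lipschitzD (delta_dle (g ^+ n)%g hu uL)
    (lipschitzZ (-1) (@lipschitz_sum 'I_n (fun j => displ (g ^+ j)%g w)
       (fun=> n%:R * delta g * (delta g * L)) _))).
  move=> x t tT; rewrite !E; apply: H tT => j.
  have := dleX j (@delta_dle g) hw wL; apply: lipschitz_le.
  rewrite ler_wpM2r ?(lipschitz_ge0 wL) // ler_wpM2r ?delta_ge0 // ler_nat; exact: ltnW.
apply: lipschitz_le HL; rewrite normrN1 mul1r sumr_const card_ord -[_ *+ n]mulr_natl.
rewrite ger0_norm ?invr_ge0 // le_eqVlt; apply/orP; left; apply/eqP.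
by field; rewrite gt_eqF.
Qed.

Lemma delta_leM g h : delta (g * h)%g <= delta g + delta h.
Proof.
by apply: delta_le; [rewrite addr_ge0 ?delta_ge0|apply: dleM; apply: delta_dle].
Qed.

Lemma delta_leV g : delta g^-1%g <= delta g.
Proof. by apply: delta_le; [apply: delta_ge0|apply: dleV; apply: delta_dle]. Qed.

Lemma delta_leX g n : delta (g ^+ n)%g <= n%:R * delta g.
Proof. by apply: delta_le; [rewrite mulr_ge0 ?delta_ge0|apply: dleX; apply: delta_dle]. Qed.

Lemma delta_leR g h : delta [~ g, h]%g <= 2 * delta g * delta h.
Proof.
rewrite -mulrA; apply: delta_le; first by rewrite !mulr_ge0 ?delta_ge0.
by apply: dleR; apply: delta_dle.
Qed.

(** The displacements shrink geometrically along the chain, so with exponents below [C] each tail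
    product displaces by at most [d / 8], and the relation gives [delta (h i ^+ a) <= d / 4]. By
    [delta_pow] a power of so small an element cannot displace less than the element by that factor,
    unless [d = 0]. *)
Lemma chain_delta (C k : nat) (h : nat -> G) i (a : nat) (e e' : nat -> nat) : (0 < C)%N ->
  (forall j, delta (h j.+1) <= (16 * C%:R)^-1 * delta (h j)) ->
  delta (h i) <= (32 * C%:R)^-1 ->
  (0 < a < C)%N -> (forall j, (e j < C)%N) -> (forall j, (e' j < C)%N) ->
  (h i ^+ a * \prod_(i.+1 <= j < k) h j ^+ e j = \prod_(i.+1 <= j < k) h j ^+ e' j)%g ->
  delta (h i) = 0.
Proof.
move=> C0 dec d0 /andP [a0 aC] eC e'C E.
have CR : 1 <= C%:R :> R by rewrite ler1n.
set d := delta (h i) in d0 *; have dd : 0 <= d := delta_ge0 _.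
have tail (f : nat -> nat) : (forall j, (f j < C)%N) ->
    delta (\prod_(i.+1 <= j < k) h j ^+ f j)%g <= 8^-1 * d.
  move=> fC; have [ik|ki] := leqP i.+1 k; last first.
    by rewrite big_geq ?(ltnW ki) //; apply: delta_le; [rewrite mulr_ge0|apply: dle_le dle1; rewrite mulr_ge0].
  have dj m : delta (h (i + m)%N) <= (16 * C%:R)^-1 ^+ m * d.
    elim: m => [|m IHm]; first by rewrite addn0 mul1r.
    rewrite addnS exprS -mulrA; apply: le_trans (dec _) _.
    by rewrite ler_pM2l // invr_gt0 mulr_gt0 // (lt_le_trans _ CR).
  have H m : delta (\prod_(i.+1 <= j < i.+1 + m) h j ^+ f j)%g <= 8^-1 * (1 - 2^-1 ^+ m) * d.
    elim: m => [|m IHm].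
      rewrite addn0 big_geq // subrr mulr0 mul0r; apply: delta_le => //; exact: dle1.
    rewrite addnS big_nat_recr /= ?leq_addr //; apply: le_trans (delta_leM _ _) _.
    apply: (@le_trans _ _ (8^-1 * (1 - 2^-1 ^+ m) * d + 16^-1 * 2^-1 ^+ m * d)); last first.
      by rewrite exprS; lra.
    apply: lerD => //; apply: le_trans (delta_leX _ _) _.
    apply: (@le_trans _ _ (C%:R * ((16 * C%:R)^-1 ^+ m.+1 * d))).
      by apply: ler_pM => //; rewrite ?delta_ge0 ?ler_nat ?(ltnW (fC _)) // addSnnS.
    rewrite mulrA ler_wpM2r // exprS mulrA.
    have -> : C%:R * (16 * C%:R)^-1 = 16^-1 :> R by field; rewrite gt_eqF // (lt_le_trans _ CR).
    rewrite ler_pM2l // lerXn2r ?nnegrE ?invr_ge0 ?mulr_ge0 // lef_pV2 ?posrE //; last by lra.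
    by lra.
  have := H (k - i.+1)%N; rewrite subnKC // => /le_trans; apply.
  have : 0 <= 2^-1 ^+ (k - i.+1) :> R by rewrite exprn_ge0.
  by move: (_ ^+ _) => p p0; nra.
have da : delta (h i ^+ a)%g <= 4^-1 * d.
  have -> : (h i ^+ a = \prod_(i.+1 <= j < k) h j ^+ e' j *
      (\prod_(i.+1 <= j < k) h j ^+ e j)^-1)%g by rewrite -E mulgK.
  apply: le_trans (delta_leM _ _) _; have := tail _ eC; have := tail _ e'C.
  by have := delta_leV (\prod_(i.+1 <= j < k) h j ^+ e j)%g; lra.
have := delta_pow (h i) a; rewrite -/d.
have a1 : 1 <= a%:R :> R by rewrite ler1n.
have ad : a%:R * d <= 32^-1.
  apply: (@le_trans _ _ (C%:R * (32 * C%:R)^-1)).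
    by apply: ler_pM => //; rewrite ler_nat ltnW.
  by rewrite le_eqVlt; apply/orP; left; apply/eqP; field; rewrite gt_eqF // (lt_le_trans _ CR).
rewrite -exprMn => key; apply/eqP; rewrite eq_le dd andbT.
have : (a%:R * d) ^+ 2 <= 32^-1 * (a%:R * d) by rewrite expr2 ler_wpM2r // mulr_ge0.
have : d <= a%:R * d by rewrite ler_peMl.
by move: da key; lra.
Qed.

End Displacement.

(** * Homomorphisms to the integers from harmonic functions *)

Section IntQuotient.
Variables (R : realType) (G : groupType) (T : seq G).
Hypothesis sT : symm T.
Hypothesis genT : forall x, sgen T x.
Local Open Scope ring_scope.
Local Notation lip := (lipschitz T).
Local Notation harm := (harmonic T).
Local Notation dle := (@dle R G T).

Definition nhl (u : G -> R) := [/\ harm u, u 1%g = 0 & exists c, lip c u].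

Lemma nhl_displ g h (u : G -> R) : nhl u -> nhl (fun x => (u (g * x)%g - u g) - (u (h * x)%g - u h)).
Proof.
move=> [hu u1 [c uc]]; split; last 1 first.
- exists (c + c) => x t tT.
  have := lipschitzD (lipschitz_trans g uc) (lipschitzZ (-1) (lipschitz_trans h uc)).
  rewrite normrN1 mul1r => /(_ x t tT); congr (`| _ | <= _); rewrite /trans; ring.
- move=> x; rewrite -[RHS](harmonicB (harmonic_trans g hu) (harmonic_trans h hu) x).
  by apply: eq_bigr => t _; rewrite /trans; ring.
- by rewrite !mulg1 !subrr.
Qed.

Variable d0 : nat.
Hypothesis dim : forall (d : nat) (u : 'I_d -> G -> R) (p : 'I_d -> G),
  (forall i, nhl (u i)) -> \det (\matrix_(i, j) u i (p j)) != 0 -> (d <= d0)%N.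

(** Take [d] maximal with a nonzero determinant of values. Bordering the matrix by any [w] and [x]
    then gives determinant zero, and the Schur complement turns this into a formula for [w x] in
    terms of the values of [w] at the points [p j]. *)
Lemma nhl_basis : exists (d : nat) (u : 'I_d -> G -> R) (p : 'I_d -> G) (N : 'M[R]_d),
  (forall i, nhl (u i)) /\
  forall w, nhl w -> forall x, w x = \sum_i (\sum_j w (p j) * N j i) * u i x.
Proof.
pose P d := exists (u : 'I_d -> G -> R) (p : 'I_d -> G),
  (forall i, nhl (u i)) /\ \det (\matrix_(i, j) u i (p j)) != 0.
have P0 : P 0%N.
  by exists (fun _ _ => 0), (fun _ => 1%g); split=> [[]//|]; rewrite det_mx00 oner_eq0.
have Pb d : P d -> (d <= d0)%N by move=> [u [p [hu du]]]; apply: dim hu du.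
have [d Pd dmax] : exists2 d, P d & ~ P d.+1.
  apply: contrapT => nE; have all_d d : P d.
    by elim: d => // d Pd; apply: contrapT => nP; apply: nE; exists d.
  by have := Pb _ (all_d d0.+1); rewrite ltnn.
move: Pd => [u [p [hu du]]]; set M := \matrix_(i, j) u i (p j) in du.
have uM : M \in unitmx by rewrite unitmxE unitfE.
exists d, u, p, (invmx M); split=> // w hw x.
pose b : 'rV[R]_d := \row_j w (p j); pose c : 'cV[R]_d := \col_i u i x.
have D0 : \det (block_mx (w x)%:M b c M : 'M[R]_(1 + d)) = 0.
  apply/eqP; apply: contrapT => /negP nz; apply: dmax.
  pose U (i : 'I_(1 + d)) := match fintype.split i with inl _ => w | inr j => u j end.
  pose Q (i : 'I_(1 + d)) := match fintype.split i with inl _ => x | inr j => p j end.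
  exists U, Q; split=> [i|]; first by rewrite /U; case: fintype.split.
  rewrite (_ : \matrix_(i, j) _ = block_mx (w x)%:M b c M) //.
  apply/matrixP => i j; rewrite !mxE /U /Q.
  case: (fintype.split i) => a; rewrite !mxE; case: (fintype.split j) => a'; rewrite !mxE //.
  by rewrite !ord1 eqxx mulr1n.
have E : M *m (- invmx M *m c) = - c by rewrite mulNmx mulmxN mulKVmx.
have := det_schur (w x)%:M b E; rewrite D0 => /esym/eqP; rewrite mulf_eq0 (negbTE du) orbF.
rewrite mulNmx mulmxN mulmxA !mxE eqxx mulr1n subr_eq0 => /eqP ->.
by apply: eq_bigr => i _; rewrite !mxE; congr (_ * _); apply: eq_bigr => j _; rewrite mxE.
Qed.

(** Compactness of the image of the group, in the form of a pigeonhole. The action of [g] is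
    governed by the finitely many numbers [u i (g p j) - u i g], which are bounded uniformly in [g].
    They fall into finitely many boxes of side [eta], and two elements in one box differ by an
    element of small displacement. *)
Lemma near_net (eps : R) : 0 < eps -> exists N : nat, forall g : nat -> G,
  exists i j, [/\ (i < j <= N)%N & dle (g i * (g j)^-1)%g eps].
Proof.
move=> e0; have [d [u [p [M [hu span]]]]] := nhl_basis.
have [L [L1 uL]] : exists L : R, 1 <= L /\ forall i, lip L (u i).
  have [L LP] := choice (fun i => let: And3 _ _ h := hu i in h).
  exists (1 + \sum_i `|L i|); split=> [|i x t tT]; first by rewrite lerDl; apply: sumr_ge0.
  apply: le_trans (LP i x t tT) _; rewrite (bigD1 i) //= addrCA.
  by apply: le_trans (ler_norm _) _; rewrite lerDl addr_ge0 // sumr_ge0.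
have [n nP] : exists n : nat, forall j, p j \in ball T n.
  have [n nP] := choice (fun j => genT (p j)); exists (\max_j n j) => j.
  by apply: (ball_le sT _ (nP j)); apply: leq_bigmax.
pose m := 1 + \sum_j \sum_i `|M j i|.
have m1 : 1 <= m by rewrite lerDl; apply: sumr_ge0 => j _; apply: sumr_ge0.
have m0 : 0 <= m := le_trans ler01 m1; have L0 : 0 <= L := le_trans ler01 L1.
have coef (w : G -> R) (c : R) i : 0 <= c -> (forall j, `|w (p j)| <= c) ->
    `|\sum_j w (p j) * M j i| <= c * m.
  move=> c0 wc; apply: le_trans (ler_norm_sum _ _ _) _.
  rewrite /m mulrDr mulr1 mulr_sumr; apply: ler_wpDl => //; apply: ler_sum => j _.
  rewrite normrM; apply: ler_pM => //.
  by rewrite (bigD1 i) //= lerDl sumr_ge0.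
have lipc (w : G -> R) (c : R) : 0 <= c -> nhl w -> (forall j, `|w (p j)| <= c) ->
    lip (d%:R * (c * m * L)) w.
  move=> c0 hw wc x t tT; rewrite !(span w hw).
  have H := @lipschitz_sum R G T 'I_d (fun i x => (\sum_j w (p j) * M j i) * u i x) (fun=> c * m * L).
  rewrite sumr_const card_ord -[_ *+ d]mulr_natl in H; apply: H tT => i.
  apply: lipschitz_le (lipschitzZ (\sum_j w (p j) * M j i) (uL i)).
  by rewrite ler_wpM2r ?coef.
(* Collects the losses from values at the [p j] to coefficients, by [m], and from coefficients to
   the Lipschitz seminorm, once for a general function and once for the translated basis; the
   summand 1 keeps it positive. *)
pose K := 1 + d%:R * (n%:R * m * (d%:R * (m * L))).
have K1 : 1 <= K.
  by rewrite lerDl !mulr_ge0.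
pose eta := eps / K; have eta0 : 0 < eta by rewrite divr_gt0 // (lt_le_trans _ K1).
pose v g i j := u i (g * p j)%g - u i g.
have vb g i j : `|v g i j| <= L * n%:R.
  have [hi ui _] := hu i.
  have h : lip L (fun x => u i (g * x)%g - u i g).
    move=> x t tT; have := lipschitz_trans g (uL i) x tT; congr (`|_| <= _).
    by rewrite /trans; ring.
  have := lipschitz_ball h _ (nP j); apply.
  by rewrite mulg1 subrr.
have close g h : (forall i j, `|v g i j - v h i j| <= eta) -> dle (g * h^-1)%g eps.
  move=> gh w Lw hw wL; pose w' x := w x - w 1%g.
  have hw' : nhl w'.
    split; [|by rewrite /w' subrr|exists Lw].
      by move=> x; rewrite -[RHS](hw x); apply: eq_bigr => t _; rewrite /w'; ring.
    by move=> x t tT; have := wL x t tT; congr (`|_| <= _); rewrite /w'; ring.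
  have Lw0 := lipschitz_ge0 sT wL.
  have w'L : lip Lw w'.
    by move=> x t tT; have := wL x t tT; congr (`|_| <= _); rewrite /w'; ring.
  have H i : lip (d%:R * (eta * m * L))
      (fun x => (u i (g * x)%g - u i g) - (u i (h * x)%g - u i h)).
    by apply: lipc (ltW eta0) (nhl_displ g h (hu i)) _ => j; apply: gh.
  pose c i := \sum_j w' (p j) * M j i.
  have cb i : `|c i| <= Lw * n%:R * m.
    apply: coef; first by rewrite mulr_ge0.
    by move=> j; apply: lipschitz_ball w'L _ (nP j); rewrite /w' subrr.
  have Hs := @lipschitz_sum R G T 'I_d
    (fun i x => c i * ((u i (g * x)%g - u i g) - (u i (h * x)%g - u i h)))
    (fun=> Lw * n%:R * m * (d%:R * (eta * m * L))).
  rewrite sumr_const card_ord -[(Lw * _ * _ * _) *+ d]mulr_natl in Hs.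
  have {}Hs : lip (eps * Lw) (fun x => \sum_i
      c i * ((u i (g * x)%g - u i g) - (u i (h * x)%g - u i h))).
    apply: lipschitz_le (Hs _) => [|i].
      rewrite (_ : d%:R * _ = eta * (K - 1) * Lw); last by rewrite /K; ring.
      rewrite ler_wpM2r // -[leRHS](_ : eta * K = _) ?ler_pM2l ?gerBl //.
      by rewrite /eta mulfVK // gt_eqF // (lt_le_trans _ K1).
    apply: lipschitz_le (lipschitzZ (c i) (H i)).
    have eb : 0 <= d%:R * (eta * m * L) by rewrite mulr_ge0 // mulr_ge0 // mulr_ge0 // ltW.
    by rewrite ler_wpM2r ?cb.
  move=> x t tT; have := Hs (h^-1 * x)%g t tT; congr (`|_| <= _).
  have E y : \sum_i c i * ((u i (g * (h^-1 * y))%g - u i g) - (u i (h * (h^-1 * y))%g - u i h)) =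
      displ (g * h^-1)%g w y - (w' g - w' h).
    rewrite /displ -[w _ - w y](_ : w' (g * h^-1 * y)%g - w' y = _); last by rewrite /w'; ring.
    rewrite !(span w' hw') -!sumrB; apply: eq_bigr => i _.
    by rewrite mulVKg -mulgA -/(c i); ring.
  by rewrite -mulgA !E; ring.
pose Q := (Num.truncn (2 * (L * n%:R) / eta)).+1.
pose I := {ffun 'I_d * 'I_d -> 'I_Q.+1}.
exists #|{: I}| => g.
have fl_ub (y : R) : 0 <= y -> y <= 2 * (L * n%:R) / eta -> (Num.truncn y < Q.+1)%N.
  by move=> y0 yb; rewrite ltnS leqW // le_truncn.
pose code (i : 'I_#|{: I}|.+1) : I := [ffun q => inord (Num.truncn ((v (g i) q.1 q.2 + L * n%:R) / eta))].
have main (i j : 'I_#|{: I}|.+1) : code i = code j -> dle (g i * (g j)^-1)%g eps.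
  move=> E; apply: close => a b.
  have := congr1 (fun f : I => val (f (a, b))) E; rewrite !ffunE /=.
  have rng k : 0 <= (v (g k) a b + L * n%:R) / eta <= 2 * (L * n%:R) / eta.
    have := vb (g k) a b; rewrite ler_norml => /andP [h1 h2].
    rewrite ler_pM2r ?invr_gt0 // divr_ge0 ?(ltW eta0) //; first by lra.
    by rewrite -lerBlDr; lra.
  have [/andP [r1 r2] /andP [r3 r4]] := (rng i, rng j).
  rewrite !inordK ?fl_ub // => Et.
  have /andP [t1 t2] := truncn_itv r1; have /andP [t3 t4] := truncn_itv r3.
  rewrite -Et in t3 t4; have T1 : ((Num.truncn ((v (g i) a b + L * n%:R) / eta)).+1%:R =
    (Num.truncn ((v (g i) a b + L * n%:R) / eta))%:R + 1 :> R) by rewrite natr1.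
  rewrite T1 in t2 t4; move: t1 t2 t3 t4; move: (Num.truncn _)%:R => z.
  rewrite ler_pdivlMr // ltr_pdivrMr // ler_pdivlMr // ltr_pdivrMr // => t1 t2 t3 t4.
  rewrite ler_norml; apply/andP; split; nra.
have [i [j [ij E]]] : exists i j, i != j /\ code i = code j.
  apply: contrapT => nE; have ic : injective code.
    by move=> i j E; apply/eqP; apply: contrapT => /negP ij; apply: nE; exists i, j.
  by have := leq_card code ic; rewrite card_ord ltnn.
case: (ltngtP i j) => [lt|lt|/val_inj eq]; last by rewrite eq eqxx in ij.
  by exists i, j; split; [rewrite lt /= -ltnS|apply: main].
by exists j, i; split; [rewrite lt /= -ltnS|apply: main].
Qed.

End IntQuotient.

Section GeneratedSubgroups.
Variable G : groupType.
Local Open Scope group_scope.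
Implicit Types (E : set G) (L X : seq G).

Lemma symz_mono L L' : {subset L <= L'} -> sgen (symz L) `<=` sgen (symz L').
Proof.
move=> LL; apply: sgen_symz_sub; first exact: sgen_subgroup (symm_symz _).
by move=> x /LL xL; apply/sgen_gen/sub_symz.
Qed.

Lemma sgp_finite E x : sgp E x -> exists2 L, forall l, l \in L -> E l & sgen (symz L) x.
Proof.
pose A := [set x | exists2 L, forall l, l \in L -> E l & sgen (symz L) x].
have sS L : subgroup (sgen (symz L)) := sgen_subgroup (symm_symz L).
apply: (sgp_min (H := A)) => [|y Ey]; last first.
  by exists [:: y] => [l|]; [rewrite inE => /eqP ->|apply/sgen_gen/sub_symz/mem_head].
split=> [|y z [L LE yL] [L' LE' zL]|y [L LE yL]].
- by exists [::] => //; apply: (subgroup1 (sS _)).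
- exists (L ++ L') => [l|]; first by rewrite mem_cat => /orP [/LE|/LE'].
  apply: (subgroupM (sS _)); [apply: symz_mono yL|apply: symz_mono zL] => l lL;
    by rewrite mem_cat lL ?orbT.
- by exists L => //; apply: (subgroupV (sS _)).
Qed.

Lemma sgp_finite_seq E X : (forall x, x \in X -> sgp E x) ->
  exists2 L, forall l, l \in L -> E l & forall x, x \in X -> sgen (symz L) x.
Proof.
elim: X => [|x X IHX] XE; first by exists [::].
have [|L LE LX] := IHX; first by move=> y yX; apply: XE; rewrite inE yX orbT.
have [L' LE' xL] := sgp_finite (XE x (mem_head _ _)).
exists (L ++ L') => [l|y]; first by rewrite mem_cat => /orP [/LE|/LE'].
rewrite inE => /orP [/eqP ->|/LX h]; [move: xL|move: h]; apply: symz_mono => l lL;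
  by rewrite mem_cat lL ?orbT.
Qed.

(** A family in pairwise different cosets has at most [N] elements, so one of maximal length meets
    every coset. *)
Lemma fin_index_pigeonhole (A : set G) N : subgroup A ->
  (forall g : nat -> G, exists i j, (i < j <= N)%N /\ A (g i * (g j)^-1)) ->
  fin_index A setT.
Proof.
move=> sA pig.
pose P n := exists g : nat -> G, forall i j, (i < j < n)%N -> ~ A (g i * (g j)^-1).
have PN n : P n -> (n <= N)%N.
  move=> [g gP]; rewrite leqNgt; apply/negP => Nn; have [i [j [/andP [ij jN] h]]] := pig g.
  by apply: (gP i j) => //; rewrite ij (leq_ltn_trans jN).
have P0 : P 0%N by exists (fun=> 1) => i j /andP [].
have [n [g gP] nmax] : exists2 n, P n & ~ P n.+1.
  apply: contrapT => nE; have Pn n : P n.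
    by elim: n => // n Pn; apply: contrapT => nP; apply: nE; exists n.
  by have := PN _ (Pn N.+1); rewrite ltnn.
exists [seq g i | i <- iota 0 n] => x _; apply: contrapT => nx; apply: nmax.
exists (fun i => if (i < n)%N then g i else x) => i j /andP [ij jn].
have iN : (i < n)%N by apply: leq_trans ij _; rewrite -ltnS.
rewrite iN; case: ltnP => jn' h; first by apply: (gP i j) => //; rewrite ij.
apply: nx; exists (g i); first by apply: map_f; rewrite mem_iota.
by have := subgroupV sA h; rewrite invgM invgK.
Qed.

End GeneratedSubgroups.

Section IntQuotientTheorem.
Variables (R : realType) (G : groupType).
Local Open Scope ring_scope.

(** A function with finitely many values attains its maximum, and harmonicity spreads the maximum to
    all neighbours. *)
Lemma maximum_principle (T r : seq G) (u : G -> R) : (forall x, sgen T x) ->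
  harmonic T u -> (forall x, exists2 y, y \in r & u x = u y) -> forall x, u x = u 1%g.
Proof.
move=> genT hu ur.
have r0 : r != [::] by have [y yr _] := ur 1%g; apply: contraTneq yr => ->.
have [m mr mP] := seq_argmax u r0.
have um x : u x <= u m by have [y yr ->] := ur x; apply: mP.
have step x t : u x = u m -> t \in T -> u (x * t)%g = u m.
  move=> xm tT; have := hu x.
  have le0 s : s \in T -> 0 <= u x - u (x * s)%g by rewrite subr_ge0 xm um.
  move=> h0; have : \sum_(s <- T) (u x - u (x * s)%g) = 0.
    rewrite (_ : \sum_(s <- T) _ = - \sum_(s <- T) (u (x * s)%g - u x)); first by rewrite h0 oppr0.
    by rewrite -sumrN; apply: eq_bigr => s _; rewrite opprB.
  move=> h1; have := sum_term (F := fun s => u x - u (x * s)%g) tT le0.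
  by rewrite h1 subr_le0 -xm => h2; apply/le_anti; rewrite h2 xm um.
have from x n y : u x = u m -> y \in ball T n -> u (x * y)%g = u m.
  move=> xm; elim: n y => [|n IHn] y; first by rewrite inE => /eqP ->; rewrite mulg1.
  by move=> /ballSP [z [t [/IHn zm tT ->]]]; rewrite mulgA; apply: step.
have all_m x : u x = u m.
  by have [n xn] := genT (m^-1 * x)%g; have := from m n _ erefl xn; rewrite mulVKg.
by move=> x; rewrite !all_m.
Qed.

(** Elements of small displacement generate a subgroup of finite index by [near_net], and long
    commutators of its generators lie in the kernel [Z] of its action, by [chain_relation] and
    [chain_delta]. If the abelianization modulo [Z] is infinite, it supplies [chi]. Otherwise [Z]
    has finite index; there [u - u 1] is an additive map to the reals, nonzero by the maximum
    principle, so the abelianization of [Z] is infinite. *)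
Theorem int_quotient (S : seq G) (D : nat) : symm S -> (forall x, sgen S x) ->
    poly_growth S D -> (forall M, exists n, (M <= size (ball S n))%N) ->
  exists (S1 : seq G) (chi : G -> int), [/\ symm S1, fin_index (sgen S1) setT,
    forall x y, sgen S1 x -> sgen S1 y -> chi (x * y)%g = chi x + chi y &
    exists2 s, sgen S1 s & chi s != 0].
Proof.
move=> sS genS pS infS.
have [T [u [sT genT uL hu [x0 ux0]]]] := harmonic_exists R sS genS infS pS.
have pT : poly_growth T D by apply: (poly_growth_sub sS _ pS).
have [d0 dim] := harmonic_fin_dim R sT genT pT.
pose C := (4 ^ D.+1)%N; have C0 : (0 < C)%N by rewrite expn_gt0.
have CR : 1 <= C%:R :> R by rewrite ler1n.
(* A commutator with a generator multiplies the displacement by at most [2 * eps], which is the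
   ratio [1 / (16 C)] that [chain_delta] demands. *)
pose eps : R := (32 * C%:R)^-1.
have eps0 : 0 < eps by rewrite invr_gt0 mulr_gt0 // (lt_le_trans _ CR).
have [N net] := near_net sT genT dim eps0.
pose E := [set g | @dle R G T g eps].
have fH : fin_index (sgp E) setT.
  apply: (fin_index_pigeonhole (N := N)) => [|g]; first exact: sgp_subgroup.
  by have [i [j [ij h]]] := net g; exists i, j; split=> //; apply: sub_sgp.
have genTT : sgen T = setT by apply/seteqP; split.
have [S' [_ [sS' HE _]]] : exists S' (r : seq G), [/\ symm S', sgp E = sgen S' &
    forall n x, x \in ball T n -> exists a y,
      [/\ a \in ball S' n.+1, y \in r & x = (a * y)%g]].
  by apply: fin_index_gens; rewrite ?genTT //; apply: sgp_subgroup.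
have [L LE LS'] : exists2 L, forall l, l \in L -> E l & forall x, x \in S' -> sgen (symz L) x.
  by apply: sgp_finite_seq => x xS'; rewrite HE; apply: sgen_gen.
set S1 := symz L; have sS1 : symm S1 := symm_symz L.
have HS1 : sgen S1 = sgp E.
  apply/seteqP; split; last by rewrite HE; apply: sgen_sub.
  by apply: sgen_symz_sub; [apply: sgp_subgroup|move=> l /LE El; apply: sub_sgp].
have S1E s : s \in S1 -> delta R T s <= eps.
  rewrite mem_symz => /or3P [/eqP ->|/LE h|/LE h].
  - by apply: le_trans (delta_le (lexx 0) (@dle1 R G T)) (ltW eps0).
  - exact: delta_le (ltW eps0) h.
  - by apply: delta_le (ltW eps0) _ => //; rewrite -[s]invgK; apply: dleV.
pose Z := [set g | sgen S1 g /\ @dle R G T g 0].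
have sG1 := sgen_subgroup sS1.
have ZS1 : Z `<=` sgen S1 by move=> g [].
have sZ : subgroup Z.
  split=> [|g h [Gg gZ] [Gh hZ]|g [Gg gZ]].
  - by split; [apply: (subgroup1 sG1)|apply: dle1].
  - split; first exact: (subgroupM sG1).
    by rewrite -[0]addr0; apply: dleM.
  - by split; [apply: (subgroupV sG1)|apply: dleV].
have ZJ z t : Z z -> t \in S1 -> Z (z ^ t)%g.
  move=> [Gz zZ] tS; split; last exact: dleJ.
  by apply: (subgroupJ sG1) => //; apply: sgen_gen.
have [c cP] := finite_sgen_ball (S := T) (X := S1) sT (fun x _ => genT x).
have [k chain] := chain_relation sT pT c.
have delta0 x : delta R T x = 0 -> @dle R G T x 0 by move=> <-; apply: delta_dle.
have lclZ x : x \in lcl S1 k -> Z x.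
  move=> xk; split; first exact: lcl_sgen xk.
  (* The chain consists of the initial segments of a left-normed commutator, continued by 1 beyond
     its length. One more entry at most quadruples the bound on the word length, which matches
     [chain_relation]. *)
  have ex m y : y \in lcl S1 m -> exists h : nat -> G, [/\ h m = y,
      forall i, h i \in ball T (c * 4 ^ i),
      forall i, delta R T (h i.+1) <= (16 * C%:R)^-1 * delta R T (h i),
      delta R T (h 0%N) <= eps & forall i, (m < i)%N -> h i = 1%g].
    have d1 : delta R T 1%g = 0.
      by apply/le_anti; rewrite delta_ge0 // andbT; apply: delta_le => //; apply: dle1.
    have C16 : 0 <= (16 * C%:R)^-1 :> R by rewrite invr_ge0 mulr_ge0.
    elim: m y => [|m IHm] y.
      move=> yS; exists (fun i => if i is 0 then y else 1%g); split=> [//|[|i]|i||[|i]//].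
      - by rewrite muln1; apply: cP.
      - exact: ball_one.
      - by rewrite d1 mulr_ge0 // delta_ge0.
      - exact: S1E.
    move=> /allpairsP [[z s] [/= zm sS1' ->]]; have [h [hm hB hd h0 h1]] := IHm z zm.
    exists (fun i => if i == m.+1 then [~ z, s]%g else h i); split=> [|i|i||i].
    - by rewrite eqxx.
    - case: eqVneq => [->|_]; last exact: hB.
      apply: (ball_le sT _ (ball_comm sT (_ : z \in ball T (c * 4 ^ m)) (cP s sS1'))).
        rewrite expnS; have : (0 < 4 ^ m)%N by rewrite expn_gt0.
        by move: (4 ^ m)%N => p; clear; nia.
      by rewrite -hm; apply: hB.
    - rewrite eqSS; case: eqVneq => [->|im].
        rewrite ltn_eqF // hm; apply: le_trans (delta_leR R sT _ _) _.
        have -> : (16 * C%:R)^-1 = 2 * eps by rewrite /eps; field; rewrite gt_eqF // (lt_le_trans _ CR).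
        by rewrite mulrAC ler_wpM2r ?delta_ge0 // ler_pM2l // S1E.
      case: (eqVneq i m.+1) => [->|_]; last exact: hd.
      by rewrite h1 // d1 mulr_ge0 // delta_ge0.
    - by [].
    - by move=> mi; rewrite gtn_eqF // h1 // ltnW.
  have [h [hk hB hd h0 _]] := ex k x xk.
  have [i [a [e [e' [ik aC eC e'C rel]]]]] := chain h hB.
  have hle j : delta R T (h j) <= eps.
    elim: j => // j IHj; apply: le_trans (hd j) (le_trans _ IHj).
    rewrite ler_piMl ?delta_ge0 // invf_le1 ?mulr_gt0 ?(lt_le_trans _ CR) //.
    by move: CR; lra.
  have di := chain_delta sT C0 hd (hle i) aC eC e'C rel.
  have later j : delta R T (h (i + j)%N) = 0.
    elim: j => [|j IHj]; first by rewrite addn0.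
    apply/le_anti; rewrite delta_ge0 // andbT addnS.
    by apply: le_trans (hd _) _; rewrite IHj mulr0.
  by apply: delta0; rewrite -hk -(subnKC (ltnW ik)) later.
have [[t [tS1 tor]]|ntor] := pselect (exists t, t \in S1 /\
    forall e, (0 < e)%N -> ~ lcs S1 Z 1 (t ^+ e)%g).
  have [chi [chiM chi0]] := abelianization_hom sS1 sZ ZS1 ZJ tS1 tor.
  exists S1, chi; split=> //; first by rewrite HS1.
  by exists t => //; apply: sgen_gen.
have fZ : fin_index Z (sgen S1).
  apply: nilpotent_torsion lclZ _ => // t tS1; apply: contrapT => h; apply: ntor.
  by exists t; split=> // e e0 De; apply: h; exists e.
have fZT : fin_index Z setT.
  by apply: (fin_index_trans (B := sgen S1)) => //; rewrite HS1.
have Zu z x : Z z -> u (z * x)%g = u x + (u z - u 1%g).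
  move=> [_ /(_ u 1 hu uL)]; rewrite mul0r => h.
  have const n y : y \in ball T n -> displ z u y = displ z u 1%g.
    elim: n y => [|n IHn] y; first by rewrite inE => /eqP ->.
    move=> /ballSP [w [t [/IHn <- tT ->]]]; apply/eqP.
    by rewrite -subr_eq0 -normr_le0 h.
  have [n xn] := genT x; have := const n x xn; rewrite /displ mulg1 => <-.
  by rewrite addrC subrK.
have [S2 [r [sS2 ZE _]]] : exists S' (r : seq G), [/\ symm S', Z = sgen S' &
    forall n x, x \in ball T n -> exists a y,
      [/\ a \in ball S' n.+1, y \in r & x = (a * y)%g]].
  by apply: fin_index_gens; rewrite ?genTT.
have [s sS2' us] : exists2 s, s \in S2 & u s != u 1%g.
  apply: contrapT => nE; have uZ z : Z z -> u z = u 1%g.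
    rewrite ZE => -[n]; elim: n z => [|n IHn] z; first by rewrite inE => /eqP ->.
    move=> /ballSP [y [t [yB tS2 ->]]].
    have Zy : Z y by rewrite ZE; exists n.
    rewrite Zu // (IHn y yB) subrr addr0; apply/eqP/negPn/negP => ut.
    by apply: nE; exists t.
  have [r' r'P] := fZT; case/eqP: ux0; apply: (maximum_principle genT hu (r := r')) => x.
  have [y yr Zxy] := r'P x I; exists y => //.
  by rewrite -[in LHS](mulgVK y x) Zu // (uZ _ Zxy) subrr addr0.
have one_sub : subgroup [set (1%g : G)].
  by split=> [//|x y -> ->|x ->]; rewrite /= ?mulg1 ?invg1.
have oneT : [set (1%g : G)] `<=` sgen S2 by move=> x ->; apply: subgroup1 (sgen_subgroup sS2).
have oneJ (z t : G) : [set (1%g : G)] z -> t \in S2 -> [set (1%g : G)] (z ^ t)%g.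
  by move=> -> _; rewrite /= conj1g.
have uM x y : sgen S2 x -> sgen S2 y -> u (x * y)%g - u 1%g = (u x - u 1%g) + (u y - u 1%g).
  by rewrite -ZE => Zx Zy; rewrite Zu //; ring.
have sG2 := sgen_subgroup sS2.
have uV x : sgen S2 x -> u x^-1%g - u 1%g = - (u x - u 1%g).
  move=> Gx; have := uM x^-1%g x (subgroupV sG2 Gx) Gx; rewrite mulVg subrr => /esym/eqP.
  by rewrite addr_eq0 => /eqP.
(* An additive map to the reals kills commutators, and an element on which it is nonzero has no
   power in the commutator subgroup, because the reals have no torsion. *)
have ker1 : lcs S2 [set 1%g] 1 `<=` [set x | sgen S2 x /\ u x = u 1%g].
  apply: lcs_min => [|[//|j] x _ /allpairsP [[y t] [/= yl tS2 ->]]|x ->].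
  - split=> [|x y [Gx x1] [Gy y1]|x [Gx x1]]; first by split=> //; apply: (subgroup1 sG2).
      split; first exact: (subgroupM sG2).
      by have := uM x y Gx Gy; rewrite x1 y1 subrr addr0 => /eqP; rewrite subr_eq0 => /eqP.
    split; first exact: (subgroupV sG2).
    by have := uV x Gx; rewrite x1 subrr oppr0 => /eqP; rewrite subr_eq0 => /eqP.
  - have Gy := lcl_sgen sS2 yl; have Gt := sgen_gen tS2.
    have GV w : sgen S2 w -> sgen S2 w^-1%g := subgroupV sG2 (x := w).
    have GM w w' : sgen S2 w -> sgen S2 w' -> sgen S2 (w * w')%g := @subgroupM _ _ w w' sG2.
    split; first exact: (subgroupR sG2).
    apply/eqP; rewrite -subr_eq0 /commg /conjg uM ?uV ?uM ?uV ?uM //; try by auto.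
    by apply/eqP; ring.
  - by split=> //; apply: (subgroup1 sG2).
have [|chi [chiM chi0]] := abelianization_hom sS2 one_sub oneT oneJ sS2' _.
  move=> e e0 /ker1 [_ ue]; have : u (s ^+ e)%g - u 1%g = (u s - u 1%g) *+ e.
    have Gs := sgen_gen sS2'; elim: (e) => [|m IHm]; first by rewrite expg0 subrr.
    by rewrite expgS uM ?IHm ?mulrS //; apply: (subgroupX _ sG2).
  rewrite ue subrr => /esym/eqP; rewrite mulrn_eq0 subr_eq0 (negbTE us) orbF.
  by rewrite eqn0Ngt e0.
exists S2, chi; split=> //; first by rewrite -ZE.
by exists s => //; apply: sgen_gen.
Qed.

End IntQuotientTheorem.

Section IntegerPowers.
Variables (G : groupType) (t : G).
Local Open Scope group_scope.

Definition zexp (q : int) : G := match q with Posz n => t ^+ n | Negz n => t ^- n.+1 end.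

Lemma zexpS q : zexp (q + 1)%R = zexp q * t.
Proof.
case: q => [n|[|n]]; first by rewrite -PoszD addn1 /= expgSr.
  by rewrite /= expg1 mulVg.
have -> : (Negz n.+1 + 1 = Negz n)%R by rewrite !NegzE; lia.
by rewrite /= [t ^+ n.+2]expgS invgM mulgVK.
Qed.

Lemma zexpB1 q : zexp (q - 1)%R = zexp q * t^-1.
Proof. by rewrite -[in RHS](subrK 1%R q) zexpS mulgK. Qed.

Lemma zexpD q r : zexp (q + r)%R = zexp q * zexp r.
Proof.
elim/int_rect: r => [|n IHn|n IHn]; first by rewrite addr0 /= mulg1.
  by rewrite -[_.+1]addn1 PoszD addrA !zexpS IHn mulgA.
by rewrite -[_.+1]addn1 PoszD opprD addrA !zexpB1 IHn mulgA.
Qed.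

Lemma zexpN q : zexp (- q)%R = (zexp q)^-1.
Proof. by apply: (mulgI (zexp q)); rewrite -zexpD subrr mulgV. Qed.

Lemma zexp_sub (A : set G) q : subgroup A -> A t -> A (zexp q).
Proof.
move=> sA At; case: q => n /=; first exact: (subgroupX _ sA).
by apply: (subgroupV sA); apply: (subgroupX n.+1 sA).
Qed.

End IntegerPowers.

(** * The kernel of a homomorphism to the integers *)

Section Kernel.
Variables (R : realType) (G : groupType) (S : seq G).
Local Open Scope group_scope.
Hypothesis sS : symm S.
Let sG := sgen_subgroup sS.

(** Milnor's argument. The [2^k] subproducts of the conjugates [x ^ (t ^+ i)] are, up to a fixed
    power of [t], words of length linear in [k], so two of them coincide. This expresses the
    conjugate of largest differing index [j] through the earlier ones, and the subgroup generated by
    these is then stable under conjugation by [t]. *)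
Lemma conj_fg D x t : poly_growth S D -> sgen S x -> sgen S t ->
  exists m, forall n, sgen (symz [seq x ^ (t ^+ i) | i <- iota 0 m]) (x ^ (t ^+ n)).
Proof.
move=> [A AP] Gx Gt.
have [c cP] : exists c, forall y, y \in [:: x; t^-1] -> y \in ball S c.
  apply: (finite_sgen_ball sS) => y; rewrite !inE => /orP [] /eqP -> //.
  exact: (subgroupV sG).
pose X i := x ^ (t ^+ i).
pose B (e : nat -> bool) k := \prod_(0 <= i < k) (if e i then X i else 1).
have [k kP] : exists k, (A * (2 * c * k).+1 ^ D < 2 ^ k)%N.
  have [k] := @exp_beats_poly R 2 (A * (2 * c).+1 ^ D)%:R D (ltr1n _ 2).
  rewrite -natrX -natrM -natrX ltr_nat => h; exists k; apply: leq_ltn_trans h.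
  rewrite -[leqRHS]mulnA -expnMn leq_mul2l; apply/orP; right; case: (D) => // D'.
  by rewrite leq_exp2r // mulSn mulnS; lia.
have [e [e' [j [jk ej tl E]]]] : exists (e e' : nat -> bool) j,
   [/\ (j < k)%N, e j != e' j, forall i, (j < i < k)%N -> e i = e' i & B e k = B e' k].
  pose g (f : {ffun 'I_k -> bool}) i := if insub i is Some j then f j else false.
  have [f [f' [ff' E]]] : exists f f', f != f' /\ B (g f) k = B (g f') k.
    apply: contrapT => nE.
    (* After multiplication by [t^-k] the product telescopes to one factor [x] or 1 and one factor
       [t^-1] for each index, of length at most [2 c k]. *)
    pose Q f := B (g f) k * t ^- k.
    have iQ : injective Q.
      move=> f f' /mulIg E; apply/eqP; apply: contrapT => /negP ff'; apply: nE.
      by exists f, f'.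
    have QB f : Q f \in ball S (2 * c * k).
      rewrite /Q; elim: (k) => [|m IHm]; first by rewrite /B big_geq // mul1g invg1 muln0 inE.
      rewrite /B big_nat_recr //= -/(B _ _).
      have -> : B (g f) m * (if g f m then X m else 1) * t ^- m.+1 =
          B (g f) m * t ^- m * ((if g f m then x else 1) * t^-1).
        rewrite expgS invgM -!mulgA; congr (_ * _); rewrite !mulgA; congr (_ * _).
        case: ifP => _; last by rewrite mul1g mulg1.
        by rewrite /X /conjg !mulgA mulgK.
      rewrite (_ : 2 * c * m.+1 = 2 * c * m + (c + c))%N; last by rewrite mulnS; lia.
      apply: ball_mul => //; apply: ball_mul; last by apply: cP; rewrite !inE eqxx orbT.
      by case: ifP => _; [apply: cP; rewrite inE eqxx|apply: ball_one].
    have : (size [seq Q f | f <- enum {: {ffun 'I_k -> bool}}] <= size (ball S (2 * c * k)))%N.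
      apply: uniq_leq_size; first by rewrite map_inj_uniq ?enum_uniq.
      by move=> _ /mapP [f _ ->].
    rewrite size_map -cardE card_ffun card_bool card_ord; apply/negP; rewrite -ltnNge.
    exact: leq_ltn_trans (AP _) kP.
  have exj : exists j, (j < k)%N && (g f j != g f' j).
    apply: contrapT => nE; case/negP: ff'; apply/eqP/ffunP => i.
    apply/eqP; apply: contrapT => /negP ne; apply: nE; exists i; rewrite ltn_ord /=.
    by rewrite /g valK.
  have bj j : (j < k)%N && (g f j != g f' j) -> (j <= k)%N by move=> /andP [/ltnW].
  case: (ex_maxnP exj bj) => j /andP [jk gj] jmax.
  exists (g f), (g f'), j; split=> // i /andP [ji ik]; apply/eqP/negPn/negP => ne.
  by have := jmax i; rewrite ik ne leqNgt ji => /(_ isT).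
have [Xs] : exists Xs, Xs = [seq X i | i <- iota 0 j] by eexists.
have sX := symm_symz [seq X i | i <- iota 0 j].
have sgX := sgen_subgroup sX.
have XB i : (i < j)%N -> sgen (symz [seq X i | i <- iota 0 j]) (X i).
  by move=> ij; apply/sgen_gen/sub_symz/map_f; rewrite mem_iota.
have Bsub (f : nat -> bool) : sgen (symz [seq X i | i <- iota 0 j]) (B f j).
  rewrite /B big_nat; elim/big_ind: _ => [|a b|i /andP [_ ij]].
  - exact: (subgroup1 sgX).
  - exact: (subgroupM sgX).
  - by case: ifP => _; [apply: XB|apply: (subgroup1 sgX)].
move=> _; exists j.
have Xj : sgen (symz [seq X i | i <- iota 0 j]) (X j).
  move: E; rewrite /B !(big_cat_nat (leq0n j) (ltnW jk)) /= !(big_ltn jk).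
  have -> : \prod_(j.+1 <= i < k) (if e i then X i else 1) =
            \prod_(j.+1 <= i < k) (if e' i then X i else 1).
    by apply: eq_big_nat => i h; rewrite tl.
  rewrite -!/(B _ j) !mulgA => /mulIg; case: (e j) (e' j) ej => [] [] // _; rewrite mulg1 => E.
    by apply/(subgroupMl _ sgX (Bsub e)); rewrite E.
  by apply/(subgroupMl _ sgX (Bsub e')); rewrite -E.
have Xall n : sgen (symz [seq X i | i <- iota 0 j]) (X n) /\
    (forall y, sgen (symz [seq X i | i <- iota 0 j]) y ->
      sgen (symz [seq X i | i <- iota 0 j]) (y ^ t)).
  have Jt : forall y, sgen (symz [seq X i | i <- iota 0 j]) y ->
      sgen (symz [seq X i | i <- iota 0 j]) (y ^ t).
    pose U := [set y | sgen (symz [seq X i | i <- iota 0 j]) (y ^ t)].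
    apply: (sgen_symz_sub (A := U)).
      split=> [|y z|y]; rewrite /U /=; first by rewrite conj1g; apply: (subgroup1 sgX).
        by rewrite conjMg; apply: (subgroupM sgX).
      by rewrite conjVg; apply: (subgroupV sgX).
    move=> y /mapP [i]; rewrite mem_iota => /andP [_ ij] ->; rewrite /U /= /X -conjgM -expgSr.
    by have [lt|ge] := ltnP i.+1 j; [apply: XB|rewrite (_ : i.+1 = j) //; lia].
  split=> //; elim: n => [|n IHn].
    by have [j0|j0] := posnP j; [rewrite -{2}j0|apply: XB].
  by rewrite /X expgSr conjgM; apply: Jt.
by move=> n; case: (Xall n).
Qed.

Variable chi : G -> int.
Hypothesis chiM : forall x y, sgen S x -> sgen S y -> chi (x * y) = (chi x + chi y)%R.

Let chi1 : chi 1 = 0%R.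
Proof.
have G1 : sgen S 1 := subgroup1 sG.
have : (chi 1 + chi 1 = chi 1 + 0)%R by rewrite -chiM // mulg1 addr0.
by move=> /addrI.
Qed.

Let chiV x : sgen S x -> chi x^-1 = (- chi x)%R.
Proof.
by move=> Gx; apply/eqP; rewrite -GRing.addr_eq0 -chiM ?mulVg ?chi1 //; apply: (subgroupV sG).
Qed.

Let chiZ x q : sgen S x -> chi (zexp x q) = (chi x * q)%R.
Proof.
move=> Gx; have Gz r : sgen S (zexp x r) by apply: zexp_sub.
elim/int_rect: q => [|n IHn|n IHn]; first by rewrite mulr0 /= chi1.
  by rewrite -[_.+1]addn1 PoszD zexpS chiM // IHn mulrDr mulr1.
have GV := subgroupV sG Gx.
by rewrite -[_.+1]addn1 PoszD opprD zexpB1 chiM // IHn chiV // mulrDr mulrN1.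
Qed.

(** Take [t] with the least positive value of [chi]; every generator is then a kernel element times
    a power of [t]. The conjugates of these kernel elements by powers of [t] generate the kernel,
    and finitely many suffice by [conj_fg] for [t] and for [t^-1]. The products [a * t^i] are
    distinct, so the kernel has one degree of growth less. *)
Theorem kernel_fg D : poly_growth S D.+1 -> (exists2 s, sgen S s & chi s != 0%R) ->
  exists A t, [/\ symm A, poly_growth A D, sgen S t,
    sgen A = [set x | sgen S x /\ chi x = 0%R] &
    forall x, sgen S x -> exists y q, sgen A y /\ x = y * zexp t q].
Proof.
move=> pS [s0 Gs0 chi0].
have exn : exists n, (0 < n)%N && `[< exists2 x, sgen S x & chi x = Posz n >].
  exists `|chi s0|%N; rewrite absz_gt0 chi0; apply/asboolP.
  have [h|h] := leP 0%R (chi s0); first by exists s0; rewrite // gez0_abs.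
  exists s0^-1; first exact: (subgroupV sG).
  by rewrite chiV // ltz0_abs.
case: (ex_minnP exn) => n /andP [n0 /asboolP [t Gt chit]] nmin.
pose q x := (chi x %/ Posz n)%Z.
have Gz r : sgen S (zexp t r) by apply: zexp_sub.
have chiq x : sgen S x -> chi x = (q x * Posz n)%R.
  move=> Gx; rewrite {1}(divz_eq (chi x) n) -/(q x).
  set r := (chi x %% n)%Z; suff -> : r = 0%R by rewrite addr0.
  have Er : chi x = (q x * Posz n + r)%R := divz_eq (chi x) n.
  have r0 : (0 <= r)%R by rewrite modz_ge0 // -lt0n.
  have rn : (r < Posz n)%R by rewrite ltz_pmod.
  apply/eqP/negPn/negP => rn0; have := nmin `|r|%N; rewrite absz_gt0 rn0 /=.
  rewrite gez0_abs // asboolT; last first.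
    exists (x * zexp t (- q x)%R); first exact: (subgroupM sG).
    by rewrite chiM // chiZ // chit Er; ring.
  by move=> /(_ isT); rewrite leqNgt -ltz_nat gez0_abs // rn.
pose kap s := s * zexp t (- q s)%R.
have Gk s : sgen S s -> sgen S (kap s) by move=> Gs; apply: (subgroupM sG).
have chik s : sgen S s -> chi (kap s) = 0%R.
  by move=> Gs; rewrite chiM // chiZ // chit {1}chiq //; ring.
have GV := subgroupV sG Gt.
have exm1 s : exists m, s \in S -> forall n,
    sgen (symz [seq kap s ^ (t ^+ i) | i <- iota 0 m]) (kap s ^ (t ^+ n)).
  have [sS'|nS] := boolP (s \in S); last by exists 0%N.
  by have [m mP] := conj_fg pS (Gk _ (sgen_gen sS')) Gt; exists m.
have [m1 m1P] := choice exm1.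
have exm2 s : exists m, s \in S -> forall n,
    sgen (symz [seq kap s ^ (t^-1 ^+ i) | i <- iota 0 m]) (kap s ^ (t^-1 ^+ n)).
  have [sS'|nS] := boolP (s \in S); last by exists 0%N.
  by have [m mP] := conj_fg pS (Gk _ (sgen_gen sS')) GV; exists m.
have [m2 m2P] := choice exm2.
pose L := flatten [seq [seq kap s ^ (t ^+ i) | i <- iota 0 (m1 s)] ++
                       [seq kap s ^ (t^-1 ^+ i) | i <- iota 0 (m2 s)] | s <- S].
pose A := symz L; have sA : symm A := symm_symz L; have sB := sgen_subgroup sA.
have Gkp s p : s \in S -> sgen A (kap s ^ (t ^+ p)).
  move=> sS'; apply: symz_mono (m1P s sS' p) => y yl.
  by apply/flatten_mapP; exists s; rewrite // mem_cat yl.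
have Gkn s p : s \in S -> sgen A (kap s ^ (t^-1 ^+ p)).
  move=> sS'; apply: symz_mono (m2P s sS' p) => y yl.
  by apply/flatten_mapP; exists s; rewrite // mem_cat yl orbT.
have Jgen (w : G) : (forall y, y \in L -> sgen A (y ^ w)) -> forall y, sgen A y -> sgen A (y ^ w).
  move=> h; apply: (sgen_symz_sub (A := [set y | sgen A (y ^ w)])) => //.
  split=> [|y z|y] /=; first by rewrite conj1g; apply: (subgroup1 sB).
    by rewrite conjMg; apply: (subgroupM sB).
  by rewrite conjVg; apply: (subgroupV sB).
have Jt y : sgen A y -> sgen A (y ^ t).
  apply: Jgen => {}y /flatten_mapP [s sS']; rewrite mem_cat => /orP [] /mapP [i _ ->].
    by rewrite -conjgM -expgSr; apply: Gkp.
  case: i => [|i]; last by rewrite expgSr conjgM conjgKV; apply: Gkn.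
  by rewrite expg0 conjg1 -(expg1 t); apply: Gkp.
have Jv y : sgen A y -> sgen A (y ^ t^-1).
  apply: Jgen => {}y /flatten_mapP [s sS']; rewrite mem_cat => /orP [] /mapP [i _ ->].
    case: i => [|i]; last by rewrite expgSr conjgM conjgK; apply: Gkp.
    by rewrite expg0 conjg1 -(expg1 t^-1); apply: Gkn.
  by rewrite -conjgM -expgSr; apply: Gkn.
have Jz y r : sgen A y -> sgen A (y ^ zexp t r).
  elim/int_rect: r => [|r IHr|r IHr] Ay; first by rewrite /= conjg1.
    by rewrite -[_.+1]addn1 PoszD zexpS conjgM; apply/Jt/IHr.
  by rewrite -[_.+1]addn1 PoszD opprD zexpB1 conjgM; apply/Jv/IHr.
have main x : sgen S x -> exists y r, sgen A y /\ x = y * zexp t r.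
  move=> [p]; elim: p x => [|p IHp] x.
    by rewrite inE => /eqP ->; exists 1, 0%R; rewrite mulg1; split=> //; apply: (subgroup1 sB).
  move=> /ballSP [z [s [/IHp [y [r [Ay ->]]] sS' ->]]].
  exists (y * kap s ^ zexp t (- r)%R), (r + q s)%R; split.
    by apply: (subgroupM sB) => //; apply: Jz; have := Gkp s 0%N sS'; rewrite expg0 conjg1.
  rewrite /kap /conjg zexpD !zexpN invgK !mulgA mulgVK.
  by rewrite mulgVK.
have AK y : sgen A y -> sgen S y /\ chi y = 0%R.
  apply: (sgen_symz_sub (A := [set y | sgen S y /\ chi y = 0%R])).
    split=> [|a b [Ga a0] [Gb b0]|a [Ga a0]]; first by split=> //; apply: (subgroup1 sG).
      by split; [apply: (subgroupM sG)|rewrite chiM // a0 b0].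
    by split; [apply: (subgroupV sG)|rewrite chiV // a0].
  have KJ k w : sgen S k -> chi k = 0%R -> sgen S w -> sgen S (k ^ w) /\ chi (k ^ w) = 0%R.
    move=> Gk' k0 Gw; split; first exact: (subgroupJ sG).
    have GVw := subgroupV sG Gw; have GM := subgroupM sG Gk' Gw.
    by rewrite /conjg !chiM // chiV // k0; ring.
  move=> {}y /flatten_mapP [s /sgen_gen Gs]; rewrite mem_cat.
  by case/orP => /mapP [i _ ->]; apply: KJ; rewrite ?chik //; first [exact: Gk|exact: (subgroupX i sG)].
have chi_t r : chi (zexp t r) = (Posz n * r)%R by rewrite chiZ // chit.
exists A, t; split=> //; last first.
  apply/seteqP; split=> [y /AK //|x [/main [y [r [Ay ->]]]]].
  have [Gy y0] := AK y Ay; rewrite chiM // y0 add0r chi_t => /eqP; rewrite mulf_eq0.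
  have /negbTE -> : Posz n != 0%R by rewrite eqz_nat -lt0n.
  by move=> /= /eqP ->; rewrite mulg1.
have [C CP] := pS.
have [c cP] : exists c, forall y, y \in t :: A -> y \in ball S c.
  apply: (finite_sgen_ball sS) => y; rewrite inE => /orP [/eqP ->//|/sgen_gen/AK []//].
exists (C * (2 * c).+1 ^ D.+1)%N => p.
have tS : t \in ball S c by apply: cP; rewrite mem_head.
have AS a : a \in A -> a \in ball S c by move=> aA; apply: cP; rewrite inE aA orbT.
have : (size (ball A p) * p.+1 <= size (ball S (2 * c * p)))%N.
  have [I [uI sI IP]] : exists I, [/\ uniq I, size I = p.+1 & forall i, i \in I -> (i <= p)%N].
    by exists (iota 0 p.+1); rewrite iota_uniq size_iota; split=> // i; rewrite mem_iota.
  rewrite -{1}sI -(size_allpairs (fun a i => a * t ^+ i)).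
  apply: uniq_leq_size.
    apply: allpairs_uniq; [exact: ball_uniq|exact: uI|].
    move=> [? ?] [? ?] /allpairsP [[a i] [/= aB _ [-> ->]]].
    move=> /allpairsP [[b j] [/= bB _ [-> ->]]] E.
    have [Ga a0] : sgen S a /\ chi a = 0%R by apply: AK; exists p.
    have [Gb b0] : sgen S b /\ chi b = 0%R by apply: AK; exists p.
    have ij : i = j.
      have := congr1 chi E; rewrite !chiM ?a0 ?b0 ?add0r //; try exact: (Gz (Posz _)).
      rewrite -![chi (t ^+ _)]/(chi (zexp t (Posz _))) !chi_t => /mulfI.
      by rewrite eqz_nat -lt0n n0 => /(_ isT) [].
    by rewrite ij in E *; rewrite (mulIg _ _ _ E).
  move=> _ /allpairsP [[a i] [/= aB /IP ip ->]].
  rewrite mul2n -addnn mulnDl; apply: ball_mul; first exact: ball_sub AS _ aB.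
  by apply: (ball_le sS _ (ball_pow _ tS)); rewrite leq_mul2l ip orbT.
move=> /leq_trans /(_ (CP _)) h.
rewrite -(leq_pmul2r (ltn0Sn p)) -[leqRHS]mulnA -expnSr; apply: leq_trans h _.
rewrite -[leqRHS]mulnA -expnMn leq_mul2l leq_exp2r //; apply/orP; right.
by rewrite mulSn mulnS; clear; lia.
Qed.

End Kernel.

(** * Automorphisms of abelian groups with a unipotent power *)

Section Unipotent.
Variable A : zmodType.
Local Open Scope ring_scope.
Implicit Types (X : seq A) (a b x y : A).

Definition addf (s : A -> A) := forall a b, s (a + b) = s a + s b.

Lemma addf0 s : addf s -> s 0 = 0.
Proof. by move=> sD; have := sD 0 0; rewrite addr0 -[X in X = _]addr0 => /addrI. Qed.
Lemma addfN s a : addf s -> s (- a) = - s a.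
Proof. by move=> sD; apply/eqP; rewrite -GRing.addr_eq0 -sD addNr addf0. Qed.
Lemma addfB s a b : addf s -> s (a - b) = s a - s b.
Proof. by move=> sD; rewrite sD addfN. Qed.
Lemma addfMn s a n : addf s -> s (a *+ n) = s a *+ n.
Proof. by move=> sD; elim: n => [|n IHn]; rewrite ?mulr0n ?addf0 // !mulrS sD IHn. Qed.
Lemma addfMz s a n : addf s -> s (a *~ n) = s a *~ n.
Proof.
by move=> sD; case: n => n; rewrite ?NegzE ?mulrNz ?addfN // -!pmulrn addfMn.
Qed.
Lemma addf_icomb s X c : addf s -> s (icomb X c) = \sum_(i < size X) s X`_i *~ c i.
Proof.
move=> sD; rewrite /icomb (big_morph s sD (addf0 sD)).
by apply: eq_bigr => i _; rewrite addfMz.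
Qed.
Lemma addf_iter s n : addf s -> addf (iter n s).
Proof. by move=> sD; elim: n => // n IHn a b; rewrite !iterS IHn sD. Qed.

Definition dlt (s : A -> A) m a := iter m s a - a.

Lemma addf_dlt s m : addf s -> addf (dlt s m).
Proof. by move=> sD a b; rewrite /dlt (addf_iter m sD) opprD addrACA. Qed.

(** [s^(nm) - 1] is a multiple of [s^m - 1], and the two factors commute. *)
Lemma dlt_mul s m k (n : nat) : addf s -> (forall a, iter k (dlt s m) a = 0) ->
  forall a, iter k (dlt s (n * m)) a = 0.
Proof.
move=> sD h a; have D1 := addf_dlt m sD; have S1 := addf_iter m sD.
have comm j b : iter j (dlt s m) (iter m s b) = iter m s (iter j (dlt s m) b).
  by elim: j b => // j IHj b; rewrite !iterSr -IHj; congr iter; rewrite /dlt addfB.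
have step j b : iter j.+1 (dlt s m) b = 0 -> iter j (dlt s m) (dlt s (n * m) b) = 0.
  move=> hb; have Dj := addf_iter j D1.
  elim: n => [|p IHp]; first by rewrite mul0n /dlt subrr addf0.
  have -> : dlt s (p.+1 * m) b = dlt s (p * m) (iter m s b) + dlt s m b.
    by rewrite /dlt mulSn addnC iterD subrKA.
  rewrite Dj -[iter j _ (dlt s m b)]iterSr hb addr0.
  have -> : dlt s (p * m) (iter m s b) = iter m s (dlt s (p * m) b).
    by rewrite /dlt addfB // -!iterD addnC.
  by rewrite comm IHp addf0.
elim: k a {h} (h a) => // k IHk a ha; rewrite iterSr; apply: IHk; exact: step.
Qed.

Variables (X : seq A) (s s' : A -> A) (C : nat).
Hypotheses (gX : forall a, ispan X a) (sD : addf s) (sK : cancel s s') (sK' : cancel s' s).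
Hypothesis rel : forall m, (0 < m)%N -> exists k, forall x, x \in X ->
  exists (i a : nat) (e e' : nat -> nat), [/\ (i < k)%N, (0 < a < C)%N &
    iter i.+1 (dlt s m) x *+ a + \sum_(i.+1 <= j < k) iter j.+1 (dlt s m) x *+ e j =
    \sum_(i.+1 <= j < k) iter j.+1 (dlt s m) x *+ e' j].

(** [A / NA] is finite, so two powers of [s] agree on the generators modulo [N]; invertibility of
    [s] cancels the smaller one. *)
Lemma power_trivial_mod N : (0 < N)%N -> exists2 m, (0 < m)%N &
  forall a, exists y, dlt s m a = y *+ N.
Proof.
move=> N0; pose r := size X; have [c cP] := choice gX.
have [N' NE] : exists N', N = N'.+1 by exists N.-1; rewrite prednK.
pose code (j : nat) : {ffun 'I_r * 'I_r -> 'I_N'.+1} :=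
  [ffun q : 'I_r * 'I_r => inord (absz (c (iter j s X`_q.1) q.2 %% N%:Z)%Z)].
have [i [j [ij E]]] : exists i j, (i < j)%N /\ code i = code j.
  apply: contrapT => nE.
  have ic : injective (fun i : 'I_#|{: {ffun 'I_r * 'I_r -> 'I_N'.+1}}|.+1 => code i).
    move=> i j E; apply: val_inj; case: (ltngtP (val i) (val j)) => // lt; case: nE.
      by exists i, j.
    by exists j, i; split.
  by have := leq_card _ ic; rewrite card_ord ltnn.
exists (j - i)%N; first by rewrite subn_gt0.
have gen (p : 'I_r) : exists y, iter j s X`_p - iter i s X`_p = y *+ N.
  exists (icomb X (fun q => (c (iter j s X`_p) q - c (iter i s X`_p) q) %/ N%:Z)%Z).
  rewrite pmulrn -icombZ {1}(cP (iter j s X`_p)) {1}(cP (iter i s X`_p)) -icombB.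
  rewrite /icomb; apply: eq_bigr => q _; congr (_ *~ _).
  have := congr1 (fun f : {ffun 'I_r * 'I_r -> 'I_N'.+1} => val (f (p, q))) E.
  rewrite !ffunE /= => E1; have lt z : (`|(z %% N%:Z)%Z| < N'.+1)%N.
    by rewrite -NE -ltz_nat gez0_abs ?modz_ge0 ?ltz_pmod // ?ltz_nat // eqz_nat -lt0n.
  rewrite !inordK // in E1; apply/esym/divzK.
  have m0 z : 0 <= (z %% N%:Z)%Z by rewrite modz_ge0 // eqz_nat -lt0n.
  have E2 : (c (iter i s X`_p) q %% N%:Z)%Z = (c (iter j s X`_p) q %% N%:Z)%Z.
    by rewrite -[LHS]gez0_abs // E1 gez0_abs.
  by rewrite -eqz_mod_dvd E2.
move=> a; have [ca ->] := gX a.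
have Dm := addf_dlt (j - i) sD; rewrite (addf_icomb X ca Dm).
have sKi n : cancel (iter n s) (iter n s').
  by elim: n => // n IHn b; rewrite [iter _ s b]iterS iterSr sK IHn.
have sKi' n : cancel (iter n s') (iter n s).
  by elim: n => // n IHn b; rewrite [iter _ s' b]iterS iterSr sK' IHn.
have genI (p : 'I_r) : exists y, dlt s (j - i) X`_p = y *+ N.
  have [y yE] := gen p; exists (iter i s' y); apply: (can_inj (sKi i)).
  rewrite addfMn ?sKi'; last exact: addf_iter.
  rewrite -yE /dlt addfB; last exact: addf_iter.
  by rewrite -iterD subnKC // ltnW.
have [f fP] := choice genI; exists (\sum_p f p *~ ca p).
by rewrite -sumrMnl; apply: eq_bigr => p _; rewrite fP pmulrn mulrzAC -pmulrn.
Qed.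

(** Choose a prime [l > C] and [m] with [s^m = 1] modulo [e l]. Then [s^m - 1] raises the
    divisibility by [l], so in the relation all terms but the first are more divisible than the
    first. Its coefficient [a < C] is prime to [l], hence the first term is divisible by all powers
    of [l]. The factor [e] places it in a free subgroup, where this means zero. *)
Theorem unipotent_power : exists m K, (0 < m)%N /\ forall a, iter K (dlt s m) a = 0.
Proof.
have [|Z [e [_ iZ e0 eX]]] := @max_indep A [::] X.
  by move=> c _ i.
rewrite cat0s in iZ eX.
have eA a : ispan Z (a *+ e).
  have [c ->] := gX a; rewrite /icomb -sumrMnl.
  elim/big_ind: _ => [||i _]; first exact: ispan0.
    exact: ispanD.
  by rewrite pmulrn mulrzAC -pmulrn; apply/ispanZ/eX/mem_nth.
have [l Cl pl] := prime_above C; have l1 := prime_gt1 pl.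
have el0 : (0 < e * l)%N by rewrite muln_gt0 e0 prime_gt0.
have [m m0 mP] := power_trivial_mod el0.
have [k kP] := rel m0; exists m, k; split=> //.
set dl := dlt s m in mP kP *; have dD : addf dl := addf_dlt m sD.
pose In n a := exists y, a = y *+ (e * l ^ n).
have In0 n : In n 0 by exists 0; rewrite mul0rn.
have InD n a b : In n a -> In n b -> In n (a + b).
  by move=> [y ->] [z ->]; exists (y + z); rewrite mulrnDl.
have InB n a b : In n a -> In n b -> In n (a - b).
  by move=> [y ->] [z ->]; exists (y - z); rewrite mulrnBl.
have InM n a p : In n a -> In n (a *+ p) by move=> [y ->]; exists (y *+ p); rewrite mulrnAC.
have InS n a : In n a -> In n.+1 (dl a).
  move=> [y ->]; rewrite addfMn //; have [z ->] := mP y.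
  by exists (z *+ e); rewrite -!mulrnA expnS; congr (_ *+ _); ring.
have InW n a : In n.+1 a -> In n a.
  by move=> [y ->]; exists (y *+ l); rewrite -mulrnA expnS mulnCA.
have Inter n i a : In n a -> In (n + i)%N (iter i dl a).
  by move=> h; elim: i => [|i IHi]; rewrite ?addn0 //= addnS; apply: InS.
have Inw n i a : In (n + i)%N a -> In n a.
  by elim: i => [|i IHi]; rewrite ?addn0 // addnS => /InW.
have Inf a : (forall n, In n a) -> a = 0.
  move=> ha; have [y0 E0] := ha 0%N; rewrite expn0 muln1 in E0.
  have [c cE] := eA y0; rewrite -E0 in cE; rewrite cE /icomb big1 // => q _.
  suff -> : c q = 0 by rewrite mulr0z.
  have [y E] := ha `|c q|%N; have [d dE] := eA y.
  have E2 : icomb Z c = icomb Z (fun i => d i * (l ^ `|c q|)%:Z).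
    by rewrite icombZ -dE -cE E mulrnA pmulrn.
  have := indep_inj iZ E2 (ltn_ord q) => E3; apply/eqP/negPn/negP => c0.
  have d0 : d q != 0 by apply: contraNneq c0 => d0; rewrite E3 d0 mul0r.
  have : (l ^ `|c q| <= `|c q|)%N by rewrite [in leqRHS]E3 abszM /= leq_pmull // absz_gt0.
  by rewrite leqNgt ltn_expl.
have key x : x \in X -> iter k dl x = 0.
  move=> /kP [i [a [f [f' [ik /andP [a0 aC] E]]]]].
  suff v0 : iter i.+1 dl x = 0.
    by rewrite -(subnK ik) iterD v0; elim: (k - i.+1)%N => //= p ->; rewrite addf0.
  apply: Inf; elim=> [|n IHn].
    have h1 : In 1%N (dl x) by have [z ->] := mP x; exists z; rewrite expn1.
    by rewrite iterSr; apply: (Inw 0%N i.+1); rewrite add0n; have := Inter _ i _ h1; rewrite add1n.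
  have tl (g : nat -> nat) : In n.+1 (\sum_(i.+1 <= j < k) iter j.+1 dl x *+ g j).
    rewrite big_nat; elim/big_ind: _ => [//|//|j /andP [ij _]]; first exact: InD.
    apply: InM; have := Inter n (j - i)%N _ IHn; rewrite -iterD.
    rewrite (_ : (j - i + i.+1 = j.+1)%N); last by rewrite addnS subnK // ltnW.
    rewrite (_ : (n + (j - i) = n.+1 + (j - i.+1))%N); first exact: Inw.
    by rewrite addSnnS -subSn.
  have h1 : In n.+1 (iter i.+1 dl x *+ a).
    by rewrite -[X in In _ X](addrK (\sum_(i.+1 <= j < k) iter j.+1 dl x *+ f j)) E; apply: InB.
  have cop : coprime a l.
    rewrite coprime_sym prime_coprime // gtnNdvd //; exact: ltn_trans Cl.
  have [u w uw _] := egcdnP l a0; rewrite (eqP cop) in uw.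
  have -> : iter i.+1 dl x = iter i.+1 dl x *+ a *+ u - iter i.+1 dl x *+ l *+ w.
    by rewrite -!mulrnA (mulnC a) uw (mulnC l) mulrnDr mulr1n addrAC subrr add0r.
  apply: InB; apply: InM => //; have [y ->] := IHn; exists y.
  by rewrite -mulrnA expnS; congr (_ *+ _); ring.
move=> a; have [c ->] := gX a.
rewrite (addf_icomb X c (addf_iter k dD)) big1 // => i _.
by rewrite key ?mul0rz // mem_nth.
Qed.

End Unipotent.

(** * Extending a nilpotent group by a cyclic one *)

Section CyclicExtension.
Variables (G : groupType) (S T3 : seq G) (D k : nat) (t : G).
Local Open Scope group_scope.
Hypotheses (sS : symm S) (pS : poly_growth S D) (sT : symm T3).
Hypotheses (TS : sgen T3 `<=` sgen S) (Gt : sgen S t).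
Hypothesis VJ : forall z g, sgen T3 z -> sgen S g -> sgen T3 (z ^ g).
Hypothesis Tk : forall x, x \in lcl T3 k -> x = 1.
Let sG := sgen_subgroup sS.
Let sV := sgen_subgroup sT.

Lemma subgroup1_set : subgroup [set 1 : G].
Proof.
split=> [//|x y -> ->|x ->]; first by rewrite /= mulg1.
by rewrite /= invg1.
Qed.
Let s1 := subgroup1_set.
Let V1 : [set 1] `<=` sgen T3. Proof. by move=> x ->; apply: (subgroup1 sV). Qed.
Let J1 z u : [set 1 : G] z -> u \in T3 -> [set 1 : G] (z ^ u).
Proof. by move=> -> _ /=; rewrite conj1g. Qed.
Local Notation DV := (lcs T3 [set 1]).
Let sD i : subgroup (DV i). Proof. exact: lcs_subgroup. Qed.
Let DV0 : DV 0 = sgen T3. Proof. exact: (lcs0 sT V1). Qed.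
Let DVV i : DV i `<=` sgen T3. Proof. exact: (lcs_sgen sT V1). Qed.
Let DVRG i x y : DV i x -> sgen T3 y -> DV i.+1 [~ x, y].
Proof. exact: (lcsRG sT s1 V1 J1). Qed.
Let DVk : DV k = [set 1].
Proof. exact: (lcs_eq s1 J1 Tk). Qed.

Lemma lcs_normal i x g : DV i x -> sgen S g -> DV i (x ^ g).
Proof.
move=> Dx Gg; have h j y : y \in lcl T3 j -> DV j (y ^ g).
  elim: j y => [|j IHj] y; first by move=> yT; rewrite DV0; apply: VJ Gg; apply: sgen_gen.
  move=> /allpairsP [[z u] [/IHj /= Dz uT ->]]; rewrite conjRg; apply: DVRG => //.
  by apply: VJ Gg; apply: sgen_gen.
suff : DV i `<=` [set x | DV i (x ^ g)] by apply.
apply: lcs_min => [|j y ij /h|z ->] /=; last by rewrite conj1g; apply: (subgroup1 (sD i)).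
  split=> [|y z /= Dy Dz|y /= Dy]; rewrite /= ?conj1g ?conjMg ?conjVg.
  - exact: (subgroup1 (sD i)).
  - exact: (subgroupM (sD i)).
  - exact: (subgroupV (sD i)).
exact: (lcs_le ij).
Qed.

Lemma lcs_comm i x g : DV i x -> sgen S g -> DV i [~ x, g].
Proof.
move=> Dx Gg; rewrite /commg; apply: (subgroupM (sD i)); first exact: (subgroupV (sD i)).
exact: lcs_normal.
Qed.

Lemma lcs_comm_iter i x g n : DV i x -> sgen S g -> DV i (iter n (fun y => [~ y, g]) x).
Proof. by move=> Dx Gg; elim: n => //= n IHn; apply: lcs_comm. Qed.

(** Conjugation by [t] is an automorphism of the layer [D i / D i.+1], on which the iterates of
    [t^m - 1] are classes of iterated commutators with [t^m]; [chain_relation] for these provides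
    the hypothesis of [unipotent_power]. Having all multiples of [m] permits one exponent for all
    layers. *)
Lemma lcs_unipotent i : exists m K, (0 < m)%N /\ forall n x, DV i x ->
  DV i.+1 (iter K (fun y => [~ y, t ^+ (n * m)]) x).
Proof.
have [Q [pi [piM pi0 piS gQ]]] := lcs_quotient sT s1 V1 J1 i.
have pi1 : pi 1 = 0%R by apply/pi0; apply: (subgroup1 (sD _)).
have piV x : DV i x -> pi x^-1 = (- pi x)%R.
  move=> Dx; apply/eqP; rewrite -GRing.addr_eq0 -piM ?mulVg ?pi1 //.
  exact: (subgroupV (sD i)).
have piX x n : DV i x -> pi (x ^+ n) = (pi x *+ n)%R.
  move=> Dx; elim: n => [|n IHn]; first by rewrite expg0 pi1 mulr0n.
  by rewrite expgS piM ?IHn ?mulrS //; apply: (subgroupX _ (sD i)).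
have piP (h : nat -> G) e a b : (forall j, DV i (h j)) ->
    pi (\prod_(a <= j < b) h j ^+ e j) = (\sum_(a <= j < b) pi (h j) *+ e j)%R.
  move=> Dh; have Dp (r : seq nat) : DV i (\prod_(j <- r) h j ^+ e j).
    by apply: (subgroup_prod (sD i)) => j _; apply: (subgroupX _ (sD i)).
  elim: (index_iota a b) => [|j r IHr]; first by rewrite !big_nil.
  by rewrite !big_cons piM ?IHr ?piX //; apply: (subgroupX _ (sD i)).
have piJ g x y : sgen S g -> DV i x -> DV i y -> pi x = pi y -> pi (x ^ g) = pi (y ^ g).
  move=> Gg Dx Dy E; apply/eqP; rewrite -subr_eq0; apply/eqP.
  have Dx' := lcs_normal Dx Gg; have Dy' := lcs_normal Dy Gg.
  have DyV := subgroupV (sD i) Dy.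
  rewrite -piV // -piM //; last exact: (subgroupV (sD i)).
  rewrite -conjVg -conjMg pi0; last by apply: lcs_normal Gg; apply: (subgroupM (sD i)).
  apply: lcs_normal Gg; apply/pi0; first exact: (subgroupM (sD i)).
  by rewrite piM // piV // E subrr.
have ex q : exists x, DV i x /\ pi x = q by have [x] := piS q; exists x.
have [lift liftP] := choice ex.
pose s g q := pi (lift q ^ g).
have sE g x : sgen S g -> DV i x -> s g (pi x) = pi (x ^ g).
  by move=> Gg Dx; have [Dl El] := liftP (pi x); apply: piJ.
have sA g : sgen S g -> addf (s g).
  move=> Gg a b; have [Da <-] := liftP a; have [Db <-] := liftP b.
  rewrite -piM // !sE //; last exact: (subgroupM (sD i)).
  by rewrite conjMg piM //; apply: lcs_normal.
have GtV := subgroupV sG Gt.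
have sK : cancel (s t) (s t^-1).
  by move=> a; have [Da <-] := liftP a; rewrite !sE ?conjgK //; apply: lcs_normal.
have sK' : cancel (s t^-1) (s t).
  by move=> a; have [Da <-] := liftP a; rewrite !sE ?conjgKV //; apply: lcs_normal.
have GtX n : sgen S (t ^+ n) := subgroupX n sG Gt.
have iterE n x : DV i x -> iter n (s t) (pi x) = pi (x ^ (t ^+ n)).
  move=> Dx; elim: n => [|n IHn]; first by rewrite expg0 conjg1.
  by rewrite iterS IHn sE ?expgSr ?conjgM //; apply: lcs_normal.
have dltE m x : DV i x -> dlt (s t) m (pi x) = pi [~ x, t ^+ m].
  move=> Dx; have DxV := subgroupV (sD i) Dx; have Dxm := lcs_normal Dx (GtX m).
  by rewrite /dlt iterE // /commg (piM x^-1) // piV // addrC.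
have idltE m n x : DV i x ->
    iter n (dlt (s t) m) (pi x) = pi (iter n (fun y => [~ y, t ^+ m]) x).
  by move=> Dx; elim: n => //= n ->; rewrite dltE //; apply: lcs_comm_iter.
pose X := [seq pi x | x <- lcl T3 i].
have rel m : (0 < m)%N -> exists k, forall x, x \in X -> exists (i a : nat) (e e' : nat -> nat),
    [/\ (i < k)%N, (0 < a < 4 ^ D.+1)%N &
    iter i.+1 (dlt (s t) m) x *+ a + \sum_(i.+1 <= j < k) iter j.+1 (dlt (s t) m) x *+ e j =
    \sum_(i.+1 <= j < k) iter j.+1 (dlt (s t) m) x *+ e' j]%R.
  move=> _.
  have [c cP] : exists c, forall x, x \in t ^+ m :: lcl T3 i -> x \in ball S c.
    apply: (finite_sgen_ball sS) => x; rewrite inE => /orP [/eqP ->|/(lcl_sgen sT)/TS] //.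
  have [l lP] := chain_relation sS pS (4 * c).
  exists l => q /mapP [x xl ->]; have Dx : DV i x by apply: lcs_lcl xl.
  pose h j := iter j.+1 (fun y => [~ y, t ^+ m]) x.
  have [|j [a [e [e' [jl a0 _ _ E]]]]] := lP h.
    elim=> [|j IHj].
      rewrite (_ : (4 * c * 4 ^ 0 = 2 * (c + c))%N); last by rewrite expn0; clear; lia.
      by apply: ball_comm => //; apply: cP; rewrite inE ?xl ?orbT ?eqxx.
    have := ball_comm sS IHj (cP _ (mem_head _ _)); apply: (ball_le sS).
    by rewrite expnS; have := expn_gt0 4 j; move: (4 ^ j)%N; clear; nia.
  have Dh p : DV i (h p) by apply: lcs_comm_iter.
  exists j, a, e, e'; split=> //.
  rewrite idltE // -/(h j) -piX //.
  rewrite (eq_bigr (fun p => pi (h p) *+ e p)%R); last by move=> p _; rewrite idltE.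
  rewrite [RHS](eq_bigr (fun p => pi (h p) *+ e' p)%R); last by move=> p _; rewrite idltE.
  rewrite -!piP // -E piM //; first exact: (subgroupX _ (sD i)).
  by apply: (subgroup_prod (sD i)) => p _; apply: (subgroupX _ (sD i)).
have [m [K [m0 mK]]] := unipotent_power gQ (sA t Gt) sK sK' rel.
exists m, K; split=> // n x Dx; apply/pi0; first exact: lcs_comm_iter.
by rewrite -idltE //; apply: dlt_mul => //; apply: sA.
Qed.

Lemma lcs_unipotent_all : exists m K, (0 < m)%N /\ forall i x, (i < k)%N -> DV i x ->
  DV i.+1 (iter K (fun y => [~ y, t ^+ m]) x).
Proof.
suff [m [K [m0 h]]] : exists m K, (0 < m)%N /\ forall n i x, (i < k)%N -> DV i x ->
    DV i.+1 (iter K (fun y => [~ y, t ^+ (n * m)]) x).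
  by exists m, K; split=> // i x ik Dx; have := h 1%N i x ik Dx; rewrite mul1n.
elim: {1}k => [|k' [m [K [m0 h]]]]; first by exists 1%N, 0%N.
have [m' [K' [m0' h']]] := lcs_unipotent k'.
exists (m * m')%N, (K + K')%N; split=> [|n i x]; first by rewrite muln_gt0 m0.
have GtX p : sgen S (t ^+ p) := subgroupX p sG Gt.
rewrite ltnS leq_eqVlt => /orP [/eqP ->|ik] Dx.
  by rewrite iterD mulnA; apply: lcs_comm_iter => //; apply: h'.
rewrite addnC iterD (_ : (n * (m * m') = n * m' * m)%N); last by rewrite -mulnA (mulnC m').
by apply: lcs_comm_iter => //; apply: h.
Qed.

(** The symmetric generating list also contains [u^-1]. On a layer [u^-1 - 1] is [-(u - 1)] followed
    by the automorphism [u^-1], which commutes with [u - 1]. *)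
Lemma comm_inv_unipotent i n x u : DV i x -> sgen S u ->
  DV i.+1 (iter n.+1 (fun y => [~ y, u]) x) ->
  DV i.+1 (iter n (fun y => [~ y, u]) [~ x, u^-1]).
Proof.
move=> Dx Gu; rewrite iterSr commVr; set c := fun y => _.
have Dy := lcs_comm Dx Gu; move: Dy; set y := [~ x, u] => Dy hy.
have GuV := subgroupV sG Gu.
have cJ j z : iter j c (z ^ u^-1) = iter j c z ^ u^-1.
  by elim: j => //= j ->; rewrite /c conjRg (conjgE u) invgK mulgV mulg1.
have [Q [pi [piM pi0 piS gQ]]] := lcs_quotient sT s1 V1 J1 i.
have pi1 : pi 1 = 0%R by apply/pi0; apply: (subgroup1 (sD _)).
have Dc j z : DV i z -> DV i (iter j c z) by move=> Dz; apply: lcs_comm_iter.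
have piJ z w : DV i z -> DV i w -> pi (z ^ w) = pi z.
  move=> Dz Dw; have Dzw := DVRG Dz (DVV Dw); have Dzw' := lcs_le (leqnSn i) Dzw.
  by rewrite conjR piM // (_ : pi [~ z, w] = 0%R) ?addr0 //; apply/pi0.
have step z w : DV i z -> DV i w -> pi (z * w) = 0%R -> pi (c z * c w) = 0%R.
  move=> Dz Dw /pi0 h; have Dzw := subgroupM (sD i) Dz Dw.
  have Dcz := Dc 1%N z Dz; have Dcw := Dc 1%N w Dw.
  rewrite piM // -(piJ (c z) w) // -piM //; last exact: (subgroupJ (sD i)).
  rewrite -commMl; apply/pi0; first exact: lcs_comm.
  by apply: lcs_comm Gu; apply: h.
have Dz : DV i (y ^ u^-1) by apply: lcs_normal.
have DzV := subgroupV (sD i) Dz.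
have : pi (iter n c (y ^ u^-1)^-1 * iter n c (y ^ u^-1)) = 0%R.
  elim: n {hy} => [|n IHn]; first by rewrite /= mulVg.
  by apply: step => //; apply: Dc.
move/pi0 => /(_ (subgroupM (sD i) (Dc _ _ DzV) (Dc _ _ Dz))).
rewrite cJ => h; have hz := lcs_normal hy GuV.
by have [h1 _] := subgroupMr (iter n c (y ^ u^-1)^-1) (sD i.+1) hz; apply: h1.
Qed.

(** Only a power [u = t^m] is known to act unipotently, so only that power is adjoined. Commutators
    of two letters lie in [sgen T3]. From then on [K] further letters push a commutator at least one
    layer down: a letter of [T3] does so at once, and each letter [u] or [u^-1] uses up one of the
    [K] applications of [u - 1]. *)
Lemma cyclic_extension : exists T4 m k', (0 < m)%N /\ [/\ symm T4, sgen T3 `<=` sgen T4,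
  forall q, sgen T4 (zexp t (q * m%:Z)%R), sgen T4 `<=` sgen S & forall x, x \in lcl T4 k' -> x = 1].
Proof.
have [m [K [m0 mK]]] := lcs_unipotent_all; pose u := t ^+ m.
have Gu : sgen S u := subgroupX m sG Gt; have GuV := subgroupV sG Gu.
have s4 := symm_symz (u :: T3); have sg4 := sgen_subgroup s4.
exists (symz (u :: T3)), m, (1 + k * K)%N.
have T4u : sgen (symz (u :: T3)) u by apply/sgen_gen/sub_symz/mem_head.
split=> //; split=> // [|q||x].
- apply: sgen_min => // x xT; apply/sgen_gen/sub_symz; by rewrite inE xT orbT.
- elim/int_rect: q => [|n IHn|n IHn]; first by rewrite mul0r; apply: (subgroup1 sg4).
    by rewrite -[n.+1]addn1 PoszD mulrDl mul1r zexpD; apply: (subgroupM sg4).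
  rewrite -[n.+1]addn1 PoszD opprD mulrDl mulN1r zexpD zexpN; apply: (subgroupM sg4) => //.
  exact: (subgroupV sg4).
- apply: sgen_symz_sub => // y; rewrite inE => /orP [/eqP ->//|yT].
  by apply: TS; apply: sgen_gen.
have T4P z : z \in symz (u :: T3) -> [\/ sgen T3 z, z = u | z = u^-1].
  rewrite mem_symz !inE => /or3P [/eqP ->|/orP [/eqP ->|zT]|/orP [/eqP zE|zT]].
  - by constructor 1; apply: (subgroup1 sV).
  - by constructor 2.
  - by constructor 1; apply: sgen_gen.
  - by constructor 3; rewrite -zE invgK.
  - by constructor 1; rewrite -[z]invgK; apply: (subgroupV sV); apply: sgen_gen.
have T4G z : z \in symz (u :: T3) -> sgen S z by move=> /T4P [/TS||] // ->.
suff h i : (i <= k)%N -> forall y, y \in lcl (symz (u :: T3)) (1 + i * K) -> DV i y.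
  by move=> /(h k (leqnn k)); rewrite DVk.
elim: i => [_|i IHi ik] y.
  move=> /allpairsP [[a b] [/= aT bT ->]]; rewrite DV0.
  have [Va|na] := pselect (sgen T3 a).
    by rewrite -DV0; apply: lcs_comm; rewrite ?DV0 //; apply: T4G.
  have [Vb|nb] := pselect (sgen T3 b).
    rewrite -[X in sgen T3 X]invgK invgR; apply: (subgroupV sV).
    by rewrite -DV0; apply: lcs_comm; rewrite ?DV0 //; apply: T4G.
  have c1 : [~ a, b] = 1.
    apply/eqP/commgP; rewrite /commute.
    by case: (T4P _ aT) na => // -> _; case: (T4P _ bT) nb => // -> _; rewrite ?mulgV ?mulVg.
  by rewrite c1; apply: (subgroup1 sV).
have {}IHi := IHi (ltnW ik).
suff h j : (j <= K)%N -> forall y, y \in lcl (symz (u :: T3)) (1 + i * K + j) ->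
    DV i y /\ DV i.+1 (iter (K - j) (fun y => [~ y, u]) y).
  by rewrite mulSn addnA addnAC => /(h K (leqnn K)) [_]; rewrite subnn.
elim: j {y} => [_ y|j IHj jK y].
  by rewrite addn0 subn0 => /IHi Dy; split=> //; apply: mK.
have {}IHj := IHj (ltnW jK).
rewrite addnS => /allpairsP [[a b] [/IHj /= [Da hb] bT ->]].
have KE : (K - j = (K - j.+1).+1)%N by clear -jK; lia.
split; first by apply: lcs_comm Da _; apply: T4G.
case: (T4P _ bT) => [Vb|bE|bE].
- by apply: lcs_comm_iter => //; apply: DVRG.
- by rewrite bE -iterSr -KE.
- by rewrite bE; apply: comm_inv_unipotent => //; rewrite -KE.
Qed.

End CyclicExtension.

(** * Virtual nilpotency by induction on the growth degree *)

Section VirtuallyNilpotent.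
Local Open Scope group_scope.

Lemma bounded_balls_fin_index (G : groupType) (S : seq G) M : symm S -> (forall x, sgen S x) ->
  (forall n, size (ball S n) <= M)%N -> fin_index (sgen [:: 1 : G]) setT.
Proof.
move=> sS gS SM; have s1 : symm [:: 1 : G] by split; rewrite /= ?inE ?invg1.
apply: (fin_index_pigeonhole (N := M)) => [|g]; first exact: sgen_subgroup.
have [c cP] := finite_sgen_ball sS (fun x (_ : x \in mkseq g M.+1) => gS x).
have : ~~ uniq (mkseq g M.+1).
  by apply/negP => /uniq_leq_size /(_ cP); rewrite size_mkseq leqNgt ltnS SM.
move=> /(uniqPn 1) [i [j [ij]]]; rewrite size_mkseq => jM E; exists i, j.
rewrite ij -ltnS jM; split=> //; rewrite !nth_mkseq // in E; last exact: ltn_trans jM.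
by rewrite E mulgV; exists 0%N; rewrite inE.
Qed.

(** Two of the first [size r + 1] powers of [x] share a representative, so some exponent between 1
    and [size r], a divisor of the factorial, brings [x] into [N]. *)
Lemma fin_index_fact_exp (G : groupType) (N K : set G) (r : seq G) : subgroup N -> subgroup K ->
  (forall x, K x -> exists2 y, y \in r & N (x * y^-1)) -> forall x, K x -> N (x ^+ (size r)`!).
Proof.
move=> sN sK rP x Kx; have ex i : exists y, y \in r /\ N (x ^+ i * y^-1).
  by have [y] := rP _ (subgroupX i sK Kx); exists y.
have [f fP] := choice ex.
have : ~~ uniq (mkseq f (size r).+1).
  have sub : {subset mkseq f (size r).+1 <= r} by move=> y /mapP [i _ ->]; case: (fP i).
  by apply/negP => u; have := uniq_leq_size u sub; rewrite size_mkseq ltnn.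
move=> /(uniqPn 1) [i [j [ij]]]; rewrite size_mkseq => jr E.
rewrite !nth_mkseq // in E; last exact: ltn_trans jr.
have [_ Ni] := fP i; have [_ Nj] := fP j; rewrite E in Ni.
have := subgroupM sN Nj (subgroupV sN Ni).
rewrite invgM invgK mulgA mulgVK -{1}(subnK (ltnW ij)) expgnDr mulgK => Nx.
have /dvdnP [q ->] : (j - i %| (size r)`!)%N.
  by apply: dvdn_fact; rewrite subn_gt0 ij /= (leq_trans (leq_subr _ _)) // -ltnS.
by rewrite mulnC expgnA; apply: (subgroupX q sN).
Qed.

Section Step.
Variables (G : groupType) (S T2 : seq G) (D k : nat) (t : G) (K : set G).
Hypotheses (sS : symm S) (pS : poly_growth S D) (sT : symm T2).
Hypotheses (sK : subgroup K) (KS : K `<=` sgen S) (Gt : sgen S t).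
Hypothesis KJ : forall z g, K z -> sgen S g -> K (z ^ g).
Hypotheses (TK : sgen T2 `<=` K) (fT : fin_index (sgen T2) K).
Hypothesis Tk : forall x, x \in lcl T2 k -> x = 1.
Hypothesis Kt : forall x, sgen S x -> exists y q, K y /\ x = y * zexp t q.
Let sG := sgen_subgroup sS.
Let sN := sgen_subgroup sT.

(** [sgen T2] need not be normalized by [t]. The subgroup [V] generated by the [M]-th powers of the
    elements of [K] is normalized, it lies in [sgen T2], and it still has finite index by
    [nilpotent_torsion]. *)
Lemma cyclic_extension_virt_nilpotent :
  exists T k', [/\ symm T, sgen T `<=` sgen S, fin_index (sgen T) (sgen S) &
    forall x, x \in lcl T k' -> x = 1].
Proof.
have [r rP] := fT; pose M := (size r)`!; have M0 : (0 < M)%N by apply: fact_gt0.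
have KM := fin_index_fact_exp sN sK rP.
pose V := sgp [set z | exists2 x, K x & z = x ^+ M].
have sV : subgroup V by apply: sgp_subgroup.
have VN : V `<=` sgen T2 by apply: sgp_min => // z [x Kx ->]; apply: KM.
have VJ z g : V z -> sgen S g -> V (z ^ g).
  move=> Vz Gg; suff : V `<=` [set z | V (z ^ g)] by apply.
  apply: sgp_min => [|_ [x Kx ->]].
    split=> [|y w /= Vy Vw|y /= Vy]; rewrite /= ?conj1g ?conjMg ?conjVg.
    - exact: (subgroup1 sV).
    - exact: (subgroupM sV).
    - exact: (subgroupV sV).
  by apply: sub_sgp; exists (x ^ g); [apply: KJ|rewrite conjXg].
have VT z u : V z -> u \in T2 -> V (z ^ u) by move=> Vz uT; apply: VJ => //; apply/KS/TK/sgen_gen.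
have fV : fin_index V (sgen T2).
  apply: (@nilpotent_torsion _ T2 V sT sV VN VT k) => [x /Tk ->|u uT].
    exact: (subgroup1 sV).
  exists M => //; apply: lcs_sub; apply: sub_sgp; exists u => //.
  by apply/TK/sgen_gen.
have fVK : fin_index V K by apply: fin_index_trans fT.
have [T3 [r3 [s3 VE _]]] := fin_index_gens sV sT VN fV.
have s1 := subgroup1_set G.
have V1 : [set 1 : G] `<=` sgen T2 by move=> x ->; apply: (subgroup1 sN).
have J1 z u : [set 1 : G] z -> u \in T2 -> [set 1 : G] (z ^ u) by move=> -> _ /=; rewrite conj1g.
have T3k x : x \in lcl T3 k -> x = 1.
  suff h i y : y \in lcl T3 i -> lcs T2 [set 1] i y.
    by move=> /h; rewrite (lcs_eq s1 J1 Tk).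
  elim: i y => [|i IHi] y.
    by move=> yT; rewrite (lcs0 sT V1); apply: VN; rewrite VE; apply: sgen_gen.
  move=> /allpairsP [[z u] [/IHi /= Dz uT ->]]; apply: (lcsRG sT s1 V1 J1 Dz).
  by apply: VN; rewrite VE; apply: sgen_gen.
have VS : V `<=` sgen S by move=> x /VN/TK/KS.
rewrite VE in VS VJ.
have [T4 [m [k' [m0 [s4 T34 T4t T4S T4k]]]]] := cyclic_extension sS pS s3 VS Gt VJ T3k.
exists T4, k'; split=> //; have sg4 := sgen_subgroup s4.
have [rK rKP] := fVK.
exists [seq y * t ^+ j | y <- rK, j <- iota 0 m] => x /Kt [y [q [Ky ->]]].
have [q1 [j [jm qE]]] : exists q1 j, (j < m)%N /\ q = (q1 * Posz m + Posz j)%R.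
  exists (q %/ Posz m)%Z, `|(q %% Posz m)%Z|%N; have mz : Posz m != 0%R by rewrite eqz_nat -lt0n.
  rewrite -ltz_nat !gez0_abs ?modz_ge0 // ltz_pmod ?ltz_nat //; split=> //.
  exact: divz_eq.
pose z := zexp t (q1 * Posz m)%R; have zG : sgen S z by apply: zexp_sub.
have -> : y * zexp t q = z * (y ^ z * t ^+ j).
  by rewrite qE zexpD -/z /conjg !mulgA mulgV mul1g.
have [w wr Vw] := rKP (y ^ z) (KJ Ky zG).
exists (w * t ^+ j); first by apply/allpairsP; exists (w, j); rewrite /= mem_iota.
have -> : z * (y ^ z * t ^+ j) * (w * t ^+ j)^-1 = z * (y ^ z * w^-1).
  by rewrite invgM !mulgA mulgK.
by apply: (subgroupM sg4); [apply: T4t|apply: T34; rewrite -VE].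
Qed.

End Step.

Lemma subgroup_type_gens (G : groupType) (S : seq G) : symm S ->
  exists (K : groupType) (f : K -> G) (S' : seq K),
  [/\ injective f, forall x y, f (x * y)%g = f x * f y,
      forall x, sgen S x <-> exists y, f y = x, map f S' = S &
      symm S' /\ forall x, sgen S' x].
Proof.
move=> sS; have [K [f [fi fM fK]]] := subgroup_type (sgen_subgroup sS).
have ex a : exists b, a \in S -> f b = a.
  by have [/sgen_gen /fK [b]|] := boolP (a \in S); [exists b|exists 1].
have [S' S'E] : exists S', map f S' = S.
  have [g gP] := choice ex; exists (map g S).
  by rewrite -map_comp -[RHS]map_id; apply/eq_in_map => a aS; apply: gP.
exists K, f, S'; split=> //; split=> [|x].
  have := sS; rewrite -S'E => -[h1 h2]; split; first by rewrite -(mem_map fi) (emb1 fM).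
  apply: (perm_map_inj fi); apply: perm_trans h2 _.
  have E : map (fun x => (f x)^-1) S' = map (fun x => f x^-1) S'.
    by apply: eq_map => x; rewrite (embV fM).
  by rewrite -!map_comp E.
by apply/(emb_sgen fi fM); rewrite S'E; apply/fK; exists x.
Qed.

(* Gromov's theorem: an infinite group of polynomial growth virtually maps onto [int], and the
   kernel grows with smaller degree. *)
Theorem virt_nilpotent (R : realType) D (G : groupType) (S : seq G) :
    symm S -> (forall x, sgen S x) -> poly_growth S D ->
  exists (T : seq G) k, [/\ symm T, fin_index (sgen T) setT & forall x, x \in lcl T k -> x = 1].
Proof.
elim: D G S => [|D IHD] G S sS gS pS; last first.
  have [inf|ninf] := pselect (forall M, exists n, (M <= size (ball S n))%N); last first.
    have [M MP] : exists M, forall n, (size (ball S n) <= M)%N.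
      apply: contrapT => h; apply: ninf => M; apply: contrapT => h2; apply: h; exists M => n.
      by rewrite leqNgt; apply/negP => /ltnW h3; apply: h2; exists n.
    exists [:: 1], 0%N; split; first by split; rewrite /= ?inE ?invg1.
      exact: bounded_balls_fin_index MP.
    by move=> x; rewrite inE => /eqP.
  have [S1 [chi [s1 f1 chiM chi0]]] := int_quotient R sS gS pS inf.
  have p1 : poly_growth S1 D.+1 by apply: poly_growth_sub pS => // x _; apply: gS.
  have [A [t [sA pA Gt AE At]]] := kernel_fg R s1 chiM p1 chi0.
  have sGA := sgen_subgroup sA; have sG1 := sgen_subgroup s1.
  have [K [f [A' [fi fM fK A'E [s' gA']]]]] := subgroup_type_gens sA.
  have pA' : poly_growth A' D by apply/(emb_growth fi fM); rewrite A'E.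
  have [T' [k [sT' fT' T'k]]] := IHD K A' s' gA' pA'.
  have TA : sgen (map f T') `<=` sgen A.
    by apply: sgen_min => // x /mapP [y _ ->]; apply/fK; exists y.
  have [T [k' [sT TS fT Tk]]] : exists T k', [/\ symm T, sgen T `<=` sgen S1,
      fin_index (sgen T) (sgen S1) & forall x, x \in lcl T k' -> x = 1].
    apply: (@cyclic_extension_virt_nilpotent G S1 (map f T') D.+1 k t (sgen A)) => //.
    - exact: emb_symm.
    - by rewrite AE => x [].
    - move=> z h; rewrite AE => -[Gz cz] Gh; split; first exact: (subgroupJ sG1).
      have GhV := subgroupV sG1 Gh; have Gzh := subgroupM sG1 Gz Gh.
      rewrite /conjg chiM // chiM // cz add0r -chiM // mulVg.
      by apply: (@addIr _ (chi 1)); rewrite add0r -chiM ?mulg1 //; apply: (subgroup1 sG1).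
    - have [r rP] := fT'; exists (map f r) => x /fK [y <-].
      have [w wr Vw] := rP y I; exists (f w); first exact: map_f.
      by rewrite -(embV fM) -fM; apply/(emb_sgen fi fM).
    - by move=> x; rewrite emb_lcl // => /mapP [y /T'k -> ->]; apply: emb1.
  exists T, k'; split=> //; exact: fin_index_trans (sgen_subgroup sT) sG1 TS fT f1.
have [C CP] := pS; exists [:: 1], 0%N; split; first by split; rewrite /= ?inE ?invg1.
  by apply: (bounded_balls_fin_index (M := C) sS gS) => n; have := CP n; rewrite expn0 muln1.
by move=> x; rewrite inE => /eqP.
Qed.

End VirtuallyNilpotent.

(** * Growth of nilpotent groups *)

Section BassUpper.
Variables (R : realType) (G : groupType) (T : seq G) (k : nat).
Local Open Scope group_scope.
Hypotheses (sT : symm T) (k0 : (0 < k)%N) (Tk : forall x, x \in lcl T k -> x = 1).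
Implicit Types (w A : seq (nat * G)) (p q a : nat * G).
Let s1 := subgroup1_set G.
Let V1 : [set 1] `<=` sgen T.
Proof. by move=> x ->; apply: (subgroup1 (sgen_subgroup sT)). Qed.
Let J1 z u : [set 1 : G] z -> u \in T -> [set 1 : G] (z ^ u).
Proof. by move=> -> _ /=; rewrite conj1g. Qed.
Local Notation DV := (lcs T [set 1]).
Let sD i : subgroup (DV i). Proof. exact: lcs_subgroup. Qed.

(* The letters are tagged with their level; a letter of level [i] has cost [n ^ - i.+1]. *)
Definition letters : seq (nat * G) :=
  [seq (i, x) | i <- iota 0 k, x <- lcl T i ++ [seq x^-1 | x <- lcl T i]].
Definition wprod w := \prod_(p <- w) p.2.
Definition cost n w : R := (\sum_(p <- w) n%:R ^- p.1.+1)%R.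

Lemma lettersP i x :
  (i, x) \in letters <-> (i < k)%N /\ (x \in lcl T i \/ x^-1 \in lcl T i).
Proof.
split=> [/allpairsPdep [j [y [jk yl [-> ->]]]]|[ik h]].
  rewrite mem_iota in jk; split=> //; move: yl; rewrite mem_cat => /orP [|/mapP [z zl ->]].
    by left.
  by right; rewrite invgK.
apply/allpairsPdep; exists i, x; rewrite mem_iota mem_cat; split=> //.
by case: h => [-> //|h]; apply/orP; right; apply/mapP; exists x^-1; rewrite ?invgK.
Qed.

Lemma lettersV i x : (i, x) \in letters -> (i, x^-1) \in letters.
Proof. by move=> /lettersP [ik h]; apply/lettersP; split=> //; rewrite invgK; tauto. Qed.

Lemma letter_lcs p : p \in letters -> DV p.1 p.2.
Proof.
case: p => i x /lettersP [_ [xl|xl]]; first exact: lcs_lcl xl.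
by rewrite -[x]invgK; apply: (subgroupV (sD i)); apply: lcs_lcl xl.
Qed.

Lemma wprod_cat w w' : wprod (w ++ w') = wprod w * wprod w'.
Proof. exact: big_cat. Qed.

Lemma wprod_cons p w : wprod (p :: w) = p.2 * wprod w.
Proof. exact: big_cons. Qed.

Lemma wprod_rcons w p : wprod (rcons w p) = wprod w * p.2.
Proof. by rewrite -cats1 wprod_cat /wprod big_seq1. Qed.

Definition words A : set G := [set x | exists2 w, {subset w <= A} & wprod w = x].

Lemma words_subgroup A : (forall i x, (i, x) \in A -> (i, x^-1) \in A) -> subgroup (words A).
Proof.
move=> AV; split=> [|x y [w wA <-] [w' wA' <-]|x [w wA <-]].
- by exists [::]; rewrite // /wprod big_nil.
- exists (w ++ w'); last exact: wprod_cat.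
  by move=> p; rewrite mem_cat => /orP [/wA|/wA'].
- elim: w wA => [_|[i x'] w IHw wA]; first by exists [::]; rewrite // /wprod big_nil invg1.
  have [|w' wA' w'E] := IHw; first by move=> p pw; apply: wA; rewrite inE pw orbT.
  exists (rcons w' (i, x'^-1)); last by rewrite wprod_rcons w'E /wprod big_cons invgM.
  move=> p; rewrite mem_rcons inE => /orP [/eqP ->|/wA' //]; apply/AV/wA; exact: mem_head.
Qed.

Definition above i := [seq p <- letters | (i <= p.1)%N].

Lemma aboveV i j x : (j, x) \in above i -> (j, x^-1) \in above i.
Proof. by rewrite !mem_filter => /andP [-> /lettersV]. Qed.

Lemma lcs_words i : DV i `<=` words (above i).
Proof.
apply: lcs_min => [|j x ij xl|x ->].
- by apply: words_subgroup; apply: aboveV.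
- have [jk|kj] := ltnP j k.
    exists [:: (j, x)]; last by rewrite /wprod big_seq1.
    move=> p; rewrite inE => /eqP ->; rewrite mem_filter ij /=; apply/lettersP; by split=> //; left.
  have := lcs_le (T := T) (Z := [set 1]) kj (lcs_lcl (Z := [set 1]) (leqnn j) xl).
  by rewrite (lcs_eq s1 J1 Tk) => ->; exists [::]; rewrite // /wprod big_nil.
- by exists [::]; rewrite // /wprod big_nil.
Qed.

(** There are finitely many pairs of letters, hence one bound [L]. The levels in [W p q] are at
    least [p.1 + q.1 + 1], so the cost of a commutator is at most [L] times the product of the two
    costs. *)
Lemma comm_words : exists (W : (nat * G) -> (nat * G) -> seq (nat * G)) (L : nat),
  forall p q, p \in letters -> q \in letters ->
  [/\ {subset W p q <= above (p.1 + q.1).+1}, wprod (W p q) = [~ p.2, q.2] &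
      (size (W p q) <= L)%N].
Proof.
have ex (pq : (nat * G) * (nat * G)) : exists w, pq.1 \in letters -> pq.2 \in letters ->
    {subset w <= above (pq.1.1 + pq.2.1).+1} /\ wprod w = [~ pq.1.2, pq.2.2].
  have [[h1 h2]|h] := pselect (pq.1 \in letters /\ pq.2 \in letters); last first.
    by exists [::] => h1 h2; case: h.
  have [w wA wE] := lcs_words (lcsR sT s1 V1 J1 (letter_lcs h1) (letter_lcs h2)).
  by exists w.
have [W WP] := choice ex; pose W' p q := W (p, q).
exists W', (\max_(p <- letters) \max_(q <- letters) size (W' p q)) => p q pl ql.
have [h1 h2] := WP (p, q) pl ql; split=> //.
apply: leq_trans (leq_bigmax_seq _ _ _) (leq_bigmax_seq _ pl _) => //.
Qed.

Lemma cost_ge0 n w : (0 <= cost n w)%R.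
Proof. by apply: sumr_ge0 => p _; rewrite invr_ge0 exprn_ge0. Qed.

Lemma cost_cat n w w' : cost n (w ++ w') = (cost n w + cost n w')%R.
Proof. exact: big_cat. Qed.

Lemma cost_cons n p w : cost n (p :: w) = (n%:R ^- p.1.+1 + cost n w)%R.
Proof. exact: big_cons. Qed.

Lemma cost_above n i w : (0 < n)%N -> {subset w <= above i} ->
  (cost n w <= (size w)%:R * n%:R ^- i.+1)%R.
Proof.
move=> n0; elim: w => [_|p w IHw wA]; first by rewrite /cost big_nil mul0r.
rewrite cost_cons /= -[(size w).+1]add1n natrD mulrDl mul1r; apply: lerD; last first.
  by apply: IHw => q qw; apply: wA; rewrite inE qw orbT.
have := wA p (mem_head _ _); rewrite mem_filter => /andP [ip _].
by rewrite lef_pV2 ?posrE ?exprn_gt0 ?ltr0n // ler_weXn2l // ler1n.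
Qed.

(** The exponent [d] is uniform, but the bound must be available for every cost [c], because moving
    letters to the front inflates the cost by a constant factor. *)
Definition cov A d := forall c : R, exists C : nat, forall n, (0 < n)%N -> exists2 Y : seq G,
  (size Y <= C * n ^ d)%N & forall w, {subset w <= A} -> (cost n w <= c)%R -> wprod w \in Y.

Section Pull.
Variables (W : (nat * G) -> (nat * G) -> seq (nat * G)) (L : nat).
Hypothesis WP : forall p q, p \in letters -> q \in letters ->
  [/\ {subset W p q <= above (p.1 + q.1).+1}, wprod (W p q) = [~ p.2, q.2] &
      (size (W p q) <= L)%N].
Variables (a : nat * G) (A : seq (nat * G)).
Hypotheses (al : a \in letters) (Al : {subset A <= letters}).
Hypothesis AW : {subset above a.1.+1 <= A}.

Definition conj_word w := flatten [seq p :: W p a | p <- w].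
Definition infl n : R := (1 + L%:R * n%:R ^- a.1.+1)%R.

Lemma infl_ge1 n : (1 <= infl n)%R.
Proof. by rewrite lerDl mulr_ge0 // invr_ge0 exprn_ge0. Qed.

Lemma conj_wordP n w : (0 < n)%N -> {subset w <= A} ->
  [/\ {subset conj_word w <= A}, wprod (conj_word w) = wprod w ^ a.2 &
      (cost n (conj_word w) <= infl n * cost n w)%R].
Proof.
move=> n0; elim: w => [|p w IHw] wA.
  by rewrite /conj_word /wprod /cost /= !big_nil conj1g mulr0.
have [|h1 h2 h3] := IHw; first by move=> q qw; apply: wA; rewrite inE qw orbT.
have pA := wA p (mem_head _ _); have pl := Al pA.
have [W1 W2 W3] := WP pl al.
rewrite /conj_word /= -/(conj_word w); split.
- move=> q; rewrite inE mem_cat => /or3P [/eqP -> //|/W1|/h1 //].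
  rewrite mem_filter => /andP [lt ql]; apply: AW; rewrite mem_filter ql andbT.
  by apply: leq_trans lt; rewrite ltnS leq_addl.
- by rewrite -cat_cons wprod_cat h2 !wprod_cons W2 conjMg -conjR.
- rewrite -cat_cons cost_cat [in leRHS]cost_cons mulrDr; apply: lerD h3.
  rewrite cost_cons /infl mulrDl mul1r lerD2l.
  apply: le_trans (cost_above n0 W1) _.
  rewrite -mulrA; apply: ler_pM; rewrite ?invr_ge0 ?exprn_ge0 ?ler_nat //.
  by rewrite -invfM -exprD addSn addnS addnC.
Qed.

Lemma conj_word_iter n w m : (0 < n)%N -> {subset w <= A} ->
  [/\ {subset iter m conj_word w <= A}, wprod (iter m conj_word w) = wprod w ^ (a.2 ^+ m) &
      (cost n (iter m conj_word w) <= infl n ^+ m * cost n w)%R].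
Proof.
move=> n0 wA; elim: m => [|m [h1 h2 h3]]; first by rewrite /= expg0 conjg1 mul1r.
have [h4 h5 h6] := conj_wordP n0 h1; split=> //=.
  by rewrite h5 h2 -conjgM -expgSr.
rewrite exprS -mulrA; apply: le_trans h6 _; apply: ler_wpM2l h3.
exact: le_trans (infl_ge1 n).
Qed.

(** Collection: the occurrences of [a] move to the front and conjugate the letters that precede
    them. One conjugation multiplies the cost by [infl n], and at most [c n^(i + 1)] of them occur
    for [a] of level [i], so the total factor stays below [exp (L c)]; see [pull_bound]. *)
Lemma pull_out n w : (0 < n)%N -> {subset w <= a :: A} -> exists m w',
  [/\ {subset w' <= A}, wprod w = a.2 ^+ m * wprod w', (m%:R * n%:R ^- a.1.+1 <= cost n w)%R &
      (cost n w' <= infl n ^+ m * cost n w)%R].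
Proof.
move=> n0; elim: w => [_|p w IHw wA].
  by exists 0%N, [::]; rewrite /wprod /cost !big_nil mul0r mulr0 mulg1.
have [|m [w' [h1 h2 h3 h4]]] := IHw; first by move=> q qw; apply: wA; rewrite inE qw orbT.
have F0 : (0 <= infl n)%R by apply: le_trans (infl_ge1 n).
have := wA p (mem_head _ _); rewrite inE => /orP [/eqP ->|pA].
  exists m.+1, w'; split=> //.
  - by rewrite wprod_cons h2 expgS mulgA.
  - by rewrite cost_cons -[m.+1]add1n natrD mulrDl mul1r lerD2l.
  - apply: le_trans h4 _; apply: ler_pM; rewrite ?exprn_ge0 ?cost_ge0 //.
      by apply: (ler_weXn2l (infl_ge1 n)).
    by rewrite cost_cons lerDr invr_ge0 exprn_ge0.
have p1 : {subset [:: p] <= A} by move=> q; rewrite inE => /eqP ->.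
have [g1 g2 g3] := conj_word_iter m n0 p1.
exists m, (iter m conj_word [:: p] ++ w'); split.
- by move=> q; rewrite mem_cat => /orP [/g1|/h1].
- rewrite wprod_cat g2 !wprod_cons h2 {2}/wprod big_nil mulg1.
  by rewrite /conjg !mulgA mulgV mul1g.
- by rewrite cost_cons; apply: le_trans h3 _; rewrite lerDr invr_ge0 exprn_ge0.
- rewrite cost_cat [in leRHS]cost_cons mulrDr; apply: lerD h4.
  by move: g3; rewrite cost_cons {2}/cost big_nil addr0.
Qed.

Lemma pull_bound n m w c : (0 < n)%N -> (cost n w <= c)%R ->
  (m%:R * n%:R ^- a.1.+1 <= cost n w)%R ->
  (infl n ^+ m * cost n w <= expR (L%:R * c) * c)%R.
Proof.
move=> n0 wc mw; apply: ler_pM => //; rewrite ?exprn_ge0 ?cost_ge0 //.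
  exact: le_trans (infl_ge1 n).
apply: (@le_trans _ _ (expR (L%:R * n%:R ^- a.1.+1) ^+ m)%R).
  by apply: lerXn2r; rewrite ?nnegrE ?expR_ge0 ?expR_ge1Dx //; apply: le_trans (infl_ge1 n).
rewrite -expRM_natl ler_expR mulrCA ler_wpM2l //; exact: le_trans wc.
Qed.

Lemma count_bound n m w (c : R) (c' : nat) : (0 < n)%N -> (cost n w <= c)%R -> (c <= c'%:R)%R ->
  (m%:R * n%:R ^- a.1.+1 <= cost n w)%R -> (m <= c' * n ^ a.1.+1)%N.
Proof.
move=> n0 wc cc mw; rewrite -(ler_nat R) natrM natrX -ler_pdivrMr ?exprn_gt0 ?ltr0n //.
exact: le_trans mw (le_trans wc cc).
Qed.

End Pull.

Lemma nat_above (c : R) : exists n : nat, (c <= n%:R)%R.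
Proof.
exists (Num.bound `|c|%R); apply/ltW/(le_lt_trans (ler_norm c)).
by apply: archi_boundP.
Qed.

(** Blocks [a^e] of the collected power are rewritten as [U], whose letters have at least the level
    of [a]; this costs only a constant factor and leaves [e] possible powers of [a]. *)
Lemma cov_torsion a A d U e : a \in letters -> {subset A <= letters} ->
  {subset above a.1.+1 <= A} -> {subset U <= A} -> {subset U <= above a.1} -> (0 < e)%N ->
  wprod U = a.2 ^+ e -> cov A d -> cov (a :: A) d.
Proof.
move=> al Al AW UA Ua e0 UE cA c; have [W [L WP]] := comm_words.
have [C CP] := cA (expR (L%:R * c) * c + (size U)%:R * c)%R.
exists (C * e)%N => n n0; have [Y Ys YP] := CP n n0.
exists [seq a.2 ^+ r * y | r <- iota 0 e, y <- Y] => [|w wA wc].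
  by rewrite size_allpairs size_iota mulnC mulnAC leq_mul2r Ys orbT.
have [m [w' [h1 h2 h3 h4]]] := pull_out WP al Al AW n0 wA.
apply/allpairsPdep; exists (m %% e)%N, (wprod (flatten (nseq (m %/ e) U) ++ w')).
rewrite mem_iota /= ltn_pmod //; split=> //.
  apply: YP => [p|].
    rewrite mem_cat => /orP [/flattenP [s]|/h1 //].
    by rewrite mem_nseq => /andP [_ /eqP ->]; apply: UA.
  rewrite cost_cat addrC; apply: lerD.
    by apply: (le_trans h4); apply: pull_bound.
  have -> : cost n (flatten (nseq (m %/ e) U)) = ((m %/ e)%:R * cost n U)%R.
    elim: (m %/ e)%N => [|q IHq]; first by rewrite /= /cost big_nil mul0r.
    by rewrite /= cost_cat IHq -[q.+1]add1n natrD mulrDl mul1r.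
  apply: le_trans (ler_wpM2l _ (cost_above n0 Ua)) _ => //.
  rewrite mulrCA ler_wpM2l //; apply: le_trans wc; apply: le_trans h3.
  by rewrite ler_wpM2r ?invr_ge0 ?exprn_ge0 // ler_nat leq_div.
have -> : wprod (flatten (nseq (m %/ e) U) ++ w') = a.2 ^+ (m %/ e * e) * wprod w'.
  rewrite wprod_cat; congr (_ * _).
  elim: (m %/ e)%N => [|q IHq]; first by rewrite /= /wprod big_nil mul0n expg0.
  by rewrite /= wprod_cat IHq UE mulSn expgnDr.
by rewrite mulgA -expgnDr addnC -divn_eq.
Qed.

(** The collected power of [x] takes at most a constant times [n^(i + 1)] values, whence the
    increment of the exponent. First [x] and then its inverse is collected, and the two powers are
    merged into an integer exponent. *)
Lemma cov_free i x A d : (i, x) \in letters -> {subset A <= letters} ->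
  {subset above i.+1 <= A} -> cov A d -> cov [:: (i, x), (i, x^-1) & A] (d + i.+1).
Proof.
move=> al Al AW cA c; have bl := lettersV al; have [W [L WP]] := comm_words.
pose c1 := (expR (L%:R * c) * c)%R; pose c2 := (expR (L%:R * c1) * c1)%R.
have [C CP] := cA c2; have [m1 cm1] := nat_above c; have [m2 cm2] := nat_above c1.
exists ((m1 + m2).+1 * C)%N => n n0; have [Y Ys YP] := CP n n0.
set N := (n ^ i.+1)%N; have N0 : (0 < N)%N by rewrite expn_gt0 n0.
exists [seq zexp x (Posz j - Posz (m2 * N))%R * y | j <- iota 0 ((m1 + m2) * N).+1, y <- Y].
  rewrite size_allpairs size_iota expnD -/N (mulnC (n ^ d)%N) mulnACA; apply: leq_mul => //.
  by rewrite mulSn -add1n leq_add2r.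
move=> w wA wc.
have bAl : {subset (i, x^-1) :: A <= letters} by move=> p; rewrite inE => /orP [/eqP ->|/Al].
have bAW : {subset above i.+1 <= (i, x^-1) :: A} by move=> p /AW pA; rewrite inE pA orbT.
have [m [w1 [h1 h2 h3 h4]]] := pull_out WP al bAl bAW n0 wA.
have w1c : (cost n w1 <= c1)%R by apply: (le_trans h4); apply: pull_bound.
have [m' [w2 [g1 g2 g3 g4]]] := pull_out WP bl Al AW n0 h1.
have w2c : (cost n w2 <= c2)%R by apply: (le_trans g4); apply: pull_bound.
have mN := count_bound n0 wc cm1 h3; have mN' := count_bound n0 w1c cm2 g3.
apply/allpairsPdep; exists (m + m2 * N - m')%N, (wprod w2).
rewrite /= -/N in mN mN'; split; last first.
- rewrite h2 g2 /= mulgA; congr (_ * _).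
  have -> : (Posz (m + m2 * N - m') - Posz (m2 * N) = Posz m - Posz m')%R.
    by move: (m2 * N)%N mN' => M; clear; lia.
  by rewrite zexpD zexpN /= expVgn.
- exact: YP.
- rewrite mem_iota /= add0n ltnS mulnDl leq_subLR.
  by apply: leq_trans (leq_addl _ _); rewrite leq_add2r.
Qed.

End BassUpper.

(** * The Bass-Guivarc'h bounds *)

Section BassGuivarch.
Variables (R : realType) (G : groupType) (T : seq G) (k : nat).
Local Open Scope group_scope.
Hypotheses (sT : symm T) (k0 : (0 < k)%N) (Tk : forall x, x \in lcl T k -> x = 1).
Let s1 := subgroup1_set G.
Let V1 : [set 1] `<=` sgen T.
Proof. by move=> x ->; apply: (subgroup1 (sgen_subgroup sT)). Qed.
Let J1 z u : [set 1 : G] z -> u \in T -> [set 1 : G] (z ^ u).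
Proof. by move=> -> _ /=; rewrite conj1g. Qed.
Local Notation DV := (lcs T [set 1]).
Let sD i : subgroup (DV i). Proof. exact: lcs_subgroup. Qed.

(** A basis modulo torsion of the layer [D i / D i.+1], chosen among the commutators of weight
    [i + 1]; its length is the rank of the layer. *)
Definition level_basis i (Z : seq G) := {subset Z <= lcl T i} /\
  exists (Q : zmodType) (pi : G -> Q),
  [/\ forall x y, DV i x -> DV i y -> pi (x * y) = (pi x + pi y)%R,
      forall x, DV i x -> pi x = 0%R <-> DV i.+1 x, indep (map pi Z) &
      exists2 e, (0 < e)%N & forall x, x \in lcl T i -> ispan (map pi Z) (pi x *+ e)%R].

Lemma level_basis_exists i : exists Z, level_basis i Z.
Proof.
have [Q [pi [piM pi0 piS gQ]]] := lcs_quotient sT s1 V1 J1 i.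
have [|Zq [e [sZ iZ e0 eX]]] := @max_indep Q [::] [seq pi x | x <- lcl T i]; first by move=> c _ j.
have ex q : exists x, q \in Zq -> x \in lcl T i /\ pi x = q.
  by have [/sZ /mapP [x xl ->]|_] := boolP (q \in Zq); [exists x|exists 1].
have [f fP] := choice ex; rewrite cat0s in iZ eX; exists (map f Zq).
have E : map pi (map f Zq) = Zq.
  by rewrite -map_comp -[RHS]map_id; apply/eq_in_map => q /fP [].
split; first by move=> x /mapP [q /fP [xl _] ->].
exists Q, pi; rewrite E; split=> //; exists e => // x xl; exact/eX/map_f.
Qed.

Lemma cov_sub (A B : seq (nat * G)) d : {subset A <= B} -> cov R B d -> cov R A d.
Proof.
move=> AB cB c; have [C CP] := cB c; exists C => n n0; have [Y Ys YP] := CP n n0.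
by exists Y => // w wA wc; apply: YP => // p /wA/AB.
Qed.

Section Morphism.
Variables (i : nat) (Q : zmodType) (pi : G -> Q).
Hypothesis piM : forall x y, DV i x -> DV i y -> pi (x * y) = (pi x + pi y)%R.
Hypothesis pi0 : forall x, DV i x -> pi x = 0%R <-> DV i.+1 x.

Lemma lcs_pi1 : pi 1 = 0%R.
Proof. by apply/pi0; apply: (subgroup1 (sD _)). Qed.

Lemma lcs_piV x : DV i x -> pi x^-1 = (- pi x)%R.
Proof.
move=> Dx; apply/eqP; rewrite -GRing.addr_eq0 -piM ?mulVg ?lcs_pi1 //.
exact: (subgroupV (sD i)).
Qed.

Lemma lcs_piX x n : DV i x -> pi (x ^+ n) = (pi x *+ n)%R.
Proof.
move=> Dx; elim: n => [|n IHn]; first by rewrite expg0 lcs_pi1 mulr0n.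
by rewrite expgS piM ?IHn ?mulrS //; apply: (subgroupX _ (sD i)).
Qed.

Lemma lcs_piZ x q : DV i x -> pi (zexp x q) = (pi x *~ q)%R.
Proof.
move=> Dx; case: q => n /=; first by rewrite lcs_piX.
by rewrite lcs_piV ?lcs_piX ?NegzE ?mulrNz //; apply: (subgroupX _ (sD i)).
Qed.

Lemma lcs_pi_eq x y : DV i x -> DV i y -> pi x = pi y <-> DV i.+1 (x^-1 * y).
Proof.
move=> Dx Dy; have DV' := subgroupV (sD i) Dx; have DM := subgroupM (sD i) DV' Dy.
split=> [E|/(pi0 DM)]; first by apply/(pi0 DM); rewrite piM // lcs_piV // E addNr.
by rewrite piM // lcs_piV // => /eqP; rewrite addrC subr_eq0 => /eqP.
Qed.

Lemma lcs_piJ x w : DV i x -> sgen T w -> pi (x ^ w) = pi x.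
Proof.
move=> Dx Gw; have Dc := lcsRG sT s1 V1 J1 Dx Gw; have Dc' := lcs_le (leqnSn i) Dc.
by rewrite conjR piM // ((pi0 Dc').2 Dc) addr0.
Qed.

End Morphism.

(** First the basis letters and their inverses are adjoined, each pair raising the exponent by
    [i + 1]; the remaining letters of level [i] are torsion modulo these and do not raise it. *)
Lemma cov_level i Z d : (i < k)%N -> level_basis i Z ->
  cov R (above T k i.+1) d -> cov R (above T k i) (d + i.+1 * size Z).
Proof.
move=> ik [sZ [Q [pi [piM pi0 iZ [e e0 eX]]]]] cA.
pose A Z := foldr (fun z A => [:: (i, z), (i, z^-1) & A]) (above T k i.+1) Z.
have zl z : z \in lcl T i -> (i, z) \in letters T k by move=> zl; apply/lettersP; split=> //; left.
have AP Z' : {subset Z' <= lcl T i} -> [/\ {subset A Z' <= above T k i},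
    {subset above T k i.+1 <= A Z'} & cov R (A Z') (d + i.+1 * size Z')].
  elim: Z' => [_|z Z' IHZ' sZ'].
    rewrite muln0 addn0; split=> // p; rewrite !mem_filter => /andP [h ->].
    by rewrite (ltnW h).
  have zi := sZ' z (mem_head _ _); have zil := zl z zi.
  have [|h1 h2 h3] := IHZ'; first by move=> p pZ; apply: sZ'; rewrite inE pZ orbT.
  split=> [p|p pA|].
  - rewrite !inE => /or3P [/eqP ->|/eqP ->|/h1 //]; rewrite mem_filter leqnn //=.
    exact: lettersV.
  - by rewrite !inE (h2 p pA) !orbT.
  - rewrite mulnS [(i.+1 + _)%N]addnC addnA; apply: (cov_free sT Tk) => //.
    by move=> p /h1; rewrite mem_filter => /andP [].
have [A1 A2 A3] := AP Z sZ.
have sA : subgroup (words (A Z)).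
  apply: words_subgroup => j x; elim: (Z) => [|z Z' IHZ] /=; first exact: aboveV.
  rewrite !inE => /or3P [/eqP [-> ->]|/eqP [-> ->]|/IHZ ->]; rewrite ?invgK ?eqxx ?orbT //.
have wZ z : z \in Z -> words (A Z) z.
  move=> zZ; exists [:: (i, z)]; last by rewrite /wprod big_seq1.
  move=> p; rewrite inE => /eqP -> {p}; elim: (Z) zZ => //= y Z' IHZ.
  by rewrite !inE => /orP [/eqP ->|/IHZ ->]; rewrite ?eqxx ?orbT.
have wD : DV i.+1 `<=` words (A Z).
  by move=> x /(lcs_words Tk) [w wA wE]; exists w => // p /wA/A2.
have ZD z : z \in Z -> DV i z by move=> /sZ; apply: lcs_lcl.
have spanw q : ispan (map pi Z) q -> exists y, [/\ words (A Z) y, DV i y & pi y = q].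
  move=> [c ->]; rewrite /icomb; elim/big_ind: _ => [||j _].
  - exists 1; split; [exact: (subgroup1 sA)|exact: (subgroup1 (sD i))|exact: lcs_pi1 pi0].
  - move=> _ _ [y [wy Dy <-]] [y' [wy' Dy' <-]]; exists (y * y'); split; last by rewrite piM.
      exact: (subgroupM sA).
    exact: (subgroupM (sD i)).
  - have jZ : (j < size Z)%N by rewrite -(size_map pi).
    have zZ := mem_nth 1 jZ; exists (zexp (nth 1 Z j) (c j)); split.
    + by apply: zexp_sub sA (wZ _ zZ).
    + by apply: zexp_sub (sD i) (ZD _ zZ).
    + by rewrite (lcs_piZ piM pi0) ?(nth_map 1) //; apply: ZD.
have tors x : (i, x) \in letters T k -> exists U, [/\ {subset U <= A Z},
    {subset U <= above T k i} & wprod U = x ^+ e].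
  move=> xl; have Dx : DV i x := letter_lcs xl; have Dxe := subgroupX e (sD i) Dx.
  have [y [wy Dy yE]] : exists y, [/\ words (A Z) y, DV i y & pi y = pi (x ^+ e)].
    apply: spanw; rewrite (lcs_piX piM pi0) //; have /lettersP [_ [/eX //|xV]] := xl.
    have := ispanZ (-1) (eX _ xV); rewrite mulrN1z (lcs_piV piM pi0) // mulNrn opprK //.
  have [U UA UE] : words (A Z) (x ^+ e).
    rewrite -[x ^+ e](mulVKg y); apply: (subgroupM sA) => //; apply: wD.
    by apply/(lcs_pi_eq piM pi0).
  by exists U; split=> // p /UA/A1.
pose X := [seq x <- above T k i | x.1 == i].
have cX X' : {subset X' <= X} -> cov R (X' ++ A Z) (d + i.+1 * size Z).
  elim: X' => // -[j x] X' IHX' sX'.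
  have := sX' (j, x) (mem_head _ _); rewrite !mem_filter => /and3P [/= /eqP ji _ xl].
  subst j; have [U [U1 U2 UE]] := tors x xl.
  have sX2 : {subset X' <= X} by move=> p pX; apply: sX'; rewrite inE pX orbT.
  apply: (cov_torsion sT Tk xl _ _ _ U2 e0 UE (IHX' sX2)) => p.
  - rewrite mem_cat => /orP [/sX2|/A1]; rewrite !mem_filter => /andP [_] //.
    by move=> /andP [].
  - by rewrite mem_cat => /A2 ->; rewrite orbT.
  - by rewrite mem_cat => /U1 ->; rewrite orbT.
apply: cov_sub (cX X (fun p => id)) => p pA; rewrite mem_cat.
have [pi_|pi_] := eqVneq p.1 i; first by rewrite mem_filter pi_ eqxx pA.
apply/orP; right; apply: A2; move: pA; rewrite !mem_filter => /andP [ip ->].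
by rewrite andbT ltn_neqAle ip eq_sym pi_.
Qed.

Variable Z : nat -> seq G.
Hypothesis ZP : forall i, level_basis i (Z i).

(* homogeneous dimension of the levels from [k - l] on *)
Fixpoint hdim l := if l is l'.+1 then (hdim l' + (k - l).+1 * size (Z (k - l)))%N else 0%N.

(** A word of length [n] in the generators has cost exactly 1, all its letters being of level 0. *)
Lemma growth_upper : exists C, forall n, (0 < n)%N -> (size (ball T n) <= C * n ^ hdim k)%N.
Proof.
have h l : (l <= k)%N -> cov R (above T k (k - l)) (hdim l).
  elim: l => [_ c|l IHl lk].
    exists 1%N => n n0; exists [:: 1] => // w wA _; case: w wA => [|p w] wA.
      by rewrite /wprod big_nil inE.
    have := wA p (mem_head _ _); rewrite mem_filter subn0 => /andP [kp].
    by case: p kp {wA} => i x /= ki /lettersP [ik _]; rewrite ltnNge ki in ik.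
  apply: cov_level => //; first by rewrite ltn_subrL k0.
  by rewrite -subSn // subSS; apply/IHl/ltnW.
have [C CP] := h k (leqnn k) 1%R; exists C => n n0; have [Y Ys YP] := CP n n0.
apply: leq_trans Ys; apply: uniq_leq_size (ball_uniq _ _) _ => x xB.
have [w [wA ws <-]] : exists w : seq (nat * G), [/\ {subset w <= [seq (0%N, t) | t <- T]},
    size w = n & wprod w = x].
  elim: n x xB {n0 CP YP Y} => [x|n IHn x].
    by rewrite inE => /eqP ->; exists [::]; rewrite /wprod big_nil.
  move=> /ballSP [y [t [/IHn [w [h1 h2 h3]] tT ->]]]; exists (rcons w (0%N, t)); split.
  - by move=> p; rewrite mem_rcons inE => /orP [/eqP ->|/h1 //]; apply: map_f.
  - by rewrite size_rcons h2.
  - by rewrite wprod_rcons h3.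
apply: YP => [p /wA /mapP [t tT ->]|].
  by rewrite subnn mem_filter /=; apply/lettersP; split=> //; left.
have -> : cost R n w = ((size w)%:R * n%:R^-1)%R.
  elim: w wA {ws} => [_|p w IHw wA]; first by rewrite /cost big_nil mul0r.
  rewrite cost_cons IHw; last by move=> q qw; apply: wA; rewrite inE qw orbT.
  have /mapP [t _ ->] := wA p (mem_head _ _).
  by rewrite expr1 -[(size (_ :: w))]/((size w).+1) -add1n natrD mulrDl mul1r.
by rewrite ws mulfV // pnatr_eq0 -lt0n.
Qed.

(** Distortion of commutators, by induction on the weight. For [z = [y0, t]] and [e = q n + r], the
    power [z^e] is [[y, t^n] [y0, t^r]] modulo the next layer, where [y] is a short approximation of
    [y0^q]; the bound [q <= n^(i + 1)] is what the induction hypothesis accepts. *)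
Lemma approx_power i z : z \in lcl T i -> exists C, forall n e, (0 < n)%N -> (e <= n ^ i.+1)%N ->
  exists y, [/\ y \in ball T (C * n), DV i y & DV i.+1 (y^-1 * z ^+ e)].
Proof.
elim: i z => [|i IHi] z.
  move=> zT; exists 1%N => n e n0 en; exists (z ^+ e); split.
  - by rewrite mul1n; apply: (ball_le sT en); have := ball_pow e (ball_gen zT); rewrite mul1n.
  - by apply: (subgroupX _ (sD 0)); apply: lcs_lcl zT.
  - by rewrite mulVg; apply: (subgroup1 (sD _)).
move=> /allpairsP [[y0 t] [/= yl tT ->]]; have [C CP] := IHi y0 yl.
have Gt := sgen_gen tT; have GtX n : sgen T (t ^+ n) := subgroupX n (sgen_subgroup sT) Gt.
have [Q [pi [piM pi0 _ _]]] := lcs_quotient sT s1 V1 J1 i.+1.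
have Dy0 : DV i y0 := lcs_lcl (leqnn i) yl.
have [c0 y0B] := lcl_sgen sT yl.
have Dc y n : DV i y -> DV i.+1 [~ y, t ^+ n] by move=> Dy; apply: lcsRG.
have piA y n : DV i y -> pi [~ y, t ^+ n] = (pi [~ y, t] *+ n)%R.
  move=> Dy; elim: n => [|n IHn]; first by rewrite expg0 commg1 (lcs_pi1 pi0).
  have Dct := Dc y 1%N Dy; rewrite expg1 in Dct.
  rewrite expgSr commMr piM //; last by apply: (lcsJ J1) => //; apply: Dc.
  by rewrite (lcs_piJ piM pi0) ?IHn ?mulrS //; apply: Dc.
have piB y v : DV i y -> DV i.+1 v -> pi [~ y * v, t] = pi [~ y, t].
  move=> Dy Dv; have Gv := lcs_sgen sT V1 Dv.
  have Dct := Dc y 1%N Dy; rewrite expg1 in Dct; have Dvt := lcsRG sT s1 V1 J1 Dv Gt.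
  have Dvt' := lcs_le (leqnSn i.+1) Dvt.
  rewrite commMl piM //; last exact: (lcsJ J1).
  by rewrite (lcs_piJ piM pi0) // ((pi0 _ Dvt').2 Dvt) addr0.
have D1 y : DV i y -> DV i.+1 [~ y, t] by move=> Dy; apply: lcsRG.
exists (2 * (C + 1) + 2 * (c0 + 1))%N => n e n0 en.
have qn : (e %/ n <= n ^ i.+1)%N.
  by rewrite -(mulnK (n ^ i.+1) n0) -expnSr leq_div2r.
have [y [yB Dy yE]] := CP n (e %/ n)%N n0 qn.
have Dyc := Dc y n Dy; have Dy0c := Dc y0 (e %% n)%N Dy0.
exists ([~ y, t ^+ n] * [~ y0, t ^+ (e %% n)]); split; last 1 first.
- have D0X : DV i.+1 ([~ y0, t] ^+ e) by apply: (subgroupX _ (sD _)); apply: D1.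
  apply/(lcs_pi_eq piM pi0) => //; first exact: (subgroupM (sD _)).
  rewrite piM // !piA // (lcs_piX piM pi0); last exact: D1.
  have -> : pi [~ y, t] = (pi [~ y0, t] *+ (e %/ n))%R.
    rewrite -(piB y _ Dy yE) mulVKg -(lcs_piX piM pi0); last exact: D1.
    apply/(lcs_pi_eq piM pi0); [|by apply: (subgroupX _ (sD _)); apply: D1|exact: lcs_commX].
    by apply: D1; apply: (subgroupX _ (sD _)).
  by rewrite -mulrnA -mulrnDr -divn_eq.
- rewrite mulnDl; apply: ball_mul.
    rewrite -mulnA mulnDl mul1n; apply: ball_comm => //.
    by have := ball_pow n (ball_gen tT); rewrite mul1n.
  rewrite -mulnA; apply: (ball_le sT (m := 2 * (c0 + n))).
    by rewrite leq_mul2l /= mulnDl mul1n leq_add2r leq_pmulr.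
  apply: ball_comm => //; apply: (ball_le sT (ltnW (ltn_pmod e n0))).
  by have := ball_pow (e %% n) (ball_gen tT); rewrite mul1n.
- exact: (subgroupM (sD _)).
Qed.

Lemma ball_prod r (F : 'I_r -> G) c : (forall q, F q \in ball T c) ->
  \prod_(q < r) F q \in ball T (r * c).
Proof.
elim: r F => [|r IHr] F h; first by rewrite big_ord0 mul0n inE.
by rewrite big_ord_recr mulSn addnC; apply: ball_mul => //; apply: IHr.
Qed.

(** Short approximations of the powers [z^e], [e < n^(i + 1)], of the basis elements of a layer
    multiply to elements that differ modulo the next layer, by independence. Multiplied by
    representatives from deeper layers they remain distinct. *)
Lemma growth_lower : exists C, forall n, (0 < n)%N -> (n ^ hdim k <= size (ball T (C * n)))%N.
Proof.
suff h l : (l <= k)%N -> exists C, forall n, (0 < n)%N -> exists E : seq G,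
    [/\ uniq E, {subset E <= ball T (C * n)}, forall x, x \in E -> DV (k - l) x &
        size E = (n ^ hdim l)%N].
  have [C CP] := h k (leqnn k); exists C => n n0; have [E [uE EB _ <-]] := CP n n0.
  exact: uniq_leq_size.
elim: l => [_|l IHl lk].
  exists 0%N => n n0; exists [:: 1]; split=> // x; rewrite inE => /eqP ->.
  exact: (subgroup1 (sD _)).
have [C' CP'] := IHl (ltnW lk); rewrite /hdim -/hdim; set i := (k - l.+1)%N.
have iE : (k - l = i.+1)%N by rewrite /i -subSn // subSS.
have [sZ [Q [pi [piM pi0 iZ _]]]] := ZP i; set r := size (Z i).
have exC (q : 'I_r) : exists C, forall n e, (0 < n)%N -> (e <= n ^ i.+1)%N ->
    exists y, [/\ y \in ball T (C * n), DV i y & DV i.+1 (y^-1 * (nth 1 (Z i) q) ^+ e)].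
  by apply: approx_power; apply: sZ; apply: mem_nth.
have [Cf CfP] := choice exC; pose C := \max_q Cf q.
exists (r * C + C')%N => n n0; have [E' [uE' EB' ED' Es']] := CP' n n0.
set N := (n ^ i.+1)%N.
have exy (qe : 'I_r * 'I_N) : exists y, [/\ y \in ball T (C * n), DV i y &
    DV i.+1 (y^-1 * (nth 1 (Z i) qe.1) ^+ qe.2)].
  have [y [yB Dy yE]] := CfP qe.1 n qe.2 n0 (ltnW (ltn_ord qe.2)).
  exists y; split=> //; apply: (ball_le sT _ yB); rewrite leq_mul2r.
  by rewrite (leq_bigmax qe.1) orbT.
have [y yP] := choice exy.
pose F (e : {ffun 'I_r -> 'I_N}) := \prod_(q < r) y (q, e q).
have Dz q : (q < r)%N -> DV i (nth 1 (Z i) q).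
  by move=> qr; apply: (lcs_lcl (leqnn i)); apply: sZ; apply: mem_nth.
have DF e : DV i (F e) by apply: (subgroup_prod (sD i)) => q _; case: (yP (q, e q)).
have piF e : pi (F e) = (\sum_(q < r) pi (nth 1%g (Z i) q) *+ e q)%R.
  have prodE (s : seq 'I_r) : pi (\prod_(q <- s) y (q, e q)) =
      (\sum_(q <- s) pi (y (q, e q)))%R.
    elim: s => [|q s IHs]; first by rewrite !big_nil (lcs_pi1 pi0).
    rewrite !big_cons piM ?IHs //; first by case: (yP (q, e q)).
    by apply: (subgroup_prod (sD i)) => q' _; case: (yP (q', e q')).
  rewrite /F prodE; apply: eq_bigr => q _; have [_ Dy yE] := yP (q, e q).
  have Dq := Dz q (ltn_ord q); rewrite -(lcs_piX piM pi0) //.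
  by apply/(lcs_pi_eq piM pi0) => //; apply: (subgroupX _ (sD i)).
have Finj e e' : pi (F e) = pi (F e') -> e = e'.
  rewrite !piF => E; apply/ffunP => q; apply: val_inj.
  pose c (e : {ffun 'I_r -> 'I_N}) (j : nat) :=
    if insub j is Some q then Posz (e q) else 0%R : int.
  have cE (e0 : {ffun 'I_r -> 'I_N}) : (\sum_(q < r) pi (nth 1%g (Z i) q) *+ e0 q = icomb (map pi (Z i)) (c e0))%R.
    rewrite /icomb size_map; apply: eq_bigr => p _.
    by rewrite (nth_map 1) // /c valK pmulrn.
  rewrite !cE in E; have qs : (q < size (map pi (Z i)))%N by rewrite size_map.
  by have := indep_inj iZ E qs; rewrite /c valK => -[].
exists [seq F e * b | e <- enum {ffun 'I_r -> 'I_N}, b <- E']; split.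
- apply: allpairs_uniq => //; first exact: enum_uniq.
  move=> [e b] [e' b'] /allpairsP [[? ?] [_ /= bE [-> ->]]] /allpairsP [[? ?] [_ /= bE' [-> ->]]].
  rewrite /= => E.
  have Db x : x \in E' -> DV i x /\ pi x = 0%R.
    move=> /ED'; rewrite iE => Dx; have Dx' := lcs_le (leqnSn i) Dx.
    by split=> //; apply/pi0.
  have [D1 p1] := Db _ bE; have [D2 p2] := Db _ bE'.
  have := congr1 pi E; rewrite !piM // p1 p2 !addr0 => /Finj e12.
  by move: E; rewrite e12 => /mulgI ->.
- move=> x /allpairsP [[e b] [_ /EB' bB ->]] /=; rewrite mulnDl; apply: ball_mul => //.
  by rewrite -mulnA; apply: ball_prod => q; case: (yP (q, e q)).
- move=> x /allpairsP [[e b] [_ /ED' Db ->]] /=; apply: (subgroupM (sD i)) => //.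
  by rewrite iE in Db; apply: lcs_le Db.
- by rewrite size_allpairs -cardE card_ffun !card_ord Es' expnD mulnC -expnM.
Qed.

End BassGuivarch.

Section GrowthDegree.
Variable R : realType.
Local Open Scope group_scope.

(** Both bounds pass from the nilpotent subgroup to the group: the lower one because [T] lies in a
    ball of [S], the upper one by the lengths in [fin_index_gens]. *)
Lemma growth_degree_full (G : groupType) (S : seq G) D : symm S -> (forall x, sgen S x) ->
  poly_growth S D -> exists d C, (0 < C)%N /\ forall n, (0 < n)%N ->
  (size (ball S n) <= C * n ^ d)%N /\ (n ^ d <= size (ball S (C * n)))%N.
Proof.
move=> sS gS pS; have [T [k [sT fT Tk]]] := virt_nilpotent R sS gS pS.
(* [growth_upper] wants a positive class; commutators with one more entry are still trivial. *)
have Tk1 x : x \in lcl T k.+1 -> x = 1.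
  by move=> /allpairsP [[y t] [/Tk /= -> _ ->]]; rewrite comm1g.
have [Z ZP] := choice (level_basis_exists sT).
have [Cu CuP] := growth_upper R sT (ltn0Sn k) Tk1 ZP.
have [Cl ClP] := growth_lower k.+1 sT ZP.
set d := hdim k.+1 Z k.+1 in CuP ClP.
have sG := sgen_subgroup sT.
have TS : sgen T `<=` sgen S by move=> x _; apply: gS.
have [S' [r [sS' SE SP]]] := fin_index_gens sG sS TS (fin_indexS (fun x _ => I) fT).
have [|c1 c1P] := finite_sgen_ball sT (X := S'); first by move=> x; rewrite SE; apply: sgen_gen.
have [|c2 c2P] := finite_sgen_ball sS (X := T); first by move=> x _; apply: gS.
pose c := c1.+1.
exists d, (size r * Cu * (2 * c) ^ d + c2 * Cl + 1)%N; split=> [|n n0]; first by rewrite addn1.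
have n2 : (0 < c * n.+1)%N by [].
split; last first.
  apply: leq_trans (ClP n n0) _; apply: leq_trans (size_ball_le (ball_sub (n := Cl * n) c2P)) _.
  apply: size_ball_le; apply: (ball_le sS); rewrite mulnA leq_mul2r; apply/orP; right.
  by rewrite -addnA addnCA leq_addr.
have h1 : (size (ball S n) <= size [seq (a * y)%g | a <- ball S' n.+1, y <- r])%N.
  apply: uniq_leq_size (ball_uniq _ _) _ => x /SP [a [y [aB yr ->]]].
  by apply/allpairsP; exists (a, y).
have h2 : (size (ball S' n.+1) <= Cu * (2 * c) ^ d * n ^ d)%N.
  apply: leq_trans (_ : _ <= size (ball T (c * n.+1)))%N _.
    apply: size_ball_le => x /(ball_sub c1P); apply: (ball_le sT).
    by rewrite leq_mul2r leqnSn orbT.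
  apply: leq_trans (CuP _ n2) _; rewrite -mulnA leq_mul2l -expnMn; apply/orP; right.
  have h3 : (c * n.+1 <= 2 * c * n)%N.
    by rewrite (mulnC 2) -mulnA leq_mul2l mul2n -addnn -addn1 leq_add2l n0 orbT.
  by case: (d) => [|d']; rewrite ?expn0 // leq_exp2r.
apply: leq_trans h1 _; rewrite size_allpairs mulnC; apply: leq_trans (leq_mul (leqnn _) h2) _.
by rewrite !mulnA leq_mul2r -addnA leq_addr orbT.
Qed.

Theorem growth_degree (G : groupType) (S : seq G) D : symm S -> poly_growth S D ->
  exists d C, (0 < C)%N /\ forall n, (0 < n)%N ->
  (size (ball S n) <= C * n ^ d)%N /\ (n ^ d <= size (ball S (C * n)))%N.
Proof.
move=> sS pS; have [K [f [A' [fi fM fK A'E [s' gA']]]]] := subgroup_type_gens sS.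
have pA' : poly_growth A' D by apply/(emb_growth fi fM); rewrite A'E.
have [d [C [C0 h]]] := growth_degree_full s' gA' pA'.
exists d, C; split=> // n /h; by rewrite -A'E !(emb_ball fi fM) !size_map.
Qed.

End GrowthDegree.

(** * Linear algebra *)

Section LinearAlgebra.
Variable k : fieldType.
Local Open Scope ring_scope.
Implicit Types V W : lmodType k.

Definition functional V (mu : V -> k) := linear (mu : V -> k^o).

Lemma lspanP V (t : seq V) v : lspan [set` t] v <->
  exists c : nat -> k, v = \sum_(j < size t) c j *: t`_j.
Proof.
split=> [|[c ->]]; last first.
  apply: subspace_sum => [|j _]; first exact: lspan_subspace.
  by apply: subspaceZ; [apply: lspan_subspace|apply/sub_lspan/mem_nth].
move: v; apply: lspan_min => [|v vt].
  split=> [|a x y [c ->] [d ->]].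
    by exists (fun _ => 0); rewrite big1 // => j _; rewrite scale0r.
  exists (fun j => a * c j + d j); rewrite scaler_sumr -big_split.
  by apply: eq_bigr => j _; rewrite scalerDl scalerA.
have it : (index v t < size t)%N by rewrite index_mem.
exists (fun j => (j == index v t)%:R); rewrite (bigD1 (Ordinal it)) //= eqxx scale1r nth_index //.
by rewrite big1 ?addr0 // => j; rewrite -val_eqE /= => /negbTE ->; rewrite scale0r.
Qed.

Lemma lspan_subset V (s t : seq V) : (forall x, x \in s -> lspan [set` t] x) ->
  lspan [set` s] `<=` lspan [set` t].
Proof. by move=> st; apply: lspan_min => [|x]; [exact: lspan_subspace|apply: st]. Qed.

Lemma functional_sum V (mu : V -> k) (I : Type) (r : seq I) (F : I -> V) : functional mu ->
  mu (\sum_(i <- r) F i) = \sum_(i <- r) mu (F i).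
Proof. exact: lin_sum. Qed.

Lemma functionalP V (mu : V -> k) a x y : functional mu -> mu (a *: x + y) = a * mu x + mu y.
Proof. by move=> fm; apply: fm. Qed.

Lemma functionalZ V (mu : V -> k) a v : functional mu -> mu (a *: v) = a * mu v.
Proof. by move=> fm; apply: (linZ a fm). Qed.

Lemma functional_neq0 V (v : V) : v != 0 -> exists2 nu : V -> k, functional nu & nu v = 1.
Proof.
move=> v0; have [q [ql q0 qv]] := subspace_proj (lspan_subspace [set v]).
have ex x : exists c : k, x - q x = c *: v.
  have : lspan [set` [:: v]] (x - q x).
    by apply: lspan_min (qv x) => [|_ ->]; [exact: lspan_subspace|apply/sub_lspan/mem_head].
  by move=> /lspanP [c]; rewrite big_ord1 /= => ->; exists (c 0%N).
have [nu nuP] := choice ex; have vI a b : a *: v = b *: v -> a = b.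
  move=> E; apply/eqP; rewrite -subr_eq0; have := v0; apply: contraNT => ab.
  by apply/eqP/(scalerI ab); rewrite scaler0 scalerBl E subrr.
exists nu; first by move=> a x y; apply: vI; rewrite -nuP ql scalerDl -scalerA -!nuP opprD addrACA scalerBr.
by apply: vI; rewrite -nuP scale1r (_ : q v = 0) ?subr0 //; apply/q0/sub_lspan.
Qed.

Lemma functional_sep V (U : set V) v : subspace U -> ~ U v ->
  exists nu : V -> k, [/\ functional nu, forall u, U u -> nu u = 0 & nu v = 1].
Proof.
move=> sU Uv; have [q [ql q0 qv]] := subspace_proj sU.
have qn0 : q v != 0 by apply/eqP => /q0.
have [nu fn nv] := functional_neq0 qn0; exists (nu \o q); split=> //.
  exact: (comp_linear ql fn).
by move=> u /q0 /= ->; apply: (lin0 fn).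
Qed.

(** Serves as a basis with its dual basis. The functionals are defined on all of [V], so that
    tensors can be contracted with them. *)
Lemma dual_coordinates V (s : seq V) : exists n (a : nat -> V) (mu : nat -> V -> k),
  (forall i, functional (mu i)) /\ forall u, lspan [set` s] u -> u = \sum_(i < n) mu i u *: a i.
Proof.
elim: s => [|v s [n [a [mu [fm E]]]]].
  exists 0%N, (fun _ => 0), (fun _ _ => 0); split=> [i a x y|u /lspanP [c]].
    by rewrite scaler0 addr0.
  by rewrite !big_ord0.
have [vs|nvs] := pselect (lspan [set` s] v).
  exists n, a, mu; split=> // u us; apply: E; move: u us; apply: lspan_subset => x.
  by rewrite inE => /orP [/eqP ->//|xs]; apply: sub_lspan.
have [nu [fn nu0 nv]] := functional_sep (lspan_subspace _) nvs.
exists n.+1, (fun i => if i == n then v - \sum_(i < n) mu i v *: a i else a i),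
  (fun i => if i == n then nu else mu i); split=> [i|u]; first by case: eqP.
rewrite big_ord_recr /= eqxx (eq_bigr (fun i : 'I_n => mu i u *: a i)); last first.
  by move=> i _; rewrite ltn_eqF.
move: u; apply: lspan_min => [|x].
  split=> [|b x y /= Ex Ey].
    rewrite (lin0 fn) scale0r addr0 big1 // => i _; by rewrite (lin0 (fm i)) scale0r.
  rewrite {1}Ex {1}Ey (functionalP _ _ _ fn) scalerDl scalerDr addrACA !scaler_sumr.
  rewrite -big_split /=; congr (_ + _); last by rewrite scalerA.
  by apply: eq_bigr => i _; rewrite (functionalP _ _ _ (fm i)) scalerDl scalerA.
rewrite /= inE => /orP [/eqP ->|xs].
  by rewrite nv scale1r addrC subrK.
by have xl := sub_lspan (S := [set` s]) xs; rewrite nu0 // scale0r addr0; apply: E.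
Qed.

Section Contractions.
Variables V W : lmodType k.
Implicit Types (t : V ⊗ W).

Definition contl (mu : V -> k) t : W := tens_lift (fun v w => mu v *: w) t.
Definition contr (mu : W -> k) t : V := tens_lift (fun v w => mu w *: v) t.

Lemma contl_bilin (mu : V -> k) : functional mu -> bilin (fun v (w : W) => mu v *: w).
Proof.
move=> fm; split=> [v a x y|w a x y]; first by rewrite scalerDr scalerA mulrC -scalerA.
by rewrite (functionalP _ _ _ fm) scalerDl scalerA.
Qed.

Lemma contr_bilin (mu : W -> k) : functional mu -> bilin (fun (v : V) w => mu w *: v).
Proof.
move=> fm; split=> [v a x y|w a x y]; last by rewrite scalerDr scalerA mulrC -scalerA.
by rewrite (functionalP _ _ _ fm) scalerDl scalerA.
Qed.

Lemma contl_linear mu : functional mu -> linear (contl mu).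
Proof. by move=> fm; apply/tens_lift_linear/contl_bilin. Qed.
Lemma contr_linear mu : functional mu -> linear (contr mu).
Proof. by move=> fm; apply/tens_lift_linear/contr_bilin. Qed.
Lemma contl_pure mu v w : functional mu -> contl mu (v ⊗ w) = mu v *: w.
Proof. by move=> fm; apply/tens_lift_pure/contl_bilin. Qed.
Lemma contr_pure mu v w : functional mu -> contr mu (v ⊗ w) = mu w *: v.
Proof. by move=> fm; apply/tens_lift_pure/contr_bilin. Qed.

Lemma contl_expand t : exists n (a : nat -> V) (mu : nat -> V -> k),
  (forall i, functional (mu i)) /\ t = \sum_(i < n) a i ⊗ contl (mu i) t.
Proof.
have [n [a [mu [fm E]]]] := dual_coordinates [seq p.1 | p <- repr t].
exists n, a, mu; split=> //; rewrite {1}(tensE t).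
have -> : \sum_(i < n) a i ⊗ contl (mu i) t =
    \sum_(p <- repr t) \sum_(i < n) mu i p.1 *: (a i ⊗ p.2).
  rewrite exchange_big /=; apply: eq_bigr => i _.
  rewrite {1}(tensE t) (lin_sum _ _ (contl_linear (fm i))).
  elim: (repr t : seq _) => [|p r IHr]; first by rewrite !big_nil tpure0r.
  by rewrite !big_cons tpureDr IHr contl_pure // tpureZr.
rewrite big_seq [RHS]big_seq; apply: eq_bigr => p pt.
rewrite {1}(E p.1); last by apply/sub_lspan/map_f.
elim: n {E} => [|n IHn]; first by rewrite !big_ord0 tpure0l.
by rewrite !big_ord_recr tpureDl IHn tpureZl.
Qed.

Lemma contr_expand t : exists n (a : nat -> W) (mu : nat -> W -> k),
  (forall i, functional (mu i)) /\ t = \sum_(i < n) contr (mu i) t ⊗ a i.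
Proof.
have [n [a [mu [fm E]]]] := dual_coordinates [seq p.2 | p <- repr t].
exists n, a, mu; split=> //; rewrite {1}(tensE t).
have -> : \sum_(i < n) contr (mu i) t ⊗ a i =
    \sum_(p <- repr t) \sum_(i < n) mu i p.2 *: (p.1 ⊗ a i).
  rewrite exchange_big /=; apply: eq_bigr => i _.
  rewrite {1}(tensE t) (lin_sum _ _ (contr_linear (fm i))).
  elim: (repr t : seq _) => [|p r IHr]; first by rewrite !big_nil tpure0l.
  by rewrite !big_cons tpureDl IHr contr_pure // tpureZl.
rewrite big_seq [RHS]big_seq; apply: eq_bigr => p pt.
rewrite {1}(E p.2); last by apply/sub_lspan/map_f.
elim: n {E} => [|n IHn]; first by rewrite !big_ord0 tpure0r.
by rewrite !big_ord_recr tpureDr IHn tpureZr.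
Qed.

Lemma contr_inj t t' : (forall mu, functional mu -> contr mu t = contr mu t') -> t = t'.
Proof.
move=> E; apply/eqP; rewrite -subr_eq0; apply/eqP.
have [n [a [mu [fm ->]]]] := contr_expand (t - t').
rewrite big1 // => i _; rewrite (linB (contr_linear (fm i))) E // subrr.
by rewrite tpure0l.
Qed.

End Contractions.

Definition freef V (I : finType) (v : I -> V) :=
  forall c : I -> k, \sum_i c i *: v i = 0 -> forall i, c i = 0.
(** Dimension at least [n]. It makes sense for every subspace and is monotone without finiteness
    assumptions, whereas [vdim] is 0 in infinite dimension; [vdimP] connects the two. *)
Definition dimge V (U : set V) n := exists2 v : 'I_n -> V, freef v & forall i, U (v i).

Lemma dimge_fin V (U : set V) (I : finType) (v : I -> V) : freef v -> (forall i, U (v i)) ->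
  dimge U #|I|.
Proof.
move=> fv Uv; exists (v \o enum_val) => [c E i|i]; last exact: Uv.
rewrite -(enum_valK i); apply: (fv (c \o enum_rank)); rewrite -[RHS]E.
rewrite (reindex_onto enum_val enum_rank) /=; last by move=> j _; apply: enum_rankK.
by apply: eq_big => [j|j _]; rewrite ?enum_valK ?eqxx.
Qed.

Lemma dimge_sub V (U U' : set V) n : U `<=` U' -> dimge U n -> dimge U' n.
Proof. by move=> UU [v fv Uv]; exists v => // i; apply/UU/Uv. Qed.

Lemma dimge_le V (U : set V) m n : (m <= n)%N -> dimge U n -> dimge U m.
Proof.
move=> mn [v fv Uv]; exists (v \o widen_ord mn) => [c E i|i]; last exact: Uv.
pose d (j : 'I_n) := if insub (val j) is Some i then c i else 0.
have dE i' : d (widen_ord mn i') = c i' by rewrite /d /= valK.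
rewrite -dE; apply: fv; rewrite -[RHS]E.
rewrite (bigID (fun j : 'I_n => (j < m)%N)) /= [X in _ + X]big1 ?addr0.
  by rewrite big_ord_narrow; apply: eq_bigr => j _; rewrite dE.
by move=> j jm; rewrite /d insubF ?scale0r //; apply: negbTE.
Qed.

(** Rank and nullity as an inequality: the kernel of the coordinate matrix of [f] on a free family
    yields a free family in the kernel of [f]. *)
Lemma dimge_ker V W (f : V -> W) (U : set V) (t : seq W) m : linear f -> subspace U ->
  (forall u, U u -> lspan [set` t] (f u)) -> dimge U m ->
  dimge [set u | U u /\ f u = 0] (m - size t).
Proof.
move=> fl sU ft [v fv Uv].
have ex i : exists c : nat -> k, f (v i) = \sum_(j < size t) c j *: t`_j by apply/lspanP/ft.
have [c cP] := choice ex; pose M := \matrix_(i < m, j < size t) c i j.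
pose B := row_base (kermx M); apply: (@dimge_le _ _ _ (\rank (kermx M))).
  by rewrite mxrank_ker leq_sub2l // rank_leq_col.
have BM : B *m M = 0 by apply/sub_kermxP; rewrite /B eq_row_base.
exists (fun l => \sum_i B l i *: v i) => [d E l|l]; last split.
- have dB : (\row_l d l) *m B = 0.
    apply/rowP => i; rewrite !mxE; apply: (fv (fun i => \sum_j (\row_l d l) 0 j * B j i)); rewrite -[RHS]E.
    rewrite [RHS](eq_bigr (fun l => \sum_i (d l * B l i) *: v i)); last first.
      by move=> l' _; rewrite scaler_sumr; apply: eq_bigr => i' _; rewrite scalerA.
    rewrite exchange_big; apply: eq_bigr => i' _; rewrite scaler_suml.
    by apply: eq_bigr => l' _; rewrite !mxE.
  have /row_freeP [B' BB] : row_free B := row_base_free _.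
  have := congr1 (mulmx^~ B') dB; rewrite -mulmxA BB mulmx1 mul0mx => /rowP /(_ l).
  by rewrite !mxE.
- by apply: subspace_sum => // i _; apply: subspaceZ.
- rewrite (lin_sum _ _ fl) (eq_bigr (fun i => \sum_(j < size t) (B l i * M i j) *: t`_j)).
    rewrite exchange_big big1 // => j _; rewrite -scaler_suml.
    by have /matrixP /(_ l j) := BM; rewrite !mxE => ->; rewrite scale0r.
  move=> i _; rewrite (linZ _ fl) cP scaler_sumr; apply: eq_bigr => j _.
  by rewrite scalerA [M i j]mxE.
Qed.

Lemma dimge_bound V (U : set V) (t : seq V) m : U `<=` lspan [set` t] -> dimge U m ->
  (m <= size t)%N.
Proof.
move=> Ut dU; have := dimge_ker (@id_linear _ V) (lspan_subspace [set` t]) (fun u h => h)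
  (dimge_sub Ut dU).
move=> [v fv v0]; rewrite -subn_eq0; case: (_ - _)%N v fv v0 => // n v fv v0.
have := fv (fun _ => 1) _ ord0; rewrite big1 => [|i _]; last first.
  by case: (v0 i) => _ /= ->; rewrite scaler0.
by move=> /(_ erefl) /eqP; rewrite oner_eq0.
Qed.

Lemma dimge_extend V (E U : set V) n u : subspace E -> dimge E n -> E `<=` U -> U u -> ~ E u ->
  dimge U n.+1.
Proof.
move=> sE [v fv Ev] EU Uu nu.
have [nu' [fnu nu0 nu1]] := functional_sep sE nu.
exists (fun i => oapp v u (unlift ord_max i)) => [c|i]; last first.
  by case: unlift => [j|//]; apply/EU/Ev.
rewrite big_ord_recr /= unlift_none /= => E1.
have {}E1 : \sum_(i < n) c (widen_ord (leqnSn n) i) *: v i + c ord_max *: u = 0.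
  rewrite -[RHS]E1; congr (_ + _); apply: eq_bigr => i _.
  have -> : widen_ord (leqnSn n) i = lift ord_max i by apply: val_inj; rewrite /= /bump leqNgt ltn_ord.
  by rewrite liftK.
have cm : c ord_max = 0.
  have := congr1 nu' E1; rewrite (lin0 fnu) (linD fnu) (functionalZ _ _ fnu) nu1 mulr1.
  by rewrite nu0 ?add0r //; apply: subspace_sum => // i _; apply: subspaceZ.
rewrite cm scale0r addr0 in E1 => i; have [j ->|->//] := unliftP ord_max i.
have -> : lift ord_max j = widen_ord (leqnSn n) j by apply: val_inj; rewrite /= /bump leqNgt ltn_ord.
exact: (fv _ E1 j).
Qed.

Lemma subspace_basis V (U : set V) (t : seq V) : subspace U -> U `<=` lspan [set` t] ->
  exists2 s, lin_free s & U = lspan [set` s].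
Proof.
move=> sU Ut; have ex : exists n, `[< dimge U n >].
  by exists 0%N; apply/asboolP; exists (fun=> 0) => [c _ []|[]].
have ub n : `[< dimge U n >] -> (n <= size t)%N by move=> /asboolP; apply: dimge_bound.
have [n /asboolP [v fv Uv] nmax] := ex_maxnP ex ub.
pose s := [seq v i | i <- enum 'I_n]; have ss : size s = n by rewrite size_map size_enum_ord.
have snth (i : 'I_n) : s`_i = v i.
  by rewrite (nth_map i) ?size_enum_ord // nth_ord_enum.
have lE (c : nat -> k) : \sum_(j < size s) c j *: s`_j = \sum_(j < n) c j *: v j.
  have aux (F : nat -> V) : \sum_(j < size s) F j = \sum_(j < n) F j by rewrite ss.
  by rewrite (aux (fun j => c j *: s`_j)); apply: eq_bigr => j _; rewrite snth.
exists s => [c E i|].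
  pose d (j : nat) := if insub j is Some i then c i else 0.
  have dE (i' : 'I_(size s)) : d i' = c i' by rewrite /d valK.
  have E' : \sum_(j < n) d j *: v j = 0.
    by rewrite -lE -[RHS]E; apply: eq_bigr => j _; rewrite dE.
  have iN : (i < n)%N by rewrite -ss.
  by rewrite -dE; have := fv (fun j => d j) E' (Ordinal iN).
apply/seteqP; split; last first.
  by apply: lspan_min => [//|x /mapP [i _ ->]].
move=> u Uu; apply: contrapT => nu.
have sl := lspan_subspace [set` s].
have sU' : lspan [set` s] `<=` U by apply: lspan_min => [//|x /mapP [i _ ->]].
have ds : dimge (lspan [set` s]) n.
  by exists v => // i; apply/sub_lspan/map_f; rewrite mem_enum.
by have /asboolP /nmax := dimge_extend sl ds sU' Uu nu; rewrite ltnn.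
Qed.

Lemma dimge_lin_free V (s : seq V) : lin_free s -> dimge (lspan [set` s]) (size s).
Proof. by move=> fs; exists (fun i => s`_i) => // i; apply/sub_lspan/mem_nth. Qed.

Lemma vdimP V (U : set V) (t : seq V) m : subspace U -> U `<=` lspan [set` t] ->
  dimge U m <-> (m <= vdim U)%N.
Proof.
move=> sU Ut; have [s fs UE] := subspace_basis sU Ut.
have -> : vdim U = size s.
  rewrite /vdim; case: xgetP => [n -> [s' [fs' UE' <-]]|/(_ (size s))]; last first.
    by move=> h; case: h; exists s.
  apply/eqP; rewrite eqn_leq; apply/andP; split.
    by apply: (@dimge_bound _ U) (dimge_sub _ (dimge_lin_free fs')); rewrite ?UE -?UE' ?UE.
  by apply: (@dimge_bound _ U) (dimge_sub _ (dimge_lin_free fs)); rewrite ?UE' -?UE ?UE'.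
split=> [|ms]; first by apply: dimge_bound; rewrite UE.
by apply: dimge_le ms _; rewrite UE; apply: dimge_lin_free.
Qed.

End LinearAlgebra.

(** * The coradical filtration *)

Section Hits.
Variables (k : fieldType) (H : hopfAlgType k).
Local Open Scope ring_scope.
Implicit Types (mu nu : H -> k) (x y g : H).

(** The two actions of the dual algebra on [H]: in Sweedler notation [hl mu x] is [mu(x1) x2] and
    [hr mu x] is [mu(x2) x1]. *)
Definition hl mu x : H := contl mu (comul x).
Definition hr mu x : H := contr mu (comul x).

Lemma hl_linear mu : functional mu -> linear (hl mu).
Proof. move=> fm; exact: (comp_linear (@comul_linear k H) (contl_linear fm)). Qed.
Lemma hr_linear mu : functional mu -> linear (hr mu).
Proof. move=> fm; exact: (comp_linear (@comul_linear k H) (contr_linear fm)). Qed.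

Lemma counit_functional : functional (@counit k H).
Proof. exact: counit_linear. Qed.

Lemma hl_counit x : hl (@counit k H) x = x. Proof. exact: counitl. Qed.
Lemma hr_counit x : hr (@counit k H) x = x. Proof. exact: counitr. Qed.

Lemma comp_functional (V W : lmodType k) (f : V -> W) (nu : W -> k) :
  linear f -> functional nu -> functional (nu \o f).
Proof. by move=> fl fn; apply: (comp_linear fl fn). Qed.

Lemma functional_ext (V W : lmodType k) (f g : V ⊗ W -> k) : functional f -> functional g ->
  (forall v w, f (v ⊗ w) = g (v ⊗ w)) -> f =1 g.
Proof. by move=> ff fg; apply: (tens_ext (V' := k^o) ff fg). Qed.

Lemma contl_contr (V W : lmodType k) (mu : V -> k) (nu : W -> k) (t : V ⊗ W) :
  functional mu -> functional nu -> nu (contl mu t) = mu (contr nu t).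
Proof.
move=> fm fn; refine (functional_ext (comp_functional (contl_linear fm) fn)
  (comp_functional (contr_linear fn) fm) _ t) => v w /=.
by rewrite contl_pure // contr_pure // !functionalZ // mulrC.
Qed.

Lemma hl_hr mu nu x : functional mu -> functional nu -> nu (hl mu x) = mu (hr nu x).
Proof. by move=> fm fn; exact: (contl_contr (comul x) fm fn). Qed.

Lemma contl_map (V W V' W' : lmodType k) (f : V -> V') (g : W -> W') (mu : V' -> k) (t : V ⊗ W) :
  linear f -> linear g -> functional mu ->
  contl mu (tens_map f g t) = g (contl (mu \o f) t).
Proof.
move=> fl gl fm; have fmf := comp_functional fl fm.
refine (tens_ext (comp_linear (tens_map_linear fl gl) (contl_linear fm))
  (comp_linear (contl_linear fmf) gl) _ t) => v w /=.
by rewrite tens_map_pure // !contl_pure // (linZ _ gl).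
Qed.

Lemma contr_map (V W V' W' : lmodType k) (f : V -> V') (g : W -> W') (mu : W' -> k) (t : V ⊗ W) :
  linear f -> linear g -> functional mu ->
  contr mu (tens_map f g t) = f (contr (mu \o g) t).
Proof.
move=> fl gl fm; have fmg := comp_functional gl fm.
refine (tens_ext (comp_linear (tens_map_linear fl gl) (contr_linear fm))
  (comp_linear (contr_linear fmg) fl) _ t) => v w /=.
by rewrite tens_map_pure // !contr_pure // (linZ _ fl).
Qed.

Lemma contl_assoc mu nu (t : (H ⊗ H) ⊗ H) : functional mu -> functional nu ->
  contl nu (contl mu (tens_assoc t)) = contl (nu \o contl mu) t.
Proof.
move=> fm fn; have fnm : functional (nu \o contl mu) := comp_functional (contl_linear fm) fn.
have lA := @tens_assoc_linear k H H H.
have lL := comp_linear lA (comp_linear (contl_linear fm) (contl_linear fn)).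
refine (tens_ext lL (contl_linear fnm) _ t) => s w /=.
have ls : linear (fun s : H ⊗ H => s ⊗ w).
  by move=> a u v; rewrite tpureDl tpureZl.
have ls' : linear (fun s : H ⊗ H => contl (nu \o contl mu) (s ⊗ w)).
  exact: (comp_linear ls (contl_linear fnm)).
refine (tens_ext (comp_linear ls lL) ls' _ s) => u v /=.
rewrite tens_assoc_pure contl_pure // (linZ _ (contl_linear fn)) !contl_pure //=.
by rewrite contl_pure // functionalZ // scalerA.
Qed.

Lemma contr_assoc mu nu (t : (H ⊗ H) ⊗ H) : functional mu -> functional nu ->
  contr (mu \o contr nu) (tens_assoc t) = contr mu (contr nu t).
Proof.
move=> fm fn; have fmn : functional (mu \o contr nu) := comp_functional (contr_linear fn) fm.
have lL := comp_linear (@tens_assoc_linear k H H H) (contr_linear fmn).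
have lR : linear (fun t : (H ⊗ H) ⊗ H => contr mu (contr nu t)).
  exact: (comp_linear (contr_linear fn) (contr_linear fm)).
refine (tens_ext lL lR _ t) => s w /=.
have ls : linear (fun s : H ⊗ H => s ⊗ w) by move=> a u v; rewrite tpureDl tpureZl.
refine (tens_ext (comp_linear ls lL) (comp_linear ls lR) _ s) => u v /=.
rewrite tens_assoc_pure !contr_pure //= (linZ _ (contr_linear fm)) !contr_pure //.
by rewrite functionalZ // scalerA.
Qed.

Lemma hl_hl mu nu x : functional mu -> functional nu -> hl nu (hl mu x) = hl (nu \o hl mu) x.
Proof.
move=> fm fn; have idl := @id_linear _ H; have cl := @comul_linear k H.
have := congr1 (fun t => contl nu (contl mu t)) (comulA x) => /=.
rewrite contl_assoc // contl_map //; last exact: comp_functional (contl_linear fm) fn.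
by rewrite contl_map //= => <-.
Qed.

Lemma hr_hr mu nu x : functional mu -> functional nu -> hr mu (hr nu x) = hr (mu \o hr nu) x.
Proof.
move=> fm fn; have idl := @id_linear _ H; have cl := @comul_linear k H.
have fmn : functional (mu \o contr nu) := comp_functional (contr_linear fn) fm.
have := congr1 (contr (mu \o contr nu)) (comulA x) => /=.
by rewrite contr_assoc // contr_map // contr_map //= => ->.
Qed.

Lemma hl_hrC mu nu x : functional mu -> functional nu -> hl mu (hr nu x) = hr nu (hl mu x).
Proof.
move=> fm fn; apply/eqP; rewrite -subr_eq0; apply/eqP; apply: contrapT => /eqP n0.
have [la fla l1] := functional_neq0 n0.
have E : la (hl mu (hr nu x)) = la (hr nu (hl mu x)).
  have fL : functional (la \o hr nu) := comp_functional (hr_linear fn) fla.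
  by rewrite (hl_hr _ fm fla) (hr_hr _ fla fn) -(hl_hr _ fm fL).
by move: l1; rewrite (linB fla) E subrr => /esym /eqP; rewrite oner_eq0.
Qed.

Lemma hl_sum mu x (s : seq (H * H)) : functional mu -> comul x = \sum_(p <- s) p.1 ⊗ p.2 ->
  hl mu x = \sum_(p <- s) mu p.1 *: p.2.
Proof.
move=> fm E; rewrite /hl E (lin_sum _ _ (contl_linear fm)).
by apply: eq_bigr => p _; rewrite contl_pure.
Qed.

Lemma hr_sum mu x (s : seq (H * H)) : functional mu -> comul x = \sum_(p <- s) p.1 ⊗ p.2 ->
  hr mu x = \sum_(p <- s) mu p.2 *: p.1.
Proof.
move=> fm E; rewrite /hr E (lin_sum _ _ (contr_linear fm)).
by apply: eq_bigr => p _; rewrite contr_pure.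
Qed.

Lemma comul_seq x : exists s : seq (H * H), comul x = \sum_(p <- s) p.1 ⊗ p.2.
Proof. by exists (repr (comul x)); rewrite -tensE. Qed.

Lemma comulM_sum x y (s s' : seq (H * H)) : comul x = \sum_(p <- s) p.1 ⊗ p.2 ->
    comul y = \sum_(p <- s') p.1 ⊗ p.2 ->
  comul (x * y) = \sum_(r <- [seq (p.1 * q.1, p.2 * q.2) | p <- s, q <- s']) r.1 ⊗ r.2.
Proof.
move=> E E'; rewrite comulM E E' big_allpairs_dep /=.
rewrite (lin_sum _ _ (tens_mul_linearl _)); apply: eq_bigr => p _.
rewrite (lin_sum _ _ (tens_mul_linearr _)); apply: eq_bigr => q _.
by rewrite tens_mul_pure.
Qed.

Lemma functional_mulr mu x : functional mu -> functional (fun y => mu (x * y)).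
Proof. by move=> fm a y z; rewrite mulrDr -scalerAr; apply: fm. Qed.

Lemma functional_mull mu x : functional mu -> functional (fun y => mu (y * x)).
Proof. by move=> fm a y z; rewrite mulrDl -scalerAl; apply: fm. Qed.

Lemma hrM mu x y (s : seq (H * H)) : functional mu -> comul x = \sum_(p <- s) p.1 ⊗ p.2 ->
  hr mu (x * y) = \sum_(p <- s) p.1 * hr (fun z => mu (p.2 * z)) y.
Proof.
move=> fm E; have [s' E'] := comul_seq y.
rewrite (hr_sum fm (comulM_sum E E')) big_allpairs_dep; apply: eq_bigr => p _.
rewrite (hr_sum (functional_mulr _ fm) E') mulr_sumr; apply: eq_bigr => q _ /=.
by rewrite scalerAr.
Qed.

Lemma hl_grouplike mu g : functional mu -> grouplike g -> hl mu g = mu g *: g.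
Proof. by move=> fm [E _]; rewrite /hl E contl_pure. Qed.

Lemma hr_grouplike mu g : functional mu -> grouplike g -> hr mu g = mu g *: g.
Proof. by move=> fm [E _]; rewrite /hr E contr_pure. Qed.

Lemma grouplike_neq0 g : grouplike g -> g != 0.
Proof.
by move=> [_ e1]; apply/eqP => g0; move/eqP: e1; rewrite g0 (lin0 counit_functional) eq_sym oner_eq0.
Qed.

(** Dedekind's argument: hitting by a functional multiplies each group-like by its value there. A
    functional that is 1 at [h] and kills the span of [T] turns a relation that involves [h] into
    [g = h]. *)
Lemma grouplike_span_notin (T : seq H) g : (forall h, h \in T -> grouplike h) -> grouplike g ->
  g \notin T -> ~ lspan [set` T] g.
Proof.
elim: T g => [|h T IHT] g gT gg; first by move=> _ /lspanP [c]; rewrite big_ord0; apply/eqP/grouplike_neq0.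
have gh := gT h (mem_head _ _).
have {}gT x : x \in T -> grouplike x by move=> xT; apply: gT; rewrite inE xT orbT.
rewrite inE negb_or => /andP [gh' gnT] /lspanP [c]; rewrite big_ord_recl /=.
set u := \sum_(i < _) _ => E.
have Tu : lspan [set` T] u by apply/lspanP; exists (fun j => c j.+1).
have [hT|hnT] := boolP (h \in T).
  apply: (IHT g gT gg gnT); rewrite E; apply: subspaceD => //; first exact: lspan_subspace.
  by apply: subspaceZ; [exact: lspan_subspace|exact: sub_lspan].
have [chi [fc c0 c1]] := functional_sep (lspan_subspace _) (IHT h gT gh hnT).
have hu : hr chi u = 0.
  apply: (lspan_min (preimage_subspace (hr_linear fc) (@set0_subspace k H)) _ Tu) => x xT /=.
  by rewrite hr_grouplike ?c0 ?scale0r //; [exact: sub_lspan|exact: gT].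
have chig : chi g = c 0%N by rewrite {1}E (linD fc) (functionalZ _ _ fc) c1 mulr1 c0 ?addr0.
have := congr1 (hr chi) E; rewrite (linD (hr_linear fc)) (linZ _ (hr_linear fc)) hu addr0.
rewrite !hr_grouplike // c1 scale1r chig; have [c00 _|c00 /(scalerI c00) gE] := eqVneq (c 0%N) 0.
  by apply: (IHT g gT gg gnT); rewrite E c00 scale0r add0r.
by rewrite gE eqxx in gh'.
Qed.

Lemma grouplike_dual (T : seq H) g : (forall h, h \in T -> grouplike h) -> grouplike g ->
  exists chi : H -> k, [/\ functional chi, chi g = 1 & forall h, h \in T -> h != g -> chi h = 0].
Proof.
move=> gT gg; pose T' := [seq h <- T | h != g].
have gT' h : h \in T' -> grouplike h by rewrite mem_filter => /andP [_ /gT].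
have gn : g \notin T' by rewrite mem_filter eqxx.
have [chi [fc c0 c1]] := functional_sep (lspan_subspace _) (grouplike_span_notin gT' gg gn).
exists chi; split=> // h hT hg; apply/c0/sub_lspan; by rewrite /= mem_filter hg.
Qed.

End Hits.

(** * The coradical filtration exhausts the Hopf algebra *)

Section Exhaustive.
Variables (k : fieldType) (H : hopfAlgType k) (pH : pointed H).
Local Open Scope ring_scope.
Local Notation F := (corad_filt_pred H).
Implicit Types (mu nu la : H -> k) (x y : H) (C D E M N : set H).

(** Project the left factors along [C]. The projected part of the comultiplication involves only
    hits of [x] by functionals that vanish on [C]. *)
Lemma comul_split C E x : subspace C ->
    (forall mu, functional mu -> (forall c, C c -> mu c = 0) -> E (hl mu x)) ->
  exists s : seq (H * H), comul x = \sum_(p <- s) p.1 ⊗ p.2 /\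
    forall p, p \in s -> (C p.1 /\ exists2 mu, functional mu & p.2 = hl mu x) \/ E p.2.
Proof.
move=> sC h; have [q [ql q0 qC]] := subspace_proj sC.
have idl := @id_linear _ H; have ql1 := tens_map_linear ql idl.
have [n [a [mu [fm Dx]]]] := contl_expand (comul x).
have [m [b [nu [fn Dq]]]] := contl_expand (tens_map q id (comul x)).
pose s1 := [seq (a (val i) - q (a (val i)), hl (mu (val i)) x) | i <- index_enum 'I_n].
pose s2 := [seq (b (val i), hl (nu (val i) \o q) x) | i <- index_enum 'I_m].
exists (s1 ++ s2); split; last first.
  move=> p; rewrite mem_cat => /orP [] /mapP [i _ ->]; [left|right].
    by split; [apply: qC|exists (mu (val i))].
  by apply: h => [|c /q0 /= ->]; [exact: comp_functional|exact: lin0 (fn _)].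
rewrite big_cat /s1 /s2 !big_map /=.
have -> : \sum_(i < m) b i ⊗ hl (nu i \o q) x = tens_map q id (comul x).
  by rewrite [RHS]Dq; apply: eq_bigr => i _; rewrite contl_map.
rewrite {2}Dx (lin_sum _ _ ql1) -big_split {1}Dx; apply: eq_bigr => i _ /=.
by rewrite tens_map_pure // -tpureDl subrK.
Qed.

Lemma wedgeP C E x : subspace C ->
  (forall mu, functional mu -> (forall c, C c -> mu c = 0) -> E (hl mu x)) -> wedge C E x.
Proof.
move=> sC h; have [s [Dx sP]] := comul_split sC h; rewrite /wedge /= Dx.
have lS U V : subspace (tens_sub U V : set (H ⊗ H)) by exact: lspan_subspace.
apply: subspace_sum => [|p /sP [[Cp _]|Ep]]; first exact: addset_subspace.
  by apply: addset_l; [exact: lS|exact: tens_sub_pure].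
by apply: addset_r; [exact: lS|exact: tens_sub_pure].
Qed.

(** For subspaces these are the left coideals, that is, the subcomodules of [H] over itself. *)
Definition hit_closed M := forall mu x, functional mu -> M x -> M (hl mu x).

Lemma subcoalgebra_hits D mu x : subcoalgebra D -> functional mu -> D x -> D (hl mu x).
Proof.
move=> [sD DD] fm /DD; apply: (tens_sub_min (preimage_subspace (contl_linear fm) sD)) => v w Dv Dw /=.
by rewrite contl_pure //; apply: subspaceZ.
Qed.

Lemma subcoalgebra_kill D mu x : subcoalgebra D -> functional mu -> (forall d, D d -> mu d = 0) ->
  D x -> hl mu x = 0.
Proof.
move=> [sD DD] fm m0 /DD.
apply: (tens_sub_min (preimage_subspace (contl_linear fm) (@set0_subspace k H))) => v w Dv Dw /=.
by rewrite contl_pure // m0 // scale0r.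
Qed.

Lemma hits_subcoalgebra C : subspace C -> hit_closed C ->
  (forall mu x, functional mu -> C x -> C (hr mu x)) -> subcoalgebra C.
Proof.
move=> sC Cl Cr; split=> // x Cx; have [q [ql q0 qC]] := subspace_proj sC.
have idl := @id_linear _ H.
have E1 : tens_map q id (comul x) = 0.
  apply: contr_inj => mu fm; rewrite contr_map // (lin0 (contr_linear fm)).
  by apply/q0/Cr.
have E2 : tens_map id q (comul x) = 0.
  have [n [a [mu [fm ->]]]] := contl_expand (tens_map id q (comul x)).
  rewrite big1 // => i _; have z : q (hl (mu i) x) = 0 by apply/q0/Cl.
  by rewrite contl_map // [q _]z tpure0r.
pose p y := y - q y; have pl : linear p.
  by move=> a y z; rewrite /p ql opprD addrACA scalerBr.
have -> : comul x = tens_map p p (comul x).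
  have lA : linear (fun t : H ⊗ H => t - tens_map q id t).
    by move=> a y z; rewrite (tens_map_linear ql idl) opprD addrACA scalerBr.
  have lB : linear (fun t : H ⊗ H => t - tens_map id q t).
    by move=> a y z; rewrite (tens_map_linear idl ql) opprD addrACA scalerBr.
  have h (t : H ⊗ H) : tens_map p p t =
      (t - tens_map q id t) - tens_map id q (t - tens_map q id t).
    refine (tens_ext (tens_map_linear pl pl) (comp_linear lA lB) _ t) => v w /=.
    have nl (a b : H) : (- a) ⊗ b = - (a ⊗ b) by rewrite -scaleN1r tpureZl scaleN1r.
    have nr (a b : H) : a ⊗ (- b) = - (a ⊗ b) by rewrite -scaleN1r tpureZr scaleN1r.
    by rewrite !tens_map_pure // -nl -tpureDl tens_map_pure // -nr -tpureDr.
  by rewrite h E1 subr0 E2 subr0.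
have sT : subspace [set t : H ⊗ H | tens_sub C C (tens_map p p t)].
  exact: (preimage_subspace (tens_map_linear pl pl) (lspan_subspace _)).
elim/tens_ind: (comul x) => [v w||t t'].
- by rewrite tens_map_pure //; apply: tens_sub_pure; apply: qC.
- by case: sT.
- exact: (subspaceD sT).
Qed.

Section SimpleQuotient.
Variables M E : set H.
Hypotheses (sM : subspace M) (sE : subspace E) (cM : hit_closed M) (cE : hit_closed E).
Hypothesis EM : E `<=` M.
Hypothesis maxE : forall N, subspace N -> hit_closed N -> E `<=` N -> N `<=` M ->
  N `<=` E \/ M `<=` N.

Definition kills la := functional la /\ forall e, E e -> la e = 0.

Let hrE0 la e : kills la -> E e -> hr la e = 0.
Proof.
move=> [fl l0] Ee; apply: contrapT => /eqP /functional_neq0 [nu fn].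
by rewrite -hl_hr // l0; [move/esym/eqP; rewrite oner_eq0|apply: cE].
Qed.

(** For [la] killing [E], the element [hr la y] is a matrix coefficient of the comodule [M / E],
    which [maxE] makes simple unless it is zero. Sums are indexed by a list of functionals so that
    the length is available for induction. *)
Fixpoint coeff_sum (l : seq (H -> k)) x : Prop :=
  if l is la :: l' then exists2 y, M y & coeff_sum l' (x - hr la y) else x = 0.
Fixpoint all_kill (l : seq (H -> k)) : Prop :=
  if l is la :: l' then kills la /\ all_kill l' else True.

Lemma coeff_sum_subspace l : all_kill l -> subspace (coeff_sum l).
Proof.
elim: l => [_|la l IHl [[fl l0] kl]] /=; first exact: set0_subspace.
have sl := IHl kl; split=> [|a x x' [y My hy] [y' My' hy']].
  by exists 0; rewrite ?(lin0 (hr_linear fl)) ?subr0; [case: sM|case: sl].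
exists (a *: y + y'); first by case: sM => _; apply.
rewrite (hr_linear fl) opprD addrACA -scalerBr; by case: sl => _; apply.
Qed.

Lemma coeff_sum_hits l : all_kill l -> hit_closed (coeff_sum l).
Proof.
elim: l => [_|la l IHl [[fl l0] kl]] mu x fm /=; first by move=> ->; apply: lin0 (hl_linear fm).
move=> [y My hy]; exists (hl mu y); first exact: cM.
by rewrite -hl_hrC // -(linB (hl_linear fm)); apply: IHl.
Qed.

(** Induction on the length of a nonzero coefficient sum in [D]. If no shorter one exists, the [y]
    with [hr la y] in [D] modulo shorter sums form a subcomodule that is all of [M], and those with
    [hr la y] a shorter sum form a proper one, contained in [E]. A functional vanishing on [D]
    carries the first into the second. *)
Lemma subcoalgebra_kill_quotient D l d : subcoalgebra D -> all_kill l -> D d -> d != 0 ->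
    coeff_sum l d ->
  forall nu, functional nu -> (forall d, D d -> nu d = 0) -> forall y, M y -> E (hl nu y).
Proof.
move=> scD; have sD := scD.1.
elim: l d => [|la l IHl] d /=; first by move=> _ _ /eqP.
move=> [kla kl] Dd d0 [y1 My1 h1]; have [fl l0] := kla.
have sP := coeff_sum_subspace kl; have cP := coeff_sum_hits kl.
have [[d' [Dd' d0' P']]|nex] := pselect (exists d', [/\ D d', d' != 0 & coeff_sum l d']).
  exact: IHl d' kl Dd' d0' P'.
pose N := [set y | M y /\ exists2 x, D x & coeff_sum l (x - hr la y)].
have sN : subspace N.
  split=> [|a y y' [My [x Dx hx]] [My' [x' Dx' hx']]].
    split; first by case: sM.
    by exists 0; rewrite ?(lin0 (hr_linear fl)) ?subr0; [case: sD|case: sP].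
  split; first by case: sM => _; apply.
  exists (a *: x + x'); first by case: sD => _; apply.
  by rewrite (hr_linear fl) opprD addrACA -scalerBr; case: sP => _; apply.
have cN : hit_closed N.
  move=> mu y fm [My [x Dx hx]]; split; first exact: cM.
  exists (hl mu x); first exact: subcoalgebra_hits.
  by rewrite -hl_hrC // -(linB (hl_linear fm)); apply: cP.
have EN : E `<=` N.
  move=> e Ee; split; first exact: EM.
  by exists 0; [case: sD|rewrite hrE0 // subr0; case: sP].
have d_ne x : D x -> coeff_sum l x -> x = 0.
  by move=> Dx Px; apply: contrapT => /eqP x0; apply: nex; exists x.
have NM : N `<=` M by move=> y [].
have MN : M `<=` N.
  have [NE|//] := maxE sN cN EN NM.
  have /NE Ey1 : N y1 by split=> //; exists d.
  by move: h1; rewrite hrE0 // subr0 => /(d_ne _ Dd) /eqP; rewrite (negbTE d0).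
pose K := [set y | M y /\ coeff_sum l (hr la y)].
have KE : K `<=` E.
  have [| | | |//|MK] := maxE (N := K); last 1 first.
  - have [_ h2] := MK _ My1; have := subspaceD sP h1 h2; rewrite subrK.
    by move=> /(d_ne _ Dd) /eqP; rewrite (negbTE d0).
  - split=> [|a y y' [My hy] [My' hy']].
      by split; [case: sM|rewrite (lin0 (hr_linear fl)); case: sP].
    split; first by case: sM => _; apply.
    by rewrite (hr_linear fl); case: sP => _; apply.
  - by move=> mu y fm [My hy]; split; [exact: cM|rewrite -hl_hrC //; apply: cP].
  - by move=> e Ee; split; [exact: EM|rewrite hrE0 //; case: sP].
  - by move=> y [].
move=> nu fn n0 y My; have [_ [x Dx hx]] := MN _ My.
apply: KE; split; first exact: cM.
have := cP nu _ fn hx; rewrite (linB (hl_linear fn)) (subcoalgebra_kill scD fn n0 Dx) hl_hrC //.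
by move=> /(subspaceZ (-1) sP); rewrite scaleN1r sub0r opprK.
Qed.

(** If some hit left [E], the coefficients of [M / E] would span a simple subcoalgebra, so they
    would lie in the coradical, where [mu] vanishes. *)
Lemma coradical_kill_quotient mu : functional mu -> (forall c, coradical H c -> mu c = 0) ->
  forall y, M y -> E (hl mu y).
Proof.
move=> fm m0 y0 My0; apply: contrapT => nE.
have [la [fla la0 la1]] := functional_sep sE nE; have kla : kills la by [].
pose G := [set c | exists la y, [/\ kills la, M y & c = hr la y]].
pose C := lspan G; have sC : subspace C := lspan_subspace G.
have Cy : C (hr la y0) by apply: sub_lspan; exists la, y0.
have Cl : hit_closed C.
  move=> nu x fn; move: x; apply: lspan_min => [|_ [l [y [[fl l0] My ->]]]].
    exact: (preimage_subspace (hl_linear fn) sC).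
  by apply: sub_lspan; exists l, (hl nu y); split=> //; [exact: cM|rewrite hl_hrC].
have Cr nu x : functional nu -> C x -> C (hr nu x).
  move=> fn; move: x; apply: lspan_min => [|_ [l [y [[fl l0] My ->]]]].
    exact: (preimage_subspace (hr_linear fn) sC).
  apply: sub_lspan; exists (nu \o hr l), y; split=> //; last by rewrite hr_hr.
  split; first exact: comp_functional (hr_linear fl) fn.
  by move=> e Ee /=; rewrite -hl_hr // l0 //; apply: cE.
suff sc : simple_subcoalgebra C.
  have : coradical H (hr la y0) by apply: sub_lspan; exists C.
  by move=> /m0; rewrite -hl_hr // la1 => /eqP; rewrite oner_eq0.
split; first exact: hits_subcoalgebra.
  move=> C0; move: Cy; rewrite C0 => /= y00.
  by move: la1; rewrite hl_hr // y00 (lin0 fm) => /esym/eqP; rewrite oner_eq0.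
move=> D scD DC; have sD := scD.1.
have [[d [Dd d0]]|nd] := pselect (exists d, D d /\ d != 0); last first.
  left; apply/seteqP; split=> [x Dx|_ ->]; last by case: sD.
  by apply: contrapT => /eqP x0; apply: nd; exists x.
right; apply/seteqP; split=> //.
have [l kl Pl] : exists2 l, all_kill l & coeff_sum l d.
  have [s Gs ->] := DC _ Dd; elim: s Gs => [_|p s IHs Gs]; first by exists [::]; rewrite ?big_nil.
  have [|l kl Pl] := IHs; first by move=> q qs; apply: Gs; rewrite inE qs orbT.
  have [l1 [y1 [k1 My1 E1]]] := Gs p (mem_head _ _).
  exists (l1 :: l) => //; exists (p.1 *: y1); first exact: subspaceZ.
  by rewrite big_cons E1 (linZ _ (hr_linear k1.1)) addrAC subrr add0r.
apply: lspan_min => // _ [l1 [y [[fl1 l10] My ->]]]; apply: contrapT => nD.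
have [nu [fn n0 n1]] := functional_sep sD nD.
have := subcoalgebra_kill_quotient scD kl Dd d0 Pl fn n0 My => /l10.
by rewrite hl_hr // n1 => /eqP; rewrite oner_eq0.
Qed.

End SimpleQuotient.

(** Induction on the dimension through a proper subcomodule [E] of maximal dimension: functionals
    that kill the coradical carry [M] into [E], which puts [M] into the wedge of the coradical and
    the step that contains [E]. *)
Lemma hit_closed_exhaust m M : subspace M -> hit_closed M ->
  (forall n, dimge M n -> (n <= m)%N) -> exists n, M `<=` F n.
Proof.
elim: m M => [|m IHm] M sM cM dM; have [M0|nM0] := pselect (M `<=` [set 0]);
  try by exists 0%N.
all: have [v Mv v0] : exists2 v, M v & v <> 0 by
  apply: contrapT => h; apply: nM0 => x Mx; apply: contrapT => x0; apply: h; exists x.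
all: have d00 : dimge [set (0 : H)] 0 by exists (fun _ => 0) => [c _ []|[]].
all: have s0 := @set0_subspace k H; have M00 : [set 0] `<=` M by move=> _ ->; case: sM.
  by have := dM _ (dimge_extend s0 d00 M00 Mv v0).
pose Q n := `[< exists E, [/\ subspace E, hit_closed E, E `<=` M, ~ M `<=` E & dimge E n] >].
have exQ : exists n, Q n.
  exists 0%N; apply/asboolP; exists [set 0]; split=> //.
  - by move=> mu x fm ->; apply: lin0 (hl_linear fm).
have ubQ n : Q n -> (n <= m.+1)%N by move=> /asboolP [E [_ _ EM _ /(dimge_sub EM)/dM]].
have [n /asboolP [E [sE cE EM nME dE]] nmax] := ex_maxnP exQ ubQ.
have [w Mw nEw] : exists2 w, M w & ~ E w.
  by apply: contrapT => h; apply: nME => x Mx; apply: contrapT => Ex; apply: h; exists x.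
have [|j Ej] := IHm E sE cE.
  by move=> n' d'; rewrite -ltnS; apply/dM/(dimge_extend sE d' EM Mw nEw).
exists j.+1 => y My; rewrite (corad_filt_predS pH); apply: wedgeP.
  exact: (corad_filt_pred_subspace H 1).
move=> mu fm m0; apply/Ej/(coradical_kill_quotient sM sE cM cE EM _ fm m0) => // N sN cN EN NM.
have [NE|nNE] := pselect (N `<=` E); first by left.
right; apply: contrapT => nMN.
have [u Nu nEu] : exists2 u, N u & ~ E u.
  by apply: contrapT => h; apply: nNE => x Nx; apply: contrapT => Ex; apply: h; exists x.
suff /nmax : Q n.+1 by rewrite ltnn.
by apply/asboolP; exists N; split=> //; apply: dimge_extend dE EN Nu nEu.
Qed.

(** The left coideal of all hits of [x] contains [x] and has finite dimension, lying in the span of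
    the right factors of one expression for [comul x]. *)
Theorem corad_filt_exhaustive x : exists n, F n x.
Proof.
have [s Dx] := comul_seq x.
pose M := [set y | exists2 mu, functional mu & y = hl mu x].
have sM : subspace M.
  split.
    exists (fun _ => 0) => [a y z|]; first by rewrite scaler0 addr0.
    by rewrite (hl_sum _ Dx) ?big1 // => [p _|a y z]; rewrite ?scale0r // scaler0 addr0.
  move=> a _ _ [mu fm ->] [nu fn ->].
  have f1 : functional (fun y => a * mu y + nu y).
    move=> b y z; rewrite (functionalP _ _ _ fm) (functionalP _ _ _ fn).
    have E : a * (b * mu y + mu z) + (b * nu y + nu z) = b * (a * mu y + nu y) + (a * mu z + nu z).
      by ring.
    exact: E.
  exists (fun y => a * mu y + nu y) => //.
  rewrite !(hl_sum _ Dx) // scaler_sumr -big_split; apply: eq_bigr => p _.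
  by rewrite scalerDl scalerA.
have cM : hit_closed M.
  move=> nu _ fn [mu fm ->]; exists (nu \o hl mu); last by rewrite hl_hl.
  exact: comp_functional (hl_linear fm) fn.
have Ms : M `<=` lspan [set` [seq p.2 | p <- s]].
  move=> _ [mu fm ->]; rewrite (hl_sum fm Dx); apply: subspace_sum => [|p ps].
    exact: lspan_subspace.
  by apply: subspaceZ; [exact: lspan_subspace|apply/sub_lspan/map_f].
have [n Mn] := hit_closed_exhaust sM cM (fun n => dimge_bound Ms).
by exists n; apply: Mn; exists (@counit k H); rewrite ?hl_counit //; apply: counit_functional.
Qed.

End Exhaustive.

(** * Wedge powers of spans of group-likes and components over group-likes *)

Section Wedges.
Variables (k : fieldType) (H : hopfAlgType k) (pH : pointed H).
Local Open Scope ring_scope.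
Local Notation F := (corad_filt_pred H).
Implicit Types (mu nu chi : H -> k) (x y g h : H) (T : seq H).

(* The wedge power of [kT], written with functionals. *)
Fixpoint Phi T n : set H := if n is m.+1 then
  [set x | forall mu, functional mu -> (forall g, g \in T -> mu g = 0) -> Phi T m (hl mu x)]
  else [set 0].

Definition grouplikes T := forall g, g \in T -> grouplike g.

Lemma Phi_subspace T n : subspace (Phi T n).
Proof.
elim: n => [|n IHn]; first exact: set0_subspace.
split=> [mu fm m0|a x y Px Py mu fm m0]; first by rewrite (lin0 (hl_linear fm)); case: IHn.
by rewrite (hl_linear fm); case: IHn => _; apply; [apply: Px|apply: Py].
Qed.

Lemma PhiS T T' n : {subset T <= T'} -> Phi T n `<=` Phi T' n.
Proof.
move=> TT; elim: n => // n IHn x Px mu fm m0; apply/IHn/Px => // g /TT; exact: m0.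
Qed.

Lemma functional_lspan mu T v : functional mu -> (forall g, g \in T -> mu g = 0) ->
  lspan [set` T] v -> mu v = 0.
Proof. by move=> fm m0 /lspanP [c ->]; rewrite functional_sum // big1 // => j _; rewrite functionalZ // m0 ?mulr0 ?mem_nth. Qed.

Lemma Phi_hits T n : grouplikes T -> hit_closed (Phi T n).
Proof.
move=> gT; case: n => [|n] mu x fm /=; first by move=> ->; apply: lin0 (hl_linear fm).
move=> Px nu fn n0; rewrite hl_hl //; apply: Px => [|g gT'].
  exact: comp_functional (hl_linear fm) fn.
by rewrite /= hl_grouplike ?functionalZ ?n0 ?mulr0 //; apply: gT.
Qed.

Lemma Phi_le T m n : grouplikes T -> (m <= n)%N -> Phi T m `<=` Phi T n.
Proof.
move=> gT /subnKC <-; elim: (n - m)%N => [|j IHj]; rewrite ?addn0 // addnS => x /IHj Px.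
by move=> mu fm m0; apply: Phi_hits.
Qed.

Lemma grouplike_Phi T g : grouplikes T -> g \in T -> Phi T 1 g.
Proof. by move=> gT gin mu fm m0; rewrite /= hl_grouplike ?m0 ?scale0r //; apply: gT. Qed.

Lemma comul_Phi T n x : grouplikes T -> Phi T n.+1 x ->
  exists s : seq (H * H), comul x = \sum_(p <- s) p.1 ⊗ p.2 /\
    forall p, p \in s -> (lspan [set` T] p.1 /\ Phi T n.+1 p.2) \/ Phi T n p.2.
Proof.
move=> gT Px; have [|s [Dx sP]] := @comul_split k H _ (Phi T n) x (lspan_subspace [set` T]).
  by move=> mu fm m0; apply: Px => // g gin; apply/m0/sub_lspan.
exists s; split=> // p /sP [[Cp [mu fm ->]]|]; [left|by right].
by split=> //; apply: Phi_hits.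
Qed.

(** As for the coradical filtration: a functional killing [T''] kills the products of left factors
    from [kT] and [kT'], and in every other term one right factor has lower order, so that induction
    applies. *)
Lemma PhiM T T' T'' i j x y : grouplikes T -> grouplikes T' -> grouplikes T'' ->
  (forall g h, g \in T -> h \in T' -> g * h \in T'') ->
  Phi T i x -> Phi T' j y -> Phi T'' (i + j).-1 (x * y).
Proof.
move=> gT gT' gT'' TT; have [N] := ubnP (i + j); elim: N i j x y => // N IHN [|i] [|j] x y ltN.
- by move=> -> _; rewrite mul0r.
- by move=> -> _; rewrite mul0r; case: (Phi_subspace T'' j).
- by move=> _ ->; rewrite mulr0; case: (Phi_subspace T'' (i.+1 + 0).-1).
move=> Px Py; rewrite addSn addnS /= => mu fm m0.
have [s [Dx sP]] := comul_Phi gT Px; have [s' [Dy sP']] := comul_Phi gT' Py.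
rewrite (hl_sum fm (comulM_sum Dx Dy)); have sPhi := Phi_subspace T'' (i + j).
apply: (subspace_sum sPhi) => r /allpairsP [[p q] [/= ps qs ->]] /=.
have lt1 : (i + j.+1 < N)%N by move: ltN; clear; lia.
have lt2 : (i.+1 + j < N)%N by move: ltN; clear; lia.
have lt3 : (i + j < N)%N by move: ltN; clear; lia.
have mpq : lspan [set` T] p.1 -> lspan [set` T'] q.1 -> mu (p.1 * q.1) = 0.
  move=> Tp Tq; apply: (functional_lspan (functional_mull _ fm) _ Tp) => g gin.
  by apply: (functional_lspan (functional_mulr _ fm) _ Tq) => h hin; apply/m0/TT.
have [[Tp Pp]|Pp] := sP p ps; have [[Tq Pq]|Pq] := sP' q qs.
- by rewrite mpq // scale0r; case: sPhi.
- by apply: (subspaceZ _ sPhi); apply: IHN Pp Pq.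
- apply: (subspaceZ _ sPhi); by have := IHN _ _ _ _ lt1 Pp Pq; rewrite addnS.
- apply: (subspaceZ _ sPhi); apply: (Phi_le gT'' (leq_pred _)).
  exact: IHN Pp Pq.
Qed.

Lemma corad_filt_Phi n x : F n x -> exists2 T, grouplikes T & Phi T n x.
Proof.
have gcat T T' : grouplikes T -> grouplikes T' -> grouplikes (T ++ T').
  by move=> gT gT' g; rewrite mem_cat => /orP [/gT|/gT'].
have subl T T' : {subset T <= T ++ T'} by move=> g gin; rewrite mem_cat gin.
have subr T T' : {subset T' <= T ++ T'} by move=> g gin; rewrite mem_cat gin orbT.
elim: n x => [x ->|n IHn x]; first by exists [::].
move=> /(comul_corad_filt pH).
pose P (t : H ⊗ H) := exists T s, [/\ grouplikes T, t = \sum_(p <- s) p.1 ⊗ p.2 &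
  forall p, p \in s -> lspan [set` T] p.1 \/ Phi T n p.2].
have lspanS T T' : {subset T <= T'} -> lspan [set` T] `<=` lspan [set` T'].
  by move=> TT; apply: lspan_subset => g /TT; apply: sub_lspan.
have sP : subspace (P : set (H ⊗ H)).
  split=> [|a t t' [T [s [gT -> sP]]] [T' [s' [gT' -> sP']]]].
    by exists [::], [::]; split=> //; rewrite big_nil.
  exists (T ++ T'), ([seq (a *: p.1, p.2) | p <- s] ++ s'); split; first exact: gcat.
    rewrite big_cat big_map scaler_sumr; congr (_ + _); apply: eq_bigr => p _.
    by rewrite tpureZl.
  move=> p; rewrite mem_cat => /orP [/mapP [q /sP qP ->]|/sP' [h|h]] /=.
  - case: qP => h; [left|right]; last exact: (PhiS (subl T T')).
    by apply: subspaceZ; [exact: lspan_subspace|exact: (lspanS _ _ (subl T T'))].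
  - by left; apply: (lspanS _ _ (subr T T')).
  - by right; apply: (PhiS (subr T T')).
move=> Dx; have {Dx} [T [s [gT Dx sT]]] : P (comul x).
  apply: (addset_min sP _ _ Dx); apply: (tens_sub_min sP) => v w.
    rewrite pH => -[s Gs ->] _; exists [seq p.2 | p <- s], [:: (\sum_(p <- s) p.1 *: p.2, w)]; split.
    - by move=> g /mapP [p /Gs gp ->].
    - by rewrite big_seq1.
    - move=> p; rewrite inE => /eqP -> /=; left.
      apply: subspace_sum => [|q qs]; first exact: lspan_subspace.
      by apply: subspaceZ; [exact: lspan_subspace|apply/sub_lspan/map_f].
  move=> _ /IHn [T gT Pw]; exists T, [:: (v, w)]; split=> //; first by rewrite big_seq1.
  by move=> p; rewrite inE => /eqP ->; right.
exists T => // mu fm m0; rewrite (hl_sum fm Dx); have sPhi := Phi_subspace T n.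
apply: (subspace_sum sPhi) => p /sT [Tp|]; last exact: (subspaceZ _ sPhi).
by rewrite (functional_lspan fm m0 Tp) scale0r; case: sPhi.
Qed.

Lemma coradical_coords y : coradical H y ->
  exists T (c : H -> k), [/\ uniq T, grouplikes T & y = \sum_(g <- T) c g *: g].
Proof.
rewrite pH => -[s Gs ->]; pose T := undup [seq p.2 | p <- s].
have gT : grouplikes T by move=> g; rewrite mem_undup => /mapP [p /Gs gp ->].
have /lspanP [c ->] : lspan [set` T] (\sum_(p <- s) p.1 *: p.2).
  apply: subspace_sum => [|q qs]; first exact: lspan_subspace.
  by apply: subspaceZ; [exact: lspan_subspace|apply: sub_lspan; rewrite /= mem_undup map_f].
exists T, (fun g => c (index g T)); split=> //; first exact: undup_uniq.
by rewrite (big_nth 0) big_mkord; apply: eq_bigr => j _; rewrite index_uniq ?undup_uniq.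
Qed.

Lemma functional_big mu T (c : H -> k) g : functional mu -> uniq T -> g \in T -> mu g = 1 ->
  (forall h, h \in T -> h != g -> mu h = 0) -> mu (\sum_(h <- T) c h *: h) = c g.
Proof.
move=> fm uT gin m1 m0; rewrite functional_sum // (bigD1_seq g) //= functionalZ // m1 mulr1.
by rewrite big_seq_cond big1 ?addr0 // => h /andP [hT hg]; rewrite functionalZ // m0 // mulr0.
Qed.

(** A functional dual to a group-like [g] outside [T] kills [T], so hitting by it puts the
    [g]-component of [y] into the preceding wedge power, where induction applies. *)
Lemma Phi_coradical T n y : grouplikes T -> Phi T n y -> coradical H y -> lspan [set` T] y.
Proof.
move=> gT; elim: n y => [|n IHn] y Py Cy; first by rewrite Py; case: (lspan_subspace [set` T]).
have [T' [c [uT' gT' yE]]] := coradical_coords Cy; rewrite yE.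
apply: subspace_sum => [|g gin]; first exact: lspan_subspace.
have [->|c0] := eqVneq (c g) 0; first by rewrite scale0r; case: (lspan_subspace [set` T]).
apply: subspaceZ; first exact: lspan_subspace.
have [gT1|gnT] := boolP (g \in T); first exact: sub_lspan.
have gTT : grouplikes (T ++ T') by move=> h; rewrite mem_cat => /orP [/gT|/gT'].
have [chi [fc c1 ch0]] := grouplike_dual gTT (gT' g gin).
have E : hl chi y = c g *: g.
  rewrite yE (lin_sum _ _ (hl_linear fc)) (bigD1_seq g) //= (linZ _ (hl_linear fc)).
  rewrite hl_grouplike ?c1 ?scale1r; [|exact: fc|exact: gT'].
  rewrite big_seq_cond big1 ?addr0 // => h /andP [hT hg].
  rewrite (linZ _ (hl_linear fc)) hl_grouplike ?ch0 ?scale0r ?scaler0 ?mem_cat ?hT ?orbT //.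
  exact: gT'.
have Pc : Phi T n (c g *: g).
  rewrite -E; apply: Py => // h hT; apply: ch0; first by rewrite mem_cat hT.
  by apply: contraNneq gnT => <-.
have := IHn _ Pc; rewrite pH => h; have {h} := h (subspaceZ _ (lspan_subspace _) (sub_lspan (gT' g gin))).
move=> /(subspaceZ (c g)^-1 (lspan_subspace _)); rewrite scalerA mulVf // scale1r.
by [].
Qed.

Lemma comul_corad_seq n x : F n.+1 x -> exists s s' : seq (H * H),
  [/\ comul x = \sum_(p <- s ++ s') p.1 ⊗ p.2,
      forall p, p \in s -> F n p.1 & forall p, p \in s' -> F n.+1 p.1 /\ coradical H p.2].
Proof.
move=> /(decomp_exists pH) [s [Fs Dx]].
exists (flatten [seq s (val i) | i <- index_enum 'I_n]), (s n); split.
- by rewrite Dx big_ord_recr big_cat big_flatten big_map.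
- move=> p /flattenP [r /mapP [i _ ->] pr]; have [Fp _] := Fs i p (ltnW (ltn_ord i)) pr.
  exact: (corad_filt_pred_le pH (ltn_ord i) Fp).
- by move=> p pr; have := Fs n p (leqnn n) pr; rewrite subnn.
Qed.

Lemma corad_filt_hr n chi x : functional chi -> F n x -> F n (hr chi x).
Proof.
move=> fc; case: n => [->|n Fx]; first exact: lin0 (hr_linear fc).
have [s [s' [Dx sP sP']]] := comul_corad_seq Fx; rewrite (hr_sum fc Dx).
have sF := corad_filt_pred_subspace H n.+1.
apply: (subspace_sum sF) => p; rewrite mem_cat => /orP [/sP Fp|/sP' [Fp _]]; apply: (subspaceZ _ sF) => //.
exact: (@corad_filt_pred_leS _ _ pH).
Qed.

(** Lifts to [H] of the elements of degree [n] in [gr H] on which the right coaction of the degree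
    zero part is given by [g]; for [g = 1] these are the lifts of [R(n)]. *)
Definition Hom n g : set H :=
  [set x | F n.+1 x /\ forall chi, functional chi -> F n (hr chi x - chi g *: x)].

Lemma Hom_subspace n g : subspace (Hom n g).
Proof.
have sF := corad_filt_pred_subspace H n; have sF1 := corad_filt_pred_subspace H n.+1.
split=> [|a x y [Fx hx] [Fy hy]].
  split; first by case: sF1.
  by move=> chi fc; rewrite (lin0 (hr_linear fc)) scaler0 subr0; case: sF.
split; first by case: sF1 => _; apply.
move=> chi fc; rewrite (hr_linear fc) scalerDr opprD addrACA scalerA mulrC -scalerA -scalerBr.
by case: sF => _; apply; [apply: hx|apply: hy].
Qed.

Lemma HomM n m g h x y : Hom n g x -> Hom m h y -> Hom (n + m) (g * h) (x * y).
Proof.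
move=> [Fx hx] [Fy hy]; split.
  by have := corad_filt_predM pH Fx Fy; rewrite addSn addnS.
move=> chi fc; have [s [s' [Dx sP sP']]] := comul_corad_seq Fx.
have sF := corad_filt_pred_subspace H (n + m).
have F1 p : p \in s ++ s' -> F n.+1 p.1.
  by rewrite mem_cat => /orP [/sP /(@corad_filt_pred_leS _ _ pH)|/sP' []].
rewrite (hrM _ fc Dx).
pose A := \sum_(p <- s ++ s') p.1 * (hr (fun z => chi (p.2 * z)) y - chi (p.2 * h) *: y).
have FA : F (n + m) A.
  apply: (subspace_sum sF) => p /F1 Fp.
  have := corad_filt_predM pH Fp (hy _ (functional_mulr p.2 fc)); by rewrite addSn.
pose B := (hr (fun z => chi (z * h)) x - chi (g * h) *: x) * y.
have FB : F (n + m) B.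
  by have := corad_filt_predM pH (hx _ (functional_mull h fc)) Fy; rewrite addnS.
rewrite (_ : _ - _ = A + B); first exact: subspaceD.
rewrite /A /B mulrBl (hr_sum (functional_mull h fc) Dx) mulr_suml addrA -scalerAl; congr (_ - _).
rewrite -big_split; apply: eq_bigr => p _ /=.
by rewrite mulrBr -scalerAr -scalerAl subrK.
Qed.

Lemma grouplike_Hom g : grouplike g -> Hom 0 g g.
Proof.
move=> gg; split; first by rewrite /= pH; apply: sub_lspan.
by move=> chi fc; rewrite hr_grouplike // subrr.
Qed.

(** Modulo [F n] only those terms of the comultiplication count whose right factor is in the
    coradical, and they involve finitely many group-likes. *)
Lemma comodule_support n x T : F n.+1 x -> grouplikes T -> exists T' (xg : H -> H),
  [/\ uniq T', grouplikes T', {subset T <= T'}, forall g, F n.+1 (xg g) &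
      forall chi, functional chi -> F n (hr chi x - \sum_(g <- T') chi g *: xg g)].
Proof.
move=> Fx gT; have [s [s' [Dx sP sP']]] := comul_corad_seq Fx.
have sF1 := corad_filt_pred_subspace H n.+1; have sF := corad_filt_pred_subspace H n.
have [L [gL FL LE]] : exists L : seq (H * H), [/\ forall q, q \in L -> grouplike q.1,
    forall q, q \in L -> F n.+1 q.2 & forall chi, functional chi ->
    \sum_(p <- s') chi p.2 *: p.1 = \sum_(q <- L) chi q.1 *: q.2].
  elim: s' sP' {Dx} => [_|p s' IHs sP']; first by exists [::]; split=> // chi _; rewrite !big_nil.
  have [|L [gL FL LE]] := IHs; first by move=> q qs; apply: sP'; rewrite inE qs orbT.
  have [Fp Cp] := sP' p (mem_head _ _); have [U [c [uU gU pE]]] := coradical_coords Cp.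
  exists ([seq (g, c g *: p.1) | g <- U] ++ L); split.
  - by move=> q; rewrite mem_cat => /orP [/mapP [g /gU gg ->]|/gL].
  - move=> q; rewrite mem_cat => /orP [/mapP [g _ ->]|/FL //]; exact: (subspaceZ _ sF1).
  - move=> chi fc; rewrite big_cons big_cat LE // big_map; congr (_ + _).
    rewrite {1}pE functional_sum // scaler_suml; apply: eq_bigr => g _ /=.
    by rewrite functionalZ // scalerA mulrC.
pose T' := undup (T ++ [seq q.1 | q <- L]); have uT' : uniq T' by apply: undup_uniq.
exists T', (fun g => \sum_(q <- L | q.1 == g) q.2); split=> //.
- by move=> g; rewrite mem_undup mem_cat => /orP [/gT //|/mapP [q /gL gq ->]].
- by move=> g gin; rewrite mem_undup mem_cat gin.
- by move=> g; rewrite -big_filter; apply: (subspace_sum sF1) => q; rewrite mem_filter => /andP [_ /FL].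
move=> chi fc; have -> : \sum_(g <- T') chi g *: \sum_(q <- L | q.1 == g) q.2 =
    \sum_(q <- L) chi q.1 *: q.2.
  rewrite (eq_bigr (fun g => \sum_(q <- L) if q.1 == g then chi g *: q.2 else 0)); last first.
    by move=> g _; rewrite big_mkcond scaler_sumr; apply: eq_bigr => q _; case: eqP; rewrite ?scaler0.
  rewrite exchange_big big_seq [RHS]big_seq; apply: eq_bigr => q qL /=.
  have qT : q.1 \in T' by rewrite mem_undup mem_cat map_f ?orbT.
  rewrite (bigD1_seq q.1) //= eqxx big1 ?addr0 // => g.
  by rewrite eq_sym => /negbTE ->.
rewrite (hr_sum fc Dx) big_cat /= LE // addrK; apply: (subspace_sum sF) => p /sP Fp.
exact: (subspaceZ _ sF).
Qed.

(** The [g]-component modulo [F n] is the hit by a functional dual to [g]. A nonzero component at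
    some [g] outside [T] would produce a left hit of [x] in the coradical with nonzero coefficient
    at [g]; but left hits stay in the wedge power of [kT], against [Phi_coradical]. *)
Lemma homogeneous_decomp n d T x : uniq T -> grouplikes T -> F n.+1 x -> Phi T d x ->
  exists xg : H -> H, (forall g, g \in T -> Hom n g (xg g)) /\ F n (x - \sum_(g <- T) xg g).
Proof.
move=> uT gT Fx Px; have [T' [xg [uT' gT' TT Fg hx]]] := comodule_support Fx gT.
have sF := corad_filt_pred_subspace H n.
have out g : g \in T' -> g \notin T -> F n (xg g).
  move=> gin gnT; apply: contrapT => nF.
  have [mu [fm m0 m1]] := functional_sep sF nF.
  pose y := \sum_(h <- T') mu (xg h) *: h.
  have yE : hl mu x = y.
    apply/eqP; rewrite -subr_eq0; apply: contrapT => /negP /functional_neq0 [chi fc].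
    rewrite (linB fc) hl_hr // => E3.
    have E := m0 _ (hx chi fc); rewrite (linB fm) in E.
    have E2 : chi y = mu (\sum_(h <- T') chi h *: xg h).
      rewrite /y [LHS]functional_sum // [RHS]functional_sum //; apply: eq_bigr => h _.
      by rewrite !functionalZ // mulrC.
    by move: E3; rewrite E2 E => /esym/eqP; rewrite oner_eq0.
  have Ty : lspan [set` T] y.
    apply: (@Phi_coradical T d) => //; first by rewrite -yE; apply: Phi_hits.
    rewrite pH; apply: subspace_sum => [|h hin]; first exact: lspan_subspace.
    by apply: subspaceZ; [exact: lspan_subspace|apply/sub_lspan/gT'].
  have [chi [fc c1 c0]] := grouplike_dual gT' (gT' g gin).
  have := functional_big (fun h => mu (xg h)) fc uT' gin c1 c0; rewrite m1 -/y.
  rewrite (functional_lspan fc _ Ty); first by move/esym/eqP; rewrite oner_eq0.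
  by move=> h hT; apply: c0; [exact: TT|apply: contraNneq gnT => <-].
have dual g : exists chi, g \in T' -> [/\ functional chi, chi g = 1 &
    forall h, h \in T' -> h != g -> chi h = 0].
  have [gin|gn] := boolP (g \in T'); last by exists (fun _ => 0).
  by have [chi [h1 h2 h3]] := grouplike_dual gT' (gT' g gin); exists chi.
have [chi chiP] := choice dual.
have sumE (c : H -> k) g : g \in T' -> (forall h, h \in T' -> h != g -> c h = 0) ->
    \sum_(h <- T') c h *: xg h = c g *: xg g.
  move=> gin c0; rewrite (bigD1_seq g) //= big_seq_cond big1 ?addr0 // => h /andP [hin hg].
  by rewrite c0 // scale0r.
have cx g : g \in T' -> F n (hr (chi g) x - xg g).
  move=> gin; have [fc c1 c0] := chiP g gin.
  by have := hx _ fc; rewrite (sumE _ g) // c1 scale1r.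
exists (fun g => hr (chi g) x); split=> [g /TT gin|].
  have [fc c1 c0] := chiP g gin; split; first exact: corad_filt_hr.
  move=> psi fp; rewrite hr_hr //.
  have fpc : functional (psi \o hr (chi g)) := comp_functional (hr_linear fc) fp.
  have cE h : h \in T' -> (psi \o hr (chi g)) h = chi g h * psi h.
    by move=> hin /=; rewrite hr_grouplike ?functionalZ //; apply: gT'.
  have := hx _ fpc; rewrite (sumE _ g) // => [|h hin hg]; last by rewrite cE // c0 // mul0r.
  rewrite cE // c1 mul1r => h1; have h2 := subspaceZ (psi g) sF (cx g gin).
  by have := subspaceB sF h1 h2; rewrite scalerBr opprB addrA subrK.
have := hx _ (@counit_functional k H); rewrite hr_counit => h1.
have E1 : \sum_(g <- T') counit g *: xg g = \sum_(g <- T) xg g + \sum_(g <- T' | g \notin T) xg g.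
  rewrite (bigID (fun g => g \in T)) /=; congr (_ + _).
    rewrite -big_filter (perm_big T); last first.
      apply: uniq_perm; rewrite ?filter_uniq // => g; rewrite mem_filter.
      by case: (boolP (g \in T)) => // /TT.
    by rewrite big_seq [RHS]big_seq; apply: eq_bigr => g /gT [_ ->]; rewrite scale1r.
  rewrite big_seq_cond [RHS]big_seq_cond; apply: eq_bigr => g /andP [/gT' [_ ->] _].
  by rewrite scale1r.
have h2 : F n (\sum_(g <- T' | g \notin T) xg g).
  rewrite -big_filter; apply: (subspace_sum sF) => g; rewrite mem_filter => /andP [gn gin].
  exact: out.
have h3 : F n (\sum_(g <- T) (hr (chi g) x - xg g)).
  by apply: (subspace_sum sF) => g /TT; apply: cx.
have := subspaceB sF (subspaceD sF h1 h2) h3; rewrite E1 sumrB.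
rewrite (_ : _ - _ = x - \sum_(g <- T) hr (chi g) x) // opprD addrA subrK opprB addrA.
by rewrite subrK.
Qed.

(** A functional dual to [g] projects the sum to its [g]-component modulo [F n], and right hits
    preserve [F n]. *)
Lemma Hom_indep n T (xg : H -> H) : uniq T -> grouplikes T ->
  (forall g, g \in T -> Hom n g (xg g)) -> F n (\sum_(g <- T) xg g) ->
  forall g, g \in T -> F n (xg g).
Proof.
move=> uT gT hT Fs g gin; have sF := corad_filt_pred_subspace H n.
have [chi [fc c1 c0]] := grouplike_dual gT (gT g gin).
have h1 := corad_filt_hr fc Fs; rewrite (lin_sum _ _ (hr_linear fc)) in h1.
have h2 : F n (\sum_(h <- T) (hr chi (xg h) - chi h *: xg h)).
  by apply: (subspace_sum sF) => h hin; apply: (hT h hin).2.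
have := subspaceB sF h1 h2; rewrite sumrB subKr (bigD1_seq g) //= c1 scale1r.
by rewrite big_seq_cond big1 ?addr0 // => h /andP [hin hg]; rewrite c0 // scale0r.
Qed.

End Wedges.

(** * The group of group-like elements *)

Section GrouplikeGroup.
Variables (k : fieldType) (H : hopfAlgType k).
Local Open Scope ring_scope.

Lemma grouplike1 : grouplike (1 : H). Proof. by split; [exact: comul1|exact: counit1]. Qed.

Lemma grouplikeM (g h : H) : grouplike g -> grouplike h -> grouplike (g * h).
Proof.
move=> [Dg eg] [Dh eh]; split; last by rewrite counitM eg eh mulr1.
by rewrite comulM Dg Dh tens_mul_pure.
Qed.

Lemma antipode_bilin : bilin (fun a b : H => antipode a * b) /\ bilin (fun a b : H => a * antipode b).
Proof.
have aL := @antipode_linear k H.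
split; split=> [v a x y|w a x y]; rewrite ?aL ?mulrDr ?mulrDl -?scalerAl -?scalerAr //.
Qed.

Lemma antipode_mul (g : H) : grouplike g -> antipode g * g = 1 /\ g * antipode g = 1.
Proof.
move=> [Dg eg]; have [b1 b2] := antipode_bilin.
have := antipodel g; have := antipoder g; rewrite Dg eg scale1r.
by rewrite (tens_lift_pure _ _ b1) (tens_lift_pure _ _ b2).
Qed.

Lemma grouplikeV (g : H) : grouplike g -> grouplike (antipode g).
Proof.
move=> gg; have [Sg gS] := antipode_mul gg; have [Dg eg] := gg; set u := antipode g in Sg gS *.
have lm (x : H) : linear (fun y => x * y) by move=> a y z; rewrite mulrDr -scalerAr.
split; last by have := @counitM k H g u; rewrite gS counit1 eg mul1r.
have := comulM g u; rewrite gS comul1 Dg.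
have -> : tens_mul (g ⊗ g) (comul u) = tens_map (fun y => g * y) (fun y => g * y) (comul u).
  refine (tens_ext (tens_mul_linearr _) (tens_map_linear (lm g) (lm g)) _ (comul u)) => v w.
  by rewrite tens_mul_pure tens_map_pure.
move=> /(congr1 (tens_map (fun y => u * y) (fun y => u * y))).
rewrite tens_map_pure // tens_mapA // !mulr1 => ->.
have idl := @id_linear _ H.
have E : (fun y => u * y) \o (fun y => g * y) = id :> (H -> H).
  by apply/funext => y /=; rewrite mulrA Sg mul1r.
rewrite !E; apply/esym; refine (tens_ext (tens_map_linear idl idl) (@id_linear _ _) _ (comul u)) => v w.
by rewrite tens_map_pure.
Qed.

Definition glk := {x : H | `[< grouplike x >]}.
HB.instance Definition _ := Choice.on glk.
Definition gval (u : glk) : H := val u.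
Lemma gval_inj : injective gval. Proof. exact: val_inj. Qed.
Lemma glkP (u : glk) : grouplike (gval u). Proof. exact: (asboolW (valP u)). Qed.
Definition glk_mk (x : H) (gx : grouplike x) : glk := exist _ x (asboolT gx).
Definition glk_one := glk_mk grouplike1.
Definition glk_mul (u v : glk) := glk_mk (grouplikeM (glkP u) (glkP v)).
Definition glk_inv (u : glk) := glk_mk (grouplikeV (glkP u)).

Lemma glk_mulA : associative glk_mul.
Proof. by move=> u v w; apply: val_inj; rewrite /= mulrA. Qed.
Lemma glk_mul1 : left_id glk_one glk_mul.
Proof. by move=> u; apply: val_inj; rewrite /= mul1r. Qed.
Lemma glk_1mul : right_id glk_one glk_mul.
Proof. by move=> u; apply: val_inj; rewrite /= mulr1. Qed.
Lemma glk_mulV : left_inverse glk_one glk_inv glk_mul.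
Proof. by move=> u; apply: val_inj; case: (antipode_mul (glkP u)). Qed.
Lemma glk_Vmul : right_inverse glk_one glk_inv glk_mul.
Proof. by move=> u; apply: val_inj; case: (antipode_mul (glkP u)). Qed.

HB.instance Definition _ :=
  isGroup.Build glk glk_mulA glk_mul1 glk_1mul glk_mulV glk_Vmul.

End GrouplikeGroup.

(** * The associated graded algebra *)

Section GradedInterface.
Variables (k : fieldType) (H : hopfAlgType k) (pH : pointed H).
Local Open Scope ring_scope.
Local Notation F := (corad_filt_pred H).
Local Notation grH := (gr pH).
Implicit Types (a b : grH) (x y g : H) (n m : nat).

Lemma lead_exists n : exists f : H -> grH, linear f /\ forall x, F n.+1 x -> f x = gr_in pH n x.
Proof.
have [q [ql q0 qr]] := subspace_proj (corad_filt_pred_subspace H n.+1).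
exists (fun x => gr_in pH n (x - q x)); split=> [c x y|x /q0 ->]; last by rewrite subr0.
by rewrite -gr_in_linear //; [rewrite ql opprD addrACA scalerBr|exact: qr|exact: qr].
Qed.

(* A linear extension to [H] of the symbol map of degree [n]. *)
Definition lead n : H -> grH := projT1 (cid (lead_exists n)).

Lemma lead_linear n : linear (lead n).
Proof. by case: (projT2 (cid (lead_exists n))). Qed.

Lemma leadE n x : F n.+1 x -> lead n x = gr_in pH n x.
Proof. by case: (projT2 (cid (lead_exists n))) => _; apply. Qed.

Lemma gr_class0 : gr_class (0 : filt_sum pH) = 0 :> grH.
Proof. by rewrite /gr_class !piE. Qed.

Lemma lead_eq0 n x : F n.+1 x -> lead n x = 0 <-> F n x.
Proof.
move=> Fx; rewrite leadE //; split=> [|Fx']; last exact: gr_in0.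
rewrite -gr_class0 => /gr_classP /(_ n).
by rewrite (gr_in_coef pH Fx) eqxx coef0 subr0.
Qed.

Lemma lead0 n x : F n x -> lead n x = 0.
Proof. by move=> Fx; apply/lead_eq0 => //; apply: (@corad_filt_pred_leS _ _ pH). Qed.

Lemma leadM n m x y : F n.+1 x -> F m.+1 y -> lead n x * lead m y = lead (n + m) (x * y).
Proof.
move=> Fx Fy; have Fxy : F (n + m).+1 (x * y).
  by have := corad_filt_predM pH Fx Fy; rewrite addSn addnS.
rewrite !leadE // [LHS]gr_mulE; apply: gr_eq => i; rewrite (gr_in_coef pH Fxy) /= coefM.
have c1 (j : nat) := gr_in_coef pH Fx j; have c2 (j : nat) := gr_in_coef pH Fy j.
under eq_bigr => j _ do rewrite c1 c2.
have [->|nm] := eqVneq i (n + m)%N.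
  rewrite (bigD1 (inord n)) //= !inordK ?ltnS ?leq_addr // eqxx addKn eqxx big1 ?addr0 // => j.
  by rewrite -val_eqE /= inordK ?ltnS ?leq_addr // => /negbTE ->; rewrite mul0r.
rewrite big1 // => j _; case: eqP => [jn|]; last by rewrite mul0r.
case: eqP => [jm|]; last by rewrite mulr0.
by move: nm; rewrite -jm jn subnKC ?eqxx // -jn -ltnS.
Qed.

Lemma lead01 : lead 0 1 = 1.
Proof.
have F1 : F 1 1 := coradical1 pH; rewrite leadE //; apply: gr_eq => i.
by rewrite (gr_in_coef pH F1) /= coef1; case: i.
Qed.

Lemma lead_span a : exists N (x : nat -> H), (forall n, F n.+1 (x n)) /\
  a = \sum_(n < N) lead n (x n).
Proof.
rewrite -(gr_class_repr a); set p := repr a.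
have sumE (I : Type) (r : seq I) (f : I -> filt_sum pH) :
    \sum_(i <- r) gr_class (f i) = gr_class (\sum_(i <- r) f i).
  elim: r => [|i r IHr]; first by rewrite !big_nil gr_class0.
  by rewrite !big_cons IHr gr_classD.
exists (size (p : {poly H})), (fun n => p`_n); split=> [n|]; first exact: filt_sumP.
under eq_bigr => n _ do rewrite (leadE (filt_sumP p n)) /gr_in.
rewrite sumE; apply: gr_eq => i.
have coefsum (I : Type) (r : seq I) (f : I -> filt_sum pH) :
    ((\sum_(j <- r) f j : filt_sum pH) : {poly H})`_i = \sum_(j <- r) (f j : {poly H})`_i.
  elim: r => [|j r IHr]; first by rewrite !big_nil coef0.
  by rewrite !big_cons -IHr -coefD.
rewrite coefsum; under eq_bigr => n _ do rewrite (gr_in_coef pH (filt_sumP p n)).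
have [ip|pi] := ltnP i (size (p : {poly H})).
  rewrite (bigD1 (Ordinal ip)) //= eqxx big1 ?addr0 // => j.
  by rewrite -val_eqE /= eq_sym => /negbTE ->.
rewrite nth_default // big1 // => j _; case: eqP => // ij.
by move: (ltn_ord j); rewrite -ij ltnNge pi.
Qed.

Definition grproj n a : grH := gr_in pH n (repr a : {poly H})`_n.

Lemma grprojE n (p : filt_sum pH) : grproj n (gr_class p) = gr_in pH n p`_n.
Proof.
have Fp := filt_sumP p n; have Fq := filt_sumP (repr (gr_class p)) n.
have /gr_classP /(_ n) h := gr_class_repr (gr_class p).
rewrite /grproj -!leadE //; apply/eqP; rewrite -subr_eq0 -(linB (lead_linear n)); apply/eqP.
exact: lead0.
Qed.

Lemma grproj_linear n : linear (grproj n).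
Proof.
move=> c a b; rewrite -(gr_class_repr a) -(gr_class_repr b) gr_classZ gr_classD !grprojE.
by rewrite coefD filt_scale_coef gr_in_linear //; apply: filt_sumP.
Qed.

Lemma grproj_lead n m x : F m.+1 x -> grproj n (lead m x) = if n == m then lead m x else 0.
Proof.
move=> Fx; rewrite leadE // grprojE (gr_in_coef pH Fx); case: eqP => [->//|_].
by apply: gr_in0; case: (corad_filt_pred_subspace H n).
Qed.

(** The right coaction of the degree zero part on [gr H], contracted by [chi]; the graded
    counterpart of [hr]. *)
Definition rhit (chi : H -> k) a : grH :=
  contr chi (tens_map id (@gr_proj0 _ _ pH) (gr_comul a)).

Lemma rhit_linear chi : functional chi -> linear (rhit chi).
Proof.
move=> fc; have l1 := tens_map_linear (@id_linear _ grH) (@gr_proj0_linear _ _ pH).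
exact: (comp_linear (comp_linear (@gr_comul_linear _ _ pH) l1) (contr_linear fc)).
Qed.

Lemma rhit_lead chi n x : functional chi -> F n.+1 x -> rhit chi (lead n x) = lead n (hr chi x).
Proof.
move=> fc Fx; have [s ds] := decomp_exists pH Fx; have [Fs Dx] := ds.
have idl := @id_linear _ grH; have pl := @gr_proj0_linear _ _ pH.
have tl := tens_map_linear idl pl; have ll := lead_linear n.
have proj_in m y : F m.+1 y -> gr_proj0 (gr_in pH m y) = if m == 0%N then y else 0.
  by move=> Fy; rewrite gr_proj0E (gr_in_coef pH Fy) eq_sym.
rewrite /rhit /hr leadE // (gr_comul_in pH ds) // /gr_decomp Dx.
rewrite (lin_sum _ _ tl) (lin_sum _ _ (contr_linear fc)).
rewrite (lin_sum _ _ (contr_linear fc)) (lin_sum _ _ ll); apply: eq_bigr => i _.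
rewrite (lin_sum _ _ tl) !(lin_sum _ _ (contr_linear fc)) (lin_sum _ _ ll).
rewrite big_seq [RHS]big_seq; apply: eq_bigr => p ps.
have [F1 F2] := Fs i p (leq_ord i) ps.
rewrite tens_map_pure // !contr_pure // (linZ _ ll) proj_in // subn_eq0.
case: leqP => ni; last first.
  rewrite (lin0 fc) scale0r lead0 ?scaler0 //.
  exact: (corad_filt_pred_le pH ni).
have E : nat_of_ord i = n by apply/eqP; rewrite eqn_leq ni -ltnS ltn_ord.
by rewrite E in F1 *; rewrite leadE.
Qed.

Lemma grproj_rhit chi n a : functional chi -> grproj n (rhit chi a) = rhit chi (grproj n a).
Proof.
move=> fc; have [N [x [Fx ->]]] := lead_span a.
rewrite (lin_sum _ _ (rhit_linear fc)) !(lin_sum _ _ (grproj_linear n)).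
rewrite (lin_sum _ _ (rhit_linear fc)); apply: eq_bigr => m _.
rewrite rhit_lead // !grproj_lead //; last exact: (corad_filt_hr pH).
by case: eqP; rewrite ?rhit_lead // (lin0 (rhit_linear fc)).
Qed.

Lemma gr_coinvP a : gr_coinv pH a <-> forall chi, functional chi -> rhit chi a = chi 1 *: a.
Proof.
split=> [E chi fc|h]; first by rewrite /rhit E contr_pure.
by apply: contr_inj => chi fc; rewrite contr_pure //; apply: h.
Qed.

Lemma gr_coinv_lead n x : F n.+1 x -> gr_coinv pH (lead n x) <-> Hom n 1 x.
Proof.
move=> Fx; have ll := lead_linear n; have sF := corad_filt_pred_subspace H n.+1.
have E chi : functional chi -> rhit chi (lead n x) = chi 1 *: lead n x <->
    F n (hr chi x - chi 1 *: x).
  move=> fc; rewrite rhit_lead // -(lead_eq0 (x := hr chi x - chi 1 *: x)); last first.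
    by apply: (subspaceB sF); [exact: (corad_filt_hr pH)|exact: (subspaceZ _ sF)].
  rewrite (linB ll) (linZ _ ll); split=> [->|/eqP]; first by rewrite subrr.
  by rewrite subr_eq0 => /eqP.
split=> [/gr_coinvP h|[_ h]]; first by split=> // chi fc; apply/E/h.
by apply/gr_coinvP => chi fc; apply/E/h.
Qed.

(** The component [R(n)] of the coinvariants, by [Rset_coinv] and [coinv_grproj]; described by
    lifts, so that products are computed in [H]. *)
Definition Rset n : set grH := [set a | exists2 x, Hom n 1 x & a = lead n x].

Lemma Rset_subspace n : subspace (Rset n).
Proof.
have sH := @Hom_subspace k H n 1; split=> [|c _ _ [x hx ->] [y hy ->]].
  by exists 0; [case: sH|rewrite (lin0 (lead_linear n))].
by exists (c *: x + y); [case: sH => _; apply|rewrite (lead_linear n)].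
Qed.

Lemma Rset_coinv n : Rset n `<=` gr_coinv pH.
Proof. by move=> _ [x hx ->]; apply/gr_coinv_lead => //; case: hx. Qed.

Lemma coinv_grproj n a : gr_coinv pH a -> Rset n (grproj n a).
Proof.
move=> /gr_coinvP ha; have : gr_coinv pH (grproj n a).
  apply/gr_coinvP => chi fc; rewrite -grproj_rhit // ha //.
  exact: (linZ _ (grproj_linear n)).
have Fx := filt_sumP (repr a) n; rewrite /grproj -leadE // => /(gr_coinv_lead Fx) hx.
by exists (repr a : {poly H})`_n.
Qed.

Lemma grproj_sum a : exists N, a = \sum_(n < N) grproj n a.
Proof.
have [N [x [Fx E]]] := lead_span a; exists N; rewrite {1}E; apply: eq_bigr => n _.
rewrite E (lin_sum _ _ (grproj_linear n)) (bigD1 n) //= grproj_lead // eqxx.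
by rewrite big1 ?addr0 // => m mn; rewrite grproj_lead // ifN // eq_sym.
Qed.

(** This is [R(0) = k], the reason why generators of [R] can be taken in positive degrees. *)
Lemma Hom01 x : Hom 0 1 x -> exists c, x = c *: 1.
Proof.
move=> [Fx hx]; have [T [c [uT gT xE]]] := coradical_coords pH Fx.
have [chi [fc c1 c0]] := grouplike_dual gT (@grouplike1 _ H).
have /= /eqP := hx chi fc; rewrite c1 scale1r subr_eq0 => /eqP <-.
exists (\sum_(g <- T | g == 1) c g); rewrite {1}xE (lin_sum _ _ (hr_linear fc)) scaler_suml.
rewrite [RHS]big_mkcond big_seq [RHS]big_seq; apply: eq_bigr => g gT'.
rewrite (linZ _ (hr_linear fc)) hr_grouplike //; last exact: gT.
by case: eqP => [->|/eqP g1]; rewrite ?c1 ?scale1r // c0 // scale0r scaler0.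
Qed.

(* Words in homogeneous lifts: [(d, x)] stands for [x] of degree [d.+1]. *)
Definition wdeg (w : seq (nat * H)) : nat := \sum_(p <- w) p.1.+1.
Definition whopf (w : seq (nat * H)) : H := \prod_(p <- w) p.2.

Lemma whopf_Hom (L w : seq (nat * H)) : (forall p, p \in L -> Hom p.1.+1 1 p.2) -> {subset w <= L} ->
  Hom (wdeg w) 1 (whopf w).
Proof.
move=> hL; elim: w => [_|p w IHw wL].
  by rewrite /wdeg /whopf !big_nil; apply: (grouplike_Hom pH); apply: grouplike1.
rewrite /wdeg /whopf !big_cons -[X in Hom _ X](mulr1 1); apply: (HomM pH).
  by apply/hL/wL/mem_head.
by apply: IHw => q qw; apply: wL; rewrite inE qw orbT.
Qed.

(** The generators are replaced by lifts of their homogeneous components of positive degree, those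
    of degree 0 being scalars. Since the words are formed in [H], one list serves both [gr H] and
    [H]. *)
Lemma coinv_words : finitely_generated (gr_coinv pH) -> exists L : seq (nat * H),
  (forall p, p \in L -> Hom p.1.+1 1 p.2) /\
  forall n a, Rset n a ->
    lspan [set lead n (whopf w) | w in [set w : seq (nat * H) | {subset w <= L} /\ wdeg w = n]] a.
Proof.
move=> [s sE]; pose W (L : seq (nat * H)) :=
  lspan [set lead (wdeg w) (whopf w) | w in [set w : seq (nat * H) | {subset w <= L}]].
have WS L L' : {subset L <= L'} -> W L `<=` W L'.
  move=> LL; apply: lspan_min => [|_ [w wL <-]]; first exact: lspan_subspace.
  by apply: sub_lspan; exists w => // p /wL/LL.
have sW L : subspace (W L) by exact: lspan_subspace.
have s_coinv a : a \in s -> gr_coinv pH a.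
  move=> as_; rewrite sE; apply: sub_lspan; exists [:: a]; rewrite ?big_seq1 //.
  by move=> x /=; rewrite inE => /eqP ->.
have [L [hL LW]] : exists L : seq (nat * H), (forall p, p \in L -> Hom p.1.+1 1 p.2) /\
    forall a, a \in s -> W L a.
  elim: s s_coinv {sE} => [_|a s IHs hs]; first by exists [::].
  have [|L [hL LW]] := IHs; first by move=> b bs; apply: hs; rewrite inE bs orbT.
  have ca := hs a (mem_head _ _); have [N aE] := grproj_sum a.
  have ex n : exists x, Hom n 1 x /\ grproj n a = lead n x.
    by have [x hx xE] := coinv_grproj n ca; exists x.
  have [x xP] := choice ex.
  pose L' := [seq (n, x n.+1) | n <- iota 0 N].
  have subl : {subset L <= L ++ L'} by move=> p pL; rewrite mem_cat pL.
  exists (L ++ L'); split=> [p|b].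
    by rewrite mem_cat => /orP [/hL //|/mapP [n _ ->]]; case: (xP n.+1).
  rewrite inE => /orP [/eqP ->|/LW]; last exact: WS.
  rewrite aE; apply: (subspace_sum (sW _)) => n _; have [hx ->] := xP n.
  have sub1 (w : seq (nat * H)) : {subset w <= L ++ L'} -> W (L ++ L') (lead (wdeg w) (whopf w)).
    by move=> wL; apply: sub_lspan; exists w.
  case: n hx => -[|n] /= nN hx.
    have [c ->] := Hom01 hx; rewrite (linZ _ (lead_linear 0)); apply: (subspaceZ _ (sW _)).
    by have := @sub1 [::]; rewrite /wdeg /whopf !big_nil; apply.
  have := @sub1 [:: (n, x n.+1)]; rewrite /wdeg /whopf !big_seq1; apply.
  move=> p; rewrite inE mem_cat => /eqP ->; apply/orP; right; apply: map_f.
  by rewrite mem_iota /= add0n ltnW.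
exists L; split=> // n a Ra; have : W L a.
  have := Rset_coinv Ra; rewrite sE; move: a {Ra}; apply: lspan_min => // _ [w ws <-].
  elim: w ws => [_|b w IHw ws].
    rewrite big_nil -lead01; apply: sub_lspan; exists [::] => //.
    by rewrite /wdeg /whopf !big_nil.
  rewrite big_cons; have {IHw} : W L (\prod_(x <- w) x).
    by apply: IHw => c cw; apply: ws; rewrite /= inE cw orbT.
  move: (\prod_(x <- w) x); have : W L b by apply/LW/ws; exact: mem_head.
  move: b {ws}; apply: lspan_min => [|_ [u uL <-]].
    split=> [c _|e b b' hb hb' c Wc]; first by rewrite mul0r; case: (sW L).
    by rewrite mulrDl -scalerAl; case: (sW L) => _; apply; [apply: hb|apply: hb'].
  apply: lspan_min => [|_ [v vL <-]].
    split=> [|e b b' hb hb']; first by rewrite /= mulr0; case: (sW L).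
    by rewrite /= mulrDr -scalerAr; case: (sW L) => _; apply.
  have [Fu _] := whopf_Hom hL uL; have [Fv _] := whopf_Hom hL vL.
  rewrite /= leadM //; apply: sub_lspan; exists (u ++ v).
    by move=> p; rewrite mem_cat => /orP [/uL|/vL].
  by rewrite /wdeg /whopf !big_cat.
move=> Wa; have aE : a = grproj n a by case: Ra => x [Fx _] ->; rewrite grproj_lead // eqxx.
rewrite aE; set Y := lspan _; have sY : subspace Y by exact: lspan_subspace.
move: a Wa {Ra aE}; apply: (lspan_min (T := [set b | Y (grproj n b)])) => [|_ [w wL <-]].
  exact: (preimage_subspace (grproj_linear n) sY).
have [Fw _] := whopf_Hom hL wL; rewrite /= grproj_lead //.
case: eqP => [nw|_]; last by case: sY.
by apply: sub_lspan; exists w; rewrite -?nw.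
Qed.

End GradedInterface.

(** * Growth of algebras *)

Section PowerSums.
Variables (k : fieldType) (A : algType k).
Local Open Scope ring_scope.
Implicit Types (s : seq A) (V : set A) (n : nat).

(** The common form of the upper bounds: it suffices to find spaces [U n] that absorb one generator
    at a time. *)
Lemma power_sum_sub s (U : nat -> set A) : (forall n, subspace (U n)) -> U 0%N 1 ->
  (forall n, U n `<=` U n.+1) -> (forall n x y, x \in s -> U n y -> U n.+1 (x * y)) ->
  forall n, power_sum (lspan [set` s]) n `<=` U n.
Proof.
move=> sU U1 US UM n; apply: lspan_min => // _ [w [ws wV] <-].
have Ule i j : (i <= j)%N -> U i `<=` U j.
  by move=> /subnKC <-; elim: (j - i)%N => [|l IHl]; rewrite ?addn0 // addnS => x /IHl /US.
apply: (Ule _ _ ws); elim: w wV {ws} => [_|x w IHw wV]; first by rewrite big_nil.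
rewrite big_cons /=; have Uw : U (size w) (\prod_(x <- w) x).
  by apply: IHw => y yw; apply: wV; rewrite inE yw orbT.
have := wV x (mem_head _ _); apply: (lspan_min (T := [set x | U (size w).+1 (x * _)])) => [|y ys].
  split=> [|c a b /= ha hb]; first by rewrite /= mul0r; case: (sU (size w).+1).
  by rewrite mulrDl -scalerAl; case: (sU (size w).+1) => _; apply.
exact: UM.
Qed.

(** A finite spanning list for the power sums, which shows that [vdim] is their true dimension. *)
Fixpoint monomials s n : seq A :=
  if n is m.+1 then monomials s m ++ [seq x * y | x <- s, y <- monomials s m] else [:: 1].

Lemma power_sum_monomials s n : power_sum (lspan [set` s]) n `<=` lspan [set` monomials s n].
Proof.
move: n; apply: (power_sum_sub (U := fun n => lspan [set` monomials s n])) => [n||n|n x y xs]; first exact: lspan_subspace.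
- by apply: sub_lspan; rewrite /= inE.
- by apply: lspan_subset => x xn; apply: sub_lspan; rewrite /= mem_cat xn.
- move: y; apply: (lspan_min (T := [set y | lspan _ (x * y)])) => [|y yn].
    have sL := lspan_subspace [set` monomials s n.+1].
    split=> [|c a b /= ha hb]; first by rewrite /= mulr0; case: sL.
    by rewrite mulrDr -scalerAr; case: sL => _; apply.
  apply: sub_lspan; rewrite /= mem_cat; apply/orP; right.
  by apply/allpairsP; exists (x, y).
Qed.

Lemma power_sum_subspace V n : subspace (power_sum V n).
Proof. exact: lspan_subspace. Qed.

Lemma power_sum_prod V n (w : seq A) : (size w <= n)%N -> (forall x, x \in w -> V x) ->
  power_sum V n (\prod_(x <- w) x).
Proof. by move=> ws wV; apply: sub_lspan; exists w. Qed.

Lemma power_sumM V m n x y : power_sum V m x -> power_sum V n y -> power_sum V (m + n) (x * y).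
Proof.
have sP := power_sum_subspace V (m + n).
move=> Px Py; move: x Px; apply: (lspan_min (T := [set x | power_sum V (m + n) (x * y)])).
  split=> [|c a b /= ha hb]; first by rewrite /= mul0r; case: sP.
  by rewrite mulrDl -scalerAl; case: sP => _; apply.
move=> _ [u [us uV] <-]; move: y Py.
apply: (lspan_min (T := [set y | power_sum V (m + n) (_ * y)])).
  split=> [|c a b /= ha hb]; first by rewrite /= mulr0; case: sP.
  by rewrite mulrDr -scalerAr; case: sP => _; apply.
move=> _ [v [vs vV] <-] /=; rewrite -big_cat; apply: power_sum_prod.
  by rewrite size_cat leq_add.
by move=> x; rewrite mem_cat => /orP [/uV|/vV].
Qed.

Lemma power_sum_le V m n : (m <= n)%N -> power_sum V m `<=` power_sum V n.
Proof.
move=> mn; apply: lspan_min; first exact: power_sum_subspace.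
by move=> _ [w [ws wV] <-]; apply: power_sum_prod => //; apply: leq_trans mn.
Qed.

Lemma vdim_power_sum s n m :
  dimge (power_sum (lspan [set` s]) n) m <-> (m <= vdim (power_sum (lspan [set` s]) n))%N.
Proof. exact: vdimP (power_sum_subspace _ _) (@power_sum_monomials s n). Qed.

Lemma vdim_power_sum_le s n m : (forall d, dimge (power_sum (lspan [set` s]) n) d -> (d <= m)%N) ->
  (vdim (power_sum (lspan [set` s]) n) <= m)%N.
Proof. by apply; apply/vdim_power_sum. Qed.

End PowerSums.

Section GradedDimension.
Variables (k : fieldType) (A W : lmodType k).
Local Open Scope ring_scope.

Lemma dimge_add (f : A -> W) (U K : set A) (I : finType) (u : I -> A) b : linear f ->
  K `<=` U -> (forall x, K x -> f x = 0) -> (forall i, U (u i)) -> freef (f \o u) ->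
  dimge K b -> dimge U (#|I| + b).
Proof.
move=> fl KU fK Uu fu [v fv Kv]; pose w (i : I + 'I_b) := match i with inl i => u i | inr j => v j end.
rewrite -[b]card_ord -card_sum; apply: (dimge_fin (v := w)) => [c|[i|j]] //=; last exact/KU/Kv.
rewrite big_sumType /= => E; have c1 : forall i, c (inl i) = 0.
  apply: fu; rewrite -[RHS](lin0 fl) -E (linD fl) !(lin_sum _ _ fl) [X in _ = _ + X]big1 ?addr0.
    by apply: eq_bigr => i _; rewrite (linZ _ fl).
  by move=> j _; rewrite (linZ _ fl) fK ?scaler0.
case=> // j; apply: (fv (fun j => c (inr j))); rewrite -[RHS]E [X in _ = X + _]big1 ?add0r //.
by move=> i _; rewrite c1 scale0r.
Qed.

(** [f j] detects degree [j] and vanishes on [K j], the part of lower degree; so families that are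
    free in their own degrees combine to a free family, the top degree being split off first. *)
Lemma graded_dimge (P : set A) (f : nat -> A -> W) (K : nat -> set A) (I : nat -> finType)
    (u : forall j, I j -> A) n :
  subspace P -> (forall j, linear (f j)) -> (forall j, subspace (K j)) ->
  (forall j, K j `<=` K j.+1) -> (forall j x, K j x -> f j x = 0) ->
  (forall j i, (j < n)%N -> P (u j i) /\ K j.+1 (u j i)) ->
  (forall j, freef (f j \o u j)) -> dimge P (\sum_(j < n) #|I j|).
Proof.
move=> sP fl sK KS f0 uP fu; apply: (@dimge_sub _ _ (P `&` K n)) => [x []//|].
elim: n uP => [_|n IHn uP].
  by rewrite big_ord0; exists (fun _ => 0) => [c _ []|[]].
rewrite big_ord_recr /= addnC; apply: (dimge_add (f := f n) (K := P `&` K n) (u := u n)) => //.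
- by move=> x [Px /KS Kx].
- by move=> x [_ /f0].
- by move=> i; apply: uP.
- by apply: IHn => j i jn; apply: uP; apply: ltnW.
Qed.

End GradedDimension.

Section Bounds.
Variables (k : fieldType) (H : hopfAlgType k) (pH : pointed H).
Local Open Scope ring_scope.
Local Notation F := (corad_filt_pred H).
Local Notation grH := (gr pH).
Local Notation lead := (@lead k H pH).
Local Notation Rset := (@Rset k H pH).

Variable L : seq (nat * H).
Hypothesis hL : forall p, p \in L -> Hom p.1.+1 1 p.2.
Hypothesis LR : forall n a, Rset n a ->
  lspan [set lead n (whopf w) | w in [set w : seq (nat * H) | {subset w <= L} /\ wdeg w = n]] a.

Definition Lgr : seq grH := [seq lead p.1.+1 p.2 | p <- L].
Definition words_of n := [set whopf w | w in [set w : seq (nat * H) | {subset w <= L} /\ wdeg w = n]].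

Lemma size_wdeg (w : seq (nat * H)) : (size w <= wdeg w)%N.
Proof.
elim: w => [|p w IHw]; first by rewrite /wdeg big_nil.
by rewrite /wdeg big_cons /= -add1n leq_add.
Qed.

Lemma lead_whopf (w : seq (nat * H)) : {subset w <= L} ->
  lead (wdeg w) (whopf w) = \prod_(a <- [seq lead p.1.+1 p.2 | p <- w]) a.
Proof.
elim: w => [_|p w IHw wL]; first by rewrite /wdeg /whopf !big_nil; apply: lead01.
have wL' : {subset w <= L} by move=> q qw; apply: wL; rewrite inE qw orbT.
have [Fp _] := hL (wL p (mem_head _ _)); have [Fw _] := whopf_Hom pH hL wL'.
by rewrite /= big_cons -IHw // leadM // /wdeg /whopf !big_cons.
Qed.

Lemma words_Hom n : lspan (words_of n) `<=` Hom n 1.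
Proof.
apply: lspan_min; first exact: Hom_subspace.
by move=> _ [w [wL <-] <-]; apply: (whopf_Hom pH hL).
Qed.

Lemma Rset_power_sum V n : (forall a, a \in Lgr -> V a) -> Rset n `<=` power_sum V n.
Proof.
move=> LV a /LR; move: a; apply: lspan_min; first exact: power_sum_subspace.
move=> _ [w [wL <-] <-]; rewrite lead_whopf //; apply: power_sum_prod.
  by rewrite size_map; apply: size_wdeg.
by move=> _ /mapP [p /wL pL ->]; apply: LV; apply: map_f.
Qed.

(** Elements of [H] whose symbols form a basis of [R(n)]. Being combinations of words, they also lie
    in the power sums of the generators inside [H]. *)
Definition is_basis n (B : seq H) := [/\ forall x, x \in B -> lspan (words_of n) x,
  lin_free (map (lead n) B) & Rset n `<=` lspan [set` map (lead n) B]].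

Lemma Rset_basis n : exists B, is_basis n B.
Proof.
have Rm : Rset n `<=` lspan [set` monomials Lgr n].
  move=> a /(Rset_power_sum (V := lspan [set` Lgr])) h; apply: power_sum_monomials.
  by apply: h => b; apply: sub_lspan.
have [s fs sE] := subspace_basis (Rset_subspace pH n) Rm.
have ex b : exists x, b \in s -> lspan (words_of n) x /\ lead n x = b.
  have [bs|_] := boolP (b \in s); last by exists 0.
  have Rb : Rset n b by rewrite sE; apply: sub_lspan.
  suff [x wx xE] : exists2 x, lspan (words_of n) x & lead n x = b by exists x.
  have := LR Rb; move: b {Rb bs}.
  apply: (lspan_min (T := [set b | exists2 x, lspan (words_of n) x & lead n x = b])).
    have ll := lead_linear pH n; have sw := lspan_subspace (words_of n).
    split=> [|c _ _ [x hx <-] [y hy <-]]; first by exists 0; [case: sw|exact: lin0 ll].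
    by exists (c *: x + y); [case: sw => _; apply|rewrite ll].
  by move=> _ [w wP <-]; exists (whopf w) => //; apply: sub_lspan; exists w.
have [g gP] := choice ex; exists (map g s).
have E : map (lead n) (map g s) = s.
  by rewrite -map_comp -[RHS]map_id; apply/eq_in_map => b /gP [].
by split=> [x /mapP [b /gP [h _] ->]||]; rewrite ?E // sE.
Qed.

Variable B : nat -> seq H.
Hypothesis BP : forall n, is_basis n (B n).

Definition rdim n := (\sum_(m < n.+1) size (B m))%N.

Let BHom n x : x \in B n -> Hom n 1 x.
Proof. by have [h _ _] := BP n; move=> /h; apply: words_Hom. Qed.

Definition cell n (T : seq H) := [seq lead n (x * g) | x <- B n, g <- T].

Lemma Hom_grouplike n (g h x : H) : Hom n g x -> grouplike h -> Hom n (g * h) (x * h).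
Proof. by move=> hx /(grouplike_Hom pH) /(HomM pH hx); rewrite addn0. Qed.

Lemma lead_grouplike n (g x : H) : F n.+1 x -> grouplike g -> lead n (x * g) = lead n x * lead 0 g.
Proof. by move=> Fx /(grouplike_Hom pH) [Fg _]; rewrite leadM // addn0. Qed.

(** Multiplication by the inverse of [g] moves a [g]-component into [R(n)]; this is the surjectivity
    in the decomposition of [gr H] as [R] times the group algebra. *)
Lemma cell_span n T (g x : H) : grouplikes T -> g \in T -> Hom n g x -> lspan [set` cell n T] (lead n x).
Proof.
move=> gT gin hx; have gg := gT g gin; have [Sg gS] := antipode_mul gg.
have hy := Hom_grouplike hx (grouplikeV gg); rewrite gS in hy; set y := x * _ in hy.
have xE : x = y * g by rewrite /y -mulrA Sg mulr1.
have [Fy _] := hy; rewrite xE lead_grouplike //.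
have [_ _ Rs] := BP n; have : lspan [set` map (lead n) (B n)] (lead n y).
  by apply: Rs; exists y.
move: (lead n y).
apply: (lspan_min (T := [set a | lspan [set` cell n T] (a * lead 0 g)])) => [|_ /mapP [z zB ->]].
  have sL := lspan_subspace [set` cell n T].
  split=> [|c a b /= ha hb]; first by rewrite /= mul0r; case: sL.
  by rewrite mulrDl -scalerAl; case: sL => _; apply.
have [Fz _] := BHom zB; rewrite /= -lead_grouplike //; apply: sub_lspan.
by apply/allpairsP; exists (z, g).
Qed.

(** Different [g] are separated by [Hom_indep]; for a single [g], multiplication by its inverse
    reduces to the freeness of the basis of [R(n)]. *)
Lemma cell_free n (T : seq H) : uniq T -> grouplikes T ->
  freef (fun q : 'I_(size (B n)) * 'I_(size T) => lead n ((B n)`_q.1 * T`_q.2)).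
Proof.
move=> uT gT c; have ll := lead_linear pH n; have sH := @Hom_subspace k H n 1.
pose y j := \sum_(i < size (B n)) c (i, j) *: (B n)`_i.
have hy j : Hom n 1 (y j).
  by apply: (subspace_sum sH) => i _; apply: (subspaceZ _ sH); apply/BHom/mem_nth.
rewrite (eq_bigr (fun q => lead n (c (q.1, q.2) *: ((B n)`_q.1 * T`_q.2)))); last first.
  by move=> [i j] _; rewrite (linZ _ ll).
rewrite -(pair_bigA _ (fun i j => lead n (c (i, j) *: ((B n)`_i * T`_j)))) /= exchange_big /=.
rewrite (eq_bigr (fun j => lead n (y j * T`_j))); last first.
  move=> j _; rewrite -(lin_sum _ _ ll); congr lead; rewrite /y mulr_suml.
  by apply: eq_bigr => i _; rewrite scalerAl.
rewrite -(lin_sum _ _ ll) => E.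
pose xg g := if insub (index g T) is Some j then y j * g else 0.
have xgE (j : 'I_(size T)) : xg T`_j = y j * T`_j by rewrite /xg index_uniq // valK.
have hg g : g \in T -> Hom n g (xg g).
  move=> gin; have jT : (index g T < size T)%N by rewrite index_mem.
  have := xgE (Ordinal jT); rewrite /= nth_index // => ->.
  by have := Hom_grouplike (hy (Ordinal jT)) (gT g gin); rewrite mul1r.
have sumE : \sum_(g <- T) xg g = \sum_(j < size T) y j * T`_j.
  by rewrite (big_nth 0) big_mkord; apply: eq_bigr => j _; rewrite xgE.
have sF := corad_filt_pred_subspace H n.+1.
have FS : F n (\sum_(g <- T) xg g).
  apply/(lead_eq0 pH); last by rewrite sumE.
  by apply: (subspace_sum sF) => g /hg [].
move=> [i j]; have := Hom_indep pH uT gT hg FS (mem_nth 0 (ltn_ord j)); rewrite xgE => Fyg.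
have gg := gT _ (mem_nth 0 (ltn_ord j)); have [Fg _] := grouplike_Hom pH (grouplikeV gg).
have Fy : F n (y j).
  have := corad_filt_predM pH Fyg Fg; rewrite addn1 /= -mulrA.
  by rewrite (antipode_mul gg).2 mulr1.
have [_ fB _] := BP n; have sB : size (map (lead n) (B n)) = size (B n) by rewrite size_map.
have := lead0 pH Fy; rewrite /y (lin_sum _ _ ll) => E0.
pose d (i' : 'I_(size (map (lead n) (B n)))) := c (cast_ord sB i', j).
have := fB d _ (cast_ord (esym sB) i); rewrite /d cast_ordKV; apply.
rewrite (reindex (cast_ord (esym sB))) /=; last first.
  by exists (cast_ord sB) => l _; rewrite ?cast_ordK ?cast_ordKV.
rewrite -[RHS]E0; apply: eq_bigr => l _; rewrite cast_ordKV (linZ _ ll).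
by rewrite (nth_map 0).
Qed.

(** Remove the top degree: by [homogeneous_decomp] the symbol map carries the space into the span of
    one cell, and its kernel is the same space with [N] lowered by one. *)
Lemma filt_dim_le (T : seq H) d N m : uniq T -> grouplikes T -> dimge (F N `&` Phi T d) m ->
  (m <= (\sum_(j < N) size (B j)) * size T)%N.
Proof.
move=> uT gT; elim: N m => [|N IHN] m dm.
  by rewrite big_ord0 mul0n; apply: (dimge_bound (t := [::])) dm => x [-> _]; case: (lspan_subspace [set` ([::] : seq H)]).
have sU : subspace (F N.+1 `&` Phi T d).
  have [F0 FD] := corad_filt_pred_subspace H N.+1; have [P0 PD] := Phi_subspace T d.
  by split=> // a x y [Fx Px] [Fy Py]; split; [apply: FD|apply: PD].
rewrite big_ord_recr /= mulnDl addnC -leq_subLR -(size_allpairs (fun x g => lead N (x * g))).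
apply: IHN; apply: (dimge_sub (U := [set u | (F N.+1 `&` Phi T d) u /\ lead N u = 0])).
  by move=> x [[Fx Px] /(lead_eq0 _ Fx)].
apply: (dimge_ker (lead_linear pH N) sU _ dm) => x [Fx Px].
have [xg [hx Fr]] := homogeneous_decomp pH uT gT Fx Px.
have -> : lead N x = \sum_(g <- T) lead N (xg g).
  have := lead0 pH Fr; rewrite (linB (lead_linear pH N)) (lin_sum _ _ (lead_linear pH N)).
  by move=> /eqP; rewrite subr_eq0 => /eqP.
apply: subspace_sum => [|g gin]; first exact: lspan_subspace.
by apply: cell_span gT gin (hx g gin).
Qed.

(** The part of [gr H] of degree at most [N] with support in [T]. *)
Definition RG N (T : seq H) : set grH := lspan [set a | exists m g x,
  [/\ (m <= N)%N, g \in T, Hom m g x & a = lead m x]].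

Lemma RG_subspace N T : subspace (RG N T). Proof. exact: lspan_subspace. Qed.

Lemma RG_mono N N' T T' : (N <= N')%N -> {subset T <= T'} -> RG N T `<=` RG N' T'.
Proof.
move=> NN TT; apply: lspan_min; first exact: RG_subspace.
move=> _ [m [g [x [mN gin hx ->]]]]; apply: sub_lspan; exists m, g, x.
by split; [exact: leq_trans NN|exact: TT|exact: hx|].
Qed.

Lemma RG_mul N N' T T' T'' a b : (forall g h, g \in T -> h \in T' -> g * h \in T'') ->
  RG N T a -> RG N' T' b -> RG (N + N') T'' (a * b).
Proof.
move=> TT Ra Rb; have sR := RG_subspace (N + N') T''; move: a Ra.
apply: (lspan_min (T := [set a | RG (N + N') T'' (a * b)])).
  split=> [|c a a' /= ha hb]; first by rewrite /= mul0r; case: sR.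
  by rewrite mulrDl -scalerAl; case: sR => _; apply.
move=> _ [m [g [x [mN gin hx ->]]]]; move: b Rb.
apply: (lspan_min (T := [set b | RG (N + N') T'' (_ * b)])).
  split=> [|c a a' /= ha hb]; first by rewrite /= mulr0; case: sR.
  by rewrite mulrDr -scalerAr; case: sR => _; apply.
move=> _ [m' [g' [x' [mN' gin' hx' ->]]]] /=; have [Fx _] := hx; have [Fx' _] := hx'.
rewrite leadM //; apply: sub_lspan; exists (m + m')%N, (g * g'), (x * x').
by split=> //; [exact: leq_add|exact: TT|exact: HomM].
Qed.

Lemma RG_dim_le N (T : seq H) m : grouplikes T -> dimge (RG N T) m -> (m <= rdim N * size T)%N.
Proof.
move=> gT dm; pose t := flatten [seq cell (val j) T | j <- index_enum 'I_N.+1].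
have -> : (rdim N * size T)%N = size t.
  rewrite /t size_flatten /shape -map_comp sumnE big_map /rdim big_distrl /=.
  by apply: eq_bigr => j _; rewrite size_allpairs.
apply: dimge_bound dm; apply: lspan_min; first exact: lspan_subspace.
move=> _ [j [g [x [jN gin hx ->]]]]; have := cell_span gT gin hx.
apply: lspan_subset => a aj; apply: sub_lspan; apply/flattenP; exists (cell j T) => //.
have jN' : (j < N.+1)%N by [].
by apply/mapP; exists (Ordinal jN'); rewrite ?mem_index_enum.
Qed.

Definition tl (T : seq (glk H)) n := [seq gval u | u <- ball T n].

Lemma tl_grouplikes T n : grouplikes (tl T n).
Proof. by move=> g /mapP [u _ ->]; apply: glkP. Qed.

Lemma tl_uniq T n : uniq (tl T n).
Proof. by rewrite map_inj_uniq ?ball_uniq //; apply: gval_inj. Qed.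

Lemma size_tl T n : size (tl T n) = size (ball T n). Proof. by rewrite size_map. Qed.

Lemma tl_mul T m n g h : g \in tl T m -> h \in tl T n -> g * h \in tl T (m + n).
Proof.
by move=> /mapP [u uB ->] /mapP [v vB ->]; apply/mapP; exists (u * v)%g => //; apply: ball_mul.
Qed.

Lemma tl_le T m n : symm T -> (m <= n)%N -> {subset tl T m <= tl T n}.
Proof. by move=> sT mn g /mapP [u /(ball_le sT mn) uB ->]; apply: map_f. Qed.

Lemma grouplikes_glk (T : seq H) : grouplikes T -> exists2 T' : seq (glk H), symm T' &
  {subset T <= tl T' 1}.
Proof.
move=> gT; have ex g : exists u : glk H, g \in T -> gval u = g.
  by have [gin|_] := boolP (g \in T); [exists (glk_mk (gT g gin))|exists (glk_one H)].
have [f fP] := choice ex; exists (symz (map f T)); first exact: symm_symz.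
move=> g gin; apply/mapP; exists (f g); last by rewrite fP.
by apply/ball_gen/sub_symz/map_f.
Qed.

Lemma tl_power_sum (T : seq (glk H)) (A : algType k) (f : H -> A) V n :
  f 1 = 1 -> (forall g h, grouplike g -> grouplike h -> f (g * h) = f g * f h) ->
  (forall u, u \in T -> V (f (gval u))) -> forall g, g \in tl T n -> power_sum V n (f g).
Proof.
move=> f1 fM fV _ /mapP [u uB ->]; elim: n u uB => [u|n IHn u].
  rewrite inE => /eqP -> /=; rewrite f1; have := @power_sum_prod _ A V 0 [::].
  by rewrite big_nil; apply.
move=> /ballSP [v [t [/IHn Pv tT ->]]] /=; rewrite fM; [|exact: glkP|exact: glkP].
rewrite -addn1; apply: power_sumM => //; have := @power_sum_prod _ A V 1 [:: f (gval t)].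
by rewrite big_seq1; apply=> // x; rewrite inE => /eqP ->; apply: fV.
Qed.

End Bounds.

(** * Upper and lower bounds for the dimensions of power sums *)

Section GrowthBounds.
Variables (k : fieldType) (H : hopfAlgType k) (pH : pointed H).
Local Open Scope ring_scope.
Local Notation F := (corad_filt_pred H).
Local Notation grH := (gr pH).
Local Notation lead := (@lead k H pH).
Local Notation Rset := (@Rset k H pH).
Local Notation RG := (@RG k H pH).

Variable L : seq (nat * H).
Hypothesis hL : forall p, p \in L -> Hom p.1.+1 1 p.2.
Hypothesis LR : forall n a, Rset n a ->
  lspan [set lead n (whopf w) | w in [set w : seq (nat * H) | {subset w <= L} /\ wdeg w = n]] a.
Variable B : nat -> seq H.
Hypothesis BP : forall n, is_basis pH L n (B n).
Local Notation r := (rdim B).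

(** Finitely many elements share one degree bound and one finite support, which is enlarged to a
    symmetric list so that its balls bound the supports of products. *)
Lemma common_support (A : choiceType) (P : nat -> seq H -> A -> Prop) (s : seq A) :
  (forall N N' T T' a, grouplikes T -> grouplikes T' -> (N <= N')%N -> {subset T <= T'} ->
    P N T a -> P N' T' a) ->
  (forall a, a \in s -> exists N T, grouplikes T /\ P N T a) ->
  exists N T, symm T /\ forall a, a \in s -> P N.+1 (tl (H := H) T 1) a.
Proof.
move=> mono h; suff [N [T [gT PT]]] : exists N T, grouplikes T /\ forall a, a \in s -> P N T a.
  have [T' sT' TT'] := grouplikes_glk gT; exists N, T'; split=> // a /PT.
  by apply: mono => //; exact: tl_grouplikes.
elim: s h => [_|a s IHs h]; first by exists 0%N, [::].
have [|N [T [gT PT]]] := IHs; first by move=> b bs; apply: h; rewrite inE bs orbT.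
have [N' [T' [gT' PT']]] := h a (mem_head _ _).
have gTT : grouplikes (T ++ T') by move=> g; rewrite mem_cat => /orP [/gT|/gT'].
exists (N + N')%N, (T ++ T'); split=> // b; rewrite inE => /orP [/eqP ->|/PT].
  by apply: mono PT' => //; [exact: leq_addl|move=> g gin; rewrite mem_cat gin orbT].
by apply: mono => //; [exact: leq_addr|move=> g gin; rewrite mem_cat gin].
Qed.

Lemma gr_support (a : grH) : exists N T, grouplikes T /\ RG N T a.
Proof.
have [M [x [Fx ->]]] := lead_span a.
have [|b|N [T [sT hT]]] := @common_support grH (fun N T b => RG N T b) [seq lead i (x i) | i <- iota 0 M].
- by move=> N N' T T' b _ _ NN TT; exact: (@RG_mono k H pH _ _ _ _ NN TT b).
- move=> /mapP [i _ ->]; have [T gT PT] := corad_filt_Phi pH (Fx i).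
  have gT' : grouplikes (undup T) by move=> g; rewrite mem_undup; apply: gT.
  have PT' : Phi (undup T) i.+1 (x i) by apply: PhiS PT => g; rewrite mem_undup.
  have [xg [hx Fr]] := homogeneous_decomp pH (undup_uniq T) gT' (Fx i) PT'.
  exists i, (undup T); split=> //; have ll := lead_linear pH i.
  have -> : lead i (x i) = \sum_(g <- undup T) lead i (xg g).
    by have /eqP := lead0 pH Fr; rewrite (linB ll) (lin_sum _ _ ll) subr_eq0 => /eqP.
  apply: subspace_sum => [|g gin]; first exact: RG_subspace.
  by apply: sub_lspan; exists i, g, (xg g); split=> //; apply: hx.
exists N.+1, (tl T 1); split; first exact: tl_grouplikes.
rewrite -(big_mkord xpredT (fun i => lead i (x i))) /index_iota subn0.
apply: subspace_sum => [|i iM]; first exact: RG_subspace.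
by apply/hT/map_f.
Qed.

Lemma RG1 N T : 1 \in T -> RG N T 1.
Proof.
move=> T1; apply: sub_lspan; exists 0%N, 1, 1; split=> //; last by rewrite lead01.
exact: (grouplike_Hom pH (@grouplike1 _ H)).
Qed.

Lemma one_tl (T : seq (glk H)) n : symm T -> (1 : H) \in tl T n.
Proof. by move=> sT; apply/mapP; exists 1%g => //; apply: ball_one. Qed.

Lemma upper_gr (s : seq grH) : exists T c, [/\ symm T, (0 < c)%N &
  forall n, (vdim (power_sum (lspan [set` s]) n) <= r (c * n) * size (ball (T : seq (glk H)) n))%N].
Proof.
have [|a _|N [T [sT hT]]] := @common_support grH (fun N T b => RG N T b) s.
- by move=> N N' T T' b _ _ NN TT; exact: (@RG_mono k H pH _ _ _ _ NN TT b).
- exact: gr_support.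
exists T, N.+1; split=> // n; apply: vdim_power_sum_le => d dm; rewrite -(size_tl T n).
apply: (RG_dim_le hL BP) (@tl_grouplikes _ _ T n) _; apply: dimge_sub dm.
move: n {d}; apply: (power_sum_sub (U := fun n => RG (N.+1 * n) (tl T n))) => [n||n|n x y /hT hx hy].
- exact: RG_subspace.
- exact/RG1/one_tl.
- by apply: RG_mono; [rewrite leq_mul2l leqnSn orbT|exact: tl_le].
- rewrite mulnS; apply: RG_mul hx hy => g h hg hh.
  by have := tl_mul hg hh; rewrite add1n.
Qed.

Lemma upper_coinv (s : seq grH) : (forall a, a \in s -> gr_coinv pH a) -> exists2 c, (0 < c)%N &
  forall n, (vdim (power_sum (lspan [set` s]) n) <= r (c * n))%N.
Proof.
move=> hs; have g1 : grouplikes [:: (1 : H)].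
  by move=> g; rewrite inE => /eqP ->; apply: grouplike1.
have [N hN] : exists N, forall a, a \in s -> RG N [:: 1] a.
  elim: s hs => [_|a s IHs hs]; first by exists 0%N.
  have [|N hN] := IHs; first by move=> b bs; apply: hs; rewrite inE bs orbT.
  have ca := hs a (mem_head _ _); have [M aE] := grproj_sum a; exists (N + M)%N => b.
  rewrite inE => /orP [/eqP ->|/hN]; last exact: (RG_mono (leq_addr _ _)).
  rewrite aE; apply: subspace_sum => [|i _]; first exact: RG_subspace.
  have [x hx ->] := coinv_grproj i ca; apply: sub_lspan; exists i, 1, x; split=> //.
    by apply: leq_trans (ltnW (ltn_ord i)) (leq_addl _ _).
  by rewrite inE.
exists N.+1 => // n; apply: vdim_power_sum_le => d dm.
rewrite -[X in (_ <= X)%N]muln1; apply: (RG_dim_le hL BP (T := [:: 1])) => //.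
apply: dimge_sub dm; move: n {d}.
apply: (power_sum_sub (U := fun n => RG (N.+1 * n) [:: 1])) => [n||n|n x y /hN hx hy].
- exact: RG_subspace.
- by apply: RG1; rewrite inE.
- by apply: RG_mono; rewrite ?leq_mul2l ?leqnSn ?orbT.
- apply: RG_mono (RG_mul (T'' := [:: 1]) _ hx hy) => //; first by rewrite mulnS addSn leqW.
  by move=> g h; rewrite !inE => /eqP -> /eqP ->; rewrite mulr1.
Qed.

(** Both conditions, filtration degree and wedge power over the ball of [T], are multiplicative. The
    order of the wedge power may grow freely, as the bound of [filt_dim_le] does not involve it. *)
Lemma upper_hopf (s : seq H) : exists T c, [/\ symm T, (0 < c)%N &
  forall n, (vdim (power_sum (lspan [set` s]) n) <= r (c * n) * size (ball (T : seq (glk H)) n))%N].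
Proof.
have [|x _|N [T [sT hT]]] := @common_support H (fun N T x => F N.+1 x /\ Phi T N.+1 x) s.
- move=> N N' T T' x gT gT' NN TT [Fx Px]; split; first exact: (corad_filt_pred_le pH _ Fx).
  by apply: (Phi_le gT' (m := N.+1)) => //; apply: PhiS Px.
- have [N Fx] := corad_filt_exhaustive pH x; have [T gT Px] := corad_filt_Phi pH Fx.
  exists N, T; split=> //; split; first exact: (@corad_filt_pred_leS _ _ pH).
  exact: (Phi_le gT (leqnSn N)).
exists T, N.+1; split=> // n; apply: vdim_power_sum_le => d dm; rewrite -(size_tl T n).
apply: (filt_dim_le hL BP (d := (N.+1 * n).+1) (@tl_uniq _ _ T n) (@tl_grouplikes _ _ T n)).
apply: dimge_sub dm; move: n {d}.
apply: (power_sum_sub (U := fun n => F (N.+1 * n).+1 `&` Phi (tl T n) (N.+1 * n).+1)).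
- move=> n; have [F0 FD] := corad_filt_pred_subspace H (N.+1 * n).+1.
  have [P0 PD] := Phi_subspace (tl T n) (N.+1 * n).+1.
  by split=> // a x y [Fx Px] [Fy Py]; split; [apply: FD|apply: PD].
- rewrite muln0; split; first exact: (coradical1 pH).
  by apply: grouplike_Phi; [exact: tl_grouplikes|exact: one_tl].
- move=> n x [Fx Px]; have le : ((N.+1 * n).+1 <= (N.+1 * n.+1).+1)%N.
    by rewrite ltnS leq_mul2l leqnSn orbT.
  split; first exact: (corad_filt_pred_le pH le Fx).
  by apply: (Phi_le (@tl_grouplikes _ _ T _) le); apply: PhiS Px; apply: tl_le.
- move=> n x y /hT [Fx Px] [Fy Py].
  (* [F] and [Phi] are indexed one above the degree, so the order of a product is one less than the
     sum of the orders. *)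
  have eN : ((N.+2 + (N.+1 * n).+1).-1 = (N.+1 * n.+1).+1)%N by rewrite mulnS addSn addnS.
  split; first by have := corad_filt_predM pH Fx Fy; rewrite eN.
  rewrite -eN; apply: PhiM Px Py; try exact: tl_grouplikes.
  by move=> g h hg hh; have := tl_mul hg hh; rewrite add1n.
Qed.

Lemma upper_grouplike (s : seq H) : (forall x, x \in s -> grouplike_span H x) ->
  exists2 T : seq (glk H), symm T &
  forall n, (vdim (power_sum (lspan [set` s]) n) <= size (ball T n))%N.
Proof.
move=> hs; have [T0 [gT0 sT0]] : exists T0, grouplikes T0 /\ forall x, x \in s -> lspan [set` T0] x.
  elim: s hs => [_|x s IHs hs]; first by exists [::].
  have [|T0 [gT0 sT0]] := IHs; first by move=> y ys; apply: hs; rewrite inE ys orbT.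
  have [q Gq xE] := hs x (mem_head _ _).
  exists (T0 ++ [seq p.2 | p <- q]); split.
    by move=> g; rewrite mem_cat => /orP [/gT0|/mapP [p /Gq gp ->]].
  move=> y; rewrite inE => /orP [/eqP ->|/sT0].
    rewrite xE; apply: subspace_sum => [|p pq]; first exact: lspan_subspace.
    apply: subspaceZ; first exact: lspan_subspace.
    by apply: sub_lspan; rewrite /= mem_cat map_f ?orbT.
  by apply: lspan_subset => g gin; apply: sub_lspan; rewrite /= mem_cat gin.
have [T sT TT] := grouplikes_glk gT0; exists T => // n; apply: vdim_power_sum_le => d dm.
rewrite -(size_tl T n); apply: dimge_bound dm; move: n {d}.
apply: (power_sum_sub (U := fun n => lspan [set` tl T n])) => [n||n|n x y xs hy].
- exact: lspan_subspace.
- exact/sub_lspan/one_tl.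
- by apply: lspan_subset => g gin; apply/sub_lspan/(tl_le sT (leqnSn n)).
have sL := lspan_subspace [set` tl T n.+1].
move: x {xs} (sT0 x xs); apply: (lspan_min (T := [set x | lspan [set` tl T n.+1] (x * y)])).
  split=> [|c a b /= ha hb]; first by rewrite /= mul0r; case: sL.
  by rewrite mulrDl -scalerAl; case: sL => _; apply.
move=> g /TT hg; move: y hy; apply: (lspan_min (T := [set y | lspan [set` tl T n.+1] (g * y)])).
  split=> [|c a b /= ha hb]; first by rewrite /= mulr0; case: sL.
  by rewrite mulrDr -scalerAr; case: sL => _; apply.
by move=> h hh; apply: sub_lspan; have := tl_mul hg hh; rewrite add1n.
Qed.

Lemma lower_grouplike (T : seq (glk H)) n :
  (size (ball T n) <= vdim (power_sum (lspan [set` map (@gval k H) T]) n))%N.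
Proof.
apply/vdim_power_sum; rewrite -(size_tl T n); exists (fun i => (tl T n)`_i) => [c E i|i].
  have gT := @tl_grouplikes _ _ T n; have uT := tl_uniq T n.
  have iT := mem_nth 0 (ltn_ord i); have [chi [fc c1 c0]] := grouplike_dual gT (gT _ iT).
  have := congr1 chi E; rewrite (lin0 fc) functional_sum // (bigD1 i) //= functionalZ // c1 mulr1.
  rewrite big1 ?addr0 // => j ji; rewrite functionalZ // c0 ?mulr0 ?mem_nth //.
  by rewrite nth_uniq.
apply: (tl_power_sum (f := id) (T := T)) => //; last by apply: mem_nth.
by move=> u uT; apply/sub_lspan/map_f.
Qed.

Lemma sum_cells T n : (\sum_(j < n.+1) #|{: 'I_(size (B j)) * 'I_(size (tl (H := H) T n))}|)%N =
  (r n * size (ball T n))%N.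
Proof.
rewrite /rdim big_distrl /=; apply: eq_bigr => j _.
by rewrite card_prod !card_ord size_tl.
Qed.

Lemma basis_power_sum V n x : (forall p, p \in L -> V p.2) -> x \in B n -> power_sum V n x.
Proof.
move=> hV xB; have [h _ _] := BP n; move: (h x xB); apply: lspan_min.
  exact: power_sum_subspace.
move=> _ [w [wL <-] <-]; have := @power_sum_prod _ H V (wdeg w) [seq p.2 | p <- w].
rewrite big_map; apply; first by rewrite size_map; apply: size_wdeg.
by move=> _ /mapP [p /wL pL ->]; apply: hV.
Qed.

(** Products of basis elements of degree [j <= n] with the ball of radius [n] are free because their
    symbols are; each of the two factors is a combination of products of at most [n] generators,
    hence [2 * n]. *)
Lemma lower_hopf (T : seq (glk H)) n : (r n * size (ball T n) <=
  vdim (power_sum (lspan [set` [seq p.2 | p <- L] ++ map (@gval k H) T]) (2 * n)))%N.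
Proof.
apply/vdim_power_sum; set V := lspan _; rewrite -(sum_cells T n).
apply: (graded_dimge (f := fun j => lead j) (K := F)
  (u := fun j (q : 'I_(size (B j)) * 'I_(size (tl T n))) => (B j)`_q.1 * (tl T n)`_q.2)).
- exact: power_sum_subspace.
- exact: lead_linear.
- exact: corad_filt_pred_subspace.
- by move=> j; apply: (@corad_filt_pred_leS _ _ pH).
- by move=> j x; apply: lead0.
- move=> j q jn; have xB := mem_nth 0 (ltn_ord q.1); have gin := mem_nth 0 (ltn_ord q.2).
  split.
    rewrite mul2n -addnn; apply: power_sumM.
      apply: (power_sum_le (m := j)) => //; apply: (basis_power_sum _ xB) => p pL.
      by apply: sub_lspan; rewrite /= mem_cat map_f.
    apply: (tl_power_sum (f := id) (T := T)) => // u uT; apply: sub_lspan.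
    by rewrite /= mem_cat map_f ?orbT.
  have hx : Hom j 1 (B j)`_q.1.
    by apply: (words_Hom pH hL); have [h _ _] := BP j; apply: h.
  by have [] := Hom_grouplike pH hx (tl_grouplikes gin).
- by move=> j; apply: (cell_free hL BP) => //; [exact: tl_uniq|exact: tl_grouplikes].
Qed.

Lemma lower_gr (T : seq (glk H)) n : (r n * size (ball T n) <=
  vdim (power_sum (lspan [set` Lgr pH L ++ [seq lead 0 (gval u) | u <- T]]) (2 * n)))%N.
Proof.
apply/vdim_power_sum; set V := lspan _; rewrite -(sum_cells T n).
have hB j (q : 'I_(size (B j)) * 'I_(size (tl T n))) : [/\ Hom j 1 (B j)`_q.1,
    grouplike (tl T n)`_q.2 & F j.+1 ((B j)`_q.1 * (tl T n)`_q.2)].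
  have gg := tl_grouplikes (mem_nth 0 (ltn_ord q.2)).
  have hx : Hom j 1 (B j)`_q.1.
    by apply: (words_Hom pH hL); have [h _ _] := BP j; apply/h/mem_nth.
  by split=> //; have [] := Hom_grouplike pH hx gg.
(* In [gr H] the projections to the components take the place of the symbol maps, and the elements
   without components of degree [j] or more that of the filtration. *)
apply: (graded_dimge (f := fun j => grproj j) (K := fun j => [set a | forall m, (j <= m)%N -> grproj m a = 0])
  (u := fun j (q : 'I_(size (B j)) * 'I_(size (tl T n))) => lead j ((B j)`_q.1 * (tl T n)`_q.2))).
- exact: power_sum_subspace.
- exact: grproj_linear.
- move=> j; split=> [m _|c a b ha hb m jm]; first exact: lin0 (grproj_linear m).
  by rewrite (grproj_linear m) ha // hb // scaler0 addr0.
- by move=> j a ha m /ltnW; apply: ha.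
- by move=> j a; apply.
- move=> j q jn; have [hx gg Fxg] := hB j q; split; last first.
    by move=> m jm; rewrite grproj_lead // gtn_eqF.
  have [Fx _] := hx; rewrite lead_grouplike // mul2n -addnn; apply: power_sumM.
    apply: (power_sum_le (m := j)) => //; apply: (Rset_power_sum hL LR); last by exists (B j)`_q.1.
    by move=> a aL; apply: sub_lspan; rewrite /= mem_cat aL.
  apply: (tl_power_sum (f := lead 0) (T := T)); last by apply: mem_nth.
  + exact: lead01.
  + by move=> g h /(grouplike_Hom pH) [Fg _] /(grouplike_Hom pH) [Fh _]; rewrite leadM.
  + by move=> u uT; apply: sub_lspan; rewrite /= mem_cat; apply/orP; right; apply/mapP; exists u.
- move=> j c E; apply: (cell_free hL BP (tl_uniq T n) (@tl_grouplikes _ _ T n)); rewrite -[RHS]E.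
  by apply: eq_bigr => q _; have [_ _ Fxg] := hB j q; rewrite /= grproj_lead // eqxx.
Qed.

Lemma rdim_gt0 n : (0 < r n)%N.
Proof.
apply: (@leq_trans (size (B 0))); last by rewrite /rdim big_ord_recl leq_addr.
rewrite lt0n size_eq0; apply/eqP => B0; have [_ _ h] := BP 0.
have : Rset 0 1 by exists 1; [exact: (grouplike_Hom pH (@grouplike1 _ H))|rewrite lead01].
by move=> /h; rewrite B0 => /lspanP [c] /eqP; rewrite big_ord0 oner_eq0.
Qed.

Lemma rdim_mono m n : (m <= n)%N -> (r m <= r n)%N.
Proof.
move=> mn; rewrite /rdim (big_ord_widen n.+1 (fun j => size (B j)) _) ?ltnS //.
by rewrite big_mkcond; apply: leq_sum => j _; case: ifP.
Qed.

End GrowthBounds.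

(** * Growth exponents of sequences *)

Section GrowthExponents.
Variable R : realType.
Local Open Scope ring_scope.
Implicit Types (phi psi : nat -> nat) (x y : R).

Definition gk phi : \bar R := limn_esup (fun n => (ln (phi n)%:R / ln n%:R)%:E).

Lemma ereal_between (a b : \bar R) : (a < b)%E -> exists y, (a < y%:E)%E /\ (y%:E < b)%E.
Proof.
case: a b => [a||] [b||] //.
- rewrite lte_fin => ab; exists ((a + b) / 2); rewrite !lte_fin.
  by split; lra.
- by move=> _; exists (a + 1); rewrite lte_fin ltrDl ltr01 ltry.
- by move=> _; exists (b - 1); rewrite ltNyr lte_fin ltrBlDr ltrDl ltr01.
- by move=> _; exists 0; rewrite ltNyr ltry.
Qed.

Lemma le_by_reals (a b : \bar R) : (forall y, (b < y%:E)%E -> (a <= y%:E)%E) -> (a <= b)%E.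
Proof.
move=> h; have [//|ba] := leP a b; have [y [b_y ya]] := ereal_between ba.
by have := h y b_y; rewrite leNgt ya.
Qed.

Lemma ln_nat_gt0 n : (1 < n)%N -> 0 < ln n%:R :> R.
Proof. by move=> n1; apply: ln_gt0; rewrite ltr1n. Qed.

Lemma ln_nat_ge0 n : 0 <= ln n%:R :> R.
Proof. by case: n => [|n]; [rewrite ln0|apply: ln_ge0; rewrite ler1n]. Qed.

Lemma ln_nat_le m n : (m <= n)%N -> (0 < n)%N -> ln m%:R <= ln n%:R :> R.
Proof.
case: m => [_ _|m mn n0]; first by rewrite ln0 // ln_nat_ge0.
by rewrite ler_ln ?posrE ?ltr0n // ler_nat.
Qed.

Lemma ln_natM m n : (0 < m)%N -> (0 < n)%N -> ln (m * n)%:R = ln m%:R + ln n%:R :> R.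
Proof. by move=> m0 n0; rewrite natrM lnM // posrE ltr0n. Qed.

Lemma ln_natX n d : (0 < n)%N -> ln (n ^ d)%:R = d%:R * ln n%:R :> R.
Proof. by move=> n0; rewrite natrX lnXn ?ltr0n // mulr_natl. Qed.

Lemma ln_nat_unbounded x : exists N, forall n, (N <= n)%N -> x <= ln n%:R.
Proof.
have [N hN] := nat_above (expR x); exists N => n Nn; rewrite -[x]expRK.
rewrite ler_ln ?posrE ?expR_gt0 //; last by apply: lt_le_trans (le_trans hN _); rewrite ?expR_gt0 ?ler_nat.
by apply: le_trans hN _; rewrite ler_nat.
Qed.

Lemma gk_lt phi y : (gk phi < y%:E)%E -> exists N, forall n, (N <= n)%N -> (1 < n)%N ->
  ln (phi n)%:R <= y * ln n%:R.
Proof.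
move=> /ereal_inf_lt [_ [V [N _ NV] <-] lt]; exists N => n Nn n1.
have : ((ln (phi n)%:R / ln n%:R)%:E < y%:E)%E.
  by apply: le_lt_trans lt; apply: ereal_sup_ubound; exists n => //; apply: NV.
by rewrite lte_fin ltr_pdivrMr ?ln_nat_gt0 // => /ltW.
Qed.

Lemma gk_le phi y : (exists N, forall n, (N <= n)%N -> (1 < n)%N ->
  ln (phi n)%:R <= y * ln n%:R) -> (gk phi <= y%:E)%E.
Proof.
move=> [N h]; apply: (@le_trans _ _ (ereal_sup ((fun n => (ln (phi n)%:R / ln n%:R)%:E) @`
  [set n : nat | (maxn N 2 <= n)%N]))).
  by apply: ereal_inf_lbound; exists [set n : nat | (maxn N 2 <= n)%N] => //; exists (maxn N 2).
apply: ge_ereal_sup => _ [n /= + <-]; rewrite geq_max => /andP [Nn n1].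
by rewrite lee_fin ler_pdivrMr ?ln_nat_gt0 //; apply: h.
Qed.

(** A linear change of the argument is harmless, because [ln (c n) / ln n] tends to 1. *)
Lemma gk_scale phi psi c : (0 < c)%N -> (forall n, (0 < n)%N -> (phi n <= psi (c * n))%N) ->
  (forall n, (0 < n)%N -> (0 < psi n)%N) -> (gk phi <= gk psi)%E.
Proof.
move=> c0 h p0; apply: le_by_reals => y /ereal_between [y' [/gk_lt [N hN]]].
rewrite lte_fin => yy; apply: gk_le.
have [N1 hN1] := ln_nat_unbounded (y' * ln c%:R / (y - y')).
exists (maxn N N1) => n; rewrite geq_max => /andP [Nn N1n] n1; have n0 := ltnW n1.
have cn0 : (0 < c * n)%N by rewrite muln_gt0 c0.
have le_n : (n <= c * n)%N by rewrite leq_pmull.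
apply: le_trans (ln_nat_le (h n n0) (p0 _ cn0)) _.
apply: le_trans (hN _ (leq_trans Nn le_n) (leq_trans n1 le_n)) _.
have := hN1 n N1n; rewrite ler_pdivrMr ?subr_gt0 // ln_natM // => h1.
have -> : y * ln n%:R = y' * ln n%:R + ln n%:R * (y - y') by ring.
by rewrite mulrDr addrC lerD2l.
Qed.

Lemma gk_ge0 phi : (0 <= gk phi)%E.
Proof.
rewrite leNgt; apply/negP => /ereal_between [y [/gk_lt [N h]]]; rewrite lte_fin => y0.
have n2 : (1 < maxn N 2)%N by rewrite leq_max orbT.
have := h _ (leq_maxl _ _) n2; rewrite leNgt => /negP; apply.
by apply: lt_le_trans (ln_nat_ge0 _); rewrite nmulr_rlt0 // ln_nat_gt0.
Qed.

Lemma gk_pow_le phi C d : (0 < C)%N -> (forall n, (0 < n)%N -> (0 < phi n)%N) ->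
  (gk (fun n => phi n * (C * n ^ d))%N <= gk phi + d%:R%:E)%E.
Proof.
move=> C0 p0; apply: le_by_reals => z hz.
have : (gk phi < (z - d%:R)%:E)%E by rewrite EFinB lteBrDr.
move=> /ereal_between [y [/gk_lt [N hN]]]; rewrite lte_fin => yz; apply: gk_le.
have e0 : 0 < z - d%:R - y by rewrite subr_gt0.
have [N1 hN1] := ln_nat_unbounded (ln C%:R / (z - d%:R - y)).
exists (maxn N N1) => n; rewrite geq_max => /andP [Nn N1n] n1; have n0 := ltnW n1.
rewrite ln_natM ?muln_gt0 ?C0 ?expn_gt0 ?n0 ?p0 // ln_natM ?expn_gt0 ?n0 // ln_natX //.
have h1 := hN n Nn n1; have := hN1 n N1n; rewrite ler_pdivrMr // => h2.
have -> : z * ln n%:R = y * ln n%:R + (ln n%:R * (z - d%:R - y) + d%:R * ln n%:R) by ring.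
by rewrite lerD // lerD2r.
Qed.

(** Superadditivity of the limit superior, available because the second factor is an exact power and
    its logarithmic quotient is constant. *)
Lemma gk_pow_ge phi d : (forall n, (0 < n)%N -> (0 < phi n)%N) ->
  (gk phi + d%:R%:E <= gk (fun n => phi n * n ^ d)%N)%E.
Proof.
move=> p0; apply: le_by_reals => y /gk_lt [N hN].
rewrite -leeBrDr // -EFinB; apply: gk_le; exists N => n Nn n1; have n0 := ltnW n1.
have := hN n Nn n1; rewrite ln_natM ?p0 ?expn_gt0 ?n0 // ln_natX //.
by rewrite mulrBl lerBrDr.
Qed.

Lemma gk1 : gk (fun=> 1%N) = 0%E.
Proof.
apply/eqP; rewrite eq_le gk_ge0 andbT; apply: gk_le; exists 0%N => n _ _.
by rewrite ln1 mul0r.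
Qed.

Lemma growth_gk (G : groupType) (T : seq G) : symm T -> (exists D, poly_growth T D) ->
  exists d C, [/\ (0 < C)%N, forall n, (0 < n)%N -> (size (ball T n) <= C * n ^ d)%N,
    forall n, (0 < n)%N -> (n ^ d <= size (ball T (C * n)))%N &
    gk (fun n => size (ball T n)) = d%:R%:E].
Proof.
move=> sT [D pT]; have [d [C [C0 h]]] := growth_degree R sT pT; exists d, C.
have h1 n n0 := (h n n0).1; have h2 n n0 := (h n n0).2.
split=> //; apply/eqP; rewrite eq_le; apply/andP; split.
  apply: le_trans (_ : _ <= gk (fun n => 1 * (C * n ^ d))%N)%E _.
    apply: (gk_scale (c := 1)) => // n n0; rewrite !mul1n; first exact: h1.
    by rewrite muln_gt0 C0 expn_gt0 n0.
  by have := @gk_pow_le (fun=> 1%N) C d C0 (fun _ _ => isT); rewrite gk1 add0e.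
apply: le_trans (_ : _ <= gk (fun n => 1 * n ^ d)%N)%E _.
  by have := @gk_pow_ge (fun=> 1%N) d (fun _ _ => isT); rewrite gk1 add0e.
apply: (gk_scale C0) => n n0; last exact: size_ball_gt0.
by rewrite mul1n; apply: h2.
Qed.

(** A finite exponent below [y <= D] bounds the balls by [n^D] from some radius on; the size of the
    ball at that radius serves as the constant for the smaller ones. *)
Lemma gk_infinite (G : groupType) (T : seq G) : symm T -> ~ (exists D, poly_growth T D) ->
  gk (fun n => size (ball T n)) = +oo%E.
Proof.
move=> sT np; apply/eqP; rewrite eq_le leey /= leNgt; apply/negP => /ereal_between [y [h _]].
apply: np; have [N hN] := gk_lt h; have [D hD] := nat_above y; exists D.
exists (size (ball T (maxn N 2))) => n; have s0 := size_ball_gt0 (maxn N 2) sT.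
have [nN|Nn] := leqP n (maxn N 2).
  apply: leq_trans (size_ball_le (ball_le sT nN)) _; by rewrite leq_pmulr // expn_gt0.
apply: leq_trans (_ : n ^ D <= _)%N; last first.
  by rewrite -[X in (X <= _)%N]mul1n leq_mul //; case: (D) => // D'; rewrite leq_exp2r.
have n1 : (1 < n)%N by apply: leq_trans Nn; rewrite ltnS leq_max orbT.
have Nn' : (N <= n)%N by apply: leq_trans (ltnW Nn); apply: leq_maxl.
have n0 := ltnW n1; rewrite -(ler_nat R) -ler_ln ?posrE ?ltr0n ?expn_gt0 ?n0 ?size_ball_gt0 //.
rewrite ln_natX //; apply: le_trans (hN n Nn' n1) _.
by rewrite ler_wpM2r // ln_nat_ge0.
Qed.

End GrowthExponents.

(** * Gelfand-Kirillov dimension of a bosonization *)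

Section GelfandKirillov.
Variables (R : realType) (k : fieldType).
Local Open Scope ring_scope.

Lemma vdim_power_sum_gt0 (A : algType k) (s : seq A) n :
  (0 < vdim (power_sum (lspan [set` s]) n))%N.
Proof.
apply/vdim_power_sum; exists (fun=> 1) => [c|i].
  rewrite big_ord1 => /eqP E i; move: E.
  by rewrite (ord1 i) scaler_eq0 oner_eq0 orbF => /eqP.
have := @power_sum_prod _ A (lspan [set` s]) n [::]; rewrite big_nil; exact.
Qed.

Lemma GKdim_ub (A : algType k) (S : set A) (s : seq A) : (forall x, x \in s -> S x) ->
  (gk R (fun n => vdim (power_sum (lspan [set` s]) n)) <= GKdim R S)%E.
Proof. by move=> sS; apply: ereal_sup_ubound; exists s. Qed.

Lemma GKdim_le (A : algType k) (S : set A) (y : \bar R) :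
  (forall s : seq A, (forall x, x \in s -> S x) ->
     (gk R (fun n => vdim (power_sum (lspan [set` s]) n)) <= y)%E) -> (GKdim R S <= y)%E.
Proof. by move=> h; apply: ge_ereal_sup => _ [s sS <-]; apply: h. Qed.

Section Bosonization.
Variables (G : groupType) (r : nat -> nat) (kG : \bar R).
Hypotheses (r0 : forall n, (0 < r n)%N) (rm : forall m n, (m <= n)%N -> (r m <= r n)%N).
Local Notation f T := (fun n => size (ball (T : seq G) n)).
Hypothesis kG_ge : forall T, symm T -> (gk R (f T) <= kG)%E.
Hypothesis kG_le : forall y, (forall T, symm T -> (gk R (f T) <= y)%E) -> (kG <= y)%E.
Variables (A : algType k) (S : set A).
Hypothesis upper : forall s : seq A, (forall x, x \in s -> S x) -> exists (T : seq G) c,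
  [/\ symm T, (0 < c)%N & forall n,
    (vdim (power_sum (lspan [set` s]) n) <= r (c * n) * size (ball T n))%N].
Hypothesis lower : forall T : seq G, symm T -> exists2 s : seq A, (forall x, x \in s -> S x) &
  forall n, (r n * size (ball T n) <= vdim (power_sum (lspan [set` s]) (2 * n)))%N.

(** Stated for any algebra with the two bounds, so that it serves [gr H] and [H] alike; [kG_ge] and
    [kG_le] make [kG] the supremum of the exponents of the balls. For polynomial growth the ball is
    replaced by [C n^d]; otherwise [kG] is infinite. *)
Lemma bosonization_le : (GKdim R S <= gk R r + kG)%E.
Proof.
apply: GKdim_le => s /upper [T [c [sT c0 h]]].
have rN : gk R r != -oo%E by rewrite gt_eqF // (lt_le_trans _ (gk_ge0 _ _)).
have [pT|npT] := pselect (exists D, poly_growth T D); last first.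
  have := kG_ge sT; rewrite (gk_infinite _ sT npT) leye_eq => /eqP ->.
  by rewrite addey // leey.
have [d [C [C0 h1 _ gkd]]] := growth_gk R sT pT.
have le1 : (gk R (fun n => vdim (power_sum (lspan [set` s]) n)) <=
    gk R (fun n => r (c * n) * (C * n ^ d))%N)%E.
  apply: (gk_scale R (c := 1)) => // n n0; rewrite ?mul1n.
    by apply: leq_trans (h n) _; rewrite leq_mul2l h1 ?orbT.
  by rewrite !muln_gt0 r0 C0 expn_gt0 n0.
apply: le_trans le1 _; apply: le_trans (gk_pow_le R d C0 (fun n _ => r0 (c * n))) _.
apply: leeD; last by rewrite -gkd; apply: kG_ge.
by apply: (gk_scale R c0) => // n _; apply: r0.
Qed.

(** At radius [C n] the ball has at least [n^d] elements, and [r] is monotone, so [r n * n^d] bounds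
    the dimension from below at a linearly rescaled argument. *)
Lemma bosonization_ge : (gk R r + kG <= GKdim R S)%E.
Proof.
have key T : symm T -> (gk R r + gk R (f T) <= GKdim R S)%E.
  move=> sT; have [s sS h] := lower sT; apply: le_trans (GKdim_ub sS).
  have p0 n : (0 < n)%N -> (0 < vdim (power_sum (lspan [set` s]) n))%N.
    by move=> _; apply: vdim_power_sum_gt0.
  have [pT|npT] := pselect (exists D, poly_growth T D); last first.
    suff -> : gk R (fun n => vdim (power_sum (lspan [set` s]) n)) = +oo%E by rewrite leey.
    apply/eqP; rewrite -leye_eq -(gk_infinite R sT npT).
    apply: (gk_scale R (c := 2)) => // n _; apply: leq_trans (h n).
    by rewrite leq_pmull.
  have [d [C [C0 h1 h2 gkd]]] := growth_gk R sT pT; rewrite gkd.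
  apply: le_trans (gk_pow_ge R d (fun n _ => r0 n)) _.
  apply: (gk_scale R (c := 2 * C)) => // [|n n0]; first by rewrite muln_gt0.
  rewrite -mulnA; apply: leq_trans (h (C * n)%N); apply: leq_mul; last exact: h2.
  by apply: rm; rewrite leq_pmull.
have s1 : symm [:: 1%g : G] by split; rewrite /= ?inE ?invg1.
have g0 := gk_ge0 R (f [:: 1%g : G]); have := gk_ge0 R r.
(* The supremum over [T] is taken after [gk R r] has been moved to the other side, which requires it
   to be finite. *)
case E : (gk R r) => [x||] // _; last first.
  have := key _ s1; rewrite E addye; last by rewrite gt_eqF // (lt_le_trans _ g0).
  by rewrite leye_eq => /eqP ->; rewrite leey.
by rewrite addeC -leeBrDr //; apply: kG_le => T /key; rewrite E addeC -leeBrDr.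
Qed.

End Bosonization.

End GelfandKirillov.

Local Open Scope classical_set_scope.
Local Open Scope ereal_scope.

Theorem theorem1p1 (R : realType) (k : fieldType) (H : hopfAlgType k)
    (pH : pointed H) :
  finitely_generated (gr_coinv pH) ->
  GKdim R (gr_coinv pH) + GKdim R (grouplike_span H) = GKdim R [set: gr pH] /\
  GKdim R [set: gr pH] = GKdim R [set: H].
Proof.
move=> fg; have [L [hL LR]] := coinv_words fg.
have [B BP] := choice (Rset_basis hL LR).
have r0 n : (0 < rdim B n)%N := rdim_gt0 BP n.
have GKcoinv : GKdim R (gr_coinv pH) = gk R (rdim B).
  apply/eqP; rewrite eq_le; apply/andP; split.
    apply: GKdim_le => s /(upper_coinv hL BP) [c c0 h].
    by apply: (gk_scale R c0) => n _; [apply: h|apply: r0].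
  (* For the trivial group the generators in [lower_gr] are coinvariant, so the same bound serves
     for [R] alone. *)
  have s1 : symm [:: 1%g : glk H] by split; rewrite /= ?inE ?invg1.
  have h := lower_gr hL LR BP [:: 1%g : glk H].
  apply: le_trans (GKdim_ub R (_ : forall x, x \in Lgr pH L ++ [seq lead pH 0 (gval u) |
    u <- [:: 1%g : glk H]] -> gr_coinv pH x)) => [|x].
    apply: (gk_scale R (c := 2)) => // n n0; last exact: vdim_power_sum_gt0.
    by apply: leq_trans (h n); rewrite leq_pmulr // size_ball_gt0.
  rewrite mem_cat inE => /orP [/mapP [p pL ->]|/eqP ->].
    by apply: (@Rset_coinv _ _ _ p.1.+1); exists p.2 => //; apply: hL.
  apply: (@Rset_coinv _ _ _ 0%N); exists 1%R => //.
  exact: (grouplike_Hom pH (@grouplike1 _ H)).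
have kG_ge (T : seq (glk H)) : symm T ->
    gk R (fun n => size (ball T n)) <= GKdim R (grouplike_span H).
  move=> sT; have hT x : x \in map (@gval k H) T -> grouplike_span H x.
    by move=> /mapP [u _ ->]; apply/sub_lspan/glkP.
  apply: le_trans (GKdim_ub R hT); apply: (gk_scale R (c := 1)) => // n _.
    by rewrite mul1n; apply: lower_grouplike.
  exact: vdim_power_sum_gt0.
have kG_le y : (forall T : seq (glk H), symm T -> gk R (fun n => size (ball T n)) <= y) ->
    GKdim R (grouplike_span H) <= y.
  move=> h; apply: GKdim_le => s /upper_grouplike [T sT hT]; apply: le_trans (h T sT).
  apply: (gk_scale R (c := 1)) => // n _; first by rewrite mul1n.
  exact: size_ball_gt0.
have rm := @rdim_mono _ _ B.
have GKgr : gk R (rdim B) + GKdim R (grouplike_span H) = GKdim R [set: gr pH].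
  apply/eqP; rewrite eq_le; apply/andP; split.
    apply: (bosonization_ge r0 rm kG_le) => T sT.
    by exists (Lgr pH L ++ [seq lead pH 0 (gval u) | u <- T]) => // n; apply: lower_gr.
  by apply: (bosonization_le r0 kG_ge) => s _; apply: (upper_gr hL BP).
have GKH : gk R (rdim B) + GKdim R (grouplike_span H) = GKdim R [set: H].
  apply/eqP; rewrite eq_le; apply/andP; split.
    apply: (bosonization_ge r0 rm kG_le) => T sT.
    by exists ([seq p.2 | p <- L] ++ map (@gval k H) T) => // n; apply: lower_hopf.
  by apply: (bosonization_le r0 kG_ge) => s _; apply: (upper_hopf hL BP).
by rewrite GKcoinv -GKgr GKH.
Qed.
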